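(* Let $\mathcal{E}_1,\mathcal{E}_2$ be two generic second order ODEs $y''=f_i(x,y,y')$, where generic means that for $\mathcal{E}=\mathcal{E}_1$ and for $\mathcal{E}=\mathcal{E}_2$ the functions $\bar H_{10}^{\mathcal{E}},\bar H_{01}^{\mathcal{E}},\bar K^{\mathcal{E}}$ are local coordinates on $\mathbb{R}^3(x,y,p)$. For each such $\mathcal{E}$ define the local functions $$\Phi^{\mathcal{E}}_{20},\ \Phi^{\mathcal{E}}_{11},\ \Phi^{\mathcal{E}}_{02},\ \Psi^{\mathcal{E}}_{10},\ \Psi^{\mathcal{E}}_{01},\ \Upsilon^{6\,\mathcal{E}},\ \Upsilon^{5\,\mathcal{E}}_{10},\ \Upsilon^{4\,\mathcal{E}}_{20}$$ on $\mathbb{R}^3$ by $$\bar H_{ij}^{\mathcal{E}}=\Phi^{\mathcal{E}}_{ij}(\bar H_{10}^{\mathcal{E}},\bar H_{01}^{\mathcal{E}},\bar K^{\mathcal{E}}),\quad \bar K_{ij}^{\mathcal{E}}=\Psi^{\mathcal{E}}_{ij}(\bar H_{10}^{\mathcal{E}},\bar H_{01}^{\mathcal{E}},\bar K^{\mathcal{E}}),\quad \bar\Omega_{ij}^{k\,\mathcal{E}}=\Upsilon^{k\,\mathcal{E}}_{ij}(\bar H_{10}^{\mathcal{E}},\bar H_{01}^{\mathcal{E}},\bar K^{\mathcal{E}})$$ (for $\bar\Omega^6$ the lower indices are omitted). Then $\mathcal{E}_1$ and $\mathcal{E}_2$ are (locally) point equivalent if and only if these collections of eight functions on $\mathbb{R}^3$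 for $\mathcal{E}_1$ and for $\mathcal{E}_2$ coincide.
   Context: **Jets.** A second order ODE $\mathcal{E}$: $y''=f(x,y,p)$, $p=y'$, is a section $u=f(x,y,p)$ of $J^0\mathbb{R}^3=\mathbb{R}^4(x,y,p,u)\to\mathbb{R}^3(x,y,p)$. $J^k\mathbb{R}^3$ is the space of $k$-jets of functions $u=u(x,y,p)$; $\mathcal{D}_x,\mathcal{D}_y,\mathcal{D}_p$ are the total derivatives, $\hat{\mathcal{D}}_x=\mathcal{D}_x+p\,\mathcal{D}_y$, and $u^k_{lm}=\hat{\mathcal{D}}_x^l\mathcal{D}_y^m\mathcal{D}_p^k(u)$ (zero indices omitted, e.g. $u^4=u_{pppp}$; superscripts on $u$ are derivative indices, not powers). For a function $J$ on $J^k\mathbb{R}^3$, $J^{\mathcal{E}}$ denotes its pull-back to $\mathbb{R}^3(x,y,p)$ by the $k$-jet of $f$. Everything is local (micro-local), and local branches of roots are fixed. **Point equivalence.** $\mathcal{E}_1,\mathcal{E}_2$ are point equivalent if there is a local diffeomorphism $\varphi$ of $\mathbb{R}^2(x,y)$ whose prolongation $\varphi^{(2)}$ to $J^2\mathbb{R}=\mathbb{R}^4(x,y,p,u)$ (with $p=y'$, $u=y''$) maps the hypersurface $\mathcal{E}_1$ to $\mathcal{E}_2$. **Relative invariants and derivations.** A vector field $a(x,y)\partial_x+b(x,y)\partial_y$ lifts canonically, through its action on ODEs, to a vector field $\hat\xi$ on $J^k\mathbb{R}^3$. $\mathcal{R}^{r,s}$ is the space of functions $\psi$ on jets with $\hat\xi(\psi)=-(r\,(a_x+p\,a_y)+s\,(b_y-p\,a_y))\psi$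 for all $a,b$. Put $$I=u^4\in\mathcal{R}^{-2,3},$$ $$H=u_{20}^2-4u_{11}^1+6u_{02}+u(2u_{10}^3-3u_{01}^2)-u^1(u_{10}^2-4u_{01}^1)+u^3u_{10}-3u^2u_{01}+u\cdot u\cdot u^4\in\mathcal{R}^{2,1}.$$ The following operators act on $\mathcal{R}^{r,s}$ (the numbers $r,s$ in the formulas are the weights of the argument): $$\Delta_p=\mathcal{D}_p+(r-s)\frac{u^5}{5u^4}:\mathcal{R}^{r,s}\to\mathcal{R}^{r-1,s+1},$$ $$\Delta_x=\hat{\mathcal{D}}_x+u\,\Delta_p+(3r+2s)\Bigl(u^1+\frac{3u\,u^5}{5u^4}\Bigr)+(2r+s)\frac{u^4_{10}}{u^4}:\mathcal{R}^{r,s}\to\mathcal{R}^{r+1,s},$$ $$\Delta_y=\mathcal{D}_y+\frac{u^5}{5u^4}\Delta_x+\Bigl(2u^1+\frac{u_{10}^4+u\,u^5}{u^4}\Bigr)\Delta_p-\Bigl((r+2s)\frac{u_{01}^4}{4u^4}+(3r+2s)\Bigl(\frac{u^2}8+\frac3{20}\frac{u^5(u_{10}^4+u\,u^5+2u^1u^4)}{u^4\cdot u^4}\Bigr)\Bigr):\mathcal{R}^{r,s}\to\mathcal{R}^{r,s+1}.$$ Put $H_{10}=\Delta_xH$, $H_{01}=\Delta_yH$, $K=\Delta_pH$, $H_{ij}=\Delta_x^i\Delta_y^jH$, $K_{ij}=\Delta_x^i\Delta_y^jK$, and $$\Omega^6=u^6-\frac65\frac{u^5\cdot u^5}{u^4},\quad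 \Omega^5_{10}=\frac{5I}{24H}\bigl([\Delta_p,\Delta_x]H-\Delta_yH\bigr),\quad \Omega^4_{20}=\Delta_p^2H-\frac{\Omega^6}{5I}H.$$ **Absolute invariants.** With $J_1=I^{-1/8}H^{3/8}$ and $J_2=I^{1/4}H^{1/4}$ (where $I\ne0$, $H\ne0$): $$\bar H_{10}=\frac{H_{10}}{J_1^3J_2},\ \bar H_{01}=\frac{H_{01}}{J_1^2J_2^2},\ \bar K=\frac{K}{J_1J_2^2},\ \bar H_{20}=\frac{H_{20}}{J_1^4J_2},\ \bar H_{11}=\frac{H_{11}}{J_1^3J_2^2},\ \bar H_{02}=\frac{H_{02}}{J_1^2J_2^3},$$ $$\bar K_{10}=\frac{K_{10}}{J_1^2J_2^2},\ \bar K_{01}=\frac{K_{01}}{J_1J_2^3},\ \bar\Omega^4_{20}=\frac{\Omega^4_{20}}{J_2^3},\ \bar\Omega^5_{10}=\frac{\Omega^5_{10}}{J_1^{-2}J_2^4},\ \bar\Omega^6=\frac{\Omega^6}{J_1^{-4}J_2^5}.$$ *)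

(* Defs.v *)
From HB Require Import structures.
From mathcomp Require Import all_boot all_order all_algebra.
From mathcomp Require Import all_classical all_reals all_analysis.

Set Implicit Arguments.
Unset Strict Implicit.
Unset Printing Implicit Defensive.

Import Order.TTheory GRing.Theory Num.Theory.
Import numFieldNormedType.Exports.

Local Open Scope classical_set_scope.
Local Open Scope ring_scope.

Fixpoint Ck_on {R : realType} {V W : normedModType R} (n : nat) (A : set V)
    (g : V -> W) : Prop :=
  match n with
  | 0 => forall a, A a -> {for a, continuous g}
  | n'.+1 => (forall a, A a -> differentiable g a) /\
             forall v, Ck_on n' A (fun a => 'D_v g a)
  end.

Definition smooth_at {R : realType} {V W : normedModType R} (g : V -> W)
    (a : V) : Prop :=
  exists2 A : set V, open_nbhs a A & forall n, Ck_on n A g.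

Definition local_diffeo {R : realType} {V W : normedModType R} (g : V -> W)
    (a : V) : Prop :=
  smooth_at g a /\
  exists h : W -> V,
    [/\ smooth_at h (g a),
        \forall z \near a, h (g z) = z &
        \forall w \near g a, g (h w) = w].

Section PointTransformations.
Variable R : realType.
Implicit Types (phi : R * R -> R * R) (g : R * R -> R).

(* derivative of g along a curve with y' = z.2, at the point z of J^1 *)
Definition along g (z : R * R * R) : R :=
  'D_((1, 0) : R * R) g z.1 + z.2 * 'D_((0, 1) : R * R) g z.1.

(* The prolongation is only meaningful where slope_den phi is nonzero, i.e.
   where the image direction is not vertical. *)
Definition slope_den phi : R * R * R -> R := along (fun q => (phi q).1).

Definition prolonged_p phi (z : R * R * R) : R :=
  along (fun q => (phi q).2) z / slope_den phi z.

Definition prolonged_u phi (w : R * R * R * R) : R :=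
  ('D_((1, 0, 0) : R * R * R) (prolonged_p phi) w.1
   + w.1.2 * 'D_((0, 1, 0) : R * R * R) (prolonged_p phi) w.1
   + w.2 * 'D_((0, 0, 1) : R * R * R) (prolonged_p phi) w.1)
  / slope_den phi w.1.

Definition prolong2 phi (w : R * R * R * R) : R * R * R * R :=
  (phi w.1.1, prolonged_p phi w.1, prolonged_u phi w).

Definition ode (f : R * R * R -> R) : set (R * R * R * R) :=
  [set w | w.2 = f w.1].

(* Equivalence of the germ of y'' = f1 at m1 with the germ of y'' = f2 at m2. *)
Definition point_equivalent (f1 : R * R * R -> R) (m1 : R * R * R)
    (f2 : R * R * R -> R) (m2 : R * R * R) : Prop :=
  exists phi : R * R -> R * R,
    [/\ local_diffeo phi m1.1,
        slope_den phi m1 != 0,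
        prolong2 phi (m1, f1 m1) = (m2, f2 m2) &
        \forall w \near (m1, f1 m1), ode f1 w <-> ode f2 (prolong2 phi w)].

End PointTransformations.

(* Pulling a total derivative back by the jet of f gives the corresponding
   partial derivative of the pull-back, so all differential expressions below
   are written directly for their pull-backs, as functions of z = (x, y, p); thus z.2 is p. *)
Section Invariants.
Variable R : realType.
Notation R3 := (R * R * R)%type.
Implicit Types (f g : R3 -> R) (z m : R3).

Definition Dp g z : R := 'D_((0, 0, 1) : R3) g z.
Definition Dy g z : R := 'D_((0, 1, 0) : R3) g z.
Definition Dx g z : R := 'D_((1, 0, 0) : R3) g z + z.2 * Dy g z.

(* jet f k l i is u^k_{l i}; the p-derivatives are taken first *)
Definition jet f (k l i : nat) : R3 -> R :=
  iter l Dx (iter i Dy (iter k Dp f)).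

Definition rel_I f : R3 -> R := jet f 4 0 0.

Definition rel_H f z : R :=
  jet f 2 2 0 z - 4 * jet f 1 1 1 z + 6 * jet f 0 0 2 z
  + f z * (2 * jet f 3 1 0 z - 3 * jet f 2 0 1 z)
  - jet f 1 0 0 z * (jet f 2 1 0 z - 4 * jet f 1 0 1 z)
  + jet f 3 0 0 z * jet f 0 1 0 z - 3 * jet f 2 0 0 z * jet f 0 0 1 z
  + f z * f z * jet f 4 0 0 z.

(* A function together with its weights (r, s); the operators below depend on
   the weights of their argument and return the weights of their value.  The
   pair (r, s) is only carried along; relative invariance is not imposed. *)
Record weighted := Weighted { wr : int; ws : int; wfun :> R3 -> R }.

Definition Delta_p f (psi : weighted) : weighted :=
  let r := (wr psi)%:~R : R in let s := (ws psi)%:~R : R in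
  Weighted (wr psi - 1) (ws psi + 1) (fun z =>
    Dp psi z + (r - s) * (jet f 5 0 0 z / (5 * jet f 4 0 0 z)) * psi z).

Definition Delta_x f (psi : weighted) : weighted :=
  let r := (wr psi)%:~R : R in let s := (ws psi)%:~R : R in
  Weighted (wr psi + 1) (ws psi) (fun z =>
    Dx psi z + f z * Delta_p f psi z
    + ((3 * r + 2 * s)
         * (jet f 1 0 0 z + 3 * f z * jet f 5 0 0 z / (5 * jet f 4 0 0 z))
       + (2 * r + s) * (jet f 4 1 0 z / jet f 4 0 0 z)) * psi z).

Definition Delta_y f (psi : weighted) : weighted :=
  let r := (wr psi)%:~R : R in let s := (ws psi)%:~R : R in
  Weighted (wr psi) (ws psi + 1) (fun z =>
    Dy psi z + jet f 5 0 0 z / (5 * jet f 4 0 0 z) * Delta_x f psi z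
    + (2 * jet f 1 0 0 z + (jet f 4 1 0 z + f z * jet f 5 0 0 z) / jet f 4 0 0 z)
      * Delta_p f psi z
    - ((r + 2 * s) * (jet f 4 0 1 z / (4 * jet f 4 0 0 z))
       + (3 * r + 2 * s)
         * (jet f 2 0 0 z / 8
            + 3 / 20 * (jet f 5 0 0 z
                        * (jet f 4 1 0 z + f z * jet f 5 0 0 z
                           + 2 * jet f 1 0 0 z * jet f 4 0 0 z)
                        / (jet f 4 0 0 z * jet f 4 0 0 z)))) * psi z).

Definition wH f : weighted := Weighted 2 1 (rel_H f).
Definition wK f : weighted := Delta_p f (wH f).

Definition rel_Hij f (i j : nat) : weighted :=
  iter i (Delta_x f) (iter j (Delta_y f) (wH f)).
Definition rel_Kij f (i j : nat) : weighted :=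
  iter i (Delta_x f) (iter j (Delta_y f) (wK f)).

Definition Omega6 f z : R :=
  jet f 6 0 0 z - 6 / 5 * (jet f 5 0 0 z * jet f 5 0 0 z / jet f 4 0 0 z).

Definition Omega5_10 f z : R :=
  5 * rel_I f z / (24 * rel_H f z)
  * ((Delta_p f (Delta_x f (wH f)) z - Delta_x f (Delta_p f (wH f)) z)
     - Delta_y f (wH f) z).

Definition Omega4_20 f z : R :=
  Delta_p f (Delta_p f (wH f)) z - Omega6 f z / (5 * rel_I f z) * rel_H f z.

(* J = (J_1, J_2) is a local branch of (I^(-1/8) H^(3/8), I^(1/4) H^(1/4)).
   Both are monomials in the same branches of I^(1/8) and H^(1/8), whence
   J_1^2 J_2 = H.  Real branches exist when I H > 0: this is s = false.  When
   I H < 0 (s = true) the branches are complex, (w J_1, w^-2 J_2) with J_1, J_2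
   real and w a constant with w^8 = -1; only J_1 and J_2 are recorded, which
   multiplies each absolute invariant by a power of w. *)
Definition root_branch (s : bool) f m (J : R3 -> R * R) : Prop :=
  [/\ rel_I f m != 0, rel_H f m != 0 &
      \forall z \near m,
        {for z, continuous J} /\
        [/\ (J z).1 ^+ 8 = (-1) ^+ s * (rel_H f z ^+ 3 / rel_I f z),
            (J z).2 ^+ 4 = (-1) ^+ s * (rel_I f z * rel_H f z) &
            (J z).1 ^+ 2 * (J z).2 = rel_H f z]].

Definition bar (J : R3 -> R * R) (a b : int) g z : R :=
  g z / ((J z).1 ^ a * (J z).2 ^ b).

(* (H_10, H_01, K), normalized *)
Definition coords f J z : R3 :=
  (bar J 3 1 (rel_Hij f 1 0) z,
   bar J 2 2 (rel_Hij f 0 1) z,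
   bar J 1 2 (wK f) z).

Definition generic f m : Prop :=
  exists s J, root_branch s f m J /\ local_diffeo (coords f J) m.

(* The eight functions Phi_20, Phi_11, Phi_02, Psi_10, Psi_01, Upsilon^6,
   Upsilon^5_10, Upsilon^4_20; they are determined as germs at coords f J m. *)
Definition structure_functions f J m (Phi : R3 -> 8.-tuple R) : Prop :=
  \forall z \near m,
    Phi (coords f J z) =
    [tuple bar J 4 1 (rel_Hij f 2 0) z;
           bar J 3 2 (rel_Hij f 1 1) z;
           bar J 2 3 (rel_Hij f 0 2) z;
           bar J 2 2 (rel_Kij f 1 0) z;
           bar J 1 3 (rel_Kij f 0 1) z;
           bar J (- 4) 5 (Omega6 f) z;
           bar J (- 2) 4 (Omega5_10 f) z;
           bar J 0 3 (Omega4_20 f) z].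

(* equality of germs, including equality of the base points *)
Definition same_structure_functions f1 m1 J1 f2 m2 J2 : Prop :=
  coords f1 J1 m1 = coords f2 J2 m2 /\
  exists Phi1 Phi2,
    [/\ structure_functions f1 J1 m1 Phi1,
        structure_functions f2 J2 m2 Phi2 &
        \forall w \near coords f1 J1 m1, Phi1 w = Phi2 w].

End Invariants.

(* Main.v *)
(* On normalized functions the derivations Delta_p, Delta_x, Delta_y become a
   frame (P, X, Y) of vector fields, proportional modulo lower terms to the
   derivative along the fibres of (x, y, p) -> (x, y), the derivative along the
   solutions, and their bracket.

   A point map multiplies the first two by functions lam and mu.  The bracket
   relations of the frame then determine how everything else transforms: I and
   H are multiplied by mu lam^3 and mu^3 lam, so a branch J1 is carried to a
   branch J2 for which all the absolute invariants agree.

   Conversely, read the frame in the coordinates (a, b, c) = (H_10, H_01, K).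
   Its components P a, P c, X a, ..., Y c are structure functions, or are
   expressed through them by the bracket [P, X] and by Omega^4_20, except P b
   and Y a.  If two frames with the same structure functions have different P b
   and Y a, then the integrability conditions lead to a contradiction on some
   open set, where either d_b Omega^4_20 = 0 or d_b Omega^4_20 <> 0.  Hence equal
   structure functions give a local diffeomorphism of R^3 matching the frames.
   It preserves the fibres over the plane and the solutions up to factors,
   that is, it is the prolongation of a point map. *)
Require Import Defs.
From HB Require Import structures.
From mathcomp Require Import all_boot all_order all_algebra.
From mathcomp Require Import all_classical all_reals all_analysis.
From mathcomp Require Import ring lra zify.
From Stdlib Require Znat Pnat.

Set Implicit Arguments.
Unset Strict Implicit.
Unset Printing Implicit Defensive.

Import Order.TTheory GRing.Theory Num.Theory.
Import numFieldNormedType.Exports.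

Local Open Scope classical_set_scope.
Local Open Scope ring_scope.

(** * Smooth maps *)

Section Smooth.
Variables (R : realType).

(** All three operators Delta annihilate I. Hence on a normalized function of weights (r, s) they
    act as P, X, Y plus (3 r + 2 s) / 8 times c, a, b, and (c, a, b) are the components along (P, X,
    Y) of a connection form. Its curvature has the components 24/5 [n5], 8 [q1] and 8 [q2]. The
    Jacobi identity of the frame expresses [q1] and [q2] by first derivatives of [n4], [n5], [n6];
    one derivative further, I and H themselves appear ([cotton_p], [cotton_x]). So both relative
    invariants can be read off brackets, and their behaviour under point maps follows without
    expanding jets. The obstacle in the converse is that P b and Y a are constrained by differential
    equations only. Subtracting the equations of two candidate frames leaves an overdetermined
    system for the two differences, whose compatibility has to be refuted. The identities are too
    long to handle by rewriting. They are certified by a reflective normal form for polynomials in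
    iterated derivations; to keep them free of divisions, I and H enter through their logarithms and
    the roots through their logarithmic derivatives. *)

Lemma near_eq_differentiable (V W : normedModType R) (f g : V -> W) (a : V) :
  (\near a, f a = g a) -> differentiable f a -> differentiable g a.
Proof.
move=> fg df.
have ga : g a = f a by rewrite (nbhs_singleton fg).
have H : g \o shift a = cst (g a) + 'd f a +o_ 0 id.
  apply/eqaddoP => e e0.
  have /eqaddoP/(_ e e0) := diff_locally df.
  have fg' : \forall h \near (0 : V), f (h + a) = g (h + a).
    by move: fg; rewrite (near_shift 0) /= subr0; apply: filterS => x ->.
  apply: filterS2 fg' => h /= E; rewrite /= !fctE /= E ga.
  by [].
have E : 'd g a = 'd f a :> (V -> W).
  by apply: diff_unique => //; exact: diff_continuous.
apply/diff_locallyP; rewrite E; split => //; exact: diff_continuous.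
Qed.

Definition eq_on (V W : Type) (A : set V) (f g : V -> W) := forall a, A a -> f a = g a.

Lemma near_open (V : normedModType R) (A : set V) (a : V) (P : V -> Prop) :
  open A -> A a -> (forall x, A x -> P x) -> \near a, P a.
Proof. by move=> oA Aa AP; apply: filterS AP _; exact: open_nbhs_nbhs. Qed.

Lemma Ck_on_eq (V W : normedModType R) n (A : set V) (f g : V -> W) :
  open A -> eq_on A f g -> Ck_on n A f -> Ck_on n A g.
Proof.
move=> oA; elim: n f g => [|n IH] f g fg /=.
  move=> cf a Aa; have fga : \near a, f a = g a by exact: near_open fg.
  have /= := cf _ Aa; rewrite /prop_for /continuous_at (fg _ Aa) => cfa.
  by apply: cvg_trans cfa; apply: near_eq_cvg; apply: filterS fga.
case=> df ck; split=> [a Aa|v].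
  by apply: near_eq_differentiable (df _ Aa); exact: near_open fg.
apply: IH (ck v) => a Aa; apply: near_eq_derive; exact: near_open fg.
Qed.

Definition smooth (V W : normedModType R) (A : set V) (g : V -> W) :=
  forall n, Ck_on n A g.

Lemma smooth_eq (V W : normedModType R) (A : set V) (f g : V -> W) :
  open A -> eq_on A f g -> smooth A f -> smooth A g.
Proof. by move=> oA fg sf n; apply: Ck_on_eq fg (sf n). Qed.

Lemma smooth_diff (V W : normedModType R) (A : set V) (f : V -> W) a :
  smooth A f -> A a -> differentiable f a.
Proof. by move=> /(_ 1%N) [df _]; exact: df. Qed.

Lemma smooth_derive (V W : normedModType R) (A : set V) (f : V -> W) v :
  smooth A f -> smooth A (fun a => 'D_v f a).
Proof. by move=> sf n; have [_] := sf n.+1; exact. Qed.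

Lemma smooth_continuous (V W : normedModType R) (A : set V) (f : V -> W) a :
  smooth A f -> A a -> {for a, continuous f}.
Proof. by move=> /(_ 0%N); exact. Qed.

Lemma Ck_on_sub (V W : normedModType R) n (A B : set V) (f : V -> W) :
  A `<=` B -> Ck_on n B f -> Ck_on n A f.
Proof.
move=> AB; elim: n f => [|n IH] f /=; first by move=> H a /AB; exact: H.
by case=> df ck; split=> [a /AB|v]; [exact: df|exact: IH].
Qed.

Lemma smooth_sub (V W : normedModType R) (A B : set V) (f : V -> W) :
  A `<=` B -> smooth B f -> smooth A f.
Proof. by move=> AB sf n; exact: Ck_on_sub (sf n). Qed.

(** An induction on the order of differentiability needs a class of functions that contains all
    directional derivatives of its members. Closure up to [eq_on A] suffices because [Ck_on] on an
    open set ignores values outside it. *)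
Lemma smooth_coind (V W : normedModType R) (A : set V) (C : (V -> W) -> Prop) :
  open A ->
  (forall g, C g -> (forall a, A a -> differentiable g a) /\
     forall v, exists2 g', C g' & eq_on A g' (fun a => 'D_v g a)) ->
  forall g, C g -> smooth A g.
Proof.
move=> oA HC g Cg n; elim: n g Cg => [|n IH] g Cg /=.
  by move=> a Aa; apply: differentiable_continuous; exact: (HC _ Cg).1.
have [dg Dg] := HC _ Cg; split => // v; have [g' Cg' gg'] := Dg v.
by apply: Ck_on_eq gg' _ => //; exact: IH.
Qed.

End Smooth.

Section SmoothClosure.
Variables (R : realType).
Notation R3 := (R * R * R)%type.
Notation R2 := (R * R)%type.

Lemma derive_R3 (g : R3 -> R) (w : R3) (x y z : R) : differentiable g w ->
  'D_((x, y, z) : R3) g w = x * 'D_((1, 0, 0) : R3) g w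
    + y * 'D_((0, 1, 0) : R3) g w + z * 'D_((0, 0, 1) : R3) g w.
Proof.
move=> dg; rewrite !deriveE //.
have -> : ((x, y, z) : R3) = x *: (1, 0, 0) + y *: (0, 1, 0) + z *: (0, 0, 1).
  rewrite -[RHS]/((x * 1 + y * 0 + z * 0, x * 0 + y * 1 + z * 0, x * 0 + y * 0 + z * 1)).
  by rewrite !(mulr1, mulr0, addr0, add0r).
by rewrite !linearD !linearZ.
Qed.

Lemma derive_R2 (g : R2 -> R) (w : R2) (x y : R) : differentiable g w ->
  'D_((x, y) : R2) g w = x * 'D_((1, 0) : R2) g w + y * 'D_((0, 1) : R2) g w.
Proof.
move=> dg; rewrite !deriveE //.
have -> : ((x, y) : R2) = x *: (1, 0) + y *: (0, 1).
  rewrite -[RHS]/((x * 1 + y * 0, x * 0 + y * 1)).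
  by rewrite !(mulr1, mulr0, addr0, add0r).
by rewrite !linearD !linearZ.
Qed.

Variable V : normedModType R.
Implicit Types (f g : V -> R) (a v : V).

Lemma derive_comp (W : normedModType R) (h : V -> W) (g : W -> R) a v :
  differentiable h a -> differentiable g (h a) ->
  'D_v (g \o h) a = 'D_('D_v h a) g (h a).
Proof.
move=> dh dg; rewrite (deriveE v (differentiable_comp dh dg)) diff_comp //.
by rewrite (deriveE _ dg) (deriveE _ dh).
Qed.

Lemma differentiable3 (f1 f2 f3 : V -> R) a :
  differentiable f1 a -> differentiable f2 a -> differentiable f3 a ->
  differentiable (fun x => (f1 x, f2 x, f3 x) : R3) a.
Proof. by move=> d1 d2 d3; do 2! apply: differentiable_pair => //. Qed.

Lemma derive_pair (W1 W2 : normedModType R) (f1 : V -> W1) (f2 : V -> W2) a v :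
  differentiable f1 a -> differentiable f2 a ->
  'D_v (fun x => (f1 x, f2 x)) a = ('D_v f1 a, 'D_v f2 a).
Proof.
move=> d1 d2; rewrite (deriveE v (differentiable_pair d1 d2)) diff_pair //.
by rewrite (deriveE _ d1) (deriveE _ d2).
Qed.

Lemma derive_comp3 (f1 f2 f3 : V -> R) (g : R3 -> R) a v :
  differentiable f1 a -> differentiable f2 a -> differentiable f3 a ->
  differentiable g (f1 a, f2 a, f3 a) ->
  'D_v (fun x => g (f1 x, f2 x, f3 x)) a =
    'D_v f1 a * 'D_((1, 0, 0) : R3) g (f1 a, f2 a, f3 a)
    + 'D_v f2 a * 'D_((0, 1, 0) : R3) g (f1 a, f2 a, f3 a)
    + 'D_v f3 a * 'D_((0, 0, 1) : R3) g (f1 a, f2 a, f3 a).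
Proof.
move=> d1 d2 d3 dg; have dF := differentiable3 d1 d2 d3.
rewrite (derive_comp v dF) // -derive_R3 // !derive_pair //.
exact: differentiable_pair.
Qed.

Lemma derive_comp2 (f1 f2 : V -> R) (g : R2 -> R) a v :
  differentiable f1 a -> differentiable f2 a -> differentiable g (f1 a, f2 a) ->
  'D_v (fun x => g (f1 x, f2 x)) a =
    'D_v f1 a * 'D_((1, 0) : R2) g (f1 a, f2 a)
    + 'D_v f2 a * 'D_((0, 1) : R2) g (f1 a, f2 a).
Proof.
move=> d1 d2 dg; have dF : differentiable (fun x => (f1 x, f2 x) : R2) a.
  exact: differentiable_pair.
by rewrite (derive_comp v dF) // -derive_R2 // !derive_pair.
Qed.

Lemma derive_comp1 f (g : R -> R) (dg : R) a v :
  differentiable f a -> is_derive (f a) 1 g dg ->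
  differentiable (g \o f) a /\ 'D_v (g \o f) a = dg * 'D_v f a.
Proof.
move=> df [ddg dgE].
have dg' : differentiable g (f a) by exact/derivable1_diffP.
split; first exact: differentiable_comp.
rewrite (derive_comp v df dg') -dgE !(deriveE _ dg').
have -> : 'd g (f a) ('D_v f a) = 'D_v f a *: 'd g (f a) 1.
  by rewrite -linearZ; congr ('d g (f a) _); rewrite /GRing.scale /= mulr1.
by rewrite mulrC.
Qed.

(** The class is syntactic so that the derivative of each constructor is again written with
    constructors, which is the form that [smooth_coind] needs. Inner maps are given by scalar
    components to keep the chain rule scalar. *)
Inductive sclass (A : set V) : (V -> R) -> Prop :=
| Sbase g : smooth A g -> sclass A g
| Scst c : sclass A (fun=> c)
| Sadd f g : sclass A f -> sclass A g -> sclass A (fun x => f x + g x)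
| Smul f g : sclass A f -> sclass A g -> sclass A (fun x => f x * g x)
| Sinv f : sclass A f -> (forall a, A a -> f a != 0) -> sclass A (fun x => (f x)^-1)
| Sexp f : sclass A f -> sclass A (fun x => expR (f x))
| Sln f : sclass A f -> (forall a, A a -> 0 < f a) -> sclass A (fun x => ln (f x))
| Scomp3 (B : set R3) (g : R3 -> R) f1 f2 f3 : smooth B g ->
    sclass A f1 -> sclass A f2 -> sclass A f3 ->
    (forall a, A a -> B (f1 a, f2 a, f3 a)) -> sclass A (fun x => g (f1 x, f2 x, f3 x))
| Scomp2 (B : set R2) (g : R2 -> R) f1 f2 : smooth B g -> sclass A f1 -> sclass A f2 ->
    (forall a, A a -> B (f1 a, f2 a)) -> sclass A (fun x => g (f1 x, f2 x)).

Lemma sclass_derive (A : set V) g : sclass A g ->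
  (forall a, A a -> differentiable g a) /\
     forall v, exists2 g', sclass A g' & eq_on A g' (fun a => 'D_v g a).
Proof.
elim=> {g} [g sg|c|f g _ [df Df] _ [dg Dg]|f g cf [df Df] cg [dg Dg]|f cf [df Df] f0
  |f cf [df Df]|f cf [df Df] f0|B g f1 f2 f3 sg c1 [d1 D1] c2 [d2 D2] c3 [d3 D3] AB
  |B g f1 f2 sg c1 [d1 D1] c2 [d2 D2] AB].
- split=> [a|v]; first exact: smooth_diff.
  by exists (fun a => 'D_v g a) => //; apply: Sbase; exact: smooth_derive.
- split=> [a _|v]; first exact: differentiable_cst.
  by exists (fun=> 0); [exact: Scst|move=> a _; rewrite derive_cst].
- split=> [a Aa|v]; first by apply: differentiableD; auto.
  have [f' cf' Ef] := Df v; have [g' cg' Eg] := Dg v.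
  exists (fun x => f' x + g' x); first exact: Sadd.
  move=> a Aa; rewrite Ef // Eg // -deriveD //.
    exact: diff_derivable (df _ Aa).
  exact: diff_derivable (dg _ Aa).
- split=> [a Aa|v]; first by apply: differentiableM; auto.
  have [f' cf' Ef] := Df v; have [g' cg' Eg] := Dg v.
  exists (fun x => f x * g' x + g x * f' x); first by apply: Sadd; exact: Smul.
  move=> a Aa; rewrite Ef // Eg // -[RHS]/('D_v (f * g) a) deriveM //.
    exact: diff_derivable (df _ Aa).
  exact: diff_derivable (dg _ Aa).
- split=> [a Aa|v]; first by apply: differentiableV; auto.
  have [f' cf' Ef] := Df v.
  exists (fun x => (- 1) * ((f x)^-1 * (f x)^-1) * f' x).
    by apply: Smul => //; apply: Smul; [exact: Scst|apply: Smul; exact: Sinv].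
  move=> a Aa; rewrite Ef // -[RHS]/('D_v (fun y => (f y)^-1) a) deriveV ?f0 //.
    by rewrite /GRing.scale /= -exprVn expr2 mulN1r.
  exact: diff_derivable (df _ Aa).
- split=> [a Aa|v]; first by have [] := derive_comp1 0 (df _ Aa) (is_derive_expR (f a)).
  have [f' cf' Ef] := Df v.
  exists (fun x => expR (f x) * f' x); first by apply: Smul => //; exact: Sexp.
  by move=> a Aa; rewrite Ef //; have [_ ->] := derive_comp1 v (df _ Aa) (is_derive_expR (f a)).
- split=> [a Aa|v].
    by have [] := derive_comp1 0 (df _ Aa) (is_derive1_ln (f0 _ Aa)).
  have [f' cf' Ef] := Df v.
  exists (fun x => (f x)^-1 * f' x).
    by apply: Smul => //; apply: Sinv => // a /f0 /lt0r_neq0.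
  by move=> a Aa; rewrite Ef //; have [_ ->] := derive_comp1 v (df _ Aa) (is_derive1_ln (f0 _ Aa)).
- have dF a : A a -> differentiable (fun x => (f1 x, f2 x, f3 x) : R3) a.
    by move=> Aa; apply: differentiable3; auto.
  split=> [a Aa|v].
    apply: (@differentiable_comp _ _ _ _ (fun x => (f1 x, f2 x, f3 x) : R3) g); first exact: dF.
    exact: smooth_diff sg (AB _ Aa).
  have [f1' c1' E1] := D1 v; have [f2' c2' E2] := D2 v; have [f3' c3' E3] := D3 v.
  exists (fun x => f1' x * 'D_((1, 0, 0) : R3) g (f1 x, f2 x, f3 x)
    + f2' x * 'D_((0, 1, 0) : R3) g (f1 x, f2 x, f3 x)
    + f3' x * 'D_((0, 0, 1) : R3) g (f1 x, f2 x, f3 x)).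
    apply: Sadd; first apply: Sadd.
    + apply: Smul => //; exact: (@Scomp3 A B (fun w => 'D_((1, 0, 0) : R3) g w) f1 f2 f3 (smooth_derive _ sg)).
    + apply: Smul => //; exact: (@Scomp3 A B (fun w => 'D_((0, 1, 0) : R3) g w) f1 f2 f3 (smooth_derive _ sg)).
    + apply: Smul => //; exact: (@Scomp3 A B (fun w => 'D_((0, 0, 1) : R3) g w) f1 f2 f3 (smooth_derive _ sg)).
  move=> a Aa; rewrite E1 // E2 // E3 // derive_comp3 //; auto.
  exact: smooth_diff sg (AB _ Aa).
- split=> [a Aa|v].
    apply: (@differentiable_comp _ _ _ _ (fun x => (f1 x, f2 x) : R2) g).
      by apply: differentiable_pair; auto.
    exact: smooth_diff sg (AB _ Aa).
  have [f1' c1' E1] := D1 v; have [f2' c2' E2] := D2 v.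
  exists (fun x => f1' x * 'D_((1, 0) : R2) g (f1 x, f2 x)
    + f2' x * 'D_((0, 1) : R2) g (f1 x, f2 x)).
    apply: Sadd.
    + apply: Smul => //; exact: (@Scomp2 A B (fun w => 'D_((1, 0) : R2) g w) f1 f2 (smooth_derive _ sg)).
    + apply: Smul => //; exact: (@Scomp2 A B (fun w => 'D_((0, 1) : R2) g w) f1 f2 (smooth_derive _ sg)).
  move=> a Aa; rewrite E1 // E2 // derive_comp2 //; auto.
  exact: smooth_diff sg (AB _ Aa).
Qed.

Lemma sclass_smooth (A : set V) g : open A -> sclass A g -> smooth A g.
Proof. by move=> oA; apply: smooth_coind => // h; exact: sclass_derive. Qed.

End SmoothClosure.

(** * Symmetry of second derivatives *)

Section Schwarz.
Variables (R : realType) (V : normedModType R).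
Implicit Types (g : V -> R) (a u v x : V) (A : set V).

Lemma is_derive_line g x u (s : R) : differentiable g (x + s *: u) ->
  is_derive s 1 (fun s => g (x + s *: u)) ('D_u g (x + s *: u)).
Proof.
move=> dg.
have dl : differentiable (fun s : R => x + s *: u) s by exact: ex_diff.
have Dl : 'D_1 (fun s : R => x + s *: u) s = u.
  rewrite (deriveE _ dl) -[fun s : R => _]/((cst x : R -> V) + ( *:%R^~ u : R -> V)).
  by rewrite diff_val /= add0r scale1r.
apply: DeriveDef; last by rewrite (derive_comp (1 : R^o) dl dg) Dl.
by apply/derivable1_diffP; exact: (differentiable_comp dl).
Qed.

Lemma line_continuous g x u (s : R) : differentiable g (x + s *: u) ->
  {for s, continuous (fun s : R => g (x + s *: u))}.
Proof.
move=> /is_derive_line [+ _] => /derivable1_diffP; exact: differentiable_continuous.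
Qed.

Lemma MVT_line g x u (h : R) : 0 < h ->
  (forall s, 0 <= s <= h -> differentiable g (x + s *: u)) ->
  exists2 s, 0 < s < h & g (x + h *: u) - g x = h * 'D_u g (x + s *: u).
Proof.
move=> h0 dg; have [||s] := @MVT R (fun s => g (x + s *: u)) (fun s => 'D_u g (x + s *: u)) 0 h h0.
- move=> s; rewrite in_itv /= => /andP[s0 sh]; apply: is_derive_line.
  by apply: dg; rewrite !ltW.
- apply: continuous_in_subspaceT => s; rewrite inE /= in_itv /= => sh.
  exact: line_continuous (dg _ sh).
rewrite in_itv /= scale0r addr0 subr0 => sh E; exists s => //.
by rewrite E mulrC.
Qed.

(** Two applications of the mean value theorem, first along u to the difference in the direction v,
    then along v. The left side is symmetric in u and v up to reordering, the right side is not. *)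
Lemma second_difference A g a u v (h : R) : 0 < h -> smooth A g ->
  (forall s t, 0 <= s <= h -> 0 <= t <= h -> A (a + s *: u + t *: v)) ->
  exists2 st : R * R, 0 < st.1 < h /\ 0 < st.2 < h &
    g (a + h *: u + h *: v) - g (a + h *: u) - (g (a + h *: v) - g a)
    = h * (h * 'D_v (fun x => 'D_u g x) (a + st.1 *: u + st.2 *: v)).
Proof.
move=> h0 sg Ast.
pose k x := g (x + h *: v) - g x.
have shiftd x : A (x + h *: v) ->
    differentiable (fun y => g (y + h *: v)) x /\
    'D_u (fun y => g (y + h *: v)) x = 'D_u g (x + h *: v).
  move=> Ax; have dsh : differentiable (fun y => y + h *: v) x by exact: ex_diff.
  have dg := smooth_diff sg Ax.
  split; first exact: (differentiable_comp dsh dg).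
  rewrite (derive_comp u dsh dg); congr ('D_ _ g _).
  rewrite (deriveE _ dsh) -[fun y : V => _]/((@idfun V : V -> V) + (cst (h *: v) : V -> V)).
  by rewrite diff_val /= addr0.
have hh : 0 <= h <= h by rewrite lexx ltW.
have h00 : 0 <= (0 : R) <= h by rewrite lexx ltW.
have As s : 0 <= s <= h -> A (a + s *: u + h *: v) by move=> sh; exact: Ast.
have As0 s : 0 <= s <= h -> A (a + s *: u).
  by move=> sh; have := Ast _ _ sh h00; rewrite scale0r addr0.
have [|s sh E] := @MVT_line k a u h h0.
  move=> s sh; apply: differentiableB; first exact: (shiftd _ (As _ sh)).1.
  exact: smooth_diff sg (As0 _ sh).
have sh' : 0 <= s <= h by case/andP: sh => /ltW -> /ltW.
have [|t th E2] := @MVT_line (fun x => 'D_u g x) (a + s *: u) v h h0.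
  by move=> t th; apply: smooth_diff (smooth_derive u sg) _; exact: Ast.
exists (s, t) => //; rewrite -E2 /= -[LHS]/(k (a + h *: u) - k a) E; congr (_ * _).
rewrite /k deriveB.
- by rewrite (shiftd _ (As _ sh')).2.
- exact: diff_derivable (shiftd _ (As _ sh')).1.
- exact: diff_derivable (smooth_diff sg (As0 _ sh')).
Qed.

Lemma continuous_eq_at (f1 f2 : V -> R) a :
  {for a, continuous f1} -> {for a, continuous f2} ->
  (forall d, 0 < d -> exists p1 p2, [/\ ball a d p1, ball a d p2 & f1 p1 = f2 p2]) ->
  f1 a = f2 a.
Proof.
move=> c1 c2 H; apply/eqP; rewrite -subr_eq0 -normr_eq0 eq_le normr_ge0 andbT.
apply/ler_addgt0Pl => e e0; rewrite addr0.
have e20 : 0 < e / 2 by rewrite divr_gt0.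
have /cvgrPdist_lt/(_ _ e20) n1 := c1.
have /cvgrPdist_lt/(_ _ e20) n2 := c2.
have [d /= d0 bd] := (nbhs_ballP _ _).1 (filterI n1 n2).
have [p1 [p2 [b1 b2 E]]] := H _ d0.
have [q1 _] := bd _ b1; have [_ q2] := bd _ b2.
have -> : f1 a - f2 a = (f1 a - f1 p1) + (f2 p2 - f2 a) by rewrite E; ring.
apply: (le_trans (ler_normD _ _)); rewrite [e]splitr lerD //; first exact: ltW.
by rewrite distrC; exact: ltW.
Qed.

(** Each order of differentiation is attained, at some point of any small ball, by the same second
    difference; continuity of both iterated derivatives then gives equality at [a]. *)
Lemma derive_comm A g a u v : open A -> smooth A g -> A a ->
  'D_u (fun x => 'D_v g x) a = 'D_v (fun x => 'D_u g x) a.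
Proof.
move=> oA sg Aa; apply: (@continuous_eq_at (fun a => 'D_u (fun x => 'D_v g x) a)
  (fun a => 'D_v (fun x => 'D_u g x) a)).
- exact: smooth_continuous (smooth_derive u (smooth_derive v sg)) Aa.
- exact: smooth_continuous (smooth_derive v (smooth_derive u sg)) Aa.
move=> d1 d10.
have [d2 /= d20 bd] := (nbhs_ballP _ _).1 (open_nbhs_nbhs (conj oA Aa)).
pose d := Num.min d1 d2.
have d0 : 0 < d by rewrite lt_min d10.
have bA x : ball a d x -> A x.
  move=> bx; apply: bd; apply: (@le_ball _ _ _ d); last exact: bx.
  by rewrite ge_min lexx orbT.
have bd1 x : ball a d x -> ball a d1 x by apply: (@le_ball _ _ _ d); rewrite ge_min lexx.
(* The summand 1 keeps the denominator positive when u = v = 0, and the factor 1/2 keeps the whole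
   parallelogram strictly inside the ball. *)
pose h := d / (`|u| + `|v| + 1) / 2.
have N0 : 0 < `|u| + `|v| + 1 by rewrite ltr_wpDl // addr_ge0.
have h0 : 0 < h by rewrite !divr_gt0.
have inb s t : 0 <= s <= h -> 0 <= t <= h -> ball a d (a + s *: u + t *: v).
  move=> /andP[s0 sh] /andP[t0 th]; rewrite -ball_normE /= -addrA opprD addrA subrr sub0r normrN.
  apply: (le_lt_trans (ler_normD _ _)); rewrite !normrZ !ger0_norm //.
  apply: (@le_lt_trans _ _ (h * (`|u| + `|v| + 1))).
    by rewrite !mulrDr mulr1 ler_wpDr ?(ltW h0) // lerD // ler_wpM2r.
  by rewrite /h mulrAC divfK ?gt_eqF // ltr_pdivrMr // mulr2n mulrDr !mulr1 ltrDl.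
have [p1 [/andP[/ltW p11 /ltW p12] /andP[/ltW p13 /ltW p14]] E1] :=
  @second_difference A g a v u h h0 sg
  (fun s t hs ht => bA _ (eq_ind_r (ball a d) (inb t s ht hs) (addrAC a (s *: v) (t *: u)))).
have [p2 [/andP[/ltW p21 /ltW p22] /andP[/ltW p23 /ltW p24]] E2] :=
  @second_difference A g a u v h h0 sg (fun s t hs ht => bA _ (inb s t hs ht)).
exists (a + p1.1 *: v + p1.2 *: u), (a + p2.1 *: u + p2.2 *: v); split.
- by rewrite addrAC; apply: bd1; apply: inb; rewrite ?p11 ?p12 ?p13 ?p14.
- by apply: bd1; apply: inb; rewrite ?p21 ?p22 ?p23 ?p24.
have hn0 : h != 0 by rewrite gt_eqF.
move: E1 E2; set D1 := 'D_u _ _; set D2 := 'D_v _ _ => E1 E2.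
have E : h * (h * D1) = h * (h * D2).
  have swap (x y t c : R) : x - y - (t - c) = x - t - (y - c) by ring.
  have e := congr1 (fun x => g x - g (a + h *: v) - (g (a + h *: u) - g a)) (addrAC a (h *: v) (h *: u)).
  exact: (etrans (esym E1) (etrans e (etrans (swap _ _ _ _) E2))).
exact: (mulfI hn0 (mulfI hn0 E)).
Qed.

End Schwarz.

(** * A normalizer for differential polynomials *)

(* Fractions in binary integers, because the rat of MathComp is too slow under [vm_compute]. *)
Section Coefficients.
Variable R : realType.

Definition coef := (BinNums.Z * BinNums.positive)%type.

Definition zr (z : BinNums.Z) : R := (BinInt.Z.to_nat z)%:R - (BinInt.Z.to_nat (BinInt.Z.opp z))%:R.
Definition pr (p : BinNums.positive) : R := (BinPos.Pos.to_nat p)%:R.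
Definition cr (c : coef) : R := zr c.1 / pr c.2.

(** Cancelling the gcd after every operation keeps the numbers short during [vm_compute]. *)
Definition cred (c : coef) : coef :=
  let '(g, (a, b)) := BinInt.Z.ggcd c.1 (BinNums.Zpos c.2) in (a, BinInt.Z.to_pos b).
Definition cadd (c d : coef) : coef :=
  cred (BinInt.Z.add (BinInt.Z.mul c.1 (BinNums.Zpos d.2)) (BinInt.Z.mul d.1 (BinNums.Zpos c.2)),
        BinPos.Pos.mul c.2 d.2).
Definition cmul (c d : coef) : coef := cred (BinInt.Z.mul c.1 d.1, BinPos.Pos.mul c.2 d.2).
Definition c1 : coef := (BinNums.Zpos BinNums.xH, BinNums.xH).
Definition cN1 : coef := (BinNums.Zneg BinNums.xH, BinNums.xH).
Definition cnat (n : nat) : coef := (BinInt.Z.of_nat n, BinNums.xH).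
(** The value at 0 follows the convention that the inverse of 0 is 0, so [cr_inv] has no side
    condition. *)
Definition cinv (n : nat) : coef :=
  if n is 0 then (BinNums.Z0, BinNums.xH) else (BinNums.Zpos BinNums.xH, BinPos.Pos.of_nat n).

Lemma zrD x y : zr (BinInt.Z.add x y) = zr x + zr y.
Proof.
have H : (BinInt.Z.to_nat (BinInt.Z.add x y) + BinInt.Z.to_nat (BinInt.Z.opp x) + BinInt.Z.to_nat (BinInt.Z.opp y)
  = BinInt.Z.to_nat (BinInt.Z.opp (BinInt.Z.add x y)) + BinInt.Z.to_nat x + BinInt.Z.to_nat y)%N.
  lia.
have := congr1 (fun n => n%:R : R) H; rewrite /zr !natrD => E; lra.
Qed.

Lemma zrM x y : zr (BinInt.Z.mul x y) = zr x * zr y.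
Proof.
have H : (BinInt.Z.to_nat (BinInt.Z.mul x y) + BinInt.Z.to_nat x * BinInt.Z.to_nat (BinInt.Z.opp y)
     + BinInt.Z.to_nat (BinInt.Z.opp x) * BinInt.Z.to_nat y
  = BinInt.Z.to_nat (BinInt.Z.opp (BinInt.Z.mul x y)) + BinInt.Z.to_nat x * BinInt.Z.to_nat y
     + BinInt.Z.to_nat (BinInt.Z.opp x) * BinInt.Z.to_nat (BinInt.Z.opp y))%N.
  by case: x => [|x|x]; case: y => [|y|y] //=; lia.
have := congr1 (fun n => n%:R : R) H; rewrite /zr !natrD !natrM => E; lra.
Qed.

Lemma zr_pos p : zr (BinNums.Zpos p) = pr p.
Proof. by rewrite /zr /pr /= subr0. Qed.

Lemma pr_gt0 p : 0 < pr p.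
Proof. by rewrite /pr ltr0n; apply/ssrnat.ltP; exact: Pnat.Pos2Nat.is_pos. Qed.

Lemma pr_neq0 p : pr p != 0.
Proof. exact: lt0r_neq0 (pr_gt0 p). Qed.

Lemma cr_red c : cr (cred c) = cr c.
Proof.
rewrite /cred; have := BinInt.Z.ggcd_correct_divisors c.1 (BinNums.Zpos c.2).
case E : (BinInt.Z.ggcd c.1 _) => [g [a b]] [E1 E2] /=.
have g0 : BinInt.Z.le BinNums.Z0 g.
  by have := BinInt.Z.ggcd_gcd c.1 (BinNums.Zpos c.2); rewrite E /= => ->; exact: BinInt.Z.gcd_nonneg.
have [b' Eb] : exists b', b = BinNums.Zpos b'.
  by case: b E2 {E} => [|b'|b'] E2; [lia|by exists b'|nia].
have g1 : zr g != 0.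
  have : zr (BinNums.Zpos c.2) != 0 by rewrite zr_pos pr_neq0.
  by rewrite E2 zrM mulf_eq0 negb_or => /andP[].
rewrite /cr -(zr_pos c.2) E1 E2 !zrM Eb /= zr_pos.
by rewrite -mulf_div divff // mul1r.
Qed.

Lemma crD c d : cr (cadd c d) = cr c + cr d.
Proof.
rewrite /cadd cr_red /cr /= zrD !zrM !zr_pos.
have -> : pr (BinPos.Pos.mul c.2 d.2) = pr c.2 * pr d.2 by rewrite -!zr_pos -zrM.
by field; rewrite !pr_neq0.
Qed.

Lemma crM c d : cr (cmul c d) = cr c * cr d.
Proof.
rewrite /cmul cr_red /cr /= !zrM.
have -> : pr (BinPos.Pos.mul c.2 d.2) = pr c.2 * pr d.2 by rewrite -!zr_pos -zrM.
by field; rewrite !pr_neq0.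
Qed.

Lemma cr1 : cr c1 = 1. Proof. by rewrite /cr /= /zr /pr /= subr0 divr1. Qed.
Lemma crN1 : cr cN1 = - 1. Proof. by rewrite /cr /= /zr /pr /= divr1 sub0r. Qed.
Lemma cr_nat n : cr (cnat n) = n%:R.
Proof.
rewrite /cr /= /pr /= divr1 /zr Znat.Nat2Z.id.
have -> : BinInt.Z.to_nat (BinInt.Z.opp (BinInt.Z.of_nat n)) = 0%N by lia.
by rewrite subr0.
Qed.
Lemma cr_inv n : cr (cinv n) = n%:R^-1.
Proof.
case: n => [|n]; first by rewrite /cr /= /zr /= subr0 mul0r invr0.
rewrite /cr -[cinv n.+1]/(BinNums.Zpos BinNums.xH, BinPos.Pos.of_nat n.+1) /fst /snd zr_pos /pr.
by rewrite Pnat.Nat2Pos.id // mul1r.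
Qed.
Lemma cr0 p : cr (BinNums.Z0, p) = 0.
Proof. by rewrite /cr /= /zr /= subr0 mul0r. Qed.
End Coefficients.

(* The variable (b, [:: k1; ..; kn]) stands for the iterated derivative d_k1 (.. (d_kn (base b))). *)
Definition dvar := (nat * seq nat)%type.
Definition dpoly := seq (coef * seq dvar).

Fixpoint lexle (s t : seq nat) : bool :=
  match s, t with
  | [::], _ => true
  | _, [::] => false
  | x :: s', y :: t' => if x == y then lexle s' t' else (x < y)%N
  end.
Definition vle (v w : dvar) : bool := if v.1 == w.1 then lexle v.2 w.2 else (v.1 < w.1)%N.

Fixpoint minsert (v : dvar) (m : seq dvar) : seq dvar :=
  if m is w :: m' then if vle v w then v :: m else w :: minsert v m' else [:: v].
Definition mmul (m1 m2 : seq dvar) := foldr minsert m2 m1.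

(** A coefficient that becomes zero is removed together with its monomial, so that cancellation
    shows up as the empty list and can be tested by [nilp]. *)
Fixpoint addt (c : coef) (m : seq dvar) (p : dpoly) : dpoly :=
  match p with
  | [::] => if c.1 is BinNums.Z0 then [::] else [:: (c, m)]
  | (c', m') :: p' =>
      if m == m' then let s := cadd c c' in if s.1 is BinNums.Z0 then p' else (s, m') :: p'
      else (c', m') :: addt c m p'
  end.
Definition padd (p q : dpoly) : dpoly := foldr (fun t acc => addt t.1 t.2 acc) q p.
Definition pmult (c : coef) (m : seq dvar) (p : dpoly) : dpoly :=
  foldr (fun t acc => addt (cmul c t.1) (mmul m t.2) acc) [::] p.
Definition pmul (p q : dpoly) : dpoly := foldr (fun t acc => padd (pmult t.1 t.2 q) acc) [::] p.
Definition pvar (v : dvar) : dpoly := [:: (c1, [:: v])].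
Definition pcst (c : coef) : dpoly := addt c [::] [::].

Fixpoint md (r : dvar -> dpoly) (m : seq dvar) : dpoly :=
  if m is v :: m' then padd (pmult c1 m' (r v)) (pmult c1 [:: v] (md r m')) else [::].
Definition pd (r : dvar -> dpoly) (p : dpoly) : dpoly :=
  foldr (fun t acc => padd (pmult t.1 [::] (md r t.2)) acc) [::] p.

Definition linc := seq (nat * dpoly).

Section Rules.
(* [alias k] expresses d_k as a combination of other derivations, [comm k k'] the
   bracket [d_k, d_k'], and [tab k v] gives the special values of d_k on variables. *)
Variables (alias : nat -> option linc) (comm : nat -> nat -> linc)
  (tab : nat -> dvar -> option dpoly).

(** Rewrites d_k applied to a variable. [n] is fuel. Aliases are expanded first, then special values
    are looked up, and otherwise d_k is moved past a smaller index at the price of a bracket term;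
    an aliased index k' has no bracket rule and is left in place. *)
Fixpoint rule (n k : nat) (v : dvar) {struct n} : dpoly :=
  if n is n'.+1 then
    match alias k with
    | Some l => foldr (fun t acc => padd (pmul t.2 (rule n' t.1 v)) acc) [::] l
    | None =>
      match tab k v with
      | Some p => p
      | None =>
        match v.2 with
        | [::] => pvar (v.1, [:: k])
        | k' :: ks =>
          if (k <= k')%N || (alias k' : bool) then pvar (v.1, k :: v.2) else
          foldr (fun t acc => padd (pmul t.2 (rule n' t.1 (v.1, ks))) acc)
            (pd (rule n' k') (rule n' k (v.1, ks))) (comm k k')
        end
      end
    end
  else pvar (v.1, k :: v.2).
End Rules.

(** Only numerals can be inverted. Quotients of functions are avoided by logarithms, or by a base
    variable for the inverse together with the equation that defines it. *)
Inductive dexpr :=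
| EB of nat | EN of nat | EI of nat
| EAdd of dexpr & dexpr | EMul of dexpr & dexpr | EOpp of dexpr | ED of nat & dexpr.

(** * Soundness of the normalizer *)

Section Engine.
Variables (R : realType) (V : normedModType R) (A : set V).
Hypothesis oA : open A.

(** The operators act on total functions but are of interest on A alone; [der_eq] says that they do
    not see values outside A. *)
Record derivation (d : (V -> R) -> V -> R) : Prop := Derivation {
  der_smooth : forall g : V -> R, smooth A g -> smooth A (d g);
  der_eq : forall g h : V -> R, smooth A g -> eq_on A g h -> eq_on A (d g) (d h);
  der_cst : forall c, eq_on A (d (fun=> c)) (fun=> 0);
  der_add : forall g h : V -> R, smooth A g -> smooth A h ->
    eq_on A (d (fun z => g z + h z)) (fun z => d g z + d h z);
  der_mul : forall g h : V -> R, smooth A g -> smooth A h ->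
    eq_on A (d (fun z => g z * h z)) (fun z => g z * d h z + h z * d g z) }.

Lemma smooth_cst (c : R) : smooth A (fun=> c).
Proof. by apply: sclass_smooth => //; exact: Scst. Qed.
Lemma smooth_add (g h : V -> R) : smooth A g -> smooth A h -> smooth A (fun z => g z + h z).
Proof. by move=> sg sh; apply: sclass_smooth => //; apply: Sadd; exact: Sbase. Qed.
Lemma smooth_mul (g h : V -> R) : smooth A g -> smooth A h -> smooth A (fun z => g z * h z).
Proof. by move=> sg sh; apply: sclass_smooth => //; apply: Smul; exact: Sbase. Qed.
Lemma smooth_opp (g : V -> R) : smooth A g -> smooth A (fun z => - g z).
Proof.
move=> sg; apply: (smooth_eq oA) (smooth_mul (smooth_cst (- 1)) sg) => z _.
by rewrite mulN1r.
Qed.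

Variables (base : nat -> V -> R) (delta : nat -> (V -> R) -> V -> R).
Hypothesis base_smooth : forall b, smooth A (base b).
Hypothesis delta_der : forall k, derivation (delta k).

Definition env (v : dvar) : V -> R := foldr delta (base v.1) v.2.

Lemma env_smooth v : smooth A (env v).
Proof.
by case: v => b; elim=> [|k ks IH] /=; [exact: base_smooth|apply: (der_smooth (delta_der k)); exact: IH].
Qed.

Fixpoint meval (m : seq dvar) : V -> R :=
  if m is v :: m' then fun z => env v z * meval m' z else fun=> 1.
Fixpoint peval (p : dpoly) : V -> R :=
  if p is t :: p' then fun z => cr R t.1 * meval t.2 z + peval p' z else fun=> 0.

Lemma meval_smooth m : smooth A (meval m).
Proof.
by elim: m => [|v m IH] /=; [exact: smooth_cst|apply: smooth_mul => //; exact: env_smooth].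
Qed.
Lemma peval_smooth p : smooth A (peval p).
Proof.
elim: p => [|t p IH] /=; first exact: smooth_cst.
apply: smooth_add => //; apply: smooth_mul; [exact: smooth_cst|exact: meval_smooth].
Qed.

Lemma meval_insert v m z : meval (minsert v m) z = env v z * meval m z.
Proof. by elim: m => //= w m IH; case: ifP => //= _; rewrite IH mulrCA. Qed.
Lemma meval_mul m1 m2 z : meval (mmul m1 m2) z = meval m1 z * meval m2 z.
Proof. by elim: m1 => [|v m IH] /=; rewrite ?mul1r // meval_insert IH mulrA. Qed.
Lemma peval_addt c m p z : peval (addt c m p) z = cr R c * meval m z + peval p z.
Proof.
elim: p => [|[c' m'] p IH] /=.
  by case: c => [[|c|c] d] //=; rewrite cr0 mul0r add0r.
case: eqP => [<-|_] /=; last by rewrite IH addrCA.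
rewrite addrA -mulrDl -crD; case: (cadd c c') => [[|x|x] y] //=.
by rewrite cr0 mul0r add0r.
Qed.
Lemma peval_add p q z : peval (padd p q) z = peval p z + peval q z.
Proof. by elim: p => [|t p IH] /=; rewrite ?add0r // peval_addt IH addrA. Qed.
Lemma peval_mult c m p z : peval (pmult c m p) z = cr R c * meval m z * peval p z.
Proof.
elim: p => [|t p IH] /=; first by rewrite mulr0.
by rewrite peval_addt IH crM meval_mul; ring.
Qed.
Lemma peval_mul p q z : peval (pmul p q) z = peval p z * peval q z.
Proof.
by elim: p => [|t p IH] /=; rewrite ?mul0r // peval_add peval_mult IH mulrDl.
Qed.
Lemma peval_var v z : peval (pvar v) z = env v z.
Proof. by rewrite /= cr1 mul1r mulr1 addr0. Qed.
Lemma peval_cst c z : peval (pcst c) z = cr R c.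
Proof. by rewrite peval_addt /= mulr1 addr0. Qed.

Lemma pd_ok k (r : dvar -> dpoly) :
  (forall v, eq_on A (delta k (env v)) (peval (r v))) ->
  forall p, eq_on A (delta k (peval p)) (peval (pd r p)).
Proof.
move=> Hr; have dk := delta_der k.
have Hm m : eq_on A (delta k (meval m)) (peval (md r m)).
  elim: m => [|v m IH] z Az /=; first by rewrite (der_cst dk).
  rewrite (der_mul dk) //; [|exact: env_smooth|exact: meval_smooth].
  by rewrite peval_add !peval_mult IH // Hr //= cr1; ring.
elim=> [|t p IH] z Az /=; first by rewrite (der_cst dk).
rewrite (der_add dk) //; last exact: peval_smooth.
  rewrite (der_mul dk) //; [|exact: smooth_cst|exact: meval_smooth].
  by rewrite (der_cst dk) // peval_add peval_mult IH // Hm //=; ring.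
by apply: smooth_mul; [exact: smooth_cst|exact: meval_smooth].
Qed.

Local Arguments peval : simpl never.
Local Arguments pvar : simpl never.

Variables (alias : nat -> option linc) (comm : nat -> nat -> linc)
  (tab : nat -> dvar -> option dpoly).

Definition leval (l : linc) (g : V -> R) (z : V) : R :=
  foldr (fun t acc => peval t.2 z * delta t.1 g z + acc) 0 l.

Hypothesis alias_ok : forall k l g, alias k = Some l -> smooth A g ->
  eq_on A (delta k g) (leval l g).
Hypothesis comm_ok : forall k k' g, alias k = None -> alias k' = None -> (k' < k)%N -> smooth A g ->
  eq_on A (delta k (delta k' g)) (fun z => delta k' (delta k g) z + leval (comm k k') g z).
Hypothesis tab_ok : forall k v p, alias k = None -> tab k v = Some p ->
  eq_on A (delta k (env v)) (peval p).

(** Every branch is a true identity, including the one reached without fuel. Soundness is therefore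
    independent of termination and of confluence; these affect only whether a true equation is
    recognized. *)
Lemma rule_ok n k v : eq_on A (delta k (env v)) (peval (rule alias comm tab n k v)).
Proof.
elim: n k v => [|n IH] k v z Az; first by rewrite peval_var.
rewrite /=; case Ea : (alias k) => [l|].
  rewrite (alias_ok Ea (env_smooth v) Az) /leval; elim: l {Ea} => [|t l IHl] //=.
  by rewrite peval_add peval_mul IHl -IH.
case Et : (tab k v) => [p|]; first exact: tab_ok Et z Az.
case: v Et => b [|k' ks] _ /=; first by rewrite peval_var.
case: ifP => [_|/negbT]; first by rewrite peval_var.
rewrite negb_or -ltnNge => /andP[kk' nEa'].
have Ea' : alias k' = None by case: (alias k') nEa'.
rewrite (comm_ok Ea Ea' kk' (env_smooth (b, ks)) Az).
  have -> : delta k' (delta k (env (b, ks))) z =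
      peval (pd (rule alias comm tab n k') (rule alias comm tab n k (b, ks))) z.
    rewrite -(pd_ok (IH k')) //.
    exact: (der_eq (delta_der k') (der_smooth (delta_der k) (env_smooth (b, ks))) (IH k (b, ks)) Az).
  rewrite addrC /leval; elim: (comm k k') => [|t l IHl] /=; first by rewrite add0r.
  by rewrite peval_add peval_mul -IHl -(IH t.1 (b, ks) z Az) addrA.
Qed.

Fixpoint sem (e : dexpr) : V -> R :=
  match e with
  | EB b => base b
  | EN n => fun=> n%:R
  | EI n => fun=> n%:R^-1
  | EAdd e1 e2 => fun z => sem e1 z + sem e2 z
  | EMul e1 e2 => fun z => sem e1 z * sem e2 z
  | EOpp e1 => fun z => - sem e1 z
  | ED k e1 => delta k (sem e1)
  end.

Fixpoint norm (n : nat) (e : dexpr) : dpoly :=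
  match e with
  | EB b => pvar (b, [::])
  | EN m => pcst (cnat m)
  | EI m => pcst (cinv m)
  | EAdd e1 e2 => padd (norm n e1) (norm n e2)
  | EMul e1 e2 => pmul (norm n e1) (norm n e2)
  | EOpp e1 => pmult cN1 [::] (norm n e1)
  | ED k e1 => pd (rule alias comm tab n k) (norm n e1)
  end.

Lemma sem_smooth e : smooth A (sem e).
Proof.
elim: e => [b|n|n|e1 H1 e2 H2|e1 H1 e2 H2|e1 H1|k e1 H1] /=.
- exact: base_smooth.
- exact: smooth_cst.
- exact: smooth_cst.
- exact: smooth_add.
- exact: smooth_mul.
- exact: smooth_opp.
- by apply: (der_smooth (delta_der k)); exact: H1.
Qed.

Lemma norm_ok n e : eq_on A (sem e) (peval (norm n e)).
Proof.
elim: e => [b|m|m|e1 H1 e2 H2|e1 H1 e2 H2|e1 H1|k e1 H1] z Az.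
- by rewrite peval_var.
- by rewrite peval_cst cr_nat.
- by rewrite peval_cst cr_inv.
- by rewrite peval_add /= H1 // H2.
- by rewrite peval_mul /= H1 // H2.
- by rewrite peval_mult /= H1 // crN1 mulr1 mulN1r.
rewrite -(pd_ok (rule_ok n k)) //=.
exact: (der_eq (delta_der k) (sem_smooth e1) H1 Az).
Qed.

(** Without fuel neither aliases nor brackets nor special values are consulted. Right sides of table
    entries can thus be normalized ([pN]) before the table has been shown to be valid. *)
Lemma norm0_ok e : eq_on A (sem e) (peval (norm 0 e)).
Proof.
elim: e => [b|m|m|e1 H1 e2 H2|e1 H1 e2 H2|e1 H1|k e1 H1] z Az.
- by rewrite peval_var.
- by rewrite peval_cst cr_nat.
- by rewrite peval_cst cr_inv.
- by rewrite peval_add /= H1 // H2.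
- by rewrite peval_mul /= H1 // H2.
- by rewrite peval_mult /= H1 // crN1 mulr1 mulN1r.
have H v : eq_on A (delta k (env v)) (peval (rule alias comm tab 0 k v)).
  by move=> w _; rewrite peval_var.
rewrite -(pd_ok H) //=; exact: (der_eq (delta_der k) (sem_smooth e1) H1 Az).
Qed.

Lemma dexpr_eq n e1 e2 : nilp (norm n (EAdd e1 (EOpp e2))) -> eq_on A (sem e1) (sem e2).
Proof.
move=> /nilP E z Az; apply/eqP; rewrite -subr_eq0; apply/eqP.
by have := norm_ok n (EAdd e1 (EOpp e2)) Az; rewrite E.
Qed.
End Engine.

Definition pN := norm (fun=> None) (fun _ _ => [::]) (fun _ _ => None) 0.

Arguments pcst : simpl never.
Arguments pvar : simpl never.
Arguments padd : simpl never.
Arguments pmul : simpl never.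
Arguments pmult : simpl never.
Arguments peval {R V} base delta p : simpl never.
Arguments pN : simpl never.

Section RuleTables.
Variables (R : realType) (V : normedModType R) (A : set V).
Hypothesis oA : open A.
Variables (base : nat -> V -> R) (delta : nat -> (V -> R) -> V -> R).
Hypothesis base_smooth : forall b, smooth A (base b).
Hypothesis delta_der : forall k, derivation A (delta k).

Definition tab_of (l : seq (nat * dvar * dexpr)) (k : nat) (v : dvar) : option dpoly :=
  foldr (fun t acc => if (t.1.1 == k) && (t.1.2 == v) then Some (pN t.2) else acc) None l.

Fixpoint valid_rules (l : seq (nat * dvar * dexpr)) : Prop :=
  if l is t :: l' then
    eq_on A (delta t.1.1 (env base delta t.1.2)) (sem base delta t.2) /\ valid_rules l'
  else True.

Lemma tab_of_ok l k v p : valid_rules l -> tab_of l k v = Some p ->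
  eq_on A (delta k (env base delta v)) (peval base delta p).
Proof.
elim: l => //= t l IH [H /IH {}IH]; case: ifP => // /andP[/eqP <- /eqP <-] /Some_inj <- z Az.
by rewrite -(norm0_ok oA base_smooth delta_der) // H.
Qed.
End RuleTables.

Declare Scope dexpr_scope.
Delimit Scope dexpr_scope with DE.
Bind Scope dexpr_scope with dexpr.
Notation "x + y" := (EAdd x y) : dexpr_scope.
Notation "x * y" := (EMul x y) : dexpr_scope.
Notation "- x" := (EOpp x) : dexpr_scope.
Notation "x - y" := (EAdd x (EOpp y)) : dexpr_scope.

Section Derivations.
Variables (R : realType) (V : normedModType R) (A : set V).
Hypothesis oA : open A.

Lemma derivation_dir (v : V) : derivation A (fun (g : V -> R) z => 'D_v g z).
Proof.
split.
- by move=> g; exact: smooth_derive.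
- by move=> g h sg gh z Az; apply: near_eq_derive; exact: near_open gh.
- by move=> c z _; rewrite derive_cst.
- move=> g h sg sh z Az; rewrite -deriveD //; exact: diff_derivable (smooth_diff _ Az).
- move=> g h sg sh z Az; rewrite -[LHS]/('D_v (g * h) z) deriveM //.
    exact: diff_derivable (smooth_diff sg Az).
  exact: diff_derivable (smooth_diff sh Az).
Qed.

Lemma derivation_scale (c : V -> R) d : smooth A c -> derivation A d ->
  derivation A (fun g z => c z * d g z).
Proof.
move=> sc dd; split.
- by move=> g sg; apply: smooth_mul => //; exact: (der_smooth dd).
- by move=> g h sg gh z Az; rewrite (der_eq dd sg gh Az).
- by move=> k z Az; rewrite (der_cst dd) // mulr0.
- by move=> g h sg sh z Az; rewrite (der_add dd) // mulrDr.
- by move=> g h sg sh z Az; rewrite (der_mul dd) //; ring.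
Qed.

Lemma derivation_add d1 d2 : derivation A d1 -> derivation A d2 ->
  derivation A (fun g z => d1 g z + d2 g z).
Proof.
move=> D1 D2; split.
- by move=> g sg; apply: smooth_add => //; [exact: (der_smooth D1)|exact: (der_smooth D2)].
- by move=> g h sg gh z Az; rewrite (der_eq D1 sg gh Az) (der_eq D2 sg gh Az).
- by move=> k z Az; rewrite (der_cst D1) // (der_cst D2) // addr0.
- by move=> g h sg sh z Az; rewrite (der_add D1) // (der_add D2) //; ring.
- by move=> g h sg sh z Az; rewrite (der_mul D1) // (der_mul D2) //; ring.
Qed.

Lemma derivation_zero : derivation A (fun _ _ => 0).
Proof.
split=> //.
- by move=> g _; exact: smooth_cst.
- by move=> g h _ _ z _; rewrite addr0.
- by move=> g h _ _ z _; rewrite !mulr0 addr0.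
Qed.

Lemma nth_smooth (s : seq (V -> R)) : (forall i, (i < size s)%N -> smooth A (nth (fun=> 0) s i)) ->
  forall b, smooth A (nth (fun=> 0) s b).
Proof.
move=> H b; case: (ltnP b (size s)) => hb; first exact: H.
by rewrite nth_default //; exact: smooth_cst.
Qed.

Lemma nth_derivation (s : seq ((V -> R) -> V -> R)) :
  (forall i, (i < size s)%N -> derivation A (nth (fun _ _ => 0) s i)) ->
  forall b, derivation A (nth (fun _ _ => 0) s b).
Proof.
move=> H b; case: (ltnP b (size s)) => hb; first exact: H.
by rewrite nth_default //; exact: derivation_zero.
Qed.
End Derivations.

(** * Derivations of the space (x, y, p) and their brackets *)

Section Coordinates.
Variables (R : realType).
Notation R3 := (R * R * R)%type.
Variable U : set R3.
Hypothesis oU : open U.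

Definition d1 (g : R3 -> R) z := 'D_((1, 0, 0) : R3) g z.

Lemma derivation_d1 : derivation U d1. Proof. exact: derivation_dir. Qed.
Lemma derivation_Dy : derivation U (@Dy R). Proof. exact: derivation_dir. Qed.
Lemma derivation_Dp : derivation U (@Dp R). Proof. exact: derivation_dir. Qed.

Lemma derive_fst (V W : normedModType R) (z v : V * W) :
  differentiable (@fst V W) z /\ 'D_v (@fst V W) z = v.1.
Proof.
have dL : differentiable (@fst V W) z by apply: linear_differentiable; move=> x; exact: cvg_fst.
by split => //; rewrite deriveE // diff_lin // => x; exact: cvg_fst.
Qed.

Lemma derive_snd (V W : normedModType R) (z v : V * W) :
  differentiable (@snd V W) z /\ 'D_v (@snd V W) z = v.2.
Proof.
have dL : differentiable (@snd V W) z by apply: linear_differentiable; move=> x; exact: cvg_snd.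
by split => //; rewrite deriveE // diff_lin // => x; exact: cvg_snd.
Qed.

Lemma derive_cx z v : differentiable (fun z : R3 => z.1.1) z /\ 'D_v (fun z : R3 => z.1.1) z = v.1.1.
Proof.
have [d1 e1] := derive_fst z v; have [d2 e2] := derive_fst z.1 v.1.
split; first exact: (differentiable_comp d1 d2).
by rewrite (derive_comp v d1 d2) e1 e2.
Qed.
Lemma derive_cy z v : differentiable (fun z : R3 => z.1.2) z /\ 'D_v (fun z : R3 => z.1.2) z = v.1.2.
Proof.
have [d1 e1] := derive_fst z v; have [d2 e2] := derive_snd z.1 v.1.
split; first exact: (differentiable_comp d1 d2).
by rewrite (derive_comp v d1 d2) e1 e2.
Qed.
Lemma derive_cp z v : differentiable (fun z : R3 => z.2) z /\ 'D_v (fun z : R3 => z.2) z = v.2.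
Proof. exact: derive_snd. Qed.

Lemma smooth_linear (V : normedModType R) (B : set V) (L dL : V -> R) : open B ->
  (forall z v, differentiable L z /\ 'D_v L z = dL v) -> smooth B L.
Proof.
move=> oB HL; apply: (@smooth_coind R V R B (fun g => g = L \/ exists c, g = fun=> c)) => //; last by left.
move=> g [->|[c ->]]; split.
- by move=> a _; exact: (HL a 0).1.
- move=> v; exists (fun=> dL v); first by right; exists (dL v).
  by move=> a _; rewrite (HL a v).2.
- by move=> a _; exact: differentiable_cst.
- move=> v; exists (fun=> 0); first by right; exists 0.
  by move=> a _; rewrite derive_cst.
Qed.

Lemma smooth_cx : smooth U (fun z : R3 => z.1.1).
Proof. by apply: (smooth_linear oU) => z v; exact: derive_cx. Qed.
Lemma smooth_cy : smooth U (fun z : R3 => z.1.2).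
Proof. by apply: (smooth_linear oU) => z v; exact: derive_cy. Qed.
Lemma smooth_cp : smooth U (fun z : R3 => z.2).
Proof. by apply: (smooth_linear oU) => z v; exact: derive_cp. Qed.

Lemma derivation_Dx : derivation U (@Dx R).
Proof.
apply: (derivation_add oU derivation_d1).
exact: (derivation_scale oU smooth_cp derivation_Dy).
Qed.

Variable f : R3 -> R.
Hypothesis sf : smooth U f.

(* [Dt] is the derivative along the solutions of y'' = f, and [Db] is its bracket with [Dp]. *)
Definition Dt (g : R3 -> R) z := Dx g z + f z * Dp g z.
Definition Db (g : R3 -> R) z := Dy g z + Dp f z * Dp g z.

Lemma derivation_Dt : derivation U Dt.
Proof.
apply: (derivation_add oU derivation_Dx).
exact: (derivation_scale oU sf derivation_Dp).
Qed.
Lemma derivation_Db : derivation U Db.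
Proof.
apply: (derivation_add oU derivation_Dy).
exact: (derivation_scale oU (der_smooth derivation_Dp sf) derivation_Dp).
Qed.

Section CoordinateJets.
Variable g : R3 -> R.
Hypothesis sg : smooth U g.
Let base := nth (fun=> 0) [:: f; (fun z : R3 => z.2); g].
Let delta k (g : R3 -> R) z := 'D_(nth 0 [:: (1, 0, 0); (0, 1, 0); (0, 0, 1)] k : R3) g z.
Let tab (k : nat) (v : dvar) : option dpoly :=
  if v == (1%N, [::]) then Some (if k == 2 then pcst c1 else [::]) else None.

Let base_smooth b : smooth U (base b).
Proof.
by apply: (nth_smooth oU) => -[|[|[|]]] //= _; exact: smooth_cp.
Qed.
Let delta_der k : derivation U (delta k).
Proof. exact: derivation_dir. Qed.
Let Hcomm k k' h : (fun=> None : option linc) k = None -> (fun=> None : option linc) k' = None -> (k' < k)%N -> smooth U h ->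
  eq_on U (delta k (delta k' h)) (fun z => delta k' (delta k h) z + leval base delta ((fun _ _ => [::]) k k') h z).
Proof.
by move=> _ _ _ sh z Uz; rewrite /leval /= addr0; exact: derive_comm Uz.
Qed.
Let Htab k v p : (fun=> None : option linc) k = None -> tab k v = Some p ->
  eq_on U (delta k (env base delta v)) (peval base delta p).
Proof.
move=> _; rewrite /tab; case: eqP => // -> [<-] z Uz.
rewrite /env /delta /= (derive_cp _ _).2; case: k => [|[|[|k]]] //=.
  by rewrite peval_cst cr1.
by rewrite nth_nil.
Qed.

Lemma coord_eq e1 e2 : nilp (norm (fun=> None) (fun _ _ => [::]) tab 20 (EAdd e1 (EOpp e2))) ->
  eq_on U (sem base delta e1) (sem base delta e2).
Proof. exact: (dexpr_eq oU base_smooth delta_der _ Hcomm Htab). Qed.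

Let F := EB 0. Let p := EB 1. Let G := EB 2.
Let eDy e := ED 1 e. Let eDp e := ED 2 e.
Let eDx e := (ED 0 e + p * ED 1 e)%DE.
Let eD e := (eDx e + F * eDp e)%DE.
Let eY e := (eDy e + eDp F * eDp e)%DE.

Lemma Dp_Dt : eq_on U (Dp (Dt g)) (fun z => Dt (Dp g) z + Db g z).
Proof. by apply: (@coord_eq (eDp (eD G)) (eD (eDp G) + eY G)%DE); vm_compute. Qed.
Lemma Dp_Db : eq_on U (Dp (Db g)) (fun z => Db (Dp g) z + Dp (Dp f) z * Dp g z).
Proof. by apply: (@coord_eq (eDp (eY G)) (eY (eDp G) + eDp (eDp F) * eDp G)%DE); vm_compute. Qed.
Lemma Db_Dt : eq_on U (Db (Dt g)) (fun z => Dt (Db g) z + (Dp f z * Db g z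
  + - (Dt (Dp f) z + - Db f z + Dp f z * Dp f z) * Dp g z)).
Proof.
by apply: (@coord_eq (eY (eD G)) (eD (eY G) + (eDp F * eY G +
  - (eD (eDp F) + - eY F + eDp F * eDp F) * eDp G))%DE); vm_compute.
Qed.
End CoordinateJets.
End Coordinates.

Section Frame.
Variables (R : realType).
Notation R3 := (R * R * R)%type.
Variable U : set R3.
Hypothesis oU : open U.
Variable f : R3 -> R.
Hypothesis sf : smooth U f.

(** The indices 0, 1, 2 are [Dt f], [Db f], [Dp], and the entries encode [Db_Dt], [Dp_Dt] and
    [Dp_Db], with base variable 0 standing for f. *)
Definition comm_frame (k k' : nat) : linc :=
  match k, k' with
  | 1, 0 => [:: (1%N, pvar (0, [:: 2])%N);
      (2%N, padd (pvar (0, [:: 1])%N) (pmult cN1 [::] (padd (pvar (0, [:: 0; 2])%N)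
        (pmul (pvar (0, [:: 2])%N) (pvar (0, [:: 2])%N)))))]
  | 2, 0 => [:: (1%N, pcst c1)]
  | 2, 1 => [:: (2%N, pvar (0, [:: 2; 2])%N)]
  | _, _ => [::]
  end.

(** [Dy] and [Dx] are replaced by combinations of the first three fields, whose brackets have
    coefficients built from f alone: the coordinate p never appears in a normal form. *)
Definition alias_frame (k : nat) : option linc :=
  match k with
  | 3 => Some [:: (1%N, pcst c1); (2%N, pmult cN1 [::] (pvar (0, [:: 2])%N))]
  | 4 => Some [:: (0%N, pcst c1); (2%N, pmult cN1 [::] (pvar (0, [::])%N))]
  | _ => None
  end.

Definition frame : nat -> (R3 -> R) -> R3 -> R :=
  nth (fun _ _ => 0) [:: Dt f; Db f; @Dp R; @Dy R; @Dx R].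

Lemma frame_der k : derivation U (frame k).
Proof.
apply: nth_derivation => // -[|[|[|[|[|]]]]] //= _.
- exact: derivation_Dt.
- exact: derivation_Db.
- exact: derivation_Dp.
- exact: derivation_Dy.
- exact: derivation_Dx.
Qed.

Variable bs : seq (R3 -> R).
Hypothesis bs_smooth : forall i, (i < size bs)%N -> smooth U (nth (fun=> 0) bs i).
Let base := nth (fun=> 0) (f :: bs).

Lemma frame_base_smooth b : smooth U (base b).
Proof. by apply: (nth_smooth oU) => -[|i] //= hi; exact: bs_smooth. Qed.

Lemma frame_alias k l g : alias_frame k = Some l -> smooth U g ->
  eq_on U (frame k g) (leval base frame l g).
Proof.
move=> E sg z Uz; case: k E => [|[|[|[|[|k]]]]] //= [<-]; rewrite /leval /=
  peval_cst cr1 peval_mult /= crN1 /= peval_var /env /= /frame /=.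
- rewrite /Db; rewrite ?/base /=; ring.
- rewrite /Dt; rewrite ?/base /=; ring.
Qed.

Lemma frame_comm k k' g : alias_frame k = None -> alias_frame k' = None -> (k' < k)%N -> smooth U g ->
  eq_on U (frame k (frame k' g)) (fun z => frame k' (frame k g) z + leval base frame (comm_frame k k') g z).
Proof.
move=> Ek Ek' kk' sg z Uz; move: Ek Ek' kk'.
case: k => [|[|[|[|[|k]]]]] //; case: k' => [|[|[|[|[|k']]]]] // _ _ _;
  rewrite /leval /= /frame /= ?nth_nil ?addr0.
- rewrite (Db_Dt oU sf sg Uz) !peval_var peval_add peval_mult peval_var peval_add peval_mul !peval_var /= crN1.
  by rewrite /env /= /frame /base /=; ring.
- by rewrite (Dp_Dt oU sf sg Uz) peval_cst cr1; ring.
- by rewrite (Dp_Db oU sf sg Uz) peval_var.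
- by rewrite (der_cst (derivation_Dt oU sf)).
- by rewrite (der_cst (derivation_Db oU sf)).
- by rewrite (der_cst (derivation_Dp oU)).
- by [].
Qed.

Variable tab : nat -> dvar -> option dpoly.
Hypothesis tab_ok : forall k v p, alias_frame k = None -> tab k v = Some p ->
  eq_on U (frame k (env base frame v)) (peval base frame p).

Lemma frame_eq e1 e2 : nilp (norm alias_frame comm_frame tab 30 (EAdd e1 (EOpp e2))) ->
  eq_on U (sem base frame e1) (sem base frame e2).
Proof. exact: (dexpr_eq oU frame_base_smooth frame_der frame_alias frame_comm tab_ok). Qed.
End Frame.

(** * The invariant frame *)

(* [iota], [eta], [g1], [g2] are meant to be ln |I|, ln |H|, 1 / J1 and J1 / J2, but the
   identities below are used also for the trivial choice [iota] = [eta] = 0.  Then [nP], [nX], [nY] are Delta_p, Delta_x, Delta_y on normalized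
   functions of weight 3 r + 2 s = 0, [cX], [cY], [cP] are the normalized H_10, H_01, K,
   and [n6], [n5], [n4] are the normalized Omega's. *)
Section Gauge.
Variables (R : realType).
Notation R3 := (R * R * R)%type.
Variable U : set R3.
Hypothesis oU : open U.
Variables f iota eta g1 g2 : R3 -> R.
Hypotheses (sf : smooth U f) (si : smooth U iota) (se : smooth U eta)
  (sg1 : smooth U g1) (sg2 : smooth U g2).

(** [wDp], [wDx], [wDy] are Delta_p, Delta_x, Delta_y with the quotients of u^5, u^4_10, u^4_01 by
    u^4 written as derivatives of [iota], and with real weights. This removes all denominators. *)
Definition wDp (r s : R) psi (z : R3) : R :=
  Dp psi z + (r - s) * (Dp iota z / 5) * psi z.
Definition wDx (r s : R) psi (z : R3) : R :=
  Dx psi z + f z * wDp r s psi z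
  + ((3 * r + 2 * s) * (Dp f z + 3 * f z * (Dp iota z / 5))
     + (2 * r + s) * Dx iota z) * psi z.
Definition wDy (r s : R) psi (z : R3) : R :=
  Dy psi z + Dp iota z / 5 * wDx r s psi z
  + (2 * Dp f z + (Dx iota z + f z * Dp iota z)) * wDp r s psi z
  - ((r + 2 * s) * (Dy iota z / 4)
     + (3 * r + 2 * s) * (Dp (Dp f) z / 8
        + 3 / 20 * (Dp iota z * (Dx iota z + f z * Dp iota z + 2 * Dp f z)))) * psi z.

Definition nP g (z : R3) : R := g2 z * Dp g z.
Definition nX g (z : R3) : R := g1 z * Dt f g z.
Definition nY g (z : R3) : R := g1 z * g2 z * (Db f g z + Dp iota z / 5 * Dt f g z
  + (Dp f z + Dt f iota z) * Dp g z).
Definition cP z : R := g2 z * (Dp eta z + Dp iota z / 5).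
Definition cX z : R := g1 z * (Dt f eta z + 8 * Dp f z + 5 * Dt f iota z).
Definition cY z : R := g1 z * g2 z * (Dy eta z
  + Dp iota z / 5 * (Dt f eta z + 8 * Dp f z + 5 * Dt f iota z)
  + (2 * Dp f z + Dt f iota z) * (Dp eta z + Dp iota z / 5)
  - (Dy iota z + Dp (Dp f) z + 6 / 5 * (Dp iota z * (Dt f iota z + 2 * Dp f z)))).
Definition o6 z : R := Dp (Dp iota) z - Dp iota z * Dp iota z / 5.
Definition o5 z : R := Dt f (Dp iota) z + 5 / 4 * Db f iota z
  + (Dp f z * Dp iota z + Dp iota z * Dt f iota z) / 4 + 15 / 8 * Dp (Dp f) z.
Definition o4 z : R := Dt f (Dt f iota) z + Dt f iota z * Dt f iota z
  + 3 * Dp f z * Dt f iota z + 2 * Dt f (Dp f) z + 3 * Dp f z * Dp f z - Db f f z.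
Definition n6 z : R := g2 z * g2 z * o6 z.
Definition n5 z : R := g1 z * g2 z * o5 z.
Definition n4 z : R := g1 z * g1 z * o4 z.
(** With c, a, b as the values of a one-form on P, X, Y, the numbers 8 [q1] and 8 [q2] are the
    values of its exterior derivative on (P, Y) and on (X, Y). *)
Definition q1 z : R := (nP cY z - (nY cP z - 3 / 8 * cY z * cP z + n6 z * cX z / 5 + n5 z * cP z)) / 8.
Definition q2 z : R := (nX cY z - cX z * cY z / 8 - n4 z * cP z - n5 z * cX z / 5 - nY cX z) / 8.

Hypothesis Dg1 : forall k, eq_on U (frame f k g1)
  (fun z => g1 z * ((frame f k iota z - 3 * frame f k eta z) / 8)).
Hypothesis Dg2 : forall k, eq_on U (frame f k g2)
  (fun z => g2 z * ((frame f k eta z - 3 * frame f k iota z) / 8)).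

Section WeightedFunction.
Variables g M : R3 -> R.
Variables r s : R.
Hypotheses (sg : smooth U g) (sM : smooth U M).
Hypothesis DM : forall k, eq_on U (frame f k M) (fun z => M z *
  (r * ((frame f k iota z - 3 * frame f k eta z) / 8)
   - s * ((frame f k eta z + frame f k iota z) / 4))).

(** The weights enter as constant functions, so that one normalization covers all r and s. [M] plays
    the role of 1 / (J1^r J2^s). *)
Let bs := [:: iota; eta; g1; g2; g; M; (fun=> r); (fun=> s)].
Let base := nth (fun=> 0) (f :: bs).

Let lgJ1 k := ((ED k (EB 1) - EN 3 * ED k (EB 2)) * EI 8)%DE.
Let tab (k : nat) (v : dvar) : option dpoly :=
  if (2 < k)%N then None else
  match v with
  | (3, [::]) => Some (pN (EB 3 * lgJ1 k)%DE)
  | (4, [::]) => Some (pN (EB 4 * ((ED k (EB 2) - EN 3 * ED k (EB 1)) * EI 8))%DE)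
  | (6, [::]) => Some (pN (EB 6 * (EB 7 * lgJ1 k
       - EB 8 * ((ED k (EB 2) + ED k (EB 1)) * EI 4)))%DE)
  | (7, [::]) | (8, [::]) => Some [::]
  | _ => None
  end.

Let bs_smooth i : (i < size bs)%N -> smooth U (nth (fun=> 0) bs i).
Proof. by case: i => [|[|[|[|[|[|[|[|]]]]]]]] //= _; exact: smooth_cst. Qed.

Let tab_ok k v p : alias_frame k = None -> tab k v = Some p ->
  eq_on U (frame f k (env base (frame f) v)) (peval base (frame f) p).
Proof.
move=> _; rewrite /tab; case: ifP => // _.
have bsm := frame_base_smooth oU sf bs_smooth; have der := frame_der oU sf.
by case: v => [[|[|[|[|[|[|[|[|[|b]]]]]]]]] [|? ?]] // /Some_inj <- z Uz;
  rewrite -?(norm0_ok oU bsm der) // /env /= ?Dg1 ?Dg2 ?DM //; apply: (der_cst (der k)).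
Qed.

Let geq := @frame_eq R U oU f sf bs bs_smooth tab tab_ok.

Let F := EB 0. Let I := EB 1. Let E := EB 2. Let G1 := EB 3. Let G2 := EB 4.
Let G := EB 5. Let m := EB 6. Let r' := EB 7. Let s' := EB 8.
Let N n := EN n.
Let q (a b : nat) := EMul (EN a) (EI b).
Local Notation D := (ED 0). Local Notation Y := (ED 1). Local Notation X := (ED 2).
Local Notation y := (ED 3). Local Notation x := (ED 4).
Local Notation "a / n" := (EMul a (EI n)) : dexpr_scope.

Let ewp e := (X e + (r' - s') * (X I / 5) * e)%DE.
Let ewx e := (x e + F * ewp e + ((N 3 * r' + N 2 * s') * (X F + N 3 * F * (X I / 5))
     + (N 2 * r' + s') * x I) * e)%DE.
Let ewy e := (y e + X I / 5 * ewx e + (N 2 * X F + (x I + F * X I)) * ewp e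
  - ((r' + N 2 * s') * (y I / 4) + (N 3 * r' + N 2 * s') * (X (X F) / 8
        + q 3 20 * (X I * (x I + F * X I + N 2 * X F)))) * e)%DE.
Let eP e := (G2 * X e)%DE.
Let eX e := (G1 * D e)%DE.
Let eY e := (G1 * G2 * (Y e + X I / 5 * D e + (X F + D I) * X e))%DE.
Let ecP := (G2 * (X E + X I / 5))%DE.
Let ecX := (G1 * (D E + N 8 * X F + N 5 * D I))%DE.
Let ecY := (G1 * G2 * (y E + X I / 5 * (D E + N 8 * X F + N 5 * D I)
  + (N 2 * X F + D I) * (X E + X I / 5)
  - (y I + X (X F) + q 6 5 * (X I * (D I + N 2 * X F)))))%DE.
Let eo6 := (X (X I) - X I * X I / 5)%DE.
Let eo5 := (D (X I) + q 5 4 * Y I + (X F * X I + X I * D I) / 4 + q 15 8 * X (X F))%DE.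
Let eo4 := (D (D I) + D I * D I + N 3 * X F * D I + N 2 * D (X F) + N 3 * X F * X F - Y F)%DE.
Let en6 := (G2 * G2 * eo6)%DE.
Let en5 := (G1 * G2 * eo5)%DE.
Let en4 := (G1 * G1 * eo4)%DE.
Let eq1 := ((eP ecY - (eY ecP - q 3 8 * ecY * ecP + en6 * ecX / 5 + en5 * ecP)) / 8)%DE.
Let eq2 := ((eX ecY - ecX * ecY / 8 - en4 * ecP - en5 * ecX / 5 - eY ecX) / 8)%DE.

(** The operators annihilate I, and J1^r J2^s is I^((2 s - r) / 8) H^((3 r + 2 s) / 8). Normalizing
    therefore leaves a derivation plus (3 r + 2 s) / 8 times the normalized derivative of H. The
    same holds for [gauge_x] and [gauge_y]. *)
Lemma gauge_p : eq_on U (fun z => g2 z * M z * wDp r s g z)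
  (fun z => nP (fun z => M z * g z) z + (3 * r + 2 * s) / 8 * cP z * (M z * g z)).
Proof.
by apply: (geq (e1 := (G2 * m * ewp G)%DE)
  (e2 := (eP (m * G) + (N 3 * r' + N 2 * s') / 8 * ecP * (m * G))%DE)); vm_compute.
Qed.

Lemma gauge_x : eq_on U (fun z => g1 z * M z * wDx r s g z)
  (fun z => nX (fun z => M z * g z) z + (3 * r + 2 * s) / 8 * cX z * (M z * g z)).
Proof.
by apply: (geq (e1 := (G1 * m * ewx G)%DE)
  (e2 := (eX (m * G) + (N 3 * r' + N 2 * s') / 8 * ecX * (m * G))%DE)); vm_compute.
Qed.

Lemma gauge_y : eq_on U (fun z => g1 z * g2 z * M z * wDy r s g z)
  (fun z => nY (fun z => M z * g z) z + (3 * r + 2 * s) / 8 * cY z * (M z * g z)).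
Proof.
by apply: (geq (e1 := (G1 * G2 * m * ewy G)%DE)
  (e2 := (eY (m * G) + (N 3 * r' + N 2 * s') / 8 * ecY * (m * G))%DE)); vm_compute.
Qed.

Lemma bracket_px : eq_on U (fun z => nP (nX g) z - nX (nP g) z)
  (fun z => nY g z - 3 / 8 * cP z * nX g z - cX z * nP g z / 8).
Proof.
by apply: (geq (e1 := (eP (eX G) - eX (eP G))%DE)
  (e2 := (eY G - q 3 8 * ecP * eX G - ecX * eP G / 8)%DE)); vm_compute.
Qed.

Lemma bracket_py : eq_on U (fun z => nP (nY g) z - nY (nP g) z)
  (fun z => n5 z * nP g z + n6 z / 5 * nX g z - cP z * nY g z / 4 - cY z * nP g z / 8).
Proof.
by apply: (geq (e1 := (eP (eY G) - eY (eP G))%DE)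
  (e2 := (en5 * eP G + en6 / 5 * eX G - ecP * eY G / 4 - ecY * eP G / 8)%DE)); vm_compute.
Qed.

Lemma bracket_xy : eq_on U (fun z => nX (nY g) z - nY (nX g) z)
  (fun z => n4 z * nP g z + n5 z / 5 * nX g z - cX z * nY g z / 4 + 3 / 8 * cY z * nX g z).
Proof.
by apply: (geq (e1 := (eX (eY G) - eY (eX G))%DE)
  (e2 := (en4 * eP G + en5 / 5 * eX G - ecX * eY G / 4 + q 3 8 * ecY * eX G)%DE)); vm_compute.
Qed.

(** The exterior derivative of the one-form (c, a, b) on (P, X): after the bracket term is removed,
    24/5 [n5] is left. *)
Lemma nP_cX : eq_on U (nP cX)
  (fun z => nX cP z + cY z + 24 / 5 * n5 z - cX z * cP z / 2).
Proof.
by apply: (geq (e1 := eP ecX)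
  (e2 := (eX ecP + ecY + q 24 5 * en5 - ecX * ecP / 2)%DE)); vm_compute.
Qed.

(** The component along X of the Jacobi identity for P, X, Y; [q2E] is the component along P. *)
Lemma q1E : eq_on U (fun z => 15 * q1 z)
  (fun z => nX n6 z - cX z * n6 z / 4 - nP n5 z - cP z * n5 z / 4).
Proof.
by apply: (geq (e1 := (N 15 * eq1)%DE)
  (e2 := (eX en6 - ecX * en6 / 4 - eP en5 - ecP * en5 / 4)%DE)); vm_compute.
Qed.

Lemma q2E : eq_on U q2
  (fun z => nX n5 z + cX z * n5 z / 4 - nP n4 z - 3 / 4 * cP z * n4 z).
Proof.
by apply: (geq (e1 := eq2)
  (e2 := (eX en5 + ecX * en5 / 4 - eP en4 - q 3 4 * ecP * en4)%DE)); vm_compute.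
Qed.

(** The lowest order at which I is visible in the frame: it is the term of this identity that is not
    built from the structure coefficients. [cotton_x] does the same for H. *)
Lemma cotton_p : eq_on U (fun z => nP q1 z + cP z * q1 z / 8)
  (fun z => - (3 / 20) * (nY n6 z - cY z * n6 z / 4) - 9 / 50 * n5 z * n6 z
    - g1 z * g2 z * g2 z * g2 z * Dp (Dp (Dp (Dp f))) z / 8).
Proof.
by apply: (geq (e1 := (eP eq1 + ecP * eq1 / 8)%DE)
  (e2 := (- q 3 20 * (eY en6 - ecY * en6 / 4) - q 9 50 * en5 * en6
    - G1 * G2 * G2 * G2 * X (X (X (X F))) / 8)%DE)); vm_compute.
Qed.

Let eH := (x (x (X (X F))) - N 4 * x (y (X F)) + N 6 * y (y F)
  + F * (N 2 * x (X (X (X F))) - N 3 * y (X (X F)))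
  - X F * (x (X (X F)) - N 4 * y (X F))
  + X (X (X F)) * x F - N 3 * X (X F) * y F + F * F * X (X (X (X F))))%DE.

Lemma cotton_x : eq_on U (fun z => nX q2 z + 5 / 8 * cX z * q2 z)
  (fun z => - (3 / 4) * (nY n4 z + 3 / 4 * cY z * n4 z) - 9 / 10 * n5 z * n4 z
    - g1 z * g1 z * g1 z * g2 z * rel_H f z / 8).
Proof.
by apply: (geq (e1 := (eX eq2 + q 5 8 * ecX * eq2)%DE)
  (e2 := (- q 3 4 * (eY en4 + q 3 4 * ecY * en4) - q 9 10 * en5 * en4
    - G1 * G1 * G1 * G2 * eH / 8)%DE)); vm_compute.
Qed.

(** Relates the two relative invariants. When [iota] is ln |I| the term with [wDx] vanishes, because
    Delta_x I = 0, and what remains says that Omega^4_20 is [o4] I. *)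
Lemma wDp2_H : eq_on U (wDp 1 2 (wDp 2 1 (rel_H f)))
  (fun z => wDx (- 1) 3 (wDx (- 2) 3 (Dp (Dp (Dp (Dp f))))) z
     + o4 z * Dp (Dp (Dp (Dp f))) z + o6 z / 5 * rel_H f z).
Proof.
pose wp k l e := (X e + (k - l) * (X I / 5) * e)%DE.
pose wx k l e := (x e + F * wp k l e + ((N 3 * k + N 2 * l) * (X F + N 3 * F * (X I / 5))
     + (N 2 * k + l) * x I) * e)%DE.
by apply: (geq (e1 := wp (N 1) (N 2) (wp (N 2) (N 1) eH))
  (e2 := (wx (- N 1) (N 3) (wx (- N 2) (N 3) (X (X (X (X F)))))
     + eo4 * X (X (X (X F))) + eo6 / 5 * eH)%DE)); vm_compute.
Qed.
End WeightedFunction.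
End Gauge.

(** * Uniqueness of the frame with given structure functions *)

Section CoordinateEngine.
Variables (R : realType).
Notation R3 := (R * R * R)%type.
Variable U : set R3.
Hypothesis oU : open U.
Variable bs : seq (R3 -> R).
Hypothesis bs_smooth : forall i, (i < size bs)%N -> smooth U (nth (fun=> 0) bs i).

Definition coordinates : seq (R3 -> R) := [:: (fun z => z.1.1); (fun z => z.1.2); (fun z => z.2)].
Definition partial k (g : R3 -> R) z := 'D_(nth 0 [:: (1, 0, 0); (0, 1, 0); (0, 0, 1); (0, 1, 0)] k : R3) g z.
Let base := nth (fun=> 0) (coordinates ++ bs).

Lemma coordinates_smooth b : smooth U (base b).
Proof.
apply: (nth_smooth oU) => -[|[|[|i]]] /= hi.
- exact: smooth_cx.
- exact: smooth_cy.
- exact: smooth_cp.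
- exact: bs_smooth.
Qed.

Lemma partial_der k : derivation U (partial k).
Proof. exact: derivation_dir. Qed.

Definition tab_coord (tab : nat -> dvar -> option dpoly) (k : nat) (v : dvar) : option dpoly :=
  if (v.1 < 3)%N && (v.2 == [::]) then Some (if (if k is 3 then 1%N else k) == v.1 then pcst c1 else [::]) else tab k v.

(* Normal forms list derivations in increasing order, the innermost last: the
   derivation along b is renamed to 3 so that rules for it always apply. *)
Definition alias_coord (k : nat) : option linc := if k is 1 then Some [:: (3%N, pcst c1)] else None.

Variable tab : nat -> dvar -> option dpoly.
Hypothesis tab_ok : forall k v p, tab k v = Some p ->
  eq_on U (partial k (env base partial v)) (peval base partial p).

Lemma coordinate_eq e1 e2 :
  nilp (norm alias_coord (fun _ _ => [::]) (tab_coord tab) 30 (EAdd e1 (EOpp e2))) ->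
  eq_on U (sem base partial e1) (sem base partial e2).
Proof.
apply: (dexpr_eq oU coordinates_smooth partial_der) => //.
- move=> [|[|k]] l g //= /Some_inj <- _ z Uz; by rewrite /leval /= peval_cst cr1 addr0 mul1r.
- by move=> k k' g _ _ _ sg z Uz; rewrite /leval /= addr0; exact: derive_comm Uz.
- move=> k [b ks] p _; rewrite /tab_coord; case: ifP => [/andP[/= hb /eqP -> /Some_inj <-] z Uz|_]; last exact: tab_ok.
rewrite /env /= /partial.
case: b hb => [|[|[|b]]] //= _;
  rewrite ?(derive_cx _ _).2 ?(derive_cy _ _).2 ?(derive_cp _ _).2;
  by case: k => [|[|[|[|k]]]] //=; rewrite ?peval_cst ?cr1 ?nth_nil.
Qed.
End CoordinateEngine.

Section CoordinateStructure.
Variables (R : realType).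
Notation R3 := (R * R * R)%type.

Definition vfield (u v w : R3 -> R) (g : R3 -> R) (z : R3) : R :=
  u z * partial 0 g z + v z * partial 1 g z + w z * partial 2 g z.

Lemma vfield_der (U : set R3) u v w : open U -> smooth U u -> smooth U v -> smooth U w ->
  derivation U (vfield u v w).
Proof.
move=> oU su sv sw; rewrite /vfield.
apply: (derivation_add oU); [apply: (derivation_add oU)|];
  apply: (derivation_scale oU) => //; exact: partial_der.
Qed.

(* The invariant frame (P, X, Y) in the local coordinates (a, b, c) = (H_10, H_01, K).
   Apart from the brackets, the equations express I = e = 1 or -1 and H = 1 after
   normalization.  All the parameters but [pb] and [ya] are structure functions or
   determined by [fs_pa] and [fs_pc]. *)
Record frame_structure (e : R) (U : set R3) (xa xb xc pa pb pc ya yb yc n4 n5 n6 : R3 -> R) : Prop :=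
  FrameStructure {
  fs_smooth : forall i, (i < 12)%N ->
    smooth U (nth (fun=> 0) [:: xa; xb; xc; pa; pb; pc; ya; yb; yc; n4; n5; n6] i);
  fs_px_on : forall V g, open V -> V `<=` U -> smooth V g -> eq_on V
    (fun z => vfield pa pb pc (vfield xa xb xc g) z - vfield xa xb xc (vfield pa pb pc g) z)
    (fun z => vfield ya yb yc g z - 3 / 8 * z.2 * vfield xa xb xc g z - z.1.1 * vfield pa pb pc g z / 8);
  fs_py_on : forall V g, open V -> V `<=` U -> smooth V g -> eq_on V
    (fun z => vfield pa pb pc (vfield ya yb yc g) z - vfield ya yb yc (vfield pa pb pc g) z)
    (fun z => n5 z * vfield pa pb pc g z + n6 z / 5 * vfield xa xb xc g z
       - z.2 * vfield ya yb yc g z / 4 - z.1.2 * vfield pa pb pc g z / 8);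
  fs_xy_on : forall V g, open V -> V `<=` U -> smooth V g -> eq_on V
    (fun z => vfield xa xb xc (vfield ya yb yc g) z - vfield ya yb yc (vfield xa xb xc g) z)
    (fun z => n4 z * vfield pa pb pc g z + n5 z / 5 * vfield xa xb xc g z
       - z.1.1 * vfield ya yb yc g z / 4 + 3 / 8 * z.1.2 * vfield xa xb xc g z);
  fs_pa : eq_on U pa (fun z => xc z + z.1.2 + 24 / 5 * n5 z - z.1.1 * z.2 / 2);
  fs_pc : eq_on U pc (fun z => e * n4 z + n6 z / 5 - 7 / 8 * z.2 * z.2);
  fs_q1 : eq_on U
    (fun z => 15 * ((pb z - (yc z - 3 / 8 * z.1.2 * z.2 + n6 z * z.1.1 / 5 + n5 z * z.2)) / 8))
    (fun z => vfield xa xb xc n6 z - z.1.1 * n6 z / 4 - vfield pa pb pc n5 z - z.2 * n5 z / 4);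
  fs_q2 : eq_on U
    (fun z => (xb z - z.1.1 * z.1.2 / 8 - n4 z * z.2 - n5 z * z.1.1 / 5 - ya z) / 8)
    (fun z => vfield xa xb xc n5 z + z.1.1 * n5 z / 4 - vfield pa pb pc n4 z - 3 / 4 * z.2 * n4 z);
  fs_cp : eq_on U
    (fun z => vfield pa pb pc (fun z => (pb z - (yc z - 3 / 8 * z.1.2 * z.2
         + n6 z * z.1.1 / 5 + n5 z * z.2)) / 8) z
       + z.2 * ((pb z - (yc z - 3 / 8 * z.1.2 * z.2 + n6 z * z.1.1 / 5 + n5 z * z.2)) / 8) / 8)
    (fun z => - (3 / 20) * (vfield ya yb yc n6 z - z.1.2 * n6 z / 4) - 9 / 50 * n5 z * n6 z - e / 8);
  fs_cx : eq_on U
    (fun z => vfield xa xb xc (fun z => (xb z - z.1.1 * z.1.2 / 8 - n4 z * z.2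
         - n5 z * z.1.1 / 5 - ya z) / 8) z
       + 5 / 8 * z.1.1 * ((xb z - z.1.1 * z.1.2 / 8 - n4 z * z.2 - n5 z * z.1.1 / 5 - ya z) / 8))
    (fun z => - (3 / 4) * (vfield ya yb yc n4 z + 3 / 4 * z.1.2 * n4 z) - 9 / 10 * n5 z * n4 z - 1 / 8) }.

Section FrameStructure.
Variables (e : R) (U : set R3) (xa xb xc pa pb pc ya yb yc n4 n5 n6 : R3 -> R).
Hypothesis S1 : frame_structure e U xa xb xc pa pb pc ya yb yc n4 n5 n6.
Hypothesis oU : open U.

Lemma fs_px g : smooth U g -> eq_on U
    (fun z => vfield pa pb pc (vfield xa xb xc g) z - vfield xa xb xc (vfield pa pb pc g) z)
    (fun z => vfield ya yb yc g z - 3 / 8 * z.2 * vfield xa xb xc g z - z.1.1 * vfield pa pb pc g z / 8).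
Proof. exact: (fs_px_on S1 oU). Qed.

Lemma fs_py g : smooth U g -> eq_on U
    (fun z => vfield pa pb pc (vfield ya yb yc g) z - vfield ya yb yc (vfield pa pb pc g) z)
    (fun z => n5 z * vfield pa pb pc g z + n6 z / 5 * vfield xa xb xc g z
       - z.2 * vfield ya yb yc g z / 4 - z.1.2 * vfield pa pb pc g z / 8).
Proof. exact: (fs_py_on S1 oU). Qed.

Lemma fs_xy g : smooth U g -> eq_on U
    (fun z => vfield xa xb xc (vfield ya yb yc g) z - vfield ya yb yc (vfield xa xb xc g) z)
    (fun z => n4 z * vfield pa pb pc g z + n5 z / 5 * vfield xa xb xc g z
       - z.1.1 * vfield ya yb yc g z / 4 + 3 / 8 * z.1.2 * vfield xa xb xc g z).
Proof. exact: (fs_xy_on S1 oU). Qed.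

(** Restriction is possible because the bracket fields of the record quantify over all smaller open
    sets: a function smooth on a smaller set need not extend to U. *)
Lemma frame_structure_sub (U' : set R3) : U' `<=` U ->
  frame_structure e U' xa xb xc pa pb pc ya yb yc n4 n5 n6.
Proof.
move=> UU; split.
- move=> i hi; exact: smooth_sub (fs_smooth S1 hi).
- move=> V g oV VU; apply: (fs_px_on S1 oV); exact: subset_trans VU UU.
- move=> V g oV VU; apply: (fs_py_on S1 oV); exact: subset_trans VU UU.
- move=> V g oV VU; apply: (fs_xy_on S1 oV); exact: subset_trans VU UU.
- move=> z /UU; exact: (fs_pa S1).
- move=> z /UU; exact: (fs_pc S1).
- move=> z /UU; exact: (fs_q1 S1).
- move=> z /UU; exact: (fs_q2 S1).
- move=> z /UU; exact: (fs_cp S1).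
- move=> z /UU; exact: (fs_cx S1).
Qed.
End FrameStructure.

(* Two frames with the same structure functions differ by the field v d_b on P and
   w d_a on Y; comparing the structure equations constrains v and w. *)
Section Difference.
Variables (e : R) (U : set R3) (xa xb xc pa pb pc ya yb yc n4 n5 n6 v w : R3 -> R).
Hypothesis oU : open U.
Hypotheses (sv : smooth U v) (sw : smooth U w) (v0 : forall z, U z -> v z != 0).
Hypothesis S1 : frame_structure e U xa xb xc pa pb pc ya yb yc n4 n5 n6.
Hypothesis S2 : frame_structure e U xa xb xc pa (fun z => pb z + v z) pc
  (fun z => ya z + w z) yb yc n4 n5 n6.

Let bs := [:: xa; xb; xc; pa; pb; pc; ya; yb; yc; n4; n5; n6; v; w; (fun=> e)].
Let base := nth (fun=> 0) (coordinates R ++ bs).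

Let bs_smooth i : (i < size bs)%N -> smooth U (nth (fun=> 0) bs i).
Proof.
move=> hi; case: (ltnP i 12) => h; first by have := fs_smooth S1 h; case: i h {hi} => [|[|[|[|[|[|[|[|[|[|[|[|]]]]]]]]]]]].
by case: i hi h => [|[|[|[|[|[|[|[|[|[|[|[|[|[|[|]]]]]]]]]]]]]]] //= _ _; exact: smooth_cst.
Qed.

Let notab (k : nat) (x : dvar) : option dpoly := if k is 0 then None else None.
Let geq : forall e1 e2, nilp (norm alias_coord (fun _ _ => [::]) (tab_coord notab) 30 (EAdd e1 (EOpp e2))) ->
  eq_on U (sem base (@partial R) e1) (sem base (@partial R) e2).
Proof. by apply: coordinate_eq => // -[|k]. Qed.

Let A := EB 0. Let B := EB 1. Let C := EB 2.
Let XA := EB 3. Let XB := EB 4. Let XC := EB 5. Let PA := EB 6. Let PB := EB 7. Let PC := EB 8.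
Let YA := EB 9. Let YB := EB 10. Let YC := EB 11. Let N4 := EB 12. Let N5 := EB 13. Let N6 := EB 14.
Let V := EB 15. Let W := EB 16. Let E := EB 17.
Let N n := EN n.
Let q (a b : nat) := EMul (EN a) (EI b).
Local Notation "a / n" := (EMul a (EI n)) : dexpr_scope.
Local Notation da := (ED 0). Local Notation db := (ED 1). Local Notation dc := (ED 2).
Let eX e := (XA * da e + XB * db e + XC * dc e)%DE.
Let eP b e := (PA * da e + b * db e + PC * dc e)%DE.
Let eY a e := (a * da e + YB * db e + YC * dc e)%DE.

(** [l] and [r] are the sides of a structure equation as functions of P b and Y a. Since all other
    entries agree, only terms with v or w survive the subtraction of its two instances; [k] adjusts
    the numerical factor. *)
Let difference (k : dexpr) (l r : dexpr -> dexpr -> dexpr) (t : dexpr) :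
  eq_on U (sem base (@partial R) (l PB YA)) (sem base (@partial R) (r PB YA)) ->
  eq_on U (sem base (@partial R) (l (PB + V)%DE (YA + W)%DE)) (sem base (@partial R) (r (PB + V)%DE (YA + W)%DE)) ->
  nilp (norm alias_coord (fun _ _ => [::]) (tab_coord notab) 30
    (k * ((l (PB + V) (YA + W) - r (PB + V) (YA + W)) - (l PB YA - r PB YA)) - t)%DE) ->
  forall z, U z -> sem base (@partial R) t z = 0.
Proof.
by move=> H1 H2 /geq H z Uz; rewrite -(H z Uz) /= (H1 z Uz) (H2 z Uz) !subrr mulr0.
Qed.

Let eq1 b := ((b - (YC - q 3 8 * B * C + N6 * A / 5 + N5 * C)) / 8)%DE.
Let eq2 a := ((XB - A * B / 8 - N4 * C - N5 * A / 5 - a) / 8)%DE.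

(** In [fs_q1] only P b and the term P n5 change, both by multiples of v, and v cancels. *)
Lemma diff_n5_b : eq_on U (partial 1 n5) (fun=> - (15 / 8)).
Proof.
move=> z Uz; have := @difference (N 1) (fun b a => N 15 * eq1 b)%DE
  (fun b a => eX N6 - A * N6 / 4 - eP b N5 - C * N5 / 4)%DE
  (V * (db N5 - - q 15 8))%DE (fs_q1 S1) (fs_q1 S2) erefl z Uz.
by move=> /= /eqP; rewrite mulf_eq0 (negbTE (v0 Uz)) /= subr_eq0 => /eqP.
Qed.

(** In [fs_q2] only Y a and P n4 change, so w is a multiple of v. Whether d_b n4 vanishes decides if
    the frames differ in one field or in two, and this splits the proof. *)
Lemma diff_w : eq_on U w (fun z => 8 * v z * partial 1 n4 z).
Proof.
move=> z Uz; apply/esym/subr0_eq; exact: (@difference (N 8) (fun b a => eq2 a)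
  (fun b a => eX N5 + A * N5 / 4 - eP b N4 - q 3 4 * C * N4)%DE
  (N 8 * V * db N4 - W)%DE (fs_q2 S1) (fs_q2 S2) erefl z Uz).
Qed.

Lemma diff_xa_b z : U z -> v z * partial 1 xa z = w z.
Proof.
move=> Uz; apply/subr0_eq; exact: (@difference (N 1) (fun b a => eP b (eX A) - eX (eP b A))%DE
  (fun b a => eY a A - q 3 8 * C * eX A - A * eP b A / 8)%DE
  (V * db XA - W)%DE (fs_px S1 oU (coordinates_smooth oU bs_smooth 0)) (fs_px S2 oU (coordinates_smooth oU bs_smooth 0)) erefl z Uz).
Qed.

Lemma diff_Xv : eq_on U (vfield xa xb xc v) (fun z => v z * (partial 1 xb z + z.1.1 / 8)).
Proof.
move=> z Uz; apply/subr0_eq; exact: (@difference (- N 1)%DE (fun b a => eP b (eX B) - eX (eP b B))%DE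
  (fun b a => eY a B - q 3 8 * C * eX B - A * eP b B / 8)%DE
  (eX V - V * (db XB + A / 8))%DE (fs_px S1 oU (coordinates_smooth oU bs_smooth 1)) (fs_px S2 oU (coordinates_smooth oU bs_smooth 1)) erefl z Uz).
Qed.

Lemma diff_xc_b : eq_on U (partial 1 xc) (fun=> 0).
Proof.
move=> z Uz; have := @difference (N 1) (fun b a => eP b (eX C) - eX (eP b C))%DE
  (fun b a => eY a C - q 3 8 * C * eX C - A * eP b C / 8)%DE
  (V * db XC)%DE (fs_px S1 oU (coordinates_smooth oU bs_smooth 2)) (fs_px S2 oU (coordinates_smooth oU bs_smooth 2)) erefl z Uz.
by move=> /= /eqP; rewrite mulf_eq0 (negbTE (v0 Uz)) /= => /eqP.
Qed.

Let exy_l (b a g : dexpr) := (eX (eY a g) - eY a (eX g))%DE.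
Let exy_r (b a g : dexpr) := (N4 * eP b g + N5 / 5 * eX g - A * eY a g / 4 + q 3 8 * B * eX g)%DE.

Lemma diff_Xw : eq_on U (vfield xa xb xc w) (fun z => w z * (partial 0 xa z - z.1.1 / 4)).
Proof.
move=> z Uz; apply/subr0_eq; exact: (@difference (N 1) (fun b a => exy_l b a A) (fun b a => exy_r b a A)
  (eX W - W * (da XA - A / 4))%DE (fs_xy S1 oU (coordinates_smooth oU bs_smooth 0)) (fs_xy S2 oU (coordinates_smooth oU bs_smooth 0)) erefl z Uz).
Qed.

Lemma diff_xb_a z : U z -> w z * partial 0 xb z = - (n4 z * v z).
Proof.
move=> Uz; apply/subr0_eq; exact: (@difference (- N 1)%DE (fun b a => exy_l b a B) (fun b a => exy_r b a B)
  (W * da XB - - (N4 * V))%DE (fs_xy S1 oU (coordinates_smooth oU bs_smooth 1)) (fs_xy S2 oU (coordinates_smooth oU bs_smooth 1)) erefl z Uz).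
Qed.

Lemma diff_xc_a z : U z -> w z * partial 0 xc z = 0.
Proof.
move=> Uz; exact: (@difference (- N 1)%DE (fun b a => exy_l b a C) (fun b a => exy_r b a C)
  (W * da XC)%DE (fs_xy S1 oU (coordinates_smooth oU bs_smooth 2)) (fs_xy S2 oU (coordinates_smooth oU bs_smooth 2)) erefl z Uz).
Qed.

Let epy_l (b a g : dexpr) := (eP b (eY a g) - eY a (eP b g))%DE.
Let epy_r (b a g : dexpr) := (N5 * eP b g + N6 / 5 * eX g - C * eY a g / 4 - B * eP b g / 8)%DE.

Lemma diff_ya_b z : U z -> vfield pa pb pc w z + v z * partial 1 ya z + v z * partial 1 w z
  - w z * partial 0 pa z + z.2 * w z / 4 = 0.
Proof.
exact: (@difference (N 1) (fun b a => epy_l b a A) (fun b a => epy_r b a A)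
  (eP PB W + V * db YA + V * db W - W * da PA + C * W / 4)%DE (fs_py S1 oU (coordinates_smooth oU bs_smooth 0)) (fs_py S2 oU (coordinates_smooth oU bs_smooth 0)) erefl).
Qed.

Lemma diff_yb_b z : U z -> v z * partial 1 yb z - vfield ya yb yc v z - w z * partial 0 pb z
  - w z * partial 0 v z - n5 z * v z + z.1.2 * v z / 8 = 0.
Proof.
exact: (@difference (N 1) (fun b a => epy_l b a B) (fun b a => epy_r b a B)
  (V * db YB - eY YA V - W * da PB - W * da V - N5 * V + B * V / 8)%DE (fs_py S1 oU (coordinates_smooth oU bs_smooth 1)) (fs_py S2 oU (coordinates_smooth oU bs_smooth 1)) erefl).
Qed.

Lemma diff_yc_b z : U z -> v z * partial 1 yc z - w z * partial 0 pc z = 0.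
Proof.
exact: (@difference (N 1) (fun b a => epy_l b a C) (fun b a => epy_r b a C)
  (V * db YC - W * da PC)%DE (fs_py S1 oU (coordinates_smooth oU bs_smooth 2)) (fs_py S2 oU (coordinates_smooth oU bs_smooth 2)) erefl).
Qed.

Lemma diff_Pv z : U z -> vfield pa pb pc v z / 8 + v z * partial 1 (fun z => (pb z - (yc z - 3 / 8 * z.1.2 * z.2
         + n6 z * z.1.1 / 5 + n5 z * z.2)) / 8) z
   + v z * partial 1 v z / 8 + z.2 * v z / 64 + 3 / 20 * w z * partial 0 n6 z = 0.
Proof.
exact: (@difference (N 1) (fun b a => eP b (eq1 b) + C * eq1 b / 8)%DE
  (fun b a => - q 3 20 * (eY a N6 - B * N6 / 4) - q 9 50 * N5 * N6 - E / 8)%DE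
  (eP PB V / 8 + V * db (eq1 PB) + V * db V / 8 + C * V / 64 + q 3 20 * W * da N6)%DE (fs_cp S1) (fs_cp S2) erefl).
Qed.

Lemma diff_n4_a z : U z -> vfield xa xb xc w z / 8 + 5 / 64 * z.1.1 * w z = 3 / 4 * w z * partial 0 n4 z.
Proof.
move=> Uz; apply/subr0_eq; exact: (@difference (- N 1)%DE (fun b a => eX (eq2 a) + q 5 8 * A * eq2 a)%DE
  (fun b a => - q 3 4 * (eY a N4 + q 3 4 * B * N4) - q 9 10 * N5 * N4 - q 1 8)%DE
  (eX W / 8 + q 5 64 * A * W - q 3 4 * W * da N4)%DE (fs_cx S1) (fs_cx S2) erefl z Uz).
Qed.
End Difference.
End CoordinateStructure.

(** * The case d_b n4 = 0 *)

Section RankOneCase.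
Variables (R : realType).
Notation R3 := (R * R * R)%type.

Lemma open_neq0 (U : set R3) (g : R3 -> R) : open U -> smooth U g ->
  open (U `&` [set z | g z != 0]).
Proof.
move=> oU sg; rewrite openE => z [Uz gz].
have c := smooth_continuous sg Uz.
apply: filterI; first exact: open_nbhs_nbhs.
have : open [set x : R | x != 0] by exact: open_neq.
by rewrite openE => /(_ _ gz) H; exact: (c _ H).
Qed.

Section Combination.
Variables (V : normedModType R) (base : nat -> V -> R) (delta : nat -> (V -> R) -> V -> R).

(** A list of triples (k, l, r) is a certificate: the claim is the sum of the equations l = r
    multiplied by k, and the normalizer checks this. *)
Definition combination (s : seq (dexpr * dexpr * dexpr)) : dexpr :=
  foldr (fun t acc => t.1.1 * (t.1.2 - t.2) + acc)%DE (EN 0) s.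

Fixpoint holds (s : seq (dexpr * dexpr * dexpr)) (z : V) : Prop :=
  if s is t :: s' then sem base delta t.1.2 z = sem base delta t.2 z /\ holds s' z else True.

Lemma combination0 s z : holds s z -> sem base delta (combination s) z = 0.
Proof. by elim: s => [|t s IH] //= [H /IH ->]; rewrite H subrr mulr0 addr0. Qed.
End Combination.

Section Facts.
Variables (e : R) (U : set R3) (xa xb xc pa pb pc ya yb yc n4 n5 n6 v : R3 -> R).
Hypothesis oU : open U.
Hypothesis sv : smooth U v.
Hypothesis S1 : frame_structure e U xa xb xc pa pb pc ya yb yc n4 n5 n6.
Hypotheses (n4_0 : eq_on U n4 (fun=> 0)) (n5_b : eq_on U (partial 1 n5) (fun=> - (15 / 8)))
  (xa_b : eq_on U (partial 1 xa) (fun=> 0)) (xc_b : eq_on U (partial 1 xc) (fun=> 0))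
  (ya_b : eq_on U (partial 1 ya) (fun=> 0)) (yc_b : eq_on U (partial 1 yc) (fun=> 0)).

Let bs := [:: xa; xb; xc; pa; pb; pc; ya; yb; yc; n4; n5; n6; v].
Let base := nth (fun=> 0) (coordinates R ++ bs).

Let bs_smooth i : (i < size bs)%N -> smooth U (nth (fun=> 0) bs i).
Proof.
move=> hi; case: (ltnP i 12) => h; first by have := fs_smooth S1 h; case: i h {hi} => [|[|[|[|[|[|[|[|[|[|[|[|]]]]]]]]]]]].
by case: i hi h => [|[|[|[|[|[|[|[|[|[|[|[|[|]]]]]]]]]]]]].
Qed.

Let A := EB 0. Let B := EB 1. Let C := EB 2.
Let XA := EB 3. Let XB := EB 4. Let XC := EB 5. Let PA := EB 6. Let PB := EB 7. Let PC := EB 8.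
Let YA := EB 9. Let YB := EB 10. Let YC := EB 11. Let N4 := EB 12. Let N5 := EB 13. Let N6 := EB 14.
Let V := EB 15.
Let N n := EN n.
Let q (a b : nat) := EMul (EN a) (EI b).
Local Notation "a / n" := (EMul a (EI n)) : dexpr_scope.
Local Notation da := (ED 0). Local Notation db := (ED 3). Local Notation dc := (ED 2).
Let eX e := (XA * da e + XB * db e + XC * dc e)%DE.
Let eP e := (PA * da e + PB * db e + PC * dc e)%DE.
Let eY e := (YA * da e + YB * db e + YC * dc e)%DE.
Local Notation sem := (sem base (@partial R)).

Let coord_smooth b : smooth U (base b).
Proof. exact: coordinates_smooth. Qed.
Let sm e' : smooth U (sem e').
Proof. exact: (sem_smooth oU coord_smooth (partial_der oU)). Qed.
Let dz k l r : eq_on U (sem l) (sem r) -> eq_on U (sem (ED k l)) (sem (ED k r)).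
Proof. by move=> H; exact: (der_eq (partial_der oU k) (sm l) H). Qed.

Let paE k : eq_on U (partial k pa) (sem (ED k (XC + B + q 24 5 * N5 - A * C / 2)%DE)).
Proof. by apply: (@dz k PA); exact: (fs_pa S1). Qed.

(** For n4 = 0 the equation [fs_pc] can be solved for n6, which is thereby eliminated in favour of P
    c. *)
Let n6E k : eq_on U (partial k n6) (sem (ED k (N 5 * PC + q 35 8 * C * C)%DE)).
Proof.
apply: (@dz k N6) => z Uz.
have h := fs_pc S1 Uz.
have h' : sem (N 5 * PC + q 35 8 * C * C)%DE z = 5 * pc z + 35 / 8 * z.2 * z.2 by [].
rewrite h' h n4_0 // -[LHS]/(n6 z); set x := n6 z; set y := z.2; by field.
Qed.

Let rl (k b : nat) (ks : seq nat) (e' : dexpr) : nat * dvar * dexpr := (k, (b, ks), e').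
(** Base variables 3 to 11 are the components of X, P and Y, and 12 to 14 are n4, n5, n6; direction
    3 is d_b. *)
Let rules0 : seq (nat * dvar * dexpr) := [::
  rl 3 3 [::] (N 0); rl 3 5 [::] (N 0); rl 3 9 [::] (N 0); rl 3 11 [::] (N 0);
  rl 0 12 [::] (N 0); rl 3 12 [::] (N 0); rl 2 12 [::] (N 0); rl 3 13 [::] (- q 15 8);
  rl 0 6 [::] (da XC + q 24 5 * da N5 - C / 2); rl 3 6 [::] (- N 8);
  rl 2 6 [::] (dc XC + q 24 5 * dc N5 - A / 2);
  rl 0 14 [::] (N 5 * da PC); rl 3 14 [::] (N 5 * db PC);
  rl 2 14 [::] (N 5 * dc PC + q 35 4 * C)]%DE.
Let rules1 : seq (nat * dvar * dexpr) := rl 3 4 [::] (- (A / 4))%DE :: rules0.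
Let rules2 : seq (nat * dvar * dexpr) := [:: rl 3 8 [:: 3%N] (N 0); rl 3 10 [:: 3%N] (N 4)]%DE ++ rules1.

Local Notation valid := (valid_rules U base (@partial R)).
Let geq rules (H : valid rules) e1 e2 :
  nilp (norm alias_coord (fun _ _ => [::]) (tab_coord (tab_of rules)) 30 (EAdd e1 (EOpp e2))) ->
  eq_on U (sem e1) (sem e2).
Proof.
apply: coordinate_eq => // k x p.
exact: (tab_of_ok oU coord_smooth (partial_der oU)).
Qed.

Let conseq rules (H : valid rules) s t z : U z -> holds base (@partial R) s z ->
  nilp (norm alias_coord (fun _ _ => [::]) (tab_coord (tab_of rules)) 30 (EAdd t (EOpp (combination s)))) ->
  sem t z = 0.
Proof. by move=> Uz hs /(geq H) ->; rewrite ?combination0. Qed.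

Let valid0 : valid rules0.
Proof.
have n40 k : eq_on U (partial k n4) (fun=> 0).
  move=> z Uz; rewrite (der_eq (partial_der oU k) (fs_smooth S1 (isT : (9 < 12)%N)) n4_0 Uz).
  exact: (der_cst (partial_der oU k)).
have H0 : valid [::] by [].
split; first exact: xa_b.
split; first exact: xc_b.
split; first exact: ya_b.
split; first exact: yc_b.
do 3! (split; first exact: n40).
split; first exact: n5_b.
split; first by move=> z Uz; rewrite (paE 0 Uz); move: z Uz; apply: (geq H0); vm_compute.
split.
  move=> z Uz; apply/subr0_eq; apply: (conseq (t := (db PA - - N 8)%DE) H0 Uz (s := [:: (N 1, db PA, db (XC + B + q 24 5 * N5 - A * C / 2));
    (N 1, db XC, N 0); (q 24 5, db N5, - q 15 8)]%DE)); last by vm_compute.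
  by split; [exact: paE|split; [exact: xc_b|split; [exact: n5_b|]]].
split; first by move=> z Uz; rewrite (paE 2 Uz); move: z Uz; apply: (geq H0); vm_compute.
split; first by move=> z Uz; rewrite (n6E 0 Uz); move: z Uz; apply: (geq H0); vm_compute.
split; first by move=> z Uz; rewrite (n6E 3 Uz); move: z Uz; apply: (geq H0); vm_compute.
by split; first by move=> z Uz; rewrite (n6E 2 Uz); move: z Uz; apply: (geq H0); vm_compute.
Qed.

Let eta := (YC - q 3 8 * B * C + N6 * A / 5 + N5 * C)%DE.
Let eq1 := ((PB - eta) / 8)%DE.

(** The derivative of [fs_q2] along b. Since d_b n5 is constant and X a, X c do not depend on b, the
    term X n5 contributes -15/8 d_b (X b), and the equation becomes linear in d_b (X b). *)
Lemma rank_one_xb_b : eq_on U (partial 1 xb) (fun z => - (z.1.1 / 4)).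
Proof.
have H := @dz 3 ((XB - A * B / 8 - N4 * C - N5 * A / 5 - YA) / 8)%DE
  (eX N5 + A * N5 / 4 - eP N4 - q 3 4 * C * N4)%DE (fs_q2 S1).
move=> z Uz; apply/subr0_eq; apply: (conseq (t := (db XB - - (A / 4))%DE) valid0 Uz (s := [:: (q 1 2, db ((XB - A * B / 8 - N4 * C - N5 * A / 5 - YA) / 8),
  db (eX N5 + A * N5 / 4 - eP N4 - q 3 4 * C * N4))]%DE)); last by vm_compute.
by split; [exact: H|].
Qed.

Let valid1 : valid rules1.
Proof. by split; first exact: rank_one_xb_b. Qed.

Let k0 := (N 5 * dc XC + q 5 4 * A - dc N5)%DE.
Let r0 := (N 40 * da XC - N 8 * da N5 + q 15 4 * C)%DE.

(** Neither [k0] nor [r0] depends on b. Hence P c is affine in b wherever [k0] is nonzero, and [k0]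
    = 0 entails [r0] = 0. *)
Lemma rank_one_pc_b : eq_on U (sem (r0 - k0 * db PC)%DE) (fun=> 0).
Proof.
have H1 := @dz 3 (eP (eX C) - eX (eP C))%DE (eY C - q 3 8 * C * eX C - A * eP C / 8)%DE
  (fs_px S1 oU (coord_smooth 2)).
have H2 := @dz 3 (N 15 * eq1)%DE (eX N6 - A * N6 / 4 - eP N5 - C * N5 / 4)%DE (fs_q1 S1).
move=> z Uz; apply: (conseq valid1 Uz (s := [:: (N 1, db (N 15 * eq1), db (eX N6 - A * N6 / 4 - eP N5 - C * N5 / 4));
   (- N 5, db (eP (eX C) - eX (eP C)), db (eY C - q 3 8 * C * eX C - A * eP C / 8))]%DE)); last by vm_compute.
by split; [exact: H2|split; [exact: H1|]].
Qed.

(** The mixed derivatives of X c and of n5 cancel in 8 d_a [k0] - d_c [r0], which leaves the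
    constant 10 - 15/4. *)
Lemma rank_one_k0 z : U z -> eq_on U (sem k0) (fun=> 0) -> eq_on U (sem r0) (fun=> 0) -> False.
Proof.
move=> Uz H1 H2.
have E1 := @dz 0 k0 (N 0) H1 z Uz; have E2 := @dz 2 r0 (N 0) H2 z Uz.
have : sem (q 25 4) z = 0.
  apply: (conseq valid1 Uz (s := [:: (N 8, da k0, da (N 0)); (- N 1, dc r0, dc (N 0))]%DE)); last by vm_compute.
  by split; [exact: E1|split; [exact: E2|]].
by rewrite /=; lra.
Qed.

Lemma rank_one_pc_bb : eq_on U (sem (k0 * db (db PC))%DE) (fun=> 0).
Proof.
have H := @dz 3 (r0 - k0 * db PC)%DE (N 0) rank_one_pc_b.
move=> z Uz; apply: (conseq valid1 Uz (s := [:: (- N 1, db (r0 - k0 * db PC), db (N 0))]%DE)); last by vm_compute.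
by split; [exact: H|].
Qed.

(** The hypotheses give v all its derivatives along the frame, so the bracket [P, X] applied to v is
    a compatibility condition. Differentiated along b and compared with the second b-derivatives of
    [P, X] b and of X v, it becomes 5 = 0. *)
Lemma rank_one_final z : U z -> (forall z, U z -> v z != 0) ->
  eq_on U (vfield xa xb xc v) (fun z => v z * (partial 1 xb z + z.1.1 / 8)) ->
  eq_on U (vfield ya yb yc v) (fun z => v z * (partial 1 yb z - n5 z + z.1.2 / 8)) ->
  eq_on U (vfield pa pb pc v) (sem (- (V * (N 8 * db eq1 + db V + C / 8)))%DE) ->
  eq_on U (partial 1 (partial 1 pc)) (fun=> 0) -> False.
Proof.
move=> Uz v0 Xv Yv Pv pcbb.
have validp : valid (rl 3 8 [:: 3%N] (N 0) :: rules1) by split; first exact: pcbb.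
(* The second derivative along b of [P, Y] a, in which P c is affine in b. *)
have ybb : eq_on U (partial 1 (partial 1 yb)) (fun=> 4).
  have H := @dz 3 _ _ (@dz 3 (eP (eY A) - eY (eP A))%DE (N5 * eP A + N6 / 5 * eX A - C * eY A / 4 - B * eP A / 8)%DE
     (fs_py S1 oU (coord_smooth 0))).
  move=> y Uy; apply/subr0_eq; apply: (conseq (t := (db (db YB) - N 4)%DE) validp Uy (s := [:: (q 1 8, db (db (eP (eY A) - eY (eP A))),
     db (db (N5 * eP A + N6 / 5 * eX A - C * eY A / 4 - B * eP A / 8)))]%DE)); last by vm_compute.
  by split; [exact: H|].
have valid2 : valid rules2 by split; [exact: pcbb|split; [exact: ybb|exact: valid1]].
have Xv' : eq_on U (sem (eX V)) (sem (- (A * V / 8))%DE).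
  move=> y Uy; rewrite -[LHS]/(vfield xa xb xc v y) Xv // rank_one_xb_b // /= /base /=; by field.
(* [kap] is - P v / v, and v [rest] is the condition that [P, X] v imposes, up to sign. *)
pose kap := (N 8 * db eq1 + db V + C / 8)%DE.
pose rest := (eX kap - PA / 8 - db YB + N5 - B / 8 - q 3 64 * A * C - A * kap / 8)%DE.
have Z1 : eq_on U (sem rest) (fun=> 0).
  move=> y Uy.
  have H1 : sem (eP (eX V)) y = sem (eP (- (A * V / 8))%DE) y.
    rewrite -[LHS]/(vfield pa pb pc (sem (eX V)) y) -[RHS]/(vfield pa pb pc (sem (- (A * V / 8))%DE) y).
    apply: (der_eq (vfield_der oU _ _ _) (sm _) Xv' Uy);
      [exact: (coord_smooth 6)|exact: (coord_smooth 7)|exact: (coord_smooth 8)].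
  have H2 : sem (eX (eP V)) y = sem (eX (- (V * kap))%DE) y.
    rewrite -[LHS]/(vfield xa xb xc (sem (eP V)) y) -[RHS]/(vfield xa xb xc (sem (- (V * kap))%DE) y).
    apply: (der_eq (vfield_der oU _ _ _) (sm (eP V)) Pv Uy);
      [exact: (coord_smooth 3)|exact: (coord_smooth 4)|exact: (coord_smooth 5)].
  have H3 := fs_px S1 oU sv Uy.
  have H4 : sem (eY V) y = sem (V * (db YB - N5 + B / 8))%DE y by exact: Yv.
  have H5 := Pv y Uy; have H6 := Xv' y Uy.
  have E1 : sem (V * rest)%DE y = 0.
    apply: (conseq valid1 Uy (s := [:: (- N 1, eP (eX V), eP (- (A * V / 8))); (N 1, eX (eP V), eX (- (V * kap)));
      (N 1, eP (eX V) - eX (eP V), eY V - q 3 8 * C * eX V - A * eP V / 8);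
      (N 1, eY V, V * (db YB - N5 + B / 8)); (- (q 3 8 * C + kap), eX V, - (A * V / 8))]%DE)); last by vm_compute.
    by split; [exact: H1|split; [exact: H2|split; [exact: H3|split; [exact: H4|split]]]].
  by move/eqP: E1; rewrite -[sem _ y]/(v y * sem rest y) mulf_eq0 (negbTE (v0 _ Uy)) /= => /eqP.
have H1 := @dz 3 _ _ (@dz 3 (eP (eX B) - eX (eP B))%DE (eY B - q 3 8 * C * eX B - A * eP B / 8)%DE (fs_px S1 oU (coord_smooth 1))).
have H2 := @dz 3 _ _ (@dz 3 (eX V) (- (A * V / 8))%DE Xv').
have H3 := @dz 3 rest (N 0) Z1.
have : sem (N 5) z = 0.
  apply: (conseq valid2 Uz (s := [:: (- N 1, db rest, db (N 0)); (- N 1, db (db (eP (eX B) - eX (eP B))),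
     db (db (eY B - q 3 8 * C * eX B - A * eP B / 8))); (N 1, db (db (eX V)), db (db (- (A * V / 8))))]%DE)); last by vm_compute.
  by split; [exact: H3|split; [exact: H1|split; [exact: H2|]]].
by move/eqP; rewrite pnatr_eq0.
Qed.
End Facts.
(** Here w = 0, and then [diff_xb_a] gives n4 = 0, so the frames differ in P b alone. Either P c is
    affine in b on U, or the argument moves to the open set where its second derivative along b is
    nonzero and [k0], [r0] vanish. *)
Lemma rank_one_case (e : R) (U : set R3) (xa xb xc pa pb pc ya yb yc n4 n5 n6 v w : R3 -> R) z :
  open U -> U z -> smooth U v -> smooth U w -> (forall z, U z -> v z != 0) ->
  frame_structure e U xa xb xc pa pb pc ya yb yc n4 n5 n6 ->
  frame_structure e U xa xb xc pa (fun z => pb z + v z) pc (fun z => ya z + w z) yb yc n4 n5 n6 ->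
  eq_on U (partial 1 n4) (fun=> 0) -> False.
Proof.
move=> oU Uz sv sw v0 S1 S2 n4_b.
have w0 : eq_on U w (fun=> 0).
  by move=> y Uy; rewrite (diff_w oU sv sw S1 S2 Uy) n4_b // mulr0.
have n40 : eq_on U n4 (fun=> 0).
  move=> y Uy; have /esym/eqP := diff_xb_a oU sv sw S1 S2 Uy.
  by rewrite w0 // mul0r oppr_eq0 mulf_eq0 (negbTE (v0 _ Uy)) orbF => /eqP.
have dw0 d : derivation U d -> eq_on U (d w) (fun=> 0).
  by move=> hd y Uy; rewrite (der_eq hd sw w0 Uy) (der_cst hd).
have div0 g : (forall y, U y -> v y * g y = 0) -> eq_on U g (fun=> 0).
  by move=> H y Uy; have /eqP := H y Uy; rewrite mulf_eq0 (negbTE (v0 _ Uy)) => /eqP.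
have xab : eq_on U (partial 1 xa) (fun=> 0).
  by apply: div0 => y Uy; rewrite (diff_xa_b oU sv sw S1 S2 Uy) w0.
have yab : eq_on U (partial 1 ya) (fun=> 0).
  apply: div0 => y Uy; have := diff_ya_b oU sv sw S1 S2 Uy.
  rewrite (dw0 _ (partial_der oU 1)) // (dw0 _ (vfield_der oU _ _ _)) //;
    [|exact: (fs_smooth S1 (isT : (3 < 12)%N))|exact: (fs_smooth S1 (isT : (4 < 12)%N))|exact: (fs_smooth S1 (isT : (5 < 12)%N))].
  by rewrite w0 // !mul0r !mulr0 mul0r add0r subr0 !addr0.
have ycb : eq_on U (partial 1 yc) (fun=> 0).
  by apply: div0 => y Uy; have := diff_yc_b oU sv sw S1 S2 Uy; rewrite w0 // mul0r subr0.
have Yv : eq_on U (vfield ya yb yc v) (fun z => v z * (partial 1 yb z - n5 z + z.1.2 / 8)).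
  move=> y Uy; have := diff_yb_b oU sv sw S1 S2 Uy; rewrite w0 // !mul0r.
  by set t := vfield _ _ _ _ _ => H; apply/subr0_eq; rewrite -[RHS]oppr0 -[in RHS]H; ring.
have Pv := diff_Pv oU sv sw S1 S2.
have n5b := diff_n5_b oU sv sw v0 S1 S2.
have xcb := diff_xc_b oU sv sw v0 S1 S2.
have Xv := diff_Xv oU sv sw S1 S2.
have [pcbb|/existsNP[y /not_implyP[Uy /eqP pcbb]]] := pselect (eq_on U (partial 1 (partial 1 pc)) (fun=> 0)).
  apply: (rank_one_final oU sv S1 n40 n5b xab xcb yab ycb Uz v0 Xv Yv _ pcbb) => y Uy.
  have := Pv _ Uy; rewrite w0 // mulr0 mul0r addr0.
  set t := vfield _ _ _ _ _; set dq := partial 1 (fun _ => _) _; set dv := partial 1 v y => H.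
  rewrite -[RHS]/(- (v y * (8 * dq + dv + y.2 / 8))).
  by apply/subr0_eq; rewrite -[RHS](mulr0 8) -[in RHS]H; field.
have spc : smooth U (partial 1 (partial 1 pc)).
  by do 2! apply: (der_smooth (partial_der oU 1)); exact: (fs_smooth S1 (isT : (5 < 12)%N)).
have oU' := open_neq0 oU spc.
set U' := U `&` _ in oU'.
have UU : U' `<=` U by move=> ? [].
have S' := frame_structure_sub S1 UU.
have n40' := fun x h => n40 x (UU x h); have n5b' := fun x h => n5b x (UU x h).
have xab' := fun x h => xab x (UU x h); have xcb' := fun x h => xcb x (UU x h).
have yab' := fun x h => yab x (UU x h); have ycb' := fun x h => ycb x (UU x h).
have sv' := smooth_sub UU sv.
have k0 : forall x, U' x -> 5 * partial 2 xc x + 5 / 4 * x.1.1 - partial 2 n5 x = 0.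
  move=> x U'x; have := rank_one_pc_bb oU' sv' S' n40' n5b' xab' xcb' yab' ycb' U'x.
  rewrite -[LHS]/((5 * partial 2 xc x + 5 / 4 * x.1.1 - partial 2 n5 x) * partial 1 (partial 1 pc) x).
  by move/eqP; rewrite mulf_eq0 (negbTE U'x.2) orbF => /eqP.
have r0 : forall x, U' x -> 40 * partial 0 xc x - 8 * partial 0 n5 x + 15 / 4 * x.2 = 0.
  move=> x U'x; have := rank_one_pc_b oU' sv' S' n40' n5b' xab' xcb' yab' ycb' U'x.
  rewrite -[LHS]/(40 * partial 0 xc x - 8 * partial 0 n5 x + 15 / 4 * x.2 -
   (5 * partial 2 xc x + 5 / 4 * x.1.1 - partial 2 n5 x) * partial 1 pc x).
  by rewrite k0 // mul0r subr0.
exact: (rank_one_k0 oU' sv' S' n40' n5b' xab' xcb' yab' ycb' (conj Uy pcbb) k0 r0).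
Qed.

End RankOneCase.

(* In the case d_b n4 <> 0, put T = (8 d_b n4)^-1 d_b and S = d_a.  The equations [hQ], [hGG],
   [hGam] and their derivatives along S and T successively annihilate the derivatives
   T^k b, down to T b, which is nonzero. *)
Section FrameChain.
Variables (R : realType).
Notation R3 := (R * R * R)%type.
Variables (U : set R3) (X S T : (R3 -> R) -> R3 -> R) (a b c s1 n4 D mu f1 g pi : R3 -> R).
Hypothesis oU : open U.
Hypotheses (dX : derivation U X) (dS : derivation U S) (dT : derivation U T).
Let bs := [:: a; b; c; s1; n4; D; mu; f1; g; pi].
Hypothesis bs_smooth : forall i, (i < size bs)%N -> smooth U (nth (fun=> 0) bs i).
Let base := nth (fun=> 0) bs.
Let frame3 : nat -> (R3 -> R) -> R3 -> R := nth (fun _ _ => 0) [:: X; S; T].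
Local Notation sem := (sem base frame3).

Let frame3_der k : derivation U (frame3 k).
Proof. by apply: nth_derivation => // -[|[|[|]]]. Qed.

Let base_smooth i : smooth U (base i).
Proof. exact: nth_smooth. Qed.

Let A := EB 0. Let B := EB 1. Let C := EB 2. Let S1 := EB 3. Let N4 := EB 4.
Let DD := EB 5. Let Mu := EB 6. Let F1 := EB 7. Let G := EB 8. Let Pi := EB 9.
Let N n := EN n.
Let q (a b : nat) := EMul (EN a) (EI b).
Local Notation "a / n" := (EMul a (EI n)) : dexpr_scope.
Local Notation eX := (ED 0). Local Notation eS := (ED 1). Local Notation eT := (ED 2).
Let kap := (q 3 8 * A - S1)%DE.

Hypothesis SX : forall h, smooth U h -> eq_on U (S (X h)) (fun z => X (S h) z + (s1 z * S h z - n4 z * T h z)).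
Hypothesis TX : forall h, smooth U h ->
  eq_on U (T (X h)) (fun z => X (T h) z + (S h z - (3 / 8 * a z - s1 z) * T h z)).
Hypothesis TS : forall h, smooth U h -> eq_on U (T (S h)) (S (T h)).

Let comm3 (k k' : nat) : linc :=
  match k, k' with
  | 1, 0 => [:: (1%N, pN S1); (2%N, pN (- N4)%DE)]
  | 2, 0 => [:: (1%N, pcst c1); (2%N, pN (- kap)%DE)]
  | _, _ => [::]
  end.

Local Notation valid := (valid_rules U base frame3).
Local Notation normal rules := (norm (fun=> None) comm3 (tab_of rules) 30).

Let Z e := forall z, U z -> sem e z = 0.
Let zcomb (s : seq (dexpr * dexpr)) := foldr (fun t acc => t.1 * t.2 + acc)%DE (EN 0) s.
Fixpoint allZ (s : seq (dexpr * dexpr)) : Prop :=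
  if s is t :: s' then Z t.2 /\ allZ s' else True.

Let conseq rules s t : valid rules -> allZ s ->
  nilp (normal rules (EAdd t (EOpp (zcomb s)))) -> Z t.
Proof.
move=> V hs E z Uz.
have F k : frame3 k.+3 = fun _ _ => 0 by rewrite /frame3 /= nth_nil.
have -> : sem t z = sem (zcomb s) z.
  apply: (dexpr_eq oU base_smooth frame3_der _ _ _ E) => //.
  - move=> k k' h _ _; case: k => [|[|[|k]]] //; case: k' => [|[|[|k']]] // _ sh y Uy.
    + rewrite -[LHS]/(S (X h) y) SX // /leval /= -!(norm0_ok oU base_smooth frame3_der) //=.
      by rewrite addr0 mulNr.
    + rewrite -[LHS]/(T (X h) y) TX // /leval /= peval_cst cr1 mul1r -!(norm0_ok oU base_smooth frame3_der) //=.
      by rewrite addr0 mulNr.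
    + by rewrite -[LHS]/(T (S h) y) TS // /leval /= addr0.
    + by rewrite /leval /= addr0 F -[frame3 _ _ _]/(X (fun=> 0) y) (der_cst dX).
    + by rewrite /leval /= addr0 F -[frame3 _ _ _]/(S (fun=> 0) y) (der_cst dS).
    + by rewrite /leval /= addr0 F -[frame3 _ _ _]/(T (fun=> 0) y) (der_cst dT).
    + by rewrite /leval /= addr0 !F.
  - by move=> k v p _; exact: (tab_of_ok oU base_smooth frame3_der).
elim: s hs {E} => [|u s IH] //= [H /IH ->]; by rewrite H // mulr0 addr0.
Qed.

Let zd k e : Z e -> Z (ED k e).
Proof.
move=> H z Uz; rewrite -[LHS]/(frame3 k (sem e) z).
rewrite (der_eq (frame3_der k) (sem_smooth oU base_smooth frame3_der e) H Uz).
exact: (der_cst (frame3_der k)).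
Qed.

Let rl (k b : nat) (ks : seq nat) (e' : dexpr) : nat * dvar * dexpr := (k, (b, ks), e').

Let rules0 : seq (nat * dvar * dexpr) := [::
  rl 1 0 [::] (N 1); rl 2 0 [::] (N 0); rl 1 1 [::] (N 0); rl 1 2 [::] (N 0); rl 2 2 [::] (N 0);
  rl 1 3 [::] (q 1 4); rl 2 3 [::] (N 0); rl 1 4 [::] ((S1 + q 3 8 * A) / 6); rl 2 4 [::] (q 1 8);
  rl 1 5 [::] Mu; rl 2 5 [::] (N 0); rl 1 6 [::] (N 0); rl 2 6 [::] (N 0);
  rl 1 7 [::] (N 0); rl 2 7 [::] (N 0); rl 2 8 [::] (N 0);
  rl 1 1 [:: 2%N] (N 0); rl 1 1 [:: 2%N; 2%N] (N 0); rl 1 1 [:: 2%N; 2%N; 2%N] (N 0);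
  rl 1 1 [:: 2%N; 2%N; 2%N; 2%N] (N 0); rl 1 1 [:: 2%N; 2%N; 2%N; 2%N; 2%N] (N 0)]%DE.

Hypotheses (Sa : eq_on U (S a) (fun=> 1)) (Ta : eq_on U (T a) (fun=> 0)) (Sb : eq_on U (S b) (fun=> 0))
  (Sc : eq_on U (S c) (fun=> 0)) (Tc : eq_on U (T c) (fun=> 0))
  (Ss1 : eq_on U (S s1) (fun=> 1 / 4)) (Ts1 : eq_on U (T s1) (fun=> 0))
  (Sn4 : eq_on U (S n4) (fun z => (s1 z + 3 / 8 * a z) / 6)) (Tn4 : eq_on U (T n4) (fun=> 1 / 8))
  (SD : eq_on U (S D) mu) (TD : eq_on U (T D) (fun=> 0))
  (Smu : eq_on U (S mu) (fun=> 0)) (Tmu : eq_on U (T mu) (fun=> 0))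
  (Sf1 : eq_on U (S f1) (fun=> 0)) (Tf1 : eq_on U (T f1) (fun=> 0)) (Tg : eq_on U (T g) (fun=> 0)).

(** S and T commute and S b = 0. Normal forms put S outside T, so the vanishing is needed as one
    rule for each power of T. *)
Let TkS k : eq_on U (S (iter k T b)) (fun=> 0).
Proof.
have sT j : smooth U (iter j T b).
  by elim: j => [|j IH] /=; [exact: (bs_smooth (isT : (1 < 10)%N))|exact: (der_smooth dT)].
elim: k => [|k IH] //= z Uz; rewrite -(TS (sT k) Uz) (der_eq dT (der_smooth dS (sT k)) IH Uz).
exact: (der_cst dT).
Qed.

Let valid0 : valid rules0.
Proof.
do 16! (split; first by []).
by split; [exact: (TkS 1)|split; [exact: (TkS 2)|split; [exact: (TkS 3)|split; [exact: (TkS 4)|split; [exact: (TkS 5)|]]]]].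
Qed.

Let M' := (- (S1 / 3) - A / 2)%DE.
Let N5 := (G - q 15 8 * B)%DE.
(** [Q], [GG] and [Gam] come from the structure equations by eliminating P b and Y a. [Pi] is P c,
    and [G] is n5 + 15/8 b, the combination that T annihilates. *)
Let Q := (N 2 * eX B - q 16 5 * eX N5 - A * B / 8 + N 5 * C * N4 - q 11 5 * A * N5
  - (M' + A / 8) * (eX C + B + q 24 5 * N5 - A * C / 2) - DD * Pi + eX (eX C) - q 7 8 * C * eX A - A * eX C / 2)%DE.
Let YC := (F1 * Pi - eX Pi + q 3 8 * C * eX C + A * Pi / 8)%DE.
Let GG := (eX YC - F1 * YC + A * YC / 4 - N4 * Pi - G * eX C / 5)%DE.
Let Gam := (eX (eT Pi) - (F1 + A / 2 - S1) * eT Pi + N 2 * eS Pi)%DE.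
Hypotheses (hQ : Z Q) (hGG : Z GG) (hGam : Z Gam) (Tb : forall z, U z -> T b z != 0).

Let r := eT B. Let e := eT r. Let e1 := eT e. Let e2 := eT e1. Let e3 := eT e2.
Let h1 := eT Pi. Let h2 := eT h1. Let h3 := eT h2.
(** Modulo the rules T^2 Q is [N2] - D [h2], which separates the derivatives of b from those of P
    c. *)
Let N2 := (N 8 * eX e - (N 5 * A - q 40 3 * S1) * e)%DE.

(** Along S the functions a and s1 are affine and n4 is quadratic, while S kills every T^k b. As
    [S, X] contains - n4 T, repeated S turns [N2] into constant multiples of derivatives of b: S^3
    [N2] is -5/6 T^3 b, and once this vanishes S [N2] is -5/3 T^2 b. The same mechanism applied to
    [Q] reaches T b. *)
Lemma chain_D0 z : U z -> eq_on U D (fun=> 0) -> False.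
Proof.
move=> Uz D0.
have hmu : Z Mu by move=> y Uy; rewrite -[LHS]/(mu y) -SD //; exact: (@zd 1 DD D0 y Uy).
have hN2 : Z N2.
  by apply: (@conseq rules0 [:: (N 1, eT (eT Q)); (h2, DD)] _ valid0); [split; [do 2! apply: zd|split]|vm_compute].
have he1 : Z e1.
  by apply: (@conseq rules0 [:: (- q 6 5, eS (eS (eS N2)))%DE] _ valid0); [split; [do 3! apply: zd|]|vm_compute].
have valid1 : valid (rl 2 1 [:: 2%N; 2%N] (N 0) :: rules0) by split.
have he : Z e.
  by apply: (@conseq _ [:: (- q 3 5, eS N2)%DE] _ valid1); [split; [apply: zd|]|vm_compute].
have valid2 : valid (rl 2 1 [:: 2%N] (N 0) :: rules0) by split.
(* With T^2 b = 0, the equation T Q = 0 can be solved for S g. *)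
pose sg := (q 5 16 * (N 8 * eX r - N 2 * A * r + q 16 3 * S1 * r - C / 4))%DE.
have valid3 : valid (rl 1 8 [::] sg :: rl 2 1 [:: 2%N] (N 0) :: rules0).
  split => // y Uy; apply/subr0_eq.
  apply: (@conseq _ [:: (- q 5 16, eT Q); (- (q 5 16) * h1, DD)]%DE (eS G - sg)%DE valid2) Uy; last by vm_compute.
  by split; [apply: zd|split].
have hr : Z r.
  apply: (@conseq _ [:: (- N 3, eS (eS (eS Q))); (- (N 3) * eS (eS (eS Pi)), DD); (- (N 9) * eS (eS Pi), Mu)]%DE _ valid3); last by vm_compute.
  by split; [do 3! apply: zd|split; [|split]].
by have /eqP := hr z Uz; apply/negP; exact: Tb.
Qed.

Hypothesis D0 : forall z, U z -> D z != 0.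

Let divD x : Z (DD * x)%DE -> Z x.
Proof.
by move=> H z Uz; have /eqP := H z Uz; rewrite -[sem _ z]/(D z * sem x z) mulf_eq0 (negbTE (D0 Uz)) => /eqP.
Qed.

(** At each point mu or x vanishes. Either way both terms of the derivative X (mu x) = 0 vanish
    separately. *)
Let mulX x : Z (Mu * x)%DE -> Z (Mu * eX x)%DE /\ Z (eX Mu * x)%DE.
Proof.
move=> H.
have H2 : Z (Mu * eX x)%DE.
  move=> z Uz; have H' := @zd 0 _ H z Uz.
  rewrite -[LHS]/(mu z * X (sem x) z).
  rewrite -[LHS]/(X (fun z => mu z * sem x z) z) (der_mul dX (base_smooth 6)
    (sem_smooth oU base_smooth frame3_der x) Uz) in H'.
  have := H z Uz; rewrite -[LHS]/(mu z * sem x z) => /eqP; rewrite mulf_eq0 => /orP[/eqP ->|/eqP E].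
    by rewrite mul0r.
  by rewrite E mul0r addr0 in H'.
split => // z Uz; have := @zd 0 _ H z Uz; have := H2 z Uz.
rewrite -[LHS]/(mu z * X (sem x) z) => H1.
rewrite -[LHS]/(X (fun z => mu z * sem x z) z) (der_mul dX (base_smooth 6)
    (sem_smooth oU base_smooth frame3_der x) Uz) H1 add0r mulrC.
by [].
Qed.

(** For W = D [h2] this is D^2 T^2 [Gam]. Since [N2] = D [h2] on the solutions, [dag N2] = 0 is a
    condition in which P c no longer occurs. *)
Let dag W := (DD * eX (eT W) - eT W * eX DD - (F1 + q 5 4 * A - N 3 * S1) * DD * eT W
  + N 4 * (DD * eS W - Mu * W))%DE.

(** The condition [dag N2] = 0 is polynomial along S, with leading parts containing D or mu = S D.
    Its highest useful S-derivative yields mu T^k b = 0 and the next lower one D T^k b = 0, for k =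
    5, 4, 3 in turn. Then [Q], [Gam] and [GG] are used alternately to remove the T-derivatives of P
    c and the remaining ones of b. *)
Lemma chain_D_neq0 z : U z -> False.
Proof.
move=> Uz.
pose tq := eT (eT Q).
have hdag : Z (dag N2).
  apply: (@conseq _ [:: (DD, eX (eT tq)); (- (eX DD + (F1 + q 5 4 * A - N 3 * S1) * DD), eT tq);
    (N 4 * DD, eS tq); (- (N 4 * Mu), tq); (DD * DD, eT (eT Gam))]%DE _ valid0); last by vm_compute.
  by repeat split; repeat apply: zd.
have hS n : Z (iter n eS (dag N2)) by elim: n => //= n IH; exact: zd.
have hme3 : Z (Mu * e3)%DE.
  by apply: (@conseq _ [:: (q 72 875, iter 7 eS (dag N2))]%DE _ valid0); [split; [exact: (hS 7)|]|vm_compute].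
have he3 : Z e3.
  apply: divD; apply: (@conseq _ [:: (q 72 125, iter 6 eS (dag N2));
    (- (q 72 125) * (q 25 4 * A + q 50 3 * S1), Mu * e3)]%DE _ valid0); last by vm_compute.
  by split; [exact: (hS 6)|split].
have valid1 : valid (rl 2 1 [:: 2%N; 2%N; 2%N; 2%N] (N 0) :: rules0) by split.
have hme2 : Z (Mu * e2)%DE.
  by apply: (@conseq _ [:: (q 36 425, iter 5 eS (dag N2))]%DE _ valid1); [split; [exact: (hS 5)|]|vm_compute].
have [hmXe2 hXme2] := mulX hme2.
have he2 : Z e2.
  apply: divD; apply: (@conseq _ [:: (q 18 35, iter 4 eS (dag N2));
    (- (q 18 35) * (q 55 4 * A + q 10 3 * F1 - q 140 9 * S1), Mu * e2);
    (- (q 18 35 * q 10 3), eX Mu * e2); (q 18 35 * q 20 3, Mu * eX e2)]%DE _ valid1); last by vm_compute.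
  by split; [exact: (hS 4)|split].
have valid2 : valid (rl 2 1 [:: 2%N; 2%N; 2%N] (N 0) :: rules0) by split.
have hme1 : Z (Mu * e1)%DE.
  by apply: (@conseq _ [:: (q 3 4, iter 3 eS (dag N2))]%DE _ valid2); [split; [exact: (hS 3)|]|vm_compute].
have [hmXe1 hXme1] := mulX hme1.
have he1 : Z e1.
  apply: divD; apply: (@conseq _ [:: (- q 3 4, iter 2 eS (dag N2));
    (q 3 4 * (q 44 3 * A + q 16 3 * F1 - N 48 * S1), Mu * e1);
    (q 3 4 * q 16 3, eX Mu * e1); (- (q 3 4 * q 46 3), Mu * eX e1)]%DE _ valid2); last by vm_compute.
  by split; [exact: (hS 2)|split].
have valid3 : valid (rl 2 1 [:: 2%N; 2%N] (N 0) :: rules0) by split.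
(* Once T^3 b = 0, the equation T^3 Q = 0 is D T^3 (P c) = 0. *)
have hh3 : Z h3.
  by apply: divD; apply: (@conseq _ [:: (- N 1, eT (eT (eT Q)))]%DE _ valid3); [split; [do 3! apply: zd|]|vm_compute].
have valid4 : valid (rl 2 9 [:: 2%N; 2%N] (N 0) :: rl 2 1 [:: 2%N; 2%N] (N 0) :: rules0) by split.
have hSh2 : Z (eS h2).
  by apply: (@conseq _ [:: (q 1 4, eT (eT Gam))]%DE _ valid4); [split; [do 2! apply: zd|]|vm_compute].
(* [Gam] and T [Gam], solved for the S-derivatives of P c and of T (P c); T Q, solved for that of g.
   With these as rules [GG] is a polynomial along S. *)
pose sh1 := (((F1 + q 7 8 * A - N 2 * S1) * h2 - eX h2) / 3)%DE.
have hSh1 : Z (eS h1 - sh1)%DE.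
  by apply: (@conseq _ [:: (q 1 3, eT Gam)]%DE _ valid4); [split; [apply: zd|]|vm_compute].
pose spi := (((F1 + A / 2 - S1) * h1 - eX h1) / 2)%DE.
have hSpi : Z (eS Pi - spi)%DE.
  by apply: (@conseq _ [:: (q 1 2, Gam)]%DE _ valid4); [split|vm_compute].
pose sg := (q 5 16 * (N 8 * eX r - N 2 * A * r + q 16 3 * S1 * r - C / 4 - DD * h1))%DE.
have hSg : Z (eS G - sg)%DE.
  by apply: (@conseq _ [:: (- q 5 16, eT Q)]%DE _ valid4); [split; [apply: zd|]|vm_compute].
have sub0 l l' : Z (l - l')%DE -> eq_on U (sem l) (sem l') by move=> H y Uy; apply/subr0_eq; exact: H.
have valid5 : valid ([:: rl 1 9 [:: 2%N; 2%N] (N 0); rl 1 9 [:: 2%N] sh1; rl 1 9 [::] spi; rl 1 8 [::] sg;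
  rl 2 9 [:: 2%N; 2%N] (N 0); rl 2 1 [:: 2%N; 2%N] (N 0)]%DE ++ rules0).
  by split; [exact: hSh2|split; [exact: (sub0 _ _ hSh1)|split; [exact: (sub0 _ _ hSpi)|split; [exact: (sub0 _ _ hSg)|]]]].
(* The sixth S-derivative of [GG] is a constant multiple of [h2]; the factor inverts this
   constant. *)
have hh2 : Z h2.
  apply: (@conseq _ [:: (- q 9216 175, eS (eS (eS (eS (eS (eS GG))))))]%DE _ valid5); last by vm_compute.
  by split; [do 6! apply: zd|].
have he : Z e.
  apply: (@conseq _ [:: (- q 3 5, eS tq); (- (q 3 5 * Mu), h2); (- (q 3 5 * DD), eS h2)]%DE _ valid4); last by vm_compute.
  by split; [do 3! apply: zd|split; [|split]].
have valid6 : valid ([:: rl 2 9 [:: 2%N] (N 0); rl 1 9 [:: 2%N] (N 0); rl 1 9 [::] spi; rl 1 8 [::] sg;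
  rl 2 1 [:: 2%N] (N 0)]%DE ++ rules0).
  split; first exact: hh2.
  split.
    move=> y Uy; apply: (@conseq _ [:: (N 1, eS h1 - sh1); (q 1 3 * (F1 + q 7 8 * A - N 2 * S1), h2); (- q 1 3, eX h2)]%DE (eS h1) valid0) Uy; last by vm_compute.
    by split; [|split; [|split; [apply: zd|]]].
  by split; [exact: (sub0 _ _ hSpi)|split; [exact: (sub0 _ _ hSg)|split]].
have hh1 : Z h1.
  by apply: (@conseq _ [:: (q 384 5, eS (eS (eS (eS GG))))]%DE _ valid6); [split; [do 4! apply: zd|]|vm_compute].
have hr : Z r.
  apply: (@conseq _ [:: (- N 3, eS (eS (eS Q))); (q 9 8 * Mu, h1)]%DE _ valid6); last by vm_compute.
  by split; [do 3! apply: zd|split].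
by have /eqP := hr z Uz; apply/negP; exact: Tb.
Qed.
End FrameChain.

(** * The case d_b n4 <> 0, and uniqueness of the frame *)

Section RankTwoCase.
Variables (R : realType).
Notation R3 := (R * R * R)%type.

Section Facts.
Variables (e : R) (U : set R3) (xa xb xc pa pb pc ya yb yc n4 n5 n6 v w : R3 -> R).
Hypothesis oU : open U.
Hypotheses (sv : smooth U v) (sw : smooth U w) (v0 : forall z, U z -> v z != 0).
Hypothesis S1 : frame_structure e U xa xb xc pa pb pc ya yb yc n4 n5 n6.
Hypothesis S2 : frame_structure e U xa xb xc pa (fun z => pb z + v z) pc
  (fun z => ya z + w z) yb yc n4 n5 n6.
Hypothesis n4b0 : forall z, U z -> partial 1 n4 z != 0.

(** By [diff_w] this is v / w, so w T and w S are the two difference fields v d_b and w d_a. *)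
Let rA z := (8 * partial 1 n4 z)^-1.
Let X := vfield xa xb xc.
Let S := @partial R 0.
Let T g z := rA z * partial 1 g z.
Let s1 := partial 0 xa.
Let D z := partial 2 xa z - 8 * partial 2 n4 z.
Let f1 := partial 2 xc.
Let g z := n5 z + 15 / 8 * z.1.2.

Let bs0 := [:: xa; xb; xc; pa; pb; pc; ya; yb; yc; n4; n5; n6; v; w; rA].

Let A_smooth : smooth U (fun z => 8 * partial 1 n4 z).
Proof.
apply: (smooth_mul oU); first exact: (smooth_cst oU).
by apply: (der_smooth (partial_der oU 1)); exact: (fs_smooth S1 (isT : (9 < 12)%N)).
Qed.
Let A0 z : U z -> 8 * partial 1 n4 z != 0.
Proof. by move=> Uz; rewrite mulf_neq0 ?pnatr_eq0 // n4b0. Qed.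

Let rA_smooth : smooth U rA.
Proof. by apply: sclass_smooth => //; apply: Sinv; [exact: Sbase|exact: A0]. Qed.

Let bs_smooth h i : smooth U h -> (i < size (rcons bs0 h))%N -> smooth U (nth (fun=> 0) (rcons bs0 h) i).
Proof.
move=> sh hi; case: (ltnP i 12) => hl.
  by have := fs_smooth S1 hl; case: i hl {hi} => [|[|[|[|[|[|[|[|[|[|[|[|]]]]]]]]]]]].
by case: i hi hl => [|[|[|[|[|[|[|[|[|[|[|[|[|[|[|[|]]]]]]]]]]]]]]]] //=.
Qed.

(** The last slot carries an arbitrary test function for the bracket rules of S, T and X; in the
    other identities it is 0. *)
Let base h := nth (fun=> 0) (coordinates R ++ rcons bs0 h).

Let A := EB 0. Let B := EB 1. Let C := EB 2.
Let XA := EB 3. Let XB := EB 4. Let XC := EB 5. Let PA := EB 6. Let PB := EB 7. Let PC := EB 8.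
Let YA := EB 9. Let YB := EB 10. Let YC := EB 11. Let N4 := EB 12. Let N5 := EB 13.
Let V := EB 15. Let W := EB 16. Let RA := EB 17. Let H := EB 18.
Let N n := EN n.
Let q (a b : nat) := EMul (EN a) (EI b).
Local Notation "a / n" := (EMul a (EI n)) : dexpr_scope.
Local Notation da := (ED 0). Local Notation db := (ED 3). Local Notation dc := (ED 2).
Let eX e := (XA * da e + XB * db e + XC * dc e)%DE.
Let eP e := (PA * da e + PB * db e + PC * dc e)%DE.
Let eY e := (YA * da e + YB * db e + YC * dc e)%DE.
Let eT e := (RA * db e)%DE.
Local Notation sem h := (sem (base h) (@partial R)).

Let notab (k : nat) (x : dvar) : option dpoly := if k is 0 then None else None.
Let conseq h s t z : smooth U h -> U z -> holds (base h) (@partial R) s z ->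
  nilp (norm alias_coord (fun _ _ => [::]) (tab_coord notab) 30 (EAdd t (EOpp (combination s)))) ->
  sem h t z = 0.
Proof.
move=> sh Uz hs E; rewrite -[RHS](combination0 hs); move: z Uz {hs}; apply: (coordinate_eq oU _ _ E).
  by move=> i; exact: bs_smooth.
by move=> [|k].
Qed.

Let sm h t : smooth U h -> smooth U (sem h t).
Proof.
move=> sh; apply: (sem_smooth oU _ (partial_der oU)) => b.
by apply: coordinates_smooth => // i; exact: bs_smooth.
Qed.
Let s0 : smooth U (fun=> 0 : R).
Proof. exact: (smooth_cst oU). Qed.
Let dz k h l r : smooth U h -> eq_on U (sem h l) (sem h r) -> eq_on U (sem h (ED k l)) (sem h (ED k r)).
Proof. by move=> sh E; exact: (der_eq (partial_der oU k) (sm l sh) E). Qed.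

Let EA := (N 8 * db N4)%DE.
Let div0 k l : (forall z, U z -> k z != 0) -> (forall z, U z -> k z * l z = 0) -> forall z, U z -> l z = 0 :> R.
Proof. by move=> k0 E z Uz; have /eqP := E z Uz; rewrite mulf_eq0 (negbTE (k0 _ Uz)) => /eqP. Qed.

Let hA z : U z -> 8 * partial 1 n4 z * rA z = 1.
Proof. by move=> Uz; rewrite mulfV // A0. Qed.

Local Notation eqn h l r := (eq_on U (sem h l) (sem h r)).

Let E0 h (sh : smooth U h) : eqn h (EA * RA)%DE (N 1).
Proof. by move=> z Uz; rewrite -[RHS](hA Uz). Qed.
Let xab h (sh : smooth U h) : eqn h (db XA) EA.
Proof.
move=> z Uz; apply/(mulfI (v0 Uz)); rewrite -[LHS]/(v z * partial 1 xa z) (diff_xa_b oU sv sw S1 S2 Uz).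
by rewrite (diff_w oU sv sw S1 S2 Uz) -mulrA mulrCA.
Qed.
Let xba h (sh : smooth U h) : eqn h (EA * da XB)%DE (- N4)%DE.
Proof.
move=> z Uz; apply/(mulfI (v0 Uz)); have := diff_xb_a oU sv sw S1 S2 Uz.
rewrite (diff_w oU sv sw S1 S2 Uz) -[sem h _ z]/(8 * partial 1 n4 z * partial 0 xb z) -[in RHS]/(- n4 z).
by rewrite mulrN [v z * n4 z]mulrC => <-; ring.
Qed.
Let w0 z : U z -> w z != 0.
Proof. by move=> Uz; rewrite (diff_w oU sv sw S1 S2 Uz) !mulf_neq0 ?pnatr_eq0 ?v0 ?n4b0. Qed.
Let xca h (sh : smooth U h) : eqn h (da XC) (N 0).
Proof. by apply: div0 w0 _ => z; exact: (diff_xc_a oU sv sw S1 S2). Qed.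
Let xcb h (sh : smooth U h) : eqn h (db XC) (N 0).
Proof. exact: (diff_xc_b oU sv sw v0 S1 S2). Qed.
Let n5b h (sh : smooth U h) : eqn h (db N5) (- q 15 8)%DE.
Proof. exact: (diff_n5_b oU sv sw v0 S1 S2). Qed.
Let wE h (sh : smooth U h) : eqn h W (EA * V)%DE.
Proof. by move=> z Uz; rewrite -[LHS]/(w z) (diff_w oU sv sw S1 S2 Uz) -mulrA mulrCA [RHS]mulrC. Qed.
Let ycb h (sh : smooth U h) : eqn h (db YC) (EA * da PC)%DE.
Proof.
move=> z Uz; apply/(mulfI (v0 Uz)); have /eqP := diff_yc_b oU sv sw S1 S2 Uz.
rewrite subr_eq0 => /eqP E; rewrite -[LHS]/(v z * partial 1 yc z) E (diff_w oU sv sw S1 S2 Uz).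
by rewrite -[sem h _ z]/(8 * partial 1 n4 z * partial 0 pc z); ring.
Qed.
Let Xw h (sh : smooth U h) : eqn h (eX W) (W * (da XA - A / 4))%DE.
Proof. exact: (diff_Xw oU sv sw S1 S2). Qed.
Let Xv h (sh : smooth U h) : eqn h (eX V) (V * (db XB + A / 8))%DE.
Proof. exact: (diff_Xv oU sv sw S1 S2). Qed.
Let xaa h (sh : smooth U h) : eqn h (da XA) (N 6 * da N4 - q 3 8 * A)%DE.
Proof.
move=> z Uz; apply/subr0_eq; move: z Uz.
change (forall z, U z -> sem h (da XA - (N 6 * da N4 - q 3 8 * A))%DE z = 0).
apply: div0 w0 _ => z Uz.
have E : sem h (eX W / 8 + q 5 64 * A * W)%DE z = sem h (q 3 4 * W * da N4)%DE z by exact: (diff_n4_a oU sv sw S1 S2).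
apply: (@conseq h [:: (- N 1, eX W, W * (da XA - A / 4)); (N 8, eX W / 8 + q 5 64 * A * W, q 3 4 * W * da N4)]%DE
  (W * (da XA - (N 6 * da N4 - q 3 8 * A)))%DE z) => //.
by split; [exact: Xw|split].
Qed.
(** X v and X w are both known, and 8 d_b n4 is the quotient w / v. *)
Let E2 h (sh : smooth U h) : eqn h (eX EA) (EA * (da XA - db XB - q 3 8 * A))%DE.
Proof.
move=> z Uz; apply/subr0_eq; move: z Uz.
change (forall z, U z -> sem h (eX EA - EA * (da XA - db XB - q 3 8 * A))%DE z = 0).
apply: div0 v0 _ => z Uz.
apply: (@conseq h [:: (N 1, eX W, W * (da XA - A / 4)); (- EA, eX V, V * (db XB + A / 8));
  (- XA, da W, da (EA * V)); (- XB, db W, db (EA * V)); (- XC, dc W, dc (EA * V));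
  (da XA - A / 4, W, EA * V)]%DE (V * (eX EA - EA * (da XA - db XB - q 3 8 * A)))%DE z) => //.
by split; [exact: Xw|split; [exact: Xv|split; [exact: (dz 0 sh (wE sh) Uz)|split; [exact: (dz 3 sh (wE sh) Uz)|split; [exact: (dz 2 sh (wE sh) Uz)|split; first exact: wE]]]]].
Qed.
(** The two expressions for the mixed derivative d_a d_b (X a) are [EA] differentiated along a and
    3/4 of it, since 6 d_b n4 is 3/4 [EA]. *)
Let Aa h (sh : smooth U h) : eqn h (da EA) (N 0).
Proof.
move=> z Uz; apply: (@conseq h [:: (- N 4, da (db XA), da EA); (N 4, db (da XA), db (N 6 * da N4 - q 3 8 * A))]%DE) => //.
by split; [exact: (dz 0 sh (xab sh) Uz)|split; [exact: (dz 3 sh (xaa sh) Uz)|]].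
Qed.
(** The derivative of [E2] along a, where [EA] is constant along a, together with that of [xba]
    along b; the common factor [EA] cancels. *)
Let xaaa h (sh : smooth U h) : eqn h (da (da XA)) (q 1 4).
Proof.
move=> z Uz; apply/subr0_eq; move: z Uz.
change (forall z, U z -> sem h (da (da XA) - q 1 4)%DE z = 0).
apply: div0 A0 _ => z Uz.
apply: (@conseq h [:: (- N 1, da (eX EA), da (EA * (da XA - db XB - q 3 8 * A))); (N 1, db (EA * da XB), db (- N4));
  (da XA - (da XA - db XB - q 3 8 * A), da EA, N 0); (XA, da (da EA), da (N 0)); (XB, db (da EA), db (N 0));
  (XC, dc (da EA), dc (N 0)); (dc EA, da XC, N 0)]%DE (EA * (da (da XA) - q 1 4))%DE z) => //.
by split; [exact: (dz 0 sh (E2 sh) Uz)|split; [exact: (dz 3 sh (xba sh) Uz)|split; [exact: Aa|split; [exact: (dz 0 sh (Aa sh) Uz)|split; [exact: (dz 3 sh (Aa sh) Uz)|split; [exact: (dz 2 sh (Aa sh) Uz)|split; first exact: xca]]]]]].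
Qed.

Let chain_SX h (sh : smooth U h) : eq_on U (S (X h)) (fun z => X (S h) z + (s1 z * S h z - n4 z * T h z)).
Proof.
move=> z Uz; apply/subr0_eq.
apply: (@conseq h [:: (RA * db H, EA * da XB, - N4); (- (da XB * db H), EA * RA, N 1); (dc H, da XC, N 0)]%DE
  (da (eX H) - (eX (da H) + (da XA * da H - N4 * eT H)))%DE z) => //.
by split; [exact: xba|split; [exact: E0|split; first exact: xca]].
Qed.

Let chain_TX h (sh : smooth U h) : eq_on U (T (X h)) (fun z => X (T h) z + (S h z - (3 / 8 * z.1.1 - s1 z) * T h z)).
Proof.
move=> z Uz; apply/subr0_eq.
apply: (@conseq h [:: (da H * RA, db XA, EA); (da H + db H * eX RA + db H * RA * (da XA - db XB - q 3 8 * A), EA * RA, N 1);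
  (RA * dc H, db XC, N 0); (- (db H * RA * XA), da (EA * RA), da (N 1)); (- (db H * RA * XB), db (EA * RA), db (N 1));
  (- (db H * RA * XC), dc (EA * RA), dc (N 1));
  (db H * RA * RA, eX EA, EA * (da XA - db XB - q 3 8 * A))]%DE
  (eT (eX H) - (eX (eT H) + (da H - (q 3 8 * A - da XA) * eT H)))%DE z) => //.
by split; [exact: xab|split; [exact: E0|split; [exact: xcb|split; [exact: (dz 0 sh (E0 sh) Uz)|split; [exact: (dz 3 sh (E0 sh) Uz)|split; [exact: (dz 2 sh (E0 sh) Uz)|split; first exact: E2]]]]]].
Qed.

Let chain_TS h (sh : smooth U h) : eq_on U (T (S h)) (S (T h)).
Proof.
move=> z Uz; apply/subr0_eq.
apply: (@conseq h [:: (- (db H * RA), da (EA * RA), da (N 1)); (db H * da RA, EA * RA, N 1); (db H * RA * RA, da EA, N 0)]%DE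
  (eT (da H) - da (eT H))%DE z) => //.
by split; [exact: (dz 0 sh (E0 sh) Uz)|split; [exact: E0|split; first exact: Aa]].
Qed.

Let paE := (XC + B + q 24 5 * N5 - A * C / 2)%DE.
Let hpa : eqn (fun=> 0) PA paE.
Proof. exact: (fs_pa S1). Qed.
Let cs i : smooth U (nth (fun=> 0) (coordinates R) i).
Proof.
apply: (nth_smooth oU) => -[|[|[|]]] //= _; [exact: smooth_cx|exact: smooth_cy|exact: smooth_cp].
Qed.

Let M' := (- (da XA / 3) - A / 2)%DE.
Let G := (N5 + q 15 8 * B)%DE.
Let N5' := (G - q 15 8 * B)%DE.
Let F1 := dc XC.
Let DD := (dc XA - N 8 * dc N4)%DE.
Let Q := (N 2 * eX B - q 16 5 * eX N5' - A * B / 8 + N 5 * C * N4 - q 11 5 * A * N5'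
  - (M' + A / 8) * (eX C + B + q 24 5 * N5' - A * C / 2) - DD * PC + eX (eX C) - q 7 8 * C * eX A - A * eX C / 2)%DE.
Let YC' := (F1 * PC - eX PC + q 3 8 * C * eX C + A * PC / 8)%DE.
Let GG := (eX YC' - F1 * YC' + A * YC' / 4 - N4 * PC - G * eX C / 5)%DE.
Let Gam := (eX (eT PC) - (F1 + A / 2 - da XA) * eT PC + N 2 * da PC)%DE.

(** Combining [fs_q2] with [P, X] a cancels Y a, and the equality of d_b (X a) with 8 d_b n4 cancels
    P b. *)
Let hQ : eqn (fun=> 0) Q (N 0).
Proof.
move=> z Uz.
apply: (@conseq _ [:: (N 8, (XB - A * B / 8 - N4 * C - N5 * A / 5 - YA) / 8, eX N5 + A * N5 / 4 - eP N4 - q 3 4 * C * N4);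
  (- N 1, eP (eX A) - eX (eP A), eY A - q 3 8 * C * eX A - A * eP A / 8);
  (- XA, da PA, da paE); (- XB, db PA, db paE); (- XC, dc PA, dc paE); (M' + A / 8, PA, paE);
  (q 4 3 * PA, da XA, N 6 * da N4 - q 3 8 * A); (PB, db XA, EA)]%DE) => //.
by split; [exact: (fs_q2 S1)|split; [exact: (fs_px S1 oU (cs 0) Uz)|split; [exact: (dz 0 s0 hpa Uz)|split;
  [exact: (dz 3 s0 hpa Uz)|split; [exact: (dz 2 s0 hpa Uz)|split; [exact: hpa|split; [exact: xaa|split; first exact: xab]]]]]]].
Qed.

(** X c depends on c alone, so [P, X] c determines Y c from X c and P c. *)
Let hYC : eqn (fun=> 0) YC' YC.
Proof.
move=> z Uz; apply/subr0_eq.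
apply: (@conseq _ [:: (N 1, eP (eX C) - eX (eP C), eY C - q 3 8 * C * eX C - A * eP C / 8);
  (- PA, da XC, N 0); (- PB, db XC, N 0)]%DE (YC' - YC)%DE z) => //.
by split; [exact: (fs_px S1 oU (cs 2) Uz)|split; [exact: xca|split; first exact: xcb]].
Qed.

(** This is [X, Y] c with Y c replaced through [hYC]. *)
Let hGG : eqn (fun=> 0) GG (N 0).
Proof.
move=> z Uz.
apply: (@conseq _ [:: (N 1, eX (eY C) - eY (eX C), N4 * eP C + N5 / 5 * eX C - A * eY C / 4 + q 3 8 * B * eX C);
  (YA, da XC, N 0); (YB, db XC, N 0); (A / 4 - F1, YC', YC); (XA, da YC', da YC); (XB, db YC', db YC); (XC, dc YC', dc YC)]%DE) => //.
by split; [exact: (fs_xy S1 oU (cs 2) Uz)|split; [exact: xca|split; [exact: xcb|split; [exact: hYC|split;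
  [exact: (dz 0 s0 hYC Uz)|split; [exact: (dz 3 s0 hYC Uz)|split; first exact: (dz 2 s0 hYC Uz)]]]]]].
Qed.

Let spc : smooth U pc. Proof. exact: (fs_smooth S1 (isT : (5 < 12)%N)). Qed.

(** The derivative of Y c along b is computed from [hYC] and also from the difference equation
    [ycb]. *)
Let hGam : eqn (fun=> 0) Gam (N 0).
Proof.
move=> z Uz.
apply: (@conseq _ [:: (- RA, db YC', db YC); (- N 1, eT (eX PC), eX (eT PC) + (da PC - (q 3 8 * A - da XA) * eT PC));
  (- RA, db YC, EA * da PC); (- da PC, EA * RA, N 1); (RA * PC, dc (db XC), dc (N 0)); (q 3 8 * C * RA, db XC, N 0)]%DE) => //.
by split; [exact: (dz 3 s0 hYC Uz)|split; [exact: (chain_TX spc Uz)|split; [exact: ycb|split; [exact: E0|split;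
  [exact: (dz 2 s0 (xcb s0) Uz)|split; first exact: xcb]]]]].
Qed.

Let Mu := (- (q 1 3 * dc (da XA)))%DE.
Let mu := sem (fun=> 0) Mu.
Let bs := [:: (fun z => z.1.1); (fun z => z.1.2); (fun z => z.2); s1; n4; D; mu; f1; g; pc] : seq (R3 -> R).

Let chain_smooth i : (i < size bs)%N -> smooth U (nth (fun=> 0) bs i).
Proof.
case: i => [|[|[|[|[|[|[|[|[|[|]]]]]]]]]] //= _.
- exact: (cs 0).
- exact: (cs 1).
- exact: (cs 2).
- exact: (@sm _ (da XA) s0).
- exact: (fs_smooth S1 (isT : (9 < 12)%N)).
- exact: (@sm _ DD s0).
- exact: (@sm _ Mu s0).
- exact: (@sm _ F1 s0).
- exact: (@sm _ G s0).
Qed.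

Let XAs i : (i < 3)%N -> smooth U (nth (fun=> 0) [:: xa; xb; xc] i).
Proof.
case: i => [|[|[|]]] //= _; [exact: (fs_smooth S1 (isT : (0 < 12)%N))|
  exact: (fs_smooth S1 (isT : (1 < 12)%N))|exact: (fs_smooth S1 (isT : (2 < 12)%N))].
Qed.
Let dX : derivation U X.
Proof. exact: (vfield_der oU (XAs (isT : (0 < 3)%N)) (XAs (isT : (1 < 3)%N)) (XAs (isT : (2 < 3)%N))). Qed.
Let dS : derivation U S. Proof. exact: partial_der. Qed.
Let dT : derivation U T.
Proof. exact: (derivation_scale oU rA_smooth (partial_der oU 1)). Qed.

Lemma chain_rules : [/\ [/\ eq_on U (S (fun z => z.1.1)) (fun=> 1), eq_on U (T (fun z => z.1.1)) (fun=> 0),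
     eq_on U (S (fun z => z.1.2)) (fun=> 0), eq_on U (S (fun z => z.2)) (fun=> 0) & eq_on U (T (fun z => z.2)) (fun=> 0)],
  [/\ eq_on U (S s1) (fun=> 1 / 4), eq_on U (T s1) (fun=> 0), eq_on U (S n4) (fun z => (s1 z + 3 / 8 * z.1.1) / 6),
    eq_on U (T n4) (fun=> 1 / 8) & eq_on U (S D) mu],
  [/\ eq_on U (T D) (fun=> 0), eq_on U (S mu) (fun=> 0) & eq_on U (T mu) (fun=> 0)],
  [/\ eq_on U (S f1) (fun=> 0), eq_on U (T f1) (fun=> 0) & eq_on U (T g) (fun=> 0)] &
  forall z, U z -> T (fun z => z.1.2) z != 0].
Proof.
pose cq := @conseq (fun=> 0).
split; [split|split|split|split|].
- by move=> z Uz; apply/subr0_eq; apply: (cq [::] (da A - N 1)%DE z s0 Uz); last by vm_compute.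
- by move=> z Uz; apply: (cq [::] (eT A)%DE z s0 Uz); last by vm_compute.
- by move=> z Uz; apply: (cq [::] (da B)%DE z s0 Uz); last by vm_compute.
- by move=> z Uz; apply: (cq [::] (da C)%DE z s0 Uz); last by vm_compute.
- by move=> z Uz; apply: (cq [::] (eT C)%DE z s0 Uz); last by vm_compute.
- by move=> z Uz; exact: (xaaa s0).
- move=> z Uz; apply: (cq [:: (RA, da (db XA), da EA); (RA, da EA, N 0)]%DE (eT (da XA)) z s0 Uz); last by vm_compute.
  by split; [exact: (dz 0 s0 (xab s0) Uz)|split; first exact: Aa].
- move=> z Uz; apply/subr0_eq; apply: (cq [:: (- q 1 6, da XA, N 6 * da N4 - q 3 8 * A)]%DE (da N4 - (da XA + q 3 8 * A) / 6)%DE z s0 Uz); last by vm_compute.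
  by split; first exact: xaa.
- move=> z Uz; apply/subr0_eq; apply: (cq [:: (q 1 8, EA * RA, N 1)]%DE (eT N4 - q 1 8)%DE z s0 Uz); last by vm_compute.
  by split; first exact: E0.
- move=> z Uz; apply/subr0_eq; apply: (cq [:: (q 4 3, dc (da XA), dc (N 6 * da N4 - q 3 8 * A))]%DE (da DD - Mu)%DE z s0 Uz); last by vm_compute.
  by split; first exact: (dz 2 s0 (xaa s0) Uz).
- move=> z Uz; apply: (cq [:: (RA, dc (db XA), dc EA)]%DE (eT DD) z s0 Uz); last by vm_compute.
  by split; first exact: (dz 2 s0 (xab s0) Uz).
- move=> z Uz; apply: (cq [:: (- q 1 3, dc (da (da XA)), dc (q 1 4))]%DE (da (Mu))%DE z s0 Uz); last by vm_compute.
  by split; first exact: (dz 2 s0 (xaaa s0) Uz).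
- move=> z Uz; apply: (cq [:: (- (q 1 3 * RA), dc (da (db XA)), dc (da EA)); (- (q 1 3 * RA), dc (da EA), dc (N 0))]%DE (eT (Mu))%DE z s0 Uz); last by vm_compute.
  by split; [exact: (dz 2 s0 (dz 0 s0 (xab s0)) Uz)|split; first exact: (dz 2 s0 (Aa s0) Uz)].
- move=> z Uz; apply: (cq [:: (N 1, dc (da XC), dc (N 0))]%DE (da F1) z s0 Uz); last by vm_compute.
  by split; first exact: (dz 2 s0 (xca s0) Uz).
- move=> z Uz; apply: (cq [:: (RA, dc (db XC), dc (N 0))]%DE (eT F1) z s0 Uz); last by vm_compute.
  by split; first exact: (dz 2 s0 (xcb s0) Uz).
- move=> z Uz; apply: (cq [:: (RA, db N5, - q 15 8)]%DE (eT G) z s0 Uz); last by vm_compute.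
  by split; first exact: n5b.
- move=> z Uz; apply/eqP => E; have /eqP : sem (fun=> 0) (N 1) z = 0.
    apply: (cq [:: (N 1, - (EA * RA), - N 1); (EA, eT B, N 0)]%DE (N 1) z s0 Uz); last by vm_compute.
    split; last by split; first exact: E.
    by rewrite -[LHS]/(- sem (fun=> 0) (EA * RA)%DE z) (E0 s0 Uz).
  by rewrite oner_eq0.
Qed.

Lemma rank_two_D0 z : U z -> eq_on U D (fun=> 0) -> False.
Proof.
move=> Uz D0; have [[Sa Ta Sb Sc Tc] [Ss1 Ts1 Sn4 Tn4 SD] [TD Smu Tmu] [Sf1 Tf1 Tg] Tb] := chain_rules.
refine (chain_D0 oU dX dS dT chain_smooth (@chain_SX) (@chain_TX) (@chain_TS) Sa Ta Sb Sc Tc Ss1 Ts1 Sn4 Tn4 SD TD Smu Tmu Sf1 Tf1 Tg hQ Tb Uz D0).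
Qed.

Lemma rank_two_D_neq0 z : U z -> (forall z, U z -> D z != 0) -> False.
Proof.
move=> Uz D0; have [[Sa Ta Sb Sc Tc] [Ss1 Ts1 Sn4 Tn4 SD] [TD Smu Tmu] [Sf1 Tf1 Tg] Tb] := chain_rules.
refine (chain_D_neq0 oU dX dS dT chain_smooth (@chain_SX) (@chain_TX) (@chain_TS) Sa Ta Sb Sc Tc Ss1 Ts1 Sn4 Tn4 SD TD Smu Tmu Sf1 Tf1 Tg hQ hGG hGam Tb D0 Uz).
Qed.
End Facts.

(** A nonzero value of v at a point persists on an open set. Each further alternative, for d_b n4
    and then for D, is either identical vanishing or a point where the function is nonzero; in the
    latter case everything is restricted to the open set where it is nonzero. Once v = 0, [diff_w]
    gives w = 0. *)
Lemma frame_structure_unique (e : R) (U : set R3) (xa xb xc pa pb pb' pc ya ya' yb yc n4 n5 n6 : R3 -> R) :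
  open U ->
  frame_structure e U xa xb xc pa pb pc ya yb yc n4 n5 n6 ->
  frame_structure e U xa xb xc pa pb' pc ya' yb yc n4 n5 n6 ->
  eq_on U pb pb' /\ eq_on U ya ya'.
Proof.
move=> oU S1 S2.
have sub (g h : R3 -> R) : smooth U g -> smooth U h -> smooth U (fun z => h z - g z).
  by move=> sg sh; exact: (smooth_add oU sh (smooth_opp oU sg)).
have sv := sub _ _ (fs_smooth S1 (isT : (4 < 12)%N)) (fs_smooth S2 (isT : (4 < 12)%N)).
have sw := sub _ _ (fs_smooth S1 (isT : (6 < 12)%N)) (fs_smooth S2 (isT : (6 < 12)%N)).
rewrite /= in sv sw; set v := (X in smooth U X) in sv; set w := (X in smooth U X) in sw.
have S2' : frame_structure e U xa xb xc pa (fun z => pb z + v z) pc (fun z => ya z + w z) yb yc n4 n5 n6.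
  have -> : (fun z => pb z + v z) = pb' by apply/funext => z; rewrite addrC subrK.
  by have -> : (fun z => ya z + w z) = ya' by apply/funext => z; rewrite addrC subrK.
have sn4 := fs_smooth S1 (isT : (9 < 12)%N); rewrite /= in sn4.
have sxa := fs_smooth S1 (isT : (0 < 12)%N); rewrite /= in sxa.
have sp k g := der_smooth (partial_der oU k) (g := g).
suff v0 : eq_on U v (fun=> 0).
  split=> z Uz; apply/esym/subr0_eq; first exact: v0.
  by rewrite -[LHS]/(w z) (diff_w oU sv sw S1 S2' Uz) v0 // mulr0 mul0r.
move=> z0 Uz0; apply/eqP/negP => /negP vz0.
have sS (V : set R3) (VU : V `<=` U) := (frame_structure_sub S1 VU, frame_structure_sub S2' VU).
have o1 := open_neq0 oU sv; set U1 := U `&` _ in o1.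
have U1U : U1 `<=` U by move=> ? [].
have [F1 F2] := sS _ U1U; have sv1 := smooth_sub U1U sv; have sw1 := smooth_sub U1U sw.
have [n40|/existsNP[z1 /not_implyP[U1z1 /eqP nz1]]] := pselect (eq_on U1 (partial 1 n4) (fun=> 0)).
  by apply: (rank_one_case o1 (conj Uz0 vz0) sv1 sw1 _ F1 F2 n40) => z [].
have o2 := open_neq0 o1 (smooth_sub U1U (sp 1%N _ sn4)); set U2 := U1 `&` _ in o2.
have U2U1 : U2 `<=` U1 by move=> ? [].
have U2U := subset_trans U2U1 U1U.
have [G1 G2] := sS _ U2U; have sv2 := smooth_sub U2U sv; have sw2 := smooth_sub U2U sw.
have v2 z : U2 z -> v z != 0 by case=> -[].
have b2 z : U2 z -> partial 1 n4 z != 0 by case.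
pose D z := partial 2 xa z - 8 * partial 2 n4 z.
have [D0|/existsNP[z2 /not_implyP[U2z2 /eqP nz2]]] := pselect (eq_on U2 D (fun=> 0)).
  exact: (rank_two_D0 o2 sv2 sw2 v2 G1 G2 b2 (conj U1z1 nz1) D0).
have sD : smooth U D.
  exact: (smooth_add oU (sp 2%N _ sxa) (smooth_opp oU (smooth_mul oU (smooth_cst oU 8) (sp 2%N _ sn4)))).
have o3 := open_neq0 o2 (smooth_sub U2U sD); set U3 := U2 `&` _ in o3.
have U3U2 : U3 `<=` U2 by move=> ? [].
have U3U := subset_trans U3U2 U2U.
have [H1 H2] := sS _ U3U; have sv3 := smooth_sub U3U sv; have sw3 := smooth_sub U3U sw.
have v3 z : U3 z -> v z != 0 by case=> /v2.
have b3 z : U3 z -> partial 1 n4 z != 0 by case=> /b2.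
have D3 z : U3 z -> D z != 0 by case.
exact: (rank_two_D_neq0 o3 sv3 sw3 v3 H1 H2 b3 (conj U2z2 nz2) D3).
Qed.
End RankTwoCase.

Lemma cancel_eighth (R : realFieldType) (x y u v : R) : u - x / 8 = v - y / 8 -> u = v -> x = y.
Proof.
move=> + uv; rewrite uv => /addrI/oppr_inj/mulIf; apply.
by rewrite invr_eq0 pnatr_eq0.
Qed.

Lemma two_equations (R : realFieldType) (x1 x2 x3 x4 : R) : x4 + 24 / 5 * x2 = x3 + 24 / 5 * x1 ->
  x2 - x4 / 8 = x1 - x3 / 8 -> x1 = x2 /\ x3 = x4.
Proof. by move=> ? ?; split; lra. Qed.

(** * Structure equations of a normalized frame and their transport *)

Section GaugeFacts.
Variables (R : realType).
Notation R3 := (R * R * R)%type.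

(** Only the logarithmic derivatives of the scale factors are recorded, with no relation of [iota]
    and [eta] to I and H. This admits the trivial gauge of an equation and its pull-back under a
    point map. *)
Record gauge (U : set R3) (f iota eta g1 g2 : R3 -> R) : Prop := Gauge {
  gauge_f : smooth U f; gauge_i : smooth U iota; gauge_e : smooth U eta;
  gauge_g1 : smooth U g1; gauge_g2 : smooth U g2;
  gauge_d1 : forall k, eq_on U (frame f k g1) (fun z => g1 z * ((frame f k iota z - 3 * frame f k eta z) / 8));
  gauge_d2 : forall k, eq_on U (frame f k g2) (fun z => g2 z * ((frame f k eta z - 3 * frame f k iota z) / 8));
  gauge_n1 : forall z, U z -> g1 z != 0;
  gauge_n2 : forall z, U z -> g2 z != 0 }.

Lemma gauge_sub (U V : set R3) f iota eta g1 g2 : V `<=` U -> gauge U f iota eta g1 g2 -> gauge V f iota eta g1 g2.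
Proof.
move=> VU [? ? ? ? ? h1 h2 h3 h4]; split; do ?[exact: smooth_sub VU _].
- by move=> k z /VU; exact: h1.
- by move=> k z /VU; exact: h2.
- by move=> z /VU; exact: h3.
- by move=> z /VU; exact: h4.
Qed.

Section Brackets.
Variables (U : set R3) (f iota eta g1 g2 : R3 -> R).
Hypothesis oU : open U.
Hypothesis G : gauge U f iota eta g1 g2.

Let DM1 k : eq_on U (frame f k (fun=> 1)) (fun z => 1 *
  (0 * ((frame f k iota z - 3 * frame f k eta z) / 8)
   - 0 * ((frame f k eta z + frame f k iota z) / 4))).
Proof.
by move=> z Uz; rewrite (der_cst (frame_der oU (gauge_f G) k) _ Uz) !mul0r subr0 mulr0.
Qed.
Let s1 : smooth U (fun=> 1 : R). Proof. exact: smooth_cst. Qed.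

Lemma nP_der : derivation U (nP g2).
Proof. exact: (derivation_scale oU (gauge_g2 G) (derivation_Dp oU)). Qed.
Lemma nX_der : derivation U (nX f g1).
Proof. exact: (derivation_scale oU (gauge_g1 G) (derivation_Dt oU (gauge_f G))). Qed.

Let dk k g (sg : smooth U g) : smooth U (frame f k g) := der_smooth (frame_der oU (gauge_f G) k) sg.

Lemma nY_der : derivation U (nY f iota g1 g2).
Proof.
have [sf si se sg1 sg2 _ _ _ _] := G.
apply: (derivation_scale oU); first exact: smooth_mul.
apply: (derivation_add oU).
  apply: (derivation_add oU); first exact: derivation_Db.
  apply: (derivation_scale oU _ (derivation_Dt oU sf)).
  exact: (smooth_mul oU (dk 2 si) (smooth_cst oU _)).
apply: (derivation_scale oU _ (derivation_Dp oU)).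
exact: (smooth_add oU (dk 2 sf) (dk 0 si)).
Qed.

Lemma gauge_px g : smooth U g -> eq_on U (fun z => nP g2 (nX f g1 g) z - nX f g1 (nP g2 g) z)
  (fun z => nY f iota g1 g2 g z - 3 / 8 * cP iota eta g2 z * nX f g1 g z - cX f iota eta g1 z * nP g2 g z / 8).
Proof. by have [? ? ? ? ? ? ? _ _] := G; move=> sg; apply: (bracket_px oU _ _ _ _ _ _ _ sg s1 DM1). Qed.

Lemma gauge_py g : smooth U g -> eq_on U (fun z => nP g2 (nY f iota g1 g2 g) z - nY f iota g1 g2 (nP g2 g) z)
  (fun z => n5 f iota g1 g2 z * nP g2 g z + n6 iota g2 z / 5 * nX f g1 g z
     - cP iota eta g2 z * nY f iota g1 g2 g z / 4 - cY f iota eta g1 g2 z * nP g2 g z / 8).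
Proof. by have [? ? ? ? ? ? ? _ _] := G; move=> sg; apply: (bracket_py oU _ _ _ _ _ _ _ sg s1 DM1). Qed.

Lemma gauge_xy g : smooth U g -> eq_on U (fun z => nX f g1 (nY f iota g1 g2 g) z - nY f iota g1 g2 (nX f g1 g) z)
  (fun z => n4 f iota g1 z * nP g2 g z + n5 f iota g1 g2 z / 5 * nX f g1 g z
     - cX f iota eta g1 z * nY f iota g1 g2 g z / 4 + 3 / 8 * cY f iota eta g1 g2 z * nX f g1 g z).
Proof. by have [? ? ? ? ? ? ? _ _] := G; move=> sg; apply: (bracket_xy oU _ _ _ _ _ _ _ sg s1 DM1). Qed.

Lemma gauge_pa : eq_on U (nP g2 (cX f iota eta g1))
  (fun z => nX f g1 (cP iota eta g2) z + cY f iota eta g1 g2 z + 24 / 5 * n5 f iota g1 g2 z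
     - cX f iota eta g1 z * cP iota eta g2 z / 2).
Proof. by have [? ? ? ? ? ? ? _ _] := G; apply: (nP_cX oU _ _ _ _ _ _ _ s1 s1 DM1). Qed.

Lemma gauge_q1 : eq_on U (fun z => 15 * q1 f iota eta g1 g2 z)
  (fun z => nX f g1 (n6 iota g2) z - cX f iota eta g1 z * n6 iota g2 z / 4 - nP g2 (n5 f iota g1 g2) z
     - cP iota eta g2 z * n5 f iota g1 g2 z / 4).
Proof. by have [? ? ? ? ? ? ? _ _] := G; apply: (q1E oU _ _ _ _ _ _ _ s1 s1 DM1). Qed.

Lemma gauge_q2 : eq_on U (q2 f iota eta g1 g2)
  (fun z => nX f g1 (n5 f iota g1 g2) z + cX f iota eta g1 z * n5 f iota g1 g2 z / 4
     - nP g2 (n4 f iota g1) z - 3 / 4 * cP iota eta g2 z * n4 f iota g1 z).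
Proof. by have [? ? ? ? ? ? ? _ _] := G; apply: (q2E oU _ _ _ _ _ _ _ s1 s1 DM1). Qed.

Lemma gauge_cp : eq_on U (fun z => nP g2 (q1 f iota eta g1 g2) z + cP iota eta g2 z * q1 f iota eta g1 g2 z / 8)
  (fun z => - (3 / 20) * (nY f iota g1 g2 (n6 iota g2) z - cY f iota eta g1 g2 z * n6 iota g2 z / 4)
    - 9 / 50 * n5 f iota g1 g2 z * n6 iota g2 z - g1 z * g2 z * g2 z * g2 z * Dp (Dp (Dp (Dp f))) z / 8).
Proof. by have [? ? ? ? ? ? ? _ _] := G; apply: (cotton_p oU _ _ _ _ _ _ _ s1 s1 DM1). Qed.

Lemma gauge_cx : eq_on U (fun z => nX f g1 (q2 f iota eta g1 g2) z + 5 / 8 * cX f iota eta g1 z * q2 f iota eta g1 g2 z)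
  (fun z => - (3 / 4) * (nY f iota g1 g2 (n4 f iota g1) z + 3 / 4 * cY f iota eta g1 g2 z * n4 f iota g1 z)
    - 9 / 10 * n5 f iota g1 g2 z * n4 f iota g1 z - g1 z * g1 z * g1 z * g2 z * rel_H f z / 8).
Proof. by have [? ? ? ? ? ? ? _ _] := G; apply: (cotton_x oU _ _ _ _ _ _ _ s1 s1 DM1). Qed.

Let si := gauge_i G. Let se := gauge_e G. Let sf := gauge_f G. Let sg1 := gauge_g1 G. Let sg2 := gauge_g2 G.
Let nu (c : R) : smooth U (fun=> c) := smooth_cst oU c.
Local Notation "a <+> b" := (smooth_add oU a b) (at level 50, left associativity).
Local Notation "a <~> b" := (smooth_add oU a (smooth_opp oU b)) (at level 50, left associativity).
Local Notation "a <*> b" := (smooth_mul oU a b) (at level 40, left associativity).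
Let Pi : smooth U (Dp iota) := dk 2 si. Let Di : smooth U (Dt f iota) := dk 0 si.
Let yi : smooth U (Dy iota) := dk 3 si. Let Yi : smooth U (Db f iota) := dk 1 si.
Let Pe : smooth U (Dp eta) := dk 2 se. Let De : smooth U (Dt f eta) := dk 0 se. Let ye : smooth U (Dy eta) := dk 3 se.
Let Pf : smooth U (Dp f) := dk 2 sf. Let PPf : smooth U (Dp (Dp f)) := dk 2 Pf.
Let DPf : smooth U (Dt f (Dp f)) := dk 0 Pf. Let Yf : smooth U (Db f f) := dk 1 sf.
Let PPi : smooth U (Dp (Dp iota)) := dk 2 Pi. Let DPi : smooth U (Dt f (Dp iota)) := dk 0 Pi.
Let DDi : smooth U (Dt f (Dt f iota)) := dk 0 Di.

Lemma cP_smooth : smooth U (cP iota eta g2).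
Proof. exact: (sg2 <*> (Pe <+> Pi <*> nu _)). Qed.
Lemma cX_smooth : smooth U (cX f iota eta g1).
Proof. exact: (sg1 <*> (De <+> nu 8 <*> Pf <+> nu 5 <*> Di)). Qed.
Lemma cY_smooth : smooth U (cY f iota eta g1 g2).
Proof.
exact: (sg1 <*> sg2 <*> (ye <+> Pi <*> nu _ <*> (De <+> nu 8 <*> Pf <+> nu 5 <*> Di)
  <+> (nu 2 <*> Pf <+> Di) <*> (Pe <+> Pi <*> nu _)
  <~> (yi <+> PPf <+> nu (6 / 5) <*> (Pi <*> (Di <+> nu 2 <*> Pf))))).
Qed.
Lemma n6_smooth : smooth U (n6 iota g2).
Proof. exact: (sg2 <*> sg2 <*> (PPi <~> Pi <*> Pi <*> nu _)). Qed.
Lemma n5_smooth : smooth U (n5 f iota g1 g2).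
Proof.
exact: (sg1 <*> sg2 <*> (DPi <+> nu (5 / 4) <*> Yi <+> (Pf <*> Pi <+> Pi <*> Di) <*> nu _ <+> nu (15 / 8) <*> PPf)).
Qed.
Lemma n4_smooth : smooth U (n4 f iota g1).
Proof.
exact: (sg1 <*> sg1 <*> (DDi <+> Di <*> Di <+> nu 3 <*> Pf <*> Di <+> nu 2 <*> DPf <+> nu 3 <*> Pf <*> Pf <~> Yf)).
Qed.
Let sP := cP_smooth. Let sX := cX_smooth. Let sY := cY_smooth.
Lemma q1_smooth : smooth U (q1 f iota eta g1 g2).
Proof.
exact: ((der_smooth nP_der sY <~> (der_smooth nY_der sP <~> nu (3 / 8) <*> sY <*> sP <+> n6_smooth <*> sX <*> nu _
  <+> n5_smooth <*> sP)) <*> nu _).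
Qed.
Lemma q2_smooth : smooth U (q2 f iota eta g1 g2).
Proof.
exact: ((der_smooth nX_der sY <~> sX <*> sY <*> nu _ <~> n4_smooth <*> sP <~> n5_smooth <*> sX <*> nu _
  <~> der_smooth nY_der sX) <*> nu _).
Qed.
End Brackets.

Section Transport.
Variables (U1 U2 : set R3) (f1 i1 e1 g11 g12 f2 i2 e2 g21 g22 : R3 -> R) (E : R3 -> R3).
Hypotheses (o1 : open U1) (o2 : open U2).
Hypotheses (G1 : gauge U1 f1 i1 e1 g11 g12) (G2 : gauge U2 f2 i2 e2 g21 g22).
Hypothesis E_U : forall z, U1 z -> U2 (E z).
Hypothesis E_smooth : forall g : R3 -> R, smooth U2 g -> smooth U1 (g \o E).
Hypothesis E_P : forall g, smooth U2 g -> eq_on U1 (nP g12 (g \o E)) (nP g22 g \o E).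
Hypothesis E_X : forall g, smooth U2 g -> eq_on U1 (nX f1 g11 (g \o E)) (nX f2 g21 g \o E).
Hypothesis E_a : eq_on U1 (cX f1 i1 e1 g11) (cX f2 i2 e2 g21 \o E).
Hypothesis E_c : eq_on U1 (cP i1 e1 g12) (cP i2 e2 g22 \o E).
Hypothesis E_n6 : eq_on U1 (n6 i1 g12) (n6 i2 g22 \o E).

Let comp d1 d2 d1' d2' g : derivation U1 d1 -> derivation U2 d2' ->
  (forall g, smooth U2 g -> eq_on U1 (d1 (g \o E)) (d2 g \o E)) ->
  (forall g, smooth U2 g -> eq_on U1 (d1' (g \o E)) (d2' g \o E)) ->
  smooth U2 g -> eq_on U1 (d1 (d1' (g \o E))) (d2 (d2' g) \o E).
Proof.
move=> D1 D2' H H' sg z Uz; rewrite -(H _ (der_smooth D2' sg)) //.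
apply: (der_eq D1 _ _ Uz); last exact: H'.
by apply: (smooth_eq o1 _ (E_smooth (der_smooth D2' sg))) => y Uy; rewrite H'.
Qed.

(** Y is the bracket [P, X] corrected by multiples of P and X with coefficients c and a, all of
    which are matched. *)
Lemma transport_Y g : smooth U2 g -> eq_on U1 (nY f1 i1 g11 g12 (g \o E)) (nY f2 i2 g21 g22 g \o E).
Proof.
move=> sg z Uz.
have h1 := gauge_px o1 G1 (E_smooth sg) Uz; have h2 := gauge_px o2 G2 sg (E_U Uz).
have k1 := comp (nP_der o1 G1) (nX_der o2 G2) E_P E_X sg Uz.
have k2 := comp (nX_der o1 G1) (nP_der o2 G2) E_X E_P sg Uz.
have k3 := E_P sg Uz; have k4 := E_X sg Uz; have k5 := E_a Uz; have k6 := E_c Uz.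
rewrite /= in h1 h2 k1 k2 k3 k4 k5 k6.
rewrite k1 k2 k3 k4 k5 k6 h2 in h1.
by move: h1 => /addIr/addIr/esym.
Qed.

Let nY1 := nY_der o1 G1. Let nY2 := nY_der o2 G2.
Let nP1 := nP_der o1 G1. Let nP2 := nP_der o2 G2.
Let nX1 := nX_der o1 G1. Let nX2 := nX_der o2 G2.
Let cp : smooth U2 (fun z : R3 => z.2). Proof. exact: smooth_cp. Qed.

(** The coordinate p serves as test function for the brackets because P p is the scale factor, which
    has no zeros: coefficients of P can be cancelled. *)
Let Pp z : U1 z -> nP g22 (fun z : R3 => z.2) (E z) != 0.
Proof.
move=> Uz; rewrite /nP /Dp (derive_cp _ _).2 /= mulr1; exact: (gauge_n2 G2 (E_U Uz)).
Qed.

Lemma transport_der d1 d2 h1 h2 : derivation U1 d1 -> (forall g, smooth U2 g -> eq_on U1 (d1 (g \o E)) (d2 g \o E)) ->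
  smooth U1 h1 -> smooth U2 h2 -> eq_on U1 h1 (h2 \o E) -> eq_on U1 (d1 h1) (d2 h2 \o E).
Proof. by move=> D1 H s1 s2 h12 z Uz; rewrite -(H _ s2 _ Uz) (der_eq D1 s1 h12 Uz). Qed.

(** The bracket [P, Y] p matches only the combination [n5] - b / 8, and the formula for P a matches
    24/5 [n5] + b. These two are linearly independent. *)
Let n5cY z : U1 z -> n5 f1 i1 g11 g12 z = n5 f2 i2 g21 g22 (E z) /\ cY f1 i1 e1 g11 g12 z = cY f2 i2 e2 g21 g22 (E z).
Proof.
move=> Uz.
have h1 := gauge_py o1 G1 (E_smooth cp) Uz; have h2 := gauge_py o2 G2 cp (E_U Uz).
have k1 := comp nP1 nY2 E_P transport_Y cp Uz; have k2 := comp nY1 nP2 transport_Y E_P cp Uz.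
have k3 := E_P cp Uz; have k4 := E_X cp Uz; have k5 := transport_Y cp Uz; have k6 := E_c Uz; have k7 := E_n6 Uz.
rewrite /= in h1 h2 k1 k2 k3 k4 k5 k6 k7.
rewrite k1 k2 k3 k4 k5 k6 k7 h2 in h1; move: h1.
have h3 := gauge_pa o1 G1 Uz; have h4 := gauge_pa o2 G2 (E_U Uz); move: h3.
have l1 := transport_der nP1 E_P (cX_smooth o1 G1) (cX_smooth o2 G2) E_a Uz.
have l2 := transport_der nX1 E_X (cP_smooth o1 G1) (cP_smooth o2 G2) E_c Uz.
rewrite /= in l1 l2; have l3 := E_a Uz; rewrite /= in l3 h4; rewrite l1 l2 l3 k6 h4; have := Pp Uz.
set p := nP g22 _ _; set x := nX f2 g21 (fun z => z.2) _; set y := nY _ _ _ _ _ _.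
set a5 := n5 f1 _ _ _ _; set b5 := n5 f2 _ _ _ _; set a := cY f1 _ _ _ _ _; set b := cY f2 _ _ _ _ _.
set u := nX _ _ _ _; set v := cX _ _ _ _ _; set c := cP _ _ _ _; set s := n6 _ _ _ => p0 t1 t2.
have t3 : b + 24 / 5 * b5 = a + 24 / 5 * a5.
  by apply/subr0_eq; move/eqP: t1; rewrite -subr_eq0 => /eqP <-; ring.
have /(mulfI p0) t4 : p * (b5 - b / 8) = p * (a5 - a / 8).
  by apply/subr0_eq; move/eqP: t2; rewrite -subr_eq0 => /eqP <-; field.
exact: two_equations t3 t4.
Qed.

Lemma transport_n5 : eq_on U1 (n5 f1 i1 g11 g12) (n5 f2 i2 g21 g22 \o E).
Proof. by move=> z /n5cY[]. Qed.

Lemma transport_cY : eq_on U1 (cY f1 i1 e1 g11 g12) (cY f2 i2 e2 g21 g22 \o E).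
Proof. by move=> z /n5cY[]. Qed.

(** All terms of [X, Y] p other than [n4] P p are already matched. *)
Lemma transport_n4 : eq_on U1 (n4 f1 i1 g11) (n4 f2 i2 g21 \o E).
Proof.
move=> z Uz.
have h1 := gauge_xy o1 G1 (E_smooth cp) Uz; have h2 := gauge_xy o2 G2 cp (E_U Uz).
have k1 := comp nX1 nY2 E_X transport_Y cp Uz; have k2 := comp nY1 nX2 transport_Y E_X cp Uz.
have k3 := E_P cp Uz; have k4 := E_X cp Uz; have k5 := transport_Y cp Uz; have k6 := E_a Uz.
have k7 := transport_n5 Uz; have k8 := transport_cY Uz.
rewrite /= in h1 h2 k1 k2 k3 k4 k5 k6 k7 k8.
rewrite k1 k2 k3 k4 k5 k6 k7 k8 h2 in h1.
by move: h1 => /addIr/addIr/addIr/(mulIf (Pp Uz))/esym.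
Qed.

Let tq1 : eq_on U1 (q1 f1 i1 e1 g11 g12) (q1 f2 i2 e2 g21 g22 \o E).
Proof.
move=> z Uz; have k1 := transport_der nP1 E_P (cY_smooth o1 G1) (cY_smooth o2 G2) transport_cY Uz.
have k2 := transport_der nY1 transport_Y (cP_smooth o1 G1) (cP_smooth o2 G2) E_c Uz.
have k3 := E_n6 Uz; have k4 := transport_n5 Uz; have k5 := E_a Uz; have k6 := E_c Uz; have k7 := transport_cY Uz.
by rewrite /= in k1 k2 k3 k4 k5 k6 k7 *; rewrite /q1 k1 k2 k3 k4 k5 k6 k7.
Qed.

Let tq2 : eq_on U1 (q2 f1 i1 e1 g11 g12) (q2 f2 i2 e2 g21 g22 \o E).
Proof.
move=> z Uz; have k1 := transport_der nX1 E_X (cY_smooth o1 G1) (cY_smooth o2 G2) transport_cY Uz.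
have k2 := transport_der nY1 transport_Y (cX_smooth o1 G1) (cX_smooth o2 G2) E_a Uz.
have k3 := transport_n4 Uz; have k4 := transport_n5 Uz; have k5 := E_a Uz; have k6 := E_c Uz; have k7 := transport_cY Uz.
by rewrite /= in k1 k2 k3 k4 k5 k6 k7 *; rewrite /q2 k1 k2 k3 k4 k5 k6 k7.
Qed.

(** In [gauge_cp] every term but the one with I is built from transported quantities; [gauge_cx]
    serves likewise for H. *)
Lemma transport_I z : U1 z -> g11 z * g12 z * g12 z * g12 z * Dp (Dp (Dp (Dp f1))) z =
  g21 (E z) * g22 (E z) * g22 (E z) * g22 (E z) * Dp (Dp (Dp (Dp f2))) (E z).
Proof.
move=> Uz; have h1 := gauge_cp o1 G1 Uz; have h2 := gauge_cp o2 G2 (E_U Uz).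
have k1 := transport_der nP1 E_P (q1_smooth o1 G1) (q1_smooth o2 G2) tq1 Uz.
have k2 := transport_der nY1 transport_Y (n6_smooth o1 G1) (n6_smooth o2 G2) E_n6 Uz.
have k3 := E_n6 Uz; have k4 := transport_n5 Uz; have k5 := tq1 Uz; have k6 := E_c Uz; have k7 := transport_cY Uz.
rewrite /= in h1 h2 k1 k2 k3 k4 k5 k6 k7.
rewrite k1 k2 k3 k4 k5 k6 k7 h2 in h1.
by apply/esym/(cancel_eighth h1).
Qed.

Lemma transport_H z : U1 z -> g11 z * g11 z * g11 z * g12 z * rel_H f1 z =
  g21 (E z) * g21 (E z) * g21 (E z) * g22 (E z) * rel_H f2 (E z).
Proof.
move=> Uz; have h1 := gauge_cx o1 G1 Uz; have h2 := gauge_cx o2 G2 (E_U Uz).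
have k1 := transport_der nX1 E_X (q2_smooth o1 G1) (q2_smooth o2 G2) tq2 Uz.
have k2 := transport_der nY1 transport_Y (n4_smooth o1 G1) (n4_smooth o2 G2) transport_n4 Uz.
have k3 := transport_n4 Uz; have k4 := transport_n5 Uz; have k5 := tq2 Uz; have k6 := E_a Uz; have k7 := transport_cY Uz.
rewrite /= in h1 h2 k1 k2 k3 k4 k5 k6 k7.
rewrite k1 k2 k3 k4 k5 k6 k7 h2 in h1.
by apply/esym/(cancel_eighth h1).
Qed.
End Transport.
End GaugeFacts.

(** * Normalization by a branch *)

Section LogarithmicDerivatives.
Variables (R : realType).
Notation R3 := (R * R * R)%type.

(** This is ln |h|. Writing it with the square makes it a composite of smooth functions for either
    sign of h. *)
Definition log_abs (h : R3 -> R) (z : R3) : R := ln (h z * h z) / 2.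

Variable U : set R3.
Hypothesis oU : open U.

Let sq_gt0 (h : R3 -> R) z : h z != 0 -> 0 < h z * h z.
Proof. by move=> h0; rewrite -expr2 exprn_even_gt0. Qed.

Lemma log_abs_smooth h : smooth U h -> (forall z, U z -> h z != 0) -> smooth U (log_abs h).
Proof.
move=> sh h0; apply: sclass_smooth => //; apply: Smul; last exact: Scst.
by apply: Sln => [|z Uz]; [apply: Smul; exact: Sbase|apply: sq_gt0; exact: h0].
Qed.

Lemma expR_log_abs h z : h z != 0 -> expR (log_abs h z) = `|h z|.
Proof.
move=> h0; apply/eqP; rewrite -(@eqrXn2 _ 2) ?expR_ge0 // -expRM_natl /log_abs mulrC divfK ?pnatr_eq0 //.
by rewrite lnK ?posrE ?sq_gt0 // real_normK ?num_real // expr2.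
Qed.

Lemma log_abs_derive h v : smooth U h -> (forall z, U z -> h z != 0) ->
  eq_on U (fun z => 'D_v (log_abs h) z) (fun z => h z * ('D_v h z / (h z * h z))).
Proof.
move=> sh h0 z Uz.
have dl := derivation_dir oU v.
have shh := smooth_mul oU sh sh.
have sl : smooth U (fun z => ln (h z * h z)).
  apply: sclass_smooth => //; apply: Sln => [|y Uy]; first exact: Sbase.
  by apply: sq_gt0; exact: h0.
rewrite /log_abs (der_mul dl sl (smooth_cst oU 2^-1) Uz) (der_cst dl) // mulr0 add0r.
have dh : differentiable (fun z => h z * h z) z := smooth_diff shh Uz.
have [_ ->] := derive_comp1 v dh (is_derive1_ln (sq_gt0 (h0 _ Uz))).
rewrite (der_mul dl sh sh Uz); field; exact: h0.
Qed.

Variable f : R3 -> R.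
Hypothesis sf : smooth U f.

Definition log_derivative (h : R3 -> R) (dl : nat -> R3 -> R) : Prop :=
  [/\ smooth U h, (forall z, U z -> h z != 0) &
      forall k, eq_on U (frame f k h) (fun z => h z * dl k z)].

Let der k := frame_der oU sf k.

Lemma log_derivative_mul h1 h2 dl1 dl2 : log_derivative h1 dl1 -> log_derivative h2 dl2 ->
  log_derivative (fun z => h1 z * h2 z) (fun k z => dl1 k z + dl2 k z).
Proof.
move=> [s1 n1 d1] [s2 n2 d2]; split=> [|z Uz|k z Uz]; first exact: smooth_mul.
  by rewrite mulf_neq0 ?n1 ?n2.
by rewrite (der_mul (der k) s1 s2 Uz) d1 // d2 //; ring.
Qed.

Lemma log_derivative_inv h dl : log_derivative h dl ->
  log_derivative (fun z => (h z)^-1) (fun k z => - dl k z).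
Proof.
move=> [s1 n1 d1].
have si : smooth U (fun z => (h z)^-1) by apply: sclass_smooth => //; apply: Sinv => //; exact: Sbase.
split=> [//|z Uz|k z Uz]; first by rewrite invr_eq0 n1.
have E : eq_on U (fun z => h z * (h z)^-1) (fun=> 1) by move=> y Uy; rewrite mulfV // n1.
have := der_eq (der k) (smooth_mul oU s1 si) E Uz.
rewrite (der_cst (der k)) // (der_mul (der k) s1 si Uz) d1 // => /eqP.
rewrite addrC addr_eq0 => /eqP H; apply/(mulfI (n1 _ Uz)); rewrite -[LHS]opprK -H.
by field; exact: n1.
Qed.

Lemma log_derivative_eq h1 h2 dl1 dl2 : log_derivative h1 dl1 -> eq_on U h1 h2 ->
  (forall k, eq_on U (dl1 k) (dl2 k)) -> log_derivative h2 dl2.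
Proof.
move=> [s1 n1 d1] h12 d12; split=> [|z Uz|k z Uz]; first exact: (smooth_eq oU h12).
  by rewrite -h12 ?n1.
by rewrite -(der_eq (der k) s1 h12 Uz) d1 // h12 // d12.
Qed.

Lemma log_derivative_cst c : c != 0 -> log_derivative (fun=> c) (fun _ _ => 0).
Proof.
move=> c0; split=> // [|k z Uz]; first exact: smooth_cst.
by rewrite (der_cst (der k)) // mulr0.
Qed.

Lemma log_derivative_exprz h dl (n : int) : log_derivative h dl ->
  log_derivative (fun z => h z ^ n) (fun k z => n%:~R * dl k z).
Proof.
move=> H.
have nat_case (m : nat) : log_derivative (fun z => h z ^+ m) (fun k z => m%:R * dl k z).
  elim: m => [|m IH].
    apply: (log_derivative_eq (log_derivative_cst (oner_neq0 _))) => [z _|k z _]; first by rewrite expr0.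
    by rewrite mul0r.
  apply: (log_derivative_eq (log_derivative_mul H IH)) => [z _|k z _]; first by rewrite exprS.
  by rewrite mulrS; ring.
case: n => m; first exact: nat_case.
apply: (log_derivative_eq (log_derivative_inv (nat_case m.+1))) => [//|k z _].
by rewrite NegzE mulrNz mulNr.
Qed.

Lemma frame_proportional h g (c : R) z k : (forall v, 'D_v h z = c * 'D_v g z) ->
  frame f k h z = c * frame f k g z.
Proof.
move=> H; case: k => [|[|[|[|[|k]]]]].
- have E u : frame f 0 u z = 'D_((1, 0, 0) : R3) u z + z.2 * 'D_((0, 1, 0) : R3) u z + f z * 'D_((0, 0, 1) : R3) u z by [].
  by rewrite !E !H !mulrDr [z.2 * (c * _)]mulrCA [f z * (c * _)]mulrCA.
- have E u : frame f 1 u z = 'D_((0, 1, 0) : R3) u z + Dp f z * 'D_((0, 0, 1) : R3) u z by [].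
  by rewrite !E !H mulrDr [Dp f z * (c * _)]mulrCA.
- exact: H.
- exact: H.
- have E u : frame f 4 u z = 'D_((1, 0, 0) : R3) u z + z.2 * 'D_((0, 1, 0) : R3) u z by [].
  by rewrite !E !H mulrDr [z.2 * (c * _)]mulrCA.
- by rewrite /frame /= !nth_nil mulr0.
Qed.

Lemma frame_log_abs h : smooth U h -> (forall z, U z -> h z != 0) ->
  log_derivative h (fun k => frame f k (log_abs h)).
Proof.
move=> sh h0; split=> // k z Uz.
apply: frame_proportional => v; rewrite (log_abs_derive v sh h0 Uz).
by rewrite mulrA mulrCA mulfV ?mulr1 // mulf_neq0 ?h0.
Qed.

End LogarithmicDerivatives.

Section Branches.
Variables (R : realType).
Notation R3 := (R * R * R)%type.
Implicit Types (f : R3 -> R) (J : R3 -> R * R).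

Definition logI f : R3 -> R := log_abs (rel_I f).
Definition logH f : R3 -> R := log_abs (rel_H f).
Definition scale1 J (z : R3) : R := ((J z).1)^-1.
Definition scale2 J (z : R3) : R := (J z).1 / (J z).2.

Record regular_branch (s : bool) (U : set R3) f J : Prop := RegularBranch {
  rb_open : open U;
  rb_f : smooth U f;
  rb_J : smooth U (fun z => (J z).1);
  rb_I : forall z, U z -> rel_I f z != 0;
  rb_H : forall z, U z -> rel_H f z != 0;
  rb_1 : forall z, U z -> (J z).1 ^+ 8 = (-1) ^+ s * (rel_H f z ^+ 3 / rel_I f z);
  rb_2 : forall z, U z -> (J z).2 ^+ 4 = (-1) ^+ s * (rel_I f z * rel_H f z);
  rb_3 : forall z, U z -> (J z).1 ^+ 2 * (J z).2 = rel_H f z }.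

Lemma regular_branch_sub s (U V : set R3) f J : open V -> V `<=` U ->
  regular_branch s U f J -> regular_branch s V f J.
Proof.
move=> oV VU [_ ? ? h1 h2 h3 h4 h5]; split=> //; do ?[exact: smooth_sub VU _].
- by move=> z /VU /h1.
- by move=> z /VU /h2.
- by move=> z /VU /h3.
- by move=> z /VU /h4.
- by move=> z /VU /h5.
Qed.

Lemma jet_smooth (U : set R3) f k l i : open U -> smooth U f -> smooth U (jet f k l i).
Proof.
move=> oU sf; rewrite /jet; elim: l => [|l IH] /=; last exact: (der_smooth (derivation_Dx oU)).
elim: i => [|i IH] /=; last exact: (der_smooth (derivation_Dy oU)).
by elim: k => [|k IH] //=; exact: (der_smooth (derivation_Dp oU)).
Qed.

Lemma rel_H_smooth (U : set R3) f : open U -> smooth U f -> smooth U (rel_H f).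
Proof.
move=> oU sf; have u k l i := jet_smooth k l i oU sf.
have nu (c : R) : smooth U (fun=> c) := smooth_cst oU c.
exact: (smooth_add oU (smooth_add oU (smooth_add oU (smooth_add oU (smooth_add oU (smooth_add oU
  (smooth_add oU (u 2%N 2%N 0%N) (smooth_opp oU (smooth_mul oU (nu 4) (u 1%N 1%N 1%N)))) (smooth_mul oU (nu 6) (u 0%N 0%N 2%N)))
  (smooth_mul oU sf (smooth_add oU (smooth_mul oU (nu 2) (u 3%N 1%N 0%N)) (smooth_opp oU (smooth_mul oU (nu 3) (u 2%N 0%N 1%N))))))
  (smooth_opp oU (smooth_mul oU (u 1%N 0%N 0%N) (smooth_add oU (u 2%N 1%N 0%N) (smooth_opp oU (smooth_mul oU (nu 4) (u 1%N 0%N 1%N)))))))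
  (smooth_mul oU (u 3%N 0%N 0%N) (u 0%N 1%N 0%N)))
  (smooth_opp oU (smooth_mul oU (smooth_mul oU (nu 3) (u 2%N 0%N 0%N)) (u 0%N 0%N 1%N))))
  (smooth_mul oU (smooth_mul oU sf sf) (u 4%N 0%N 0%N))).
Qed.

Lemma same_sign (x y : R) : 0 < x * y -> x = Num.sg y * `|x|.
Proof.
move=> xy; have [x0 y0] : x != 0 /\ y != 0.
  by split; apply/eqP => E; move: xy; rewrite E ?mul0r ?mulr0 ltxx.
rewrite [LHS]numEsg; congr (_ * _).
have := gtr0_sg xy; rewrite sgrM => E.
by rewrite -[LHS]mulr1 -E mulrA -expr2 sqr_sg x0 mul1r.
Qed.

(** A branch is only assumed continuous. Near m the sign of J1 is constant, and |J1| is exp ((3 ln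
    |H| - ln |I|) / 8) by the equation for its eighth power, so J1 is smooth. *)
Lemma root_branch_regular s f m J : smooth_at f m -> root_branch s f m J ->
  exists2 U, U m & regular_branch s U f J.
Proof.
move=> [A [oA Am] sA] [I0 H0 nJ].
have sf : smooth A f := sA.
have [B [oB Bm] BJ] : exists2 B, open_nbhs m B & B `<=` [set z | {for z, continuous J} /\
        [/\ (J z).1 ^+ 8 = (-1) ^+ s * (rel_H f z ^+ 3 / rel_I f z),
            (J z).2 ^+ 4 = (-1) ^+ s * (rel_I f z * rel_H f z) &
            (J z).1 ^+ 2 * (J z).2 = rel_H f z]] by move: nJ; rewrite /prop_near1 nbhsE.
have [cJ [_ _ Jm]] := BJ _ Bm.
have Jm0 : (J m).1 != 0.
  by apply/eqP => E; move/eqP: H0; apply; rewrite -Jm E expr0n mul0r.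
have cJ1 : {for m, continuous (fun z => (J z).1 * (J m).1)}.
  apply: (@continuousM _ _ (fun z => (J z).1) (fun=> (J m).1)); last exact: cst_continuous.
  exact: (continuous_comp cJ (differentiable_continuous (derive_fst (J m) 0).1)).
have [C [oC Cm] CJ] : exists2 C, open_nbhs m C & C `<=` [set z | 0 < (J z).1 * (J m).1].
  suff : nbhs m [set z | 0 < (J z).1 * (J m).1] by rewrite nbhsE.
  apply: (cJ1 [set x : R | 0 < x]); apply: open_nbhs_nbhs; split; first exact: open_gt.
  by rewrite /= -expr2 exprn_even_gt0.
have oI := open_neq0 oA (jet_smooth 4 0 0 oA sf).
have oH := open_neq0 oA (rel_H_smooth oA sf).
set AI := A `&` _ in oI; set AH := A `&` _ in oH.
pose U := (AI `&` AH) `&` (B `&` C).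
have oU : open U by apply: openI; apply: openI.
have UA : U `<=` A by move=> z [[[]]].
have UI z : U z -> rel_I f z != 0 by case=> -[[]].
have UH z : U z -> rel_H f z != 0 by case=> -[_ []].
have UJ z : U z -> [/\ (J z).1 ^+ 8 = (-1) ^+ s * (rel_H f z ^+ 3 / rel_I f z),
     (J z).2 ^+ 4 = (-1) ^+ s * (rel_I f z * rel_H f z) & (J z).1 ^+ 2 * (J z).2 = rel_H f z].
  by case=> _ [/BJ[]].
have sI : smooth U (logI f).
  by apply: log_abs_smooth => //; exact: smooth_sub UA (jet_smooth 4 0 0 oA sf).
have sH : smooth U (logH f).
  by apply: log_abs_smooth => //; exact: smooth_sub UA (rel_H_smooth oA sf).
exists U; first by do !split.
split; [exact: oU|exact: smooth_sub UA sf| |exact: UI|exact: UH|by move=> z /UJ[]|by move=> z /UJ[]|by move=> z /UJ[]].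
pose u z := (3 * logH f z - logI f z) / 8.
have su : smooth U u.
  exact: (smooth_mul oU (smooth_add oU (smooth_mul oU (smooth_cst oU 3) sH) (smooth_opp oU sI)) (smooth_cst oU _)).
have se : smooth U (fun z => expR (u z)) by apply: sclass_smooth => //; apply: Sexp; exact: Sbase.
apply: (smooth_eq oU _ (smooth_mul oU (smooth_cst oU (Num.sg (J m).1)) se)) => z Uz /=.
rewrite [RHS](same_sign (CJ _ Uz.2.2)); congr (_ * _).
apply/eqP; rewrite -(@eqrXn2 _ 8) ?expR_ge0 // -expRM_natl mulrC divfK ?pnatr_eq0 //.
rewrite expRD expRM_natl expRN !expR_log_abs ?UI ?UH // -[X in _ == X]normrX.
have [-> _ _] := UJ _ Uz.
by rewrite normrM normrX normrN1 expr1n mul1r normrM normfV normrX.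
Qed.
End Branches.

(** * The operators Delta on normalized functions *)

Section Bars.
Variables (R : realType).
Notation R3 := (R * R * R)%type.
Variables (s : bool) (U : set R3) (f : R3 -> R) (J : R3 -> R * R).
Hypothesis B : regular_branch s U f J.
Let oU := rb_open B.
Let sf := rb_f B.
Let iota := logI f.
Let eta := logH f.
Let g1 := scale1 J.
Let g2 := scale2 J.
Let J1 z := (J z).1.
Let J2 z := (J z).2.
Let d k g := frame f k g.

Let sI : smooth U (rel_I f). Proof. exact: (jet_smooth 4 0 0 oU sf). Qed.
Let sH : smooth U (rel_H f). Proof. exact: rel_H_smooth. Qed.
Let LI : log_derivative U f (rel_I f) (fun k => d k iota).
Proof. exact: (frame_log_abs oU f sI (rb_I B)). Qed.
Let LH : log_derivative U f (rel_H f) (fun k => d k eta).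
Proof. exact: (frame_log_abs oU f sH (rb_H B)). Qed.

Let J1_neq0 z : U z -> J1 z != 0.
Proof. by move=> Uz; apply/eqP => E; have := rb_H B Uz; rewrite -(rb_3 B Uz) -/(J1 z) E expr0n mul0r eqxx. Qed.
Let J2_neq0 z : U z -> J2 z != 0.
Proof. by move=> Uz; apply/eqP => E; have := rb_H B Uz; rewrite -(rb_3 B Uz) -/(J2 z) E mulr0 eqxx. Qed.

(** Logarithmic differentiation of the equation for the eighth power of J1. [L2] then follows from
    J2 = H / J1^2. *)
Let L1 : log_derivative U f J1 (fun k z => (3 * d k eta z - d k iota z) / 8).
Proof.
have K := frame_log_abs oU f (rb_J B) J1_neq0.
have K8 := log_derivative_exprz oU sf 8 K.
have s0 : (-1) ^+ s != 0 :> R by rewrite signr_eq0.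
have K8' := log_derivative_mul oU sf (log_derivative_cst oU sf s0)
  (log_derivative_mul oU sf (log_derivative_exprz oU sf 3 LH) (log_derivative_inv oU sf LI)).
apply: (log_derivative_eq oU sf K) => [//|k z Uz].
have [_ n8 D8] := K8; have [s8 _ D8'] := K8'.
have E : eq_on U (fun z => (-1) ^+ s * (rel_H f z ^ 3 * (rel_I f z)^-1)) (fun z => J1 z ^ 8).
  by move=> y Uy; rewrite /= -[LHS](rb_1 B Uy).
have := der_eq (frame_der oU sf k) s8 E Uz; rewrite D8' // D8 // E // => /(mulfI (n8 _ Uz)).
move=> /= H; apply/(@mulfI _ 8); first by rewrite pnatr_eq0.
by rewrite -[LHS]H [RHS]mulrC divfK ?pnatr_eq0 // add0r.
Qed.

Let L2 : log_derivative U f J2 (fun k z => (d k eta z + d k iota z) / 4).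
Proof.
have K := log_derivative_mul oU sf LH (log_derivative_inv oU sf (log_derivative_mul oU sf L1 L1)).
apply: (log_derivative_eq oU sf K) => [z Uz|k z Uz]; last by field.
by rewrite -(rb_3 B Uz) -/(J1 z) -/(J2 z) expr2 mulrAC mulfV ?mul1r // mulf_neq0 // J1_neq0.
Qed.

Lemma branch_gauge : gauge U f iota eta g1 g2.
Proof.
have K1 := log_derivative_inv oU sf L1.
have [s1 n1 d1] := K1; have [s2 n2 d2] := log_derivative_mul oU sf L1 (log_derivative_inv oU sf L2).
split; [exact: sf| | |exact: s1|exact: s2| | |exact: n1|exact: n2].
- exact: (log_abs_smooth oU sI (rb_I B)).
- exact: (log_abs_smooth oU sH (rb_H B)).
- by move=> k z Uz; rewrite [LHS](d1 _ _ Uz) /d; congr (_ * _); field.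
- by move=> k z Uz; rewrite [LHS](d2 _ _ Uz) /d; congr (_ * _); field.
Qed.

Let M (r s : int) z := (J1 z ^ r * J2 z ^ s)^-1.

Let LM (r t : int) : log_derivative U f (M r t) (fun k z => r%:~R * ((d k iota z - 3 * d k eta z) / 8)
   - t%:~R * ((d k eta z + d k iota z) / 4)).
Proof.
have K := log_derivative_inv oU sf (log_derivative_mul oU sf (log_derivative_exprz oU sf r L1) (log_derivative_exprz oU sf t L2)).
by apply: (log_derivative_eq oU sf K) => [//|k z Uz]; field.
Qed.

Let barE r t g : bar J r t g = fun z => M r t z * g z.
Proof. by apply/funext => z; rewrite /bar mulrC. Qed.

Let M_step (r t i j : int) z : U z -> M (r + i) (t + j) z = (J1 z ^ i)^-1 * (J2 z ^ j)^-1 * M r t z.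
Proof. by move=> Uz; rewrite /M !expfzDr ?J1_neq0 ?J2_neq0 // !invfM; ring. Qed.

Let DI k z : U z -> d k iota z = d k (rel_I f) z / rel_I f z.
Proof. by move=> Uz; have [_ _ E] := LI; rewrite {2}/d E // mulrC mulKf // (rb_I B). Qed.

Variable psi : weighted R.
Hypothesis spsi : smooth U psi.
Let r : R := (wr psi)%:~R.
Let t : R := (ws psi)%:~R.
Let chi := bar J (wr psi) (ws psi) psi.

Lemma bar_smooth : smooth U chi.
Proof. by rewrite /chi barE; have [sM _ _] := LM (wr psi) (ws psi); exact: smooth_mul. Qed.

Let jet_ratios z : U z ->
  [/\ jet f 5 0 0 z = Dp iota z * jet f 4 0 0 z, jet f 4 1 0 z = Dx iota z * jet f 4 0 0 z
    & jet f 4 0 1 z = Dy iota z * jet f 4 0 0 z].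
Proof.
move=> Uz; rewrite -[Dp iota z]/(d 2 iota z) -[Dx iota z]/(d 4 iota z) -[Dy iota z]/(d 3 iota z) !DI //.
have I0 := rb_I B Uz; by split; rewrite -?/(rel_I f z) divfK.
Qed.

Lemma Delta_pE : eq_on U (Delta_p f psi) (wDp iota r t psi).
Proof.
move=> z Uz; have [E5 _ _] := jet_ratios Uz.
rewrite -[LHS]/(Dp psi z + (r - t) * (jet f 5 0 0 z / (5 * jet f 4 0 0 z)) * psi z) /wDp E5.
have I0 : jet f 4 0 0 z != 0 := rb_I B Uz.
by rewrite [5 * _]mulrC invfM !mulrA mulfK.
Qed.

Let Delta_xE : eq_on U (Delta_x f psi) (wDx f iota r t psi).
Proof.
move=> z Uz; have [E5 E41 _] := jet_ratios Uz.
rewrite -[LHS]/(Dx psi z + f z * Delta_p f psi z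
    + ((3 * r + 2 * t)
         * (Dp f z + 3 * f z * jet f 5 0 0 z / (5 * jet f 4 0 0 z))
       + (2 * r + t) * (jet f 4 1 0 z / jet f 4 0 0 z)) * psi z) Delta_pE // /wDx E5 E41.
have I0 : jet f 4 0 0 z != 0 := rb_I B Uz.
congr (_ + (_ * (_ + _) + _ * _) * _); last by rewrite mulfK.
by rewrite [5 * _]mulrC invfM !mulrA mulfK.
Qed.

Let Delta_yE : eq_on U (Delta_y f psi) (wDy f iota r t psi).
Proof.
move=> z Uz; have [E5 E41 E401] := jet_ratios Uz.
rewrite -[LHS]/(Dy psi z + jet f 5 0 0 z / (5 * jet f 4 0 0 z) * Delta_x f psi z
    + (2 * Dp f z + (jet f 4 1 0 z + f z * jet f 5 0 0 z) / jet f 4 0 0 z)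
      * Delta_p f psi z
    - ((r + 2 * t) * (jet f 4 0 1 z / (4 * jet f 4 0 0 z))
       + (3 * r + 2 * t)
         * (Dp (Dp f) z / 8
            + 3 / 20 * (jet f 5 0 0 z
                        * (jet f 4 1 0 z + f z * jet f 5 0 0 z
                           + 2 * Dp f z * jet f 4 0 0 z)
                        / (jet f 4 0 0 z * jet f 4 0 0 z)))) * psi z) Delta_pE // Delta_xE // /wDy E5 E41 E401.
have I0 : jet f 4 0 0 z != 0 := rb_I B Uz.
move: (jet f 4 0 0 z) I0 => i i0; congr (_ + _ * _ + (_ + _) * _ - (_ * _ + _ * (_ + _ * _)) * _).
- by rewrite [5 * _]mulrC invfM mulrA mulfK.
- by rewrite mulrA -mulrDl mulfK.
- by rewrite [4 * _]mulrC invfM mulrA mulfK.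
- by rewrite invfM -mulrA [f z * _]mulrA -!mulrDl [_ * i * (_ * _)]mulrACA !mulrA !mulfK // -!mulrA; congr (_ * _).
Qed.

Lemma bar_p : eq_on U (bar J (wr psi - 1) (ws psi + 1) (Delta_p f psi))
  (fun z => nP g2 chi z + (3 * r + 2 * t) / 8 * cP iota eta g2 z * chi z).
Proof.
have [sf' si se sg1 sg2 h1 h2 _ _] := branch_gauge; have [sM _ dM] := LM (wr psi) (ws psi).
move=> z Uz; rewrite /chi !barE.
rewrite -(gauge_p oU sf si se sg1 sg2 h1 h2 spsi sM dM Uz) -Delta_pE // M_step //.
rewrite /g2 /scale2 -/(J1 z) -/(J2 z).
by rewrite exprN1 invrK expr1z.
Qed.

Lemma bar_x : eq_on U (bar J (wr psi + 1) (ws psi) (Delta_x f psi))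
  (fun z => nX f g1 chi z + (3 * r + 2 * t) / 8 * cX f iota eta g1 z * chi z).
Proof.
have [sf' si se sg1 sg2 h1 h2 _ _] := branch_gauge; have [sM _ dM] := LM (wr psi) (ws psi).
move=> z Uz; rewrite /chi !barE.
rewrite -(gauge_x oU sf si se sg1 sg2 h1 h2 spsi sM dM Uz) -Delta_xE //.
by rewrite -[ws psi]addr0 M_step // expr0z invr1 mulr1 expr1z addr0.
Qed.

Lemma bar_y : eq_on U (bar J (wr psi) (ws psi + 1) (Delta_y f psi))
  (fun z => nY f iota g1 g2 chi z + (3 * r + 2 * t) / 8 * cY f iota eta g1 g2 z * chi z).
Proof.
have [sf' si se sg1 sg2 h1 h2 _ _] := branch_gauge; have [sM _ dM] := LM (wr psi) (ws psi).
move=> z Uz; rewrite /chi !barE.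
rewrite -(gauge_y oU sf si se sg1 sg2 h1 h2 spsi sM dM Uz) -Delta_yE //.
rewrite -[wr psi]addr0 M_step // expr0z invr1 mul1r expr1z addr0.
rewrite /g1 /g2 /scale1 /scale2 -/(J1 z) -/(J2 z) [_^-1 * (_ / _)]mulrA mulVf ?mul1r ?mulrA //; exact: J1_neq0.
Qed.

Lemma Delta_smooth : [/\ smooth U (Delta_p f psi), smooth U (Delta_x f psi) & smooth U (Delta_y f psi)].
Proof.
have [_ si _ _ _ _ _ _ _] := branch_gauge.
have dk k g (sg : smooth U g) : smooth U (d k g) := der_smooth (frame_der oU sf k) sg.
have nu (c : R) : smooth U (fun=> c) := smooth_cst oU c.
have S1 : smooth U (wDp iota r t psi).
  exact: (smooth_add oU (dk 2%N _ spsi) (smooth_mul oU (smooth_mul oU (nu _) (smooth_mul oU (dk 2%N _ si) (nu _))) spsi)).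
have S2 : smooth U (wDx f iota r t psi).
  exact: (smooth_add oU (smooth_add oU (dk 4%N _ spsi) (smooth_mul oU sf S1)) (smooth_mul oU
   (smooth_add oU (smooth_mul oU (nu _) (smooth_add oU (dk 2%N _ sf) (smooth_mul oU (smooth_mul oU (nu _) sf)
      (smooth_mul oU (dk 2%N _ si) (nu _))))) (smooth_mul oU (nu _) (dk 4%N _ si))) spsi)).
have S3 : smooth U (wDy f iota r t psi).
  have e1 := smooth_add oU (smooth_add oU (dk 4%N _ si) (smooth_mul oU sf (dk 2%N _ si))) (smooth_mul oU (nu 2) (dk 2%N _ sf)).
  have e2 := smooth_add oU (smooth_mul oU (dk 2%N _ (dk 2%N _ sf)) (nu 8^-1)) (smooth_mul oU (nu (3 / 20)) (smooth_mul oU (dk 2%N _ si) e1)).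
  exact: (smooth_add oU (smooth_add oU (smooth_add oU (dk 3%N _ spsi) (smooth_mul oU (smooth_mul oU (dk 2%N _ si) (nu _)) S2))
    (smooth_mul oU (smooth_add oU (smooth_mul oU (nu _) (dk 2%N _ sf)) (smooth_add oU (dk 4%N _ si) (smooth_mul oU sf (dk 2%N _ si)))) S1))
    (smooth_opp oU (smooth_mul oU (smooth_add oU (smooth_mul oU (nu _) (smooth_mul oU (dk 3%N _ si) (nu _)))
      (smooth_mul oU (nu _) e2)) spsi))).
by split; [apply: (smooth_eq oU _ S1) => z Uz; rewrite Delta_pE|apply: (smooth_eq oU _ S2) => z Uz; rewrite Delta_xE|
  apply: (smooth_eq oU _ S3) => z Uz; rewrite Delta_yE].
Qed.
End Bars.

(** * The absolute invariants in terms of the frame *)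

Section InvariantFormulas.
Variables (R : realType).
Notation R3 := (R * R * R)%type.
Variables (s : bool) (U : set R3) (f : R3 -> R) (J : R3 -> R * R).
Hypothesis B : regular_branch s U f J.
Let oU := rb_open B.
Let sf := rb_f B.
Let iota := logI f.
Let eta := logH f.
Let g1 := scale1 J.
Let g2 := scale2 J.
Let G := branch_gauge B.
Let eps : R := (-1) ^+ s.
Local Notation a := (cX f iota eta g1).
Local Notation b := (cY f iota eta g1 g2).
Local Notation c := (cP iota eta g2).
Local Notation nX := (nX f g1).
Local Notation nY := (nY f iota g1 g2).
Local Notation nP := (nP g2).

Let J1_neq0 z : U z -> (J z).1 != 0.
Proof. by move=> Uz; apply/eqP => E; have := rb_H B Uz; rewrite -(rb_3 B Uz) E expr0n mul0r eqxx. Qed.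
Let J2_neq0 z : U z -> (J z).2 != 0.
Proof. by move=> Uz; apply/eqP => E; have := rb_H B Uz; rewrite -(rb_3 B Uz) E mulr0 eqxx. Qed.

Let eps2 : eps * eps = 1.
Proof. by rewrite /eps -expr2 sqrr_sign. Qed.

(** The normalized I is the sign [eps], as follows by dividing the equation for J2^4 by J1^2 J2 =
    H. *)
Lemma rel_IE z : U z -> rel_I f z = eps * (J z).2 ^+ 3 / (J z).1 ^+ 2.
Proof.
move=> Uz; apply/(mulIf (rb_H B Uz)).
have -> : rel_I f z * rel_H f z = eps * (J z).2 ^+ 4 by rewrite (rb_2 B Uz) -/eps mulrA eps2 mul1r.
rewrite -(rb_3 B Uz); have := J1_neq0 Uz; move: ((J z).1) ((J z).2) eps => x y e x0; by field.
Qed.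

Section Step.
Variables (psi : weighted R) (h : R3 -> R).
Hypothesis spsi : smooth U psi.
Hypothesis E : eq_on U (bar J (wr psi) (ws psi) psi) h.
Let r : R := (wr psi)%:~R.
Let t : R := (ws psi)%:~R.

Lemma bar_step_p : eq_on U (bar J (wr psi - 1) (ws psi + 1) (Delta_p f psi))
  (fun z => nP h z + (3 * r + 2 * t) / 8 * c z * h z).
Proof.
move=> z Uz; rewrite (bar_p B spsi Uz) E //; congr (_ + _).
exact: (der_eq (nP_der oU G) (bar_smooth B spsi) E Uz).
Qed.

Lemma bar_step_x : eq_on U (bar J (wr psi + 1) (ws psi) (Delta_x f psi))
  (fun z => nX h z + (3 * r + 2 * t) / 8 * a z * h z).
Proof.
move=> z Uz; rewrite (bar_x B spsi Uz) E //; congr (_ + _).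
exact: (der_eq (nX_der oU G) (bar_smooth B spsi) E Uz).
Qed.

Lemma bar_step_y : eq_on U (bar J (wr psi) (ws psi + 1) (Delta_y f psi))
  (fun z => nY h z + (3 * r + 2 * t) / 8 * b z * h z).
Proof.
move=> z Uz; rewrite (bar_y B spsi Uz) E //; congr (_ + _).
exact: (der_eq (nY_der oU G) (bar_smooth B spsi) E Uz).
Qed.
End Step.

Let sH : smooth U (wH f). Proof. exact: rel_H_smooth. Qed.

(** The normalized H is 1 and has 3 r + 2 s = 8. Hence its normalized derivatives are a, b and c
    themselves. *)
Let bH : eq_on U (bar J 2 1 (wH f)) (fun=> 1).
Proof.
move=> z Uz; rewrite /bar expr1z -[wfun _ _]/(rel_H f z) -(rb_3 B Uz) mulfV //.
by rewrite mulf_neq0 ?J2_neq0 // expf_neq0 // J1_neq0.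
Qed.

Let w8 : (3 * 2%:~R + 2 * 1%:~R) / 8 = 1 :> R.
Proof. by rewrite mulr1 -natrM -natrD divff. Qed.

Let bHx : eq_on U (bar J 3 1 (Delta_x f (wH f))) a.
Proof.
move=> z Uz; rewrite [LHS](bar_step_x sH bH Uz) (der_cst (nX_der oU G)) // add0r mulr1.
by rewrite [X in X * _]w8 mul1r.
Qed.

Let bHy : eq_on U (bar J 2 2 (Delta_y f (wH f))) b.
Proof.
move=> z Uz; rewrite [LHS](bar_step_y sH bH Uz) (der_cst (nY_der oU G)) // add0r mulr1.
by rewrite [X in X * _]w8 mul1r.
Qed.

Let bHp : eq_on U (bar J 1 2 (wK f)) c.
Proof.
move=> z Uz; rewrite [LHS](bar_step_p sH bH Uz) (der_cst (nP_der oU G)) // add0r mulr1.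
by rewrite [X in X * _]w8 mul1r.
Qed.

Lemma coordsE : eq_on U (coords f J) (fun z => (a z, b z, c z)).
Proof.
move=> z Uz; have e1 := bHx Uz; have e2 := bHy Uz; have e3 := bHp Uz.
by rewrite -[LHS]/(bar J 3 1 (Delta_x f (wH f)) z, bar J 2 2 (Delta_y f (wH f)) z, bar J 1 2 (wK f) z) e1 e2 e3.
Qed.

Let sHx : smooth U (Delta_x f (wH f)). Proof. by have [] := Delta_smooth B sH. Qed.
Let sHy : smooth U (Delta_y f (wH f)). Proof. by have [] := Delta_smooth B sH. Qed.
Let sK : smooth U (wK f). Proof. by have [] := Delta_smooth B sH. Qed.

Let wt (m n k : nat) : (3 * m + 2 * n = k)%N -> (3 * m%:~R + 2 * n%:~R) / 8 = k%:R / 8 :> R.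
Proof. by move=> <-; rewrite natrD !natrM. Qed.

Lemma bar_H20 : eq_on U (bar J 4 1 (rel_Hij f 2 0)) (fun z => nX a z + 11 / 8 * a z * a z).
Proof. by move=> z Uz; rewrite -(@wt 3 1 11 erefl); exact: (bar_step_x sHx bHx Uz). Qed.
Lemma bar_H11 : eq_on U (bar J 3 2 (rel_Hij f 1 1)) (fun z => nX b z + 10 / 8 * a z * b z).
Proof. by move=> z Uz; rewrite -(@wt 2 2 10 erefl); exact: (bar_step_x sHy bHy Uz). Qed.
Lemma bar_H02 : eq_on U (bar J 2 3 (rel_Hij f 0 2)) (fun z => nY b z + 10 / 8 * b z * b z).
Proof. by move=> z Uz; rewrite -(@wt 2 2 10 erefl); exact: (bar_step_y sHy bHy Uz). Qed.
Lemma bar_K10 : eq_on U (bar J 2 2 (rel_Kij f 1 0)) (fun z => nX c z + 7 / 8 * a z * c z).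
Proof. by move=> z Uz; rewrite -(@wt 1 2 7 erefl); exact: (bar_step_x sK bHp Uz). Qed.
Lemma bar_K01 : eq_on U (bar J 1 3 (rel_Kij f 0 1)) (fun z => nY c z + 7 / 8 * b z * c z).
Proof. by move=> z Uz; rewrite -(@wt 1 2 7 erefl); exact: (bar_step_y sK bHp Uz). Qed.
Let bKp : eq_on U (bar J 0 3 (Delta_p f (wK f))) (fun z => nP c z + 7 / 8 * c z * c z).
Proof. by move=> z Uz; rewrite -(@wt 1 2 7 erefl); exact: (bar_step_p sK bHp Uz). Qed.
Let bHxp : eq_on U (bar J 2 2 (Delta_p f (Delta_x f (wH f)))) (fun z => nP a z + 11 / 8 * c z * a z).
Proof. by move=> z Uz; rewrite -(@wt 3 1 11 erefl); exact: (bar_step_p sHx bHx Uz). Qed.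

Let LI z : U z -> Dp (rel_I f) z = rel_I f z * Dp iota z /\ Dx (rel_I f) z = rel_I f z * Dx iota z.
Proof.
move=> Uz; have [_ _ d] := frame_log_abs oU f (jet_smooth 4 0 0 oU sf : smooth U (rel_I f)) (rb_I B).
by split; [exact: (d 2%N z Uz)|exact: (d 4%N z Uz)].
Qed.

Lemma bar_Omega6 : eq_on U (bar J (- 4) 5 (Omega6 f)) (fun z => eps * n6 iota g2 z).
Proof.
move=> z Uz.
have O6 : Omega6 f z = rel_I f z * o6 iota z.
  have sI : smooth U (rel_I f) := jet_smooth 4 0 0 oU sf.
  have si := gauge_i G; have sPi : smooth U (Dp iota) := der_smooth (derivation_Dp oU) si.
  have E5 : jet f 5 0 0 z = rel_I f z * Dp iota z := (LI Uz).1.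
  have E6 : jet f 6 0 0 z = rel_I f z * Dp (Dp iota) z + Dp iota z * (rel_I f z * Dp iota z).
    rewrite -(LI Uz).1 -(der_mul (derivation_Dp oU) sI sPi Uz).
    rewrite -[LHS]/(Dp (Dp (rel_I f)) z).
    exact: (der_eq (derivation_Dp oU) (der_smooth (derivation_Dp oU) sI) (fun y Uy => (LI Uy).1) Uz).
  rewrite /Omega6 E5 E6 -/(rel_I f z) /o6; have I0 := rb_I B Uz.
  by move: (rel_I f z) (Dp iota z) (Dp (Dp iota) z) I0 => i p pp i0; field.
rewrite -[LHS]/(Omega6 f z / ((J z).1 ^- 4 * (J z).2 ^+ 5)) O6 rel_IE // /n6 /g2 /scale2.
have := J1_neq0 Uz; have := J2_neq0 Uz; move: (o6 iota z) ((J z).1) ((J z).2) => o x y y0 x0.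
by field; rewrite x0 y0.
Qed.

(** The bracket expression in the definition of Omega^5_10 is P a - X c - b + a c / 2 after
    normalization, which [gauge_pa] identifies with 24/5 [n5]. *)
Lemma bar_Omega5 : eq_on U (bar J (- 2) 4 (Omega5_10 f)) (fun z => eps * n5 f iota g1 g2 z).
Proof.
move=> z Uz.
have K : bar J 2 2 (fun z => (Delta_p f (Delta_x f (wH f)) z - Delta_x f (Delta_p f (wH f)) z)
     - Delta_y f (wH f) z) z = 24 / 5 * n5 f iota g1 g2 z.
  have e1 := bHxp Uz; have e2 := bar_K10 Uz; have e3 := bHy Uz.
  have Eb (h1 h2 h3 : R3 -> R) : bar J 2 2 (fun z => (h1 z - h2 z) - h3 z) z =
    bar J 2 2 h1 z - bar J 2 2 h2 z - bar J 2 2 h3 z by rewrite /bar !mulrBl.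
  rewrite Eb -[bar J 2 2 (Delta_x f (Delta_p f _)) z]/(bar J 2 2 (rel_Kij f 1 0) z) e1 e2 e3 (gauge_pa oU G Uz).
  move: (nX c z) (a z) (b z) (c z) (n5 f iota g1 g2 z) => x1 x2 x3 x4 x5; by field.
have -> : n5 f iota g1 g2 z = 5 / 24 * (24 / 5 * n5 f iota g1 g2 z) by field.
rewrite -K.
set D := fun z => Delta_p f (Delta_x f (wH f)) z - Delta_x f (Delta_p f (wH f)) z - Delta_y f (wH f) z.
rewrite -[LHS]/((5 * rel_I f z / (24 * rel_H f z) * D z) / ((J z).1 ^- 2 * (J z).2 ^+ 4)).
rewrite -[bar J 2 2 D z]/(D z / ((J z).1 ^+ 2 * (J z).2 ^+ 2)).
have -> : rel_H f z = (J z).1 ^+ 2 * (J z).2 by rewrite (rb_3 B Uz).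
rewrite rel_IE //; have := J1_neq0 Uz; have := J2_neq0 Uz.
move: (D z) ((J z).1) ((J z).2) => o x y y0 x0.
by field; rewrite x0 y0.
Qed.

(** This is [wDp2_H] after normalization; its term with [wDx] vanishes since Delta_x I = 0. *)
Let pc_full : eq_on U (fun z => nP c z + 7 / 8 * c z * c z) (fun z => eps * n4 f iota g1 z + n6 iota g2 z / 5).
Proof.
move=> z Uz; rewrite -bKp //.
have si := gauge_i G.
have s1 : smooth U (fun=> 1 : R) := smooth_cst oU 1.
have DM1 k : eq_on U (frame f k (fun=> 1)) (fun z => 1 *
  (0 * ((frame f k iota z - 3 * frame f k eta z) / 8)
   - 0 * ((frame f k eta z + frame f k iota z) / 4))).
  by move=> y Uy; rewrite (der_cst (frame_der oU sf k) _ Uy) !mul0r subr0 mulr0.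
have [_ _ se sg1 sg2 h1 h2 _ _] := G.
have W : wDp iota 1 2 (wDp iota 2 1 (rel_H f)) z = wDx f iota (- 1) 3 (wDx f iota (- 2) 3 (rel_I f)) z
     + o4 f iota z * rel_I f z + o6 iota z / 5 * rel_H f z := wDp2_H oU sf si se sg1 sg2 h1 h2 s1 s1 DM1 Uz.
have E1 : Delta_p f (wK f) z = wDp iota 1 2 (wDp iota 2 1 (rel_H f)) z.
  have e y : U y -> wK f y = wDp iota 2 1 (rel_H f) y by exact: (Delta_pE B (wH f)).
  rewrite (Delta_pE B (wK f) Uz) -[LHS]/(Dp (wK f) z + (1 - 2) * (Dp iota z / 5) * wK f z).
  by rewrite (der_eq (derivation_Dp oU) sK e Uz) e.
have Z : eq_on U (wDx f iota (- 2) 3 (rel_I f)) (fun=> 0).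
  move=> y Uy; have [L1 L2] := LI Uy; rewrite /wDx /wDp L1 L2.
  by move: (Dp iota y) (Dx iota y) (rel_I f y) (f y) (Dp f y) => x1 x2 x3 x4 x5; field.
have sZ : smooth U (wDx f iota (- 2) 3 (rel_I f)).
  by apply: (smooth_eq oU _ (smooth_cst oU 0)) => y Uy; rewrite Z.
have Z0 (h : R3 -> R) : smooth U h -> eq_on U h (fun=> 0) -> wDx f iota (- 1) 3 h z = 0.
  move=> sh h0; rewrite /wDx /wDp (der_eq (derivation_Dp oU) sh h0 Uz) (der_eq (derivation_Dx oU) sh h0 Uz) h0 //.
  by rewrite (der_cst (derivation_Dp oU)) // (der_cst (derivation_Dx oU)) // !mulr0 !addr0 mulr0 addr0.
have Z2 := Z0 _ sZ Z.
rewrite -[bar J 0 3 _ z]/(Delta_p f (wK f) z / (1 * (J z).2 ^+ 3)) mul1r E1 W Z2 add0r rel_IE // -(rb_3 B Uz).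
rewrite /n4 /n6 /g1 /g2 /scale1 /scale2 /=; have := J1_neq0 Uz; have := J2_neq0 Uz.
move: (o6 iota z) (o4 f iota z) ((J z).1) ((J z).2) => o o' x y y0 x0.
by field; rewrite x0 y0.
Qed.

Lemma frame_pc : eq_on U (nP c) (fun z => eps * n4 f iota g1 z + n6 iota g2 z / 5 - 7 / 8 * c z * c z).
Proof. by move=> z Uz; have := pc_full Uz => /= <-; rewrite addrK. Qed.

Lemma bar_Omega4 : eq_on U (bar J 0 3 (Omega4_20 f)) (fun z => eps * n4 f iota g1 z).
Proof.
move=> z Uz; have e1 := bKp Uz; have e2 := pc_full Uz; rewrite /= in e2.
have e3 := bar_Omega6 Uz.
have -> : eps * n4 f iota g1 z = bar J 0 3 (Delta_p f (wK f)) z - n6 iota g2 z / 5 by rewrite e1 e2 addrK.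
rewrite /bar /Omega4_20 mulrBl; congr (_ - _).
have -> : n6 iota g2 z = eps * bar J (- 4) 5 (Omega6 f) z by rewrite e3 mulrA eps2 mul1r.
rewrite -[bar J (- 4) 5 _ z]/(Omega6 f z / ((J z).1 ^- 4 * (J z).2 ^+ 5)).
rewrite -[(J z).1 ^ 0 * (J z).2 ^ 3]/(1 * (J z).2 ^+ 3) mul1r -(rb_3 B Uz) rel_IE //.
have := J1_neq0 Uz; have := J2_neq0 Uz.
have e0 : eps != 0 by rewrite signr_eq0.
have ee : eps = eps^-1 by apply/(mulfI e0); rewrite mulfV.
move: (Omega6 f z) ((J z).1) ((J z).2) => o x y y0 x0; rewrite [X in _ = X * _ / _]ee.
by field; rewrite x0 y0 e0.
Qed.

Lemma scale_I z : U z -> g1 z * g2 z * g2 z * g2 z * Dp (Dp (Dp (Dp f))) z = eps.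
Proof.
move=> Uz; rewrite -[Dp (Dp (Dp (Dp f)))]/(rel_I f) rel_IE // /g1 /g2 /scale1 /scale2.
have := J1_neq0 Uz; have := J2_neq0 Uz; move: ((J z).1) ((J z).2) => x y y0 x0.
by field; rewrite x0 y0.
Qed.

Lemma scale_H z : U z -> g1 z * g1 z * g1 z * g2 z * rel_H f z = 1.
Proof.
move=> Uz; rewrite -(rb_3 B Uz) /g1 /g2 /scale1 /scale2.
have := J1_neq0 Uz; have := J2_neq0 Uz; move: ((J z).1) ((J z).2) => x y y0 x0.
by field; rewrite x0 y0.
Qed.
End InvariantFormulas.

(** * From equal structure functions to a point equivalence *)

Section SmoothMaps.
Variables (R : realType).
Notation R2 := (R * R)%type.
Notation R3 := (R * R * R)%type.

Lemma smooth_pair (V W1 W2 : normedModType R) (A : set V) (g1 : V -> W1) (g2 : V -> W2) : open A ->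
  smooth A g1 -> smooth A g2 -> smooth A (fun z => (g1 z, g2 z)).
Proof.
move=> oA s1 s2.
apply: (@smooth_coind _ _ _ A (fun g => exists h1 h2, [/\ smooth A h1, smooth A h2 & g = fun z => (h1 z, h2 z)])) => //;
  last by exists g1, g2.
move=> _ [h1 [h2 [t1 t2 ->]]]; split=> [z Az|v].
  by apply: differentiable_pair; [exact: smooth_diff t1 Az|exact: smooth_diff t2 Az].
exists (fun z => ('D_v h1 z, 'D_v h2 z)).
  by exists (fun z => 'D_v h1 z), (fun z => 'D_v h2 z); split => //; exact: smooth_derive.
by move=> z Az; rewrite (derive_pair _ (smooth_diff t1 Az) (smooth_diff t2 Az)).
Qed.

Lemma smooth_fst (V W1 W2 : normedModType R) (A : set V) (g : V -> W1 * W2) : open A ->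
  smooth A g -> smooth A (fun z => (g z).1).
Proof.
move=> oA sg.
apply: (@smooth_coind _ _ _ A (fun h => exists2 g' : V -> W1 * W2, smooth A g' & h = fun z => (g' z).1)) => //;
  last by exists g.
move=> _ [g' sg' ->]; split=> [z Az|v].
  exact: (differentiable_comp (smooth_diff sg' Az) (derive_fst (g' z) 0).1).
exists (fun z => ('D_v g' z).1); first by exists (fun z => 'D_v g' z) => //; exact: smooth_derive.
move=> z Az; have dg := smooth_diff sg' Az; have [df _] := derive_fst (g' z) 0.
rewrite -[RHS]/('D_v (fst \o g') z) (deriveE v (differentiable_comp dg df)) diff_comp //=.
by rewrite -(deriveE _ df) -(deriveE _ dg) (derive_fst _ _).2.
Qed.

Lemma smooth_snd (V W1 W2 : normedModType R) (A : set V) (g : V -> W1 * W2) : open A ->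
  smooth A g -> smooth A (fun z => (g z).2).
Proof.
move=> oA sg.
apply: (@smooth_coind _ _ _ A (fun h => exists2 g' : V -> W1 * W2, smooth A g' & h = fun z => (g' z).2)) => //;
  last by exists g.
move=> _ [g' sg' ->]; split=> [z Az|v].
  exact: (differentiable_comp (smooth_diff sg' Az) (derive_snd (g' z) 0).1).
exists (fun z => ('D_v g' z).2); first by exists (fun z => 'D_v g' z) => //; exact: smooth_derive.
move=> z Az; have dg := smooth_diff sg' Az; have [df _] := derive_snd (g' z) 0.
rewrite -[RHS]/('D_v (snd \o g') z) (deriveE v (differentiable_comp dg df)) diff_comp //=.
by rewrite -(deriveE _ df) -(deriveE _ dg) (derive_snd _ _).2.
Qed.

Lemma smooth_comp3 (V : normedModType R) (A : set V) (B : set R3) (k : V -> R3) (g : R3 -> R) :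
  open A -> smooth A k -> smooth B g -> (forall z, A z -> B (k z)) -> smooth A (fun z => g (k z)).
Proof.
move=> oA sk sg AB.
have s1 := smooth_fst oA (smooth_fst oA sk); have s2 := smooth_snd oA (smooth_fst oA sk); have s3 := smooth_snd oA sk.
have E : eq_on A (fun z => g ((k z).1.1, (k z).1.2, (k z).2)) (fun z => g (k z)).
  by move=> z _; case: (k z) => [[]].
apply: (smooth_eq oA E); apply: sclass_smooth => //.
apply: (Scomp3 sg); do ?exact: Sbase.
by move=> z /AB; case: (k z) => [[]].
Qed.

Lemma smooth_comp2 (V : normedModType R) (A : set V) (B : set R2) (k : V -> R2) (g : R2 -> R) :
  open A -> smooth A k -> smooth B g -> (forall z, A z -> B (k z)) -> smooth A (fun z => g (k z)).
Proof.
move=> oA sk sg AB.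
have s1 := smooth_fst oA sk; have s2 := smooth_snd oA sk.
have E : eq_on A (fun z => g ((k z).1, (k z).2)) (fun z => g (k z)) by move=> z _; case: (k z).
apply: (smooth_eq oA E); apply: sclass_smooth => //.
apply: (Scomp2 sg); do ?exact: Sbase.
by move=> z /AB; case: (k z).
Qed.

Lemma open_preimage_smooth (V W : normedModType R) (A : set V) (B : set W) (k : V -> W) :
  open A -> smooth A k -> open B -> open (A `&` [set z | B (k z)]).
Proof.
move=> oA sk oB; rewrite openE => z [Az Bz].
apply: filterI; first exact: open_nbhs_nbhs.
by apply: (smooth_continuous sk Az); exact: open_nbhs_nbhs.
Qed.
End SmoothMaps.

Section FrameLinear.
Variables (R : realType).
Notation R3 := (R * R * R)%type.

Lemma frame_comp3 (f a b c : R3 -> R) (g : R3 -> R) z k : differentiable a z -> differentiable b z ->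
  differentiable c z -> differentiable g (a z, b z, c z) ->
  frame f k (fun z => g (a z, b z, c z)) z = frame f k a z * partial 0 g (a z, b z, c z)
    + frame f k b z * partial 1 g (a z, b z, c z) + frame f k c z * partial 2 g (a z, b z, c z).
Proof.
move=> da db dc dg; have H v := derive_comp3 v da db dc dg.
have P0 : partial 0 g (a z, b z, c z) = 'D_((1, 0, 0) : R3) g (a z, b z, c z) := erefl.
have P1 : partial 1 g (a z, b z, c z) = 'D_((0, 1, 0) : R3) g (a z, b z, c z) := erefl.
have P2 : partial 2 g (a z, b z, c z) = 'D_((0, 0, 1) : R3) g (a z, b z, c z) := erefl.
rewrite P0 P1 P2; move: H; move: ('D_((1, 0, 0) : R3) g _) ('D_((0, 1, 0) : R3) g _) ('D_((0, 0, 1) : R3) g _) => x y t H {P0 P1 P2}.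
have D1 := H (1, 0, 0); have D2 := H (0, 1, 0); have D3 := H (0, 0, 1).
case: k => [|[|[|[|[|k]]]]].
- have E u : frame f 0 u z = 'D_((1, 0, 0) : R3) u z + z.2 * 'D_((0, 1, 0) : R3) u z + f z * 'D_((0, 0, 1) : R3) u z by [].
  rewrite !E D1 D2 D3.
  move: ('D_((1, 0, 0) : R3) a z) ('D_((1, 0, 0) : R3) b z) ('D_((1, 0, 0) : R3) c z)
    ('D_((0, 1, 0) : R3) a z) ('D_((0, 1, 0) : R3) b z) ('D_((0, 1, 0) : R3) c z)
    ('D_((0, 0, 1) : R3) a z) ('D_((0, 0, 1) : R3) b z) ('D_((0, 0, 1) : R3) c z) => *; ring.
- have E u : frame f 1 u z = 'D_((0, 1, 0) : R3) u z + Dp f z * 'D_((0, 0, 1) : R3) u z by [].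
  rewrite !E D2 D3; move: (Dp f z)
    ('D_((0, 1, 0) : R3) a z) ('D_((0, 1, 0) : R3) b z) ('D_((0, 1, 0) : R3) c z)
    ('D_((0, 0, 1) : R3) a z) ('D_((0, 0, 1) : R3) b z) ('D_((0, 0, 1) : R3) c z) => *; ring.
- exact: D3.
- exact: D2.
- have E u : frame f 4 u z = 'D_((1, 0, 0) : R3) u z + z.2 * 'D_((0, 1, 0) : R3) u z by [].
  rewrite !E D1 D2.
  move: ('D_((1, 0, 0) : R3) a z) ('D_((1, 0, 0) : R3) b z) ('D_((1, 0, 0) : R3) c z)
    ('D_((0, 1, 0) : R3) a z) ('D_((0, 1, 0) : R3) b z) ('D_((0, 1, 0) : R3) c z) => *; ring.
- by rewrite /frame /= !nth_nil !mul0r !addr0.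
Qed.

Lemma nP_comp3 g2 (a b c g : R3 -> R) z : differentiable a z -> differentiable b z ->
  differentiable c z -> differentiable g (a z, b z, c z) ->
  nP g2 (fun z => g (a z, b z, c z)) z = nP g2 a z * partial 0 g (a z, b z, c z)
    + nP g2 b z * partial 1 g (a z, b z, c z) + nP g2 c z * partial 2 g (a z, b z, c z).
Proof.
move=> da db dc dg; have H := frame_comp3 (fun=> 0) 2 da db dc dg.
have E u : nP g2 u z = g2 z * frame (fun=> 0) 2 u z by [].
rewrite !E H; move: (frame _ _ _ _) (frame _ _ b _) (frame _ _ c _) (partial 0 _ _) (partial 1 _ _) (partial 2 _ _) => *; ring.
Qed.

Lemma nX_comp3 f g1 (a b c g : R3 -> R) z : differentiable a z -> differentiable b z ->
  differentiable c z -> differentiable g (a z, b z, c z) ->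
  nX f g1 (fun z => g (a z, b z, c z)) z = nX f g1 a z * partial 0 g (a z, b z, c z)
    + nX f g1 b z * partial 1 g (a z, b z, c z) + nX f g1 c z * partial 2 g (a z, b z, c z).
Proof.
move=> da db dc dg; have H := frame_comp3 f 0 da db dc dg.
have E u : nX f g1 u z = g1 z * frame f 0 u z by [].
rewrite !E H; move: (frame _ _ _ _) (frame _ _ b _) (frame _ _ c _) (partial 0 _ _) (partial 1 _ _) (partial 2 _ _) => *; ring.
Qed.

Lemma nY_comp3 f iota g1 g2 (a b c g : R3 -> R) z : differentiable a z -> differentiable b z ->
  differentiable c z -> differentiable g (a z, b z, c z) ->
  nY f iota g1 g2 (fun z => g (a z, b z, c z)) z = nY f iota g1 g2 a z * partial 0 g (a z, b z, c z)
    + nY f iota g1 g2 b z * partial 1 g (a z, b z, c z) + nY f iota g1 g2 c z * partial 2 g (a z, b z, c z).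
Proof.
move=> da db dc dg; have H0 := frame_comp3 f 0 da db dc dg.
have H1 := frame_comp3 f 1 da db dc dg; have H2 := frame_comp3 f 2 da db dc dg.
have E u : nY f iota g1 g2 u z = g1 z * g2 z * (frame f 1 u z + Dp iota z / 5 * frame f 0 u z
  + (Dp f z + Dt f iota z) * frame f 2 u z) by [].
rewrite !E H0 H1 H2; move: (frame f 0 a z) (frame f 0 b z) (frame f 0 c z) (frame f 1 a z) (frame f 1 b z) (frame f 1 c z)
  (frame f 2 a z) (frame f 2 b z) (frame f 2 c z) (partial 0 _ _) (partial 1 _ _) (partial 2 _ _)
  (Dp iota z) (Dp f z) (Dt f iota z) => *; ring.
Qed.
End FrameLinear.

(** * The invariant frame in the coordinates (a, b, c) *)

Section CoordinateFrame.
Variables (R : realType).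
Notation R3 := (R * R * R)%type.
Variables (s : bool) (U W : set R3) (f : R3 -> R) (J : R3 -> R * R) (k : R3 -> R3).
Hypothesis B : regular_branch s U f J.
Hypotheses (oW : open W) (sk : smooth W k).
Let oU := rb_open B.
Let iota := logI f.
Let eta := logH f.
Let g1 := scale1 J.
Let g2 := scale2 J.
Let G : gauge U f iota eta g1 g2 := branch_gauge B.
Let eps : R := (-1) ^+ s.
Let a := cX f iota eta g1.
Let b := cY f iota eta g1 g2.
Let c := cP iota eta g2.
Let X := nX f g1.
Let Y := nY f iota g1 g2.
Let P := nP g2.
Let h z : R3 := (a z, b z, c z).
Hypothesis kU : forall w, W w -> U (k w).
Hypothesis hk : forall w, W w -> h (k w) = w.
Hypothesis kh : forall z, U z -> k (h z) = z.

Let sa : smooth U a := cX_smooth oU G.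
Let sb : smooth U b := cY_smooth oU G.
Let sc : smooth U c := cP_smooth oU G.
Let sh : smooth U h := smooth_pair oU (smooth_pair oU sa sb) sc.
Let dX : derivation U X := nX_der oU G.
Let dY : derivation U Y := nY_der oU G.
Let dP : derivation U P := nP_der oU G.

Let comp_smooth (F : R3 -> R) : smooth U F -> smooth W (fun w => F (k w)).
Proof. by move=> sF; exact: (smooth_comp3 oW sk sF kU). Qed.

(** The components are prescribed only up to equality on W, so that components computed from one
    equation can be used to describe the frame of another. *)
Variables xa xb xc pa pb pc ya yb yc m4 m5 m6 : R3 -> R.
Hypotheses (xaE : eq_on W xa (fun w => X a (k w))) (xbE : eq_on W xb (fun w => X b (k w)))
  (xcE : eq_on W xc (fun w => X c (k w))) (paE : eq_on W pa (fun w => P a (k w)))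
  (pbE : eq_on W pb (fun w => P b (k w))) (pcE : eq_on W pc (fun w => P c (k w)))
  (yaE : eq_on W ya (fun w => Y a (k w))) (ybE : eq_on W yb (fun w => Y b (k w)))
  (ycE : eq_on W yc (fun w => Y c (k w))) (n4E : eq_on W m4 (fun w => n4 f iota g1 (k w)))
  (n5E : eq_on W m5 (fun w => n5 f iota g1 g2 (k w))) (n6E : eq_on W m6 (fun w => n6 iota g2 (k w))).

Let sym (g g' : R3 -> R) V : eq_on V g g' -> eq_on V g' g.
Proof. by move=> E z Vz; rewrite E. Qed.

Let comps_smooth i : (i < 12)%N -> smooth W (nth (fun=> 0) [:: xa; xb; xc; pa; pb; pc; ya; yb; yc; m4; m5; m6] i).
Proof.
case: i => [|[|[|[|[|[|[|[|[|[|[|[|]]]]]]]]]]]] // _.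
- exact: (smooth_eq oW (sym xaE) (comp_smooth (der_smooth dX sa))).
- exact: (smooth_eq oW (sym xbE) (comp_smooth (der_smooth dX sb))).
- exact: (smooth_eq oW (sym xcE) (comp_smooth (der_smooth dX sc))).
- exact: (smooth_eq oW (sym paE) (comp_smooth (der_smooth dP sa))).
- exact: (smooth_eq oW (sym pbE) (comp_smooth (der_smooth dP sb))).
- exact: (smooth_eq oW (sym pcE) (comp_smooth (der_smooth dP sc))).
- exact: (smooth_eq oW (sym yaE) (comp_smooth (der_smooth dY sa))).
- exact: (smooth_eq oW (sym ybE) (comp_smooth (der_smooth dY sb))).
- exact: (smooth_eq oW (sym ycE) (comp_smooth (der_smooth dY sc))).
- exact: (smooth_eq oW (sym n4E) (comp_smooth (n4_smooth oU G))).
- exact: (smooth_eq oW (sym n5E) (comp_smooth (n5_smooth oU G))).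
- exact: (smooth_eq oW (sym n6E) (comp_smooth (n6_smooth oU G))).
Qed.

Section Local.
Variables (V : set R3).
Hypotheses (oV : open V) (VW : V `<=` W).

Let dh (g : R3 -> R) w : smooth V g -> V w -> [/\ differentiable a (k w), differentiable b (k w),
  differentiable c (k w) & differentiable g (h (k w))].
Proof.
move=> sg Vw; have Uk := kU (VW Vw); rewrite hk; last exact: VW.
by split; [exact: smooth_diff sa Uk|exact: smooth_diff sb Uk|exact: smooth_diff sc Uk|exact: smooth_diff sg Vw].
Qed.

Lemma push_X (g : R3 -> R) : smooth V g -> eq_on V (vfield xa xb xc g) (fun w => X (g \o h) (k w)).
Proof.
move=> sg w Vw; have [da db dc dg] := dh sg Vw; have H := nX_comp3 f g1 da db dc dg.
rewrite -[RHS]/(nX f g1 (fun z => g (a z, b z, c z)) (k w)) H -[(_, _, _)]/(h (k w)) hk /vfield; last exact: VW.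
by rewrite xaE ?xbE ?xcE //; exact: VW.
Qed.

Lemma push_P (g : R3 -> R) : smooth V g -> eq_on V (vfield pa pb pc g) (fun w => P (g \o h) (k w)).
Proof.
move=> sg w Vw; have [da db dc dg] := dh sg Vw; have H := nP_comp3 g2 da db dc dg.
rewrite -[RHS]/(nP g2 (fun z => g (a z, b z, c z)) (k w)) H -[(_, _, _)]/(h (k w)) hk /vfield; last exact: VW.
by rewrite paE ?pbE ?pcE //; exact: VW.
Qed.

Lemma push_Y (g : R3 -> R) : smooth V g -> eq_on V (vfield ya yb yc g) (fun w => Y (g \o h) (k w)).
Proof.
move=> sg w Vw; have [da db dc dg] := dh sg Vw; have H := nY_comp3 f iota g1 g2 da db dc dg.
rewrite -[RHS]/(nY f iota g1 g2 (fun z => g (a z, b z, c z)) (k w)) H -[(_, _, _)]/(h (k w)) hk /vfield; last exact: VW.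
by rewrite yaE ?ybE ?ycE //; exact: VW.
Qed.

Let UV := U `&` [set z | V (h z)].
Let oUV : open UV. Proof. exact: open_preimage_smooth. Qed.
Let UVU : UV `<=` U. Proof. by move=> ? []. Qed.
Let GV := gauge_sub UVU G.
Let UVk w : V w -> UV (k w).
Proof. by move=> Vw; split; [exact: kU (VW Vw)|rewrite /= hk //; exact: VW]. Qed.
Let sgh (g : R3 -> R) : smooth V g -> smooth UV (g \o h).
Proof. by move=> sg; apply: (smooth_comp3 oUV (smooth_sub UVU sh) sg) => z []. Qed.

(** Iterates a push-forward. The inner result is known only on V, so the outer derivation acts on
    the part of U that lies over V. *)
Let second (d v : (R3 -> R) -> R3 -> R) (g vf : R3 -> R) : smooth V g -> derivation UV d -> smooth V vf ->
  eq_on V vf (fun w => v (g \o h) (k w)) ->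
  forall vd : (R3 -> R) -> R3 -> R, (forall g, smooth V g -> eq_on V (vd g) (fun w => d (g \o h) (k w))) ->
  eq_on V (vd vf) (fun w => d (v (g \o h)) (k w)).
Proof.
move=> sg Dd svf E vd Hd w Vw; rewrite Hd //.
apply: (der_eq Dd (sgh svf) _ (UVk Vw)) => z [Uz Vz] /=.
by rewrite E //= kh.
Qed.

Let vx (g : R3 -> R) : smooth V g -> smooth V (vfield xa xb xc g).
Proof.
have s_ i (hi : (i < 12)%N) := smooth_sub VW (comps_smooth hi).
exact: (der_smooth (vfield_der oV (s_ 0 isT) (s_ 1 isT) (s_ 2 isT)))%N.
Qed.
Let vp (g : R3 -> R) : smooth V g -> smooth V (vfield pa pb pc g).
Proof.
have s_ i (hi : (i < 12)%N) := smooth_sub VW (comps_smooth hi).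
exact: (der_smooth (vfield_der oV (s_ 3 isT) (s_ 4 isT) (s_ 5 isT)))%N.
Qed.
Let vy (g : R3 -> R) : smooth V g -> smooth V (vfield ya yb yc g).
Proof.
have s_ i (hi : (i < 12)%N) := smooth_sub VW (comps_smooth hi).
exact: (der_smooth (vfield_der oV (s_ 6 isT) (s_ 7 isT) (s_ 8 isT)))%N.
Qed.

Lemma push_px (g : R3 -> R) : smooth V g -> eq_on V
    (fun z => vfield pa pb pc (vfield xa xb xc g) z - vfield xa xb xc (vfield pa pb pc g) z)
    (fun z => vfield ya yb yc g z - 3 / 8 * z.2 * vfield xa xb xc g z - z.1.1 * vfield pa pb pc g z / 8).
Proof.
move=> sg w Vw; have H := gauge_px oUV GV (sgh sg) (UVk Vw).
rewrite (second sg (nP_der oUV GV) (vx sg) (push_X sg) push_P Vw).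
rewrite (second sg (nX_der oUV GV) (vp sg) (push_P sg) push_X Vw).
rewrite push_X // push_Y // push_P // -(congr1 (fun q : R3 => q.2) (hk (VW Vw))) -(congr1 (fun q : R3 => q.1.1) (hk (VW Vw))).
exact: H.
Qed.

Lemma push_py (g : R3 -> R) : smooth V g -> eq_on V
    (fun z => vfield pa pb pc (vfield ya yb yc g) z - vfield ya yb yc (vfield pa pb pc g) z)
    (fun z => m5 z * vfield pa pb pc g z + m6 z / 5 * vfield xa xb xc g z
       - z.2 * vfield ya yb yc g z / 4 - z.1.2 * vfield pa pb pc g z / 8).
Proof.
move=> sg w Vw; have H := gauge_py oUV GV (sgh sg) (UVk Vw).
rewrite (second sg (nP_der oUV GV) (vy sg) (push_Y sg) push_P Vw).
rewrite (second sg (nY_der oUV GV) (vp sg) (push_P sg) push_Y Vw).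
rewrite push_X // push_Y // push_P // -(congr1 (fun q : R3 => q.2) (hk (VW Vw))) -(congr1 (fun q : R3 => q.1.2) (hk (VW Vw))).
rewrite n5E ?n6E; [exact: H|exact: VW|exact: VW].
Qed.

Lemma push_xy (g : R3 -> R) : smooth V g -> eq_on V
    (fun z => vfield xa xb xc (vfield ya yb yc g) z - vfield ya yb yc (vfield xa xb xc g) z)
    (fun z => m4 z * vfield pa pb pc g z + m5 z / 5 * vfield xa xb xc g z
       - z.1.1 * vfield ya yb yc g z / 4 + 3 / 8 * z.1.2 * vfield xa xb xc g z).
Proof.
move=> sg w Vw; have H := gauge_xy oUV GV (sgh sg) (UVk Vw).
rewrite (second sg (nX_der oUV GV) (vy sg) (push_Y sg) push_X Vw).
rewrite (second sg (nY_der oUV GV) (vx sg) (push_X sg) push_Y Vw).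
rewrite push_X // push_Y // push_P // -(congr1 (fun q : R3 => q.1.1) (hk (VW Vw))) -(congr1 (fun q : R3 => q.1.2) (hk (VW Vw))).
rewrite n4E ?n5E; [exact: H|exact: VW|exact: VW].
Qed.
End Local.

Let UW := U `&` [set z | W (h z)].
Let oUW : open UW. Proof. exact: open_preimage_smooth. Qed.
Let UWU : UW `<=` U. Proof. by move=> ? []. Qed.
Let GW := gauge_sub UWU G.
Let UWk w : W w -> UW (k w).
Proof. by move=> Ww; split; [exact: kU|rewrite /= hk]. Qed.

Let pull (d vd : (R3 -> R) -> R3 -> R) (F F' : R3 -> R) : derivation UW d ->
  (forall g, smooth W g -> eq_on W (vd g) (fun w => d (g \o h) (k w))) ->
  smooth U F -> eq_on W F' (fun w => F (k w)) -> eq_on W (vd F') (fun w => d F (k w)).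
Proof.
move=> Dd Hd sF E w Ww; have sF' : smooth W F' := smooth_eq oW (sym E) (comp_smooth sF).
rewrite Hd //; apply/esym; apply: (der_eq Dd (smooth_sub UWU sF) _ (UWk Ww)) => z [Uz Wz] /=.
by rewrite E // kh.
Qed.

Lemma pull_X (F F' : R3 -> R) : smooth U F -> eq_on W F' (fun w => F (k w)) -> eq_on W (vfield xa xb xc F') (fun w => X F (k w)).
Proof. exact: (pull (nX_der oUW GW) (push_X (@subset_refl _ W))). Qed.
Lemma pull_P (F F' : R3 -> R) : smooth U F -> eq_on W F' (fun w => F (k w)) -> eq_on W (vfield pa pb pc F') (fun w => P F (k w)).
Proof. exact: (pull (nP_der oUW GW) (push_P (@subset_refl _ W))). Qed.
Lemma pull_Y (F F' : R3 -> R) : smooth U F -> eq_on W F' (fun w => F (k w)) -> eq_on W (vfield ya yb yc F') (fun w => Y F (k w)).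
Proof. exact: (pull (nY_der oUW GW) (push_Y (@subset_refl _ W))). Qed.

Let aE w : W w -> w.1.1 = a (k w). Proof. by move=> /hk {1}<-. Qed.
Let bE w : W w -> w.1.2 = b (k w). Proof. by move=> /hk {1}<-. Qed.
Let cE w : W w -> w.2 = c (k w). Proof. by move=> /hk {1}<-. Qed.

Let q1W : eq_on W (fun z => (pb z - (yc z - 3 / 8 * z.1.2 * z.2 + m6 z * z.1.1 / 5 + m5 z * z.2)) / 8)
  (fun w => q1 f iota eta g1 g2 (k w)).
Proof. by move=> w Ww; rewrite pbE // ycE // n6E // n5E // (aE Ww) (bE Ww) (cE Ww). Qed.
Let q2W : eq_on W (fun z => (xb z - z.1.1 * z.1.2 / 8 - m4 z * z.2 - m5 z * z.1.1 / 5 - ya z) / 8)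
  (fun w => q2 f iota eta g1 g2 (k w)).
Proof. by move=> w Ww; rewrite xbE // yaE // n4E // n5E // (aE Ww) (bE Ww) (cE Ww). Qed.

Lemma coordinate_frame : frame_structure eps W xa xb xc pa pb pc ya yb yc m4 m5 m6.
Proof.
have s4 := n4_smooth oU G; have s5 := n5_smooth oU G; have s6 := n6_smooth oU G.
split; [exact: comps_smooth|by move=> V g oV VW sg; exact: push_px|by move=> V g oV VW sg; exact: push_py|
  by move=> V g oV VW sg; exact: push_xy| | | | | |].
- move=> w Ww; rewrite paE // xcE // n5E // (aE Ww) (bE Ww) (cE Ww); exact: (gauge_pa oU G (kU Ww)).
- move=> w Ww; rewrite pcE // n4E // n6E // (cE Ww); exact: (frame_pc B (kU Ww)).
- move=> w Ww; have e := q1W Ww; rewrite /= in e; rewrite e (pull_X s6 n6E Ww) (pull_P s5 n5E Ww) n6E // n5E // (aE Ww) (cE Ww).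
  exact: (gauge_q1 oU G (kU Ww)).
- move=> w Ww; have e := q2W Ww; rewrite /= in e; rewrite e (pull_X s5 n5E Ww) (pull_P s4 n4E Ww) n4E // n5E // (aE Ww) (cE Ww).
  exact: (gauge_q2 oU G (kU Ww)).
- move=> w Ww; have e := q1W Ww; rewrite /= in e.
  rewrite (pull_P (q1_smooth oU G) q1W Ww) e (pull_Y s6 n6E Ww) n6E // n5E // (bE Ww) (cE Ww).
  by have := gauge_cp oU G (kU Ww); rewrite (scale_I B (kU Ww)).
- move=> w Ww; have e := q2W Ww; rewrite /= in e.
  rewrite (pull_X (q2_smooth oU G) q2W Ww) e (pull_Y s4 n4E Ww) n4E // n5E // (aE Ww) (bE Ww).
  by have := gauge_cx oU G (kU Ww); rewrite (scale_H B (kU Ww)).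
Qed.
End CoordinateFrame.

(** * Matching two equations with the same structure functions *)

Section Match.
Variables (R : realType).
Notation R3 := (R * R * R)%type.

Record chart (s : bool) (U W : set R3) (f : R3 -> R) (J : R3 -> R * R) (k : R3 -> R3) : Prop := Chart {
  ch_branch : regular_branch s U f J;
  ch_open : open W;
  ch_smooth : smooth W k;
  ch_U : forall w, W w -> U (k w);
  ch_hk : forall w, W w -> coords f J (k w) = w;
  ch_kh : forall z, U z -> k (coords f J z) = z }.

Lemma chart_sub s U W V f J k : open V -> V `<=` W -> chart s U W f J k -> chart s U V f J k.
Proof.
move=> oV VW [? _ sk kU hk ?]; split=> //; first exact: smooth_sub sk.
  by move=> w /VW; exact: kU.
by move=> w /VW; exact: hk.
Qed.

Lemma near_openP (V : normedModType R) (a : V) (Q : V -> Prop) :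
  (\forall z \near a, Q z) -> exists A : set V, [/\ open A, A a & forall z, A z -> Q z].
Proof.
move=> H; have : nbhs a [set z | Q z] by [].
by rewrite nbhsE => -[A [oA Aa] AQ]; exists A.
Qed.

Lemma local_chart s f m J : smooth_at f m -> root_branch s f m J -> local_diffeo (coords f J) m ->
  exists U W k, [/\ chart s U W f J k, U m & W (coords f J m)].
Proof.
move=> sf bJ [_ [k [[A [oA Am] sA] kh hk]]].
have [U0 U0m B0] := root_branch_regular sf bJ.
have [V1 [oV1 V1m kh1]] := near_openP kh; have [W1 [oW1 W1m hk1]] := near_openP hk.
pose U := U0 `&` V1; pose W0 := A `&` W1.
have oU : open U by apply: openI => //; exact: rb_open B0.
have oW0 : open W0 by exact: openI.
have sk0 : smooth W0 k by apply: smooth_sub (sA : smooth A k) => ? [].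
have oW := open_preimage_smooth oW0 sk0 oU; set W := W0 `&` _ in oW.
exists U, W, k; split => //; last first.
  by split; [split|rewrite /= kh1].
split => //.
- by apply: regular_branch_sub B0 => // ? [].
- by apply: smooth_sub sk0 => ? [].
- by move=> w [].
- by move=> w [[_ /hk1]].
- by move=> z [_ /kh1].
Qed.

Section TwoEquations.
Variables (s : bool) (U1 U2 W : set R3) (f1 f2 : R3 -> R) (J1 J2 : R3 -> R * R) (k1 k2 : R3 -> R3).
Hypotheses (C1 : chart s U1 W f1 J1 k1) (C2 : chart s U2 W f2 J2 k2).
Let B1 := ch_branch C1. Let B2 := ch_branch C2.
Let oU1 := rb_open B1. Let oU2 := rb_open B2. Let oW := ch_open C1.
Let G1 := branch_gauge B1. Let G2 := branch_gauge B2.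

Local Notation a1 := (cX f1 (logI f1) (logH f1) (scale1 J1)).
Local Notation b1 := (cY f1 (logI f1) (logH f1) (scale1 J1) (scale2 J1)).
Local Notation c1 := (cP (logI f1) (logH f1) (scale2 J1)).
Local Notation a2 := (cX f2 (logI f2) (logH f2) (scale1 J2)).
Local Notation b2 := (cY f2 (logI f2) (logH f2) (scale1 J2) (scale2 J2)).
Local Notation c2 := (cP (logI f2) (logH f2) (scale2 J2)).
Local Notation X1 := (nX f1 (scale1 J1)).
Local Notation Y1 := (nY f1 (logI f1) (scale1 J1) (scale2 J1)).
Local Notation P1 := (nP (scale2 J1)).
Local Notation X2 := (nX f2 (scale1 J2)).
Local Notation Y2 := (nY f2 (logI f2) (scale1 J2) (scale2 J2)).
Local Notation P2 := (nP (scale2 J2)).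

Definition structure_tuple f J z : 8.-tuple R :=
    [tuple bar J 4 1 (rel_Hij f 2 0) z;
           bar J 3 2 (rel_Hij f 1 1) z;
           bar J 2 3 (rel_Hij f 0 2) z;
           bar J 2 2 (rel_Kij f 1 0) z;
           bar J 1 3 (rel_Kij f 0 1) z;
           bar J (- 4) 5 (Omega6 f) z;
           bar J (- 2) 4 (Omega5_10 f) z;
           bar J 0 3 (Omega4_20 f) z].

Hypothesis same : forall w, W w -> structure_tuple f1 J1 (k1 w) = structure_tuple f2 J2 (k2 w).

Let k1U w : W w -> U1 (k1 w) := ch_U C1 (w := w).
Let k2U w : W w -> U2 (k2 w) := ch_U C2 (w := w).
Let h1 z := (a1 z, b1 z, c1 z). Let h2 z := (a2 z, b2 z, c2 z).
Let hk1 w : W w -> h1 (k1 w) = w.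
Proof. by move=> Ww; rewrite -[RHS](ch_hk C1 Ww) (coordsE B1) //; exact: k1U. Qed.
Let hk2 w : W w -> h2 (k2 w) = w.
Proof. by move=> Ww; rewrite -[RHS](ch_hk C2 Ww) (coordsE B2) //; exact: k2U. Qed.
Let kh1 z : U1 z -> k1 (h1 z) = z.
Proof. by move=> Uz; rewrite -[RHS](ch_kh C1 Uz) (coordsE B1). Qed.
Let kh2 z : U2 z -> k2 (h2 z) = z.
Proof. by move=> Uz; rewrite -[RHS](ch_kh C2 Uz) (coordsE B2). Qed.

Let same_abc w : W w -> [/\ a1 (k1 w) = a2 (k2 w), b1 (k1 w) = b2 (k2 w) & c1 (k1 w) = c2 (k2 w)].
Proof.
move=> Ww; have E := etrans (hk1 Ww) (esym (hk2 Ww)).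
split; [exact: (congr1 (fun q : R3 => q.1.1) E)|exact: (congr1 (fun q : R3 => q.1.2) E)|exact: (congr1 (fun q : R3 => q.2) E)].
Qed.

Let same8 w : W w ->
  [/\ X1 a1 (k1 w) = X2 a2 (k2 w), X1 b1 (k1 w) = X2 b2 (k2 w), Y1 b1 (k1 w) = Y2 b2 (k2 w) &
      X1 c1 (k1 w) = X2 c2 (k2 w) /\ Y1 c1 (k1 w) = Y2 c2 (k2 w)] /\
  [/\ n6 (logI f1) (scale2 J1) (k1 w) = n6 (logI f2) (scale2 J2) (k2 w),
      n5 f1 (logI f1) (scale1 J1) (scale2 J1) (k1 w) = n5 f2 (logI f2) (scale1 J2) (scale2 J2) (k2 w) &
      n4 f1 (logI f1) (scale1 J1) (k1 w) = n4 f2 (logI f2) (scale1 J2) (k2 w)].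
Proof.
move=> Ww; have [Ea Eb Ec] := same_abc Ww; have E i := congr1 (fun t : 8.-tuple R => nth 0 t i) (same Ww).
have u1 := k1U Ww; have u2 := k2U Ww.
have e0 : (-1) ^+ s != 0 :> R by rewrite signr_eq0.
have E0 : bar J1 4 1 (rel_Hij f1 2 0) (k1 w) = bar J2 4 1 (rel_Hij f2 2 0) (k2 w) := E 0%N.
have E1 : bar J1 3 2 (rel_Hij f1 1 1) (k1 w) = bar J2 3 2 (rel_Hij f2 1 1) (k2 w) := E 1%N.
have E2 : bar J1 2 3 (rel_Hij f1 0 2) (k1 w) = bar J2 2 3 (rel_Hij f2 0 2) (k2 w) := E 2%N.
have E3 : bar J1 2 2 (rel_Kij f1 1 0) (k1 w) = bar J2 2 2 (rel_Kij f2 1 0) (k2 w) := E 3%N.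
have E4 : bar J1 1 3 (rel_Kij f1 0 1) (k1 w) = bar J2 1 3 (rel_Kij f2 0 1) (k2 w) := E 4%N.
have E5 : bar J1 (- 4) 5 (Omega6 f1) (k1 w) = bar J2 (- 4) 5 (Omega6 f2) (k2 w) := E 5%N.
have E6 : bar J1 (- 2) 4 (Omega5_10 f1) (k1 w) = bar J2 (- 2) 4 (Omega5_10 f2) (k2 w) := E 6%N.
have E7 : bar J1 0 3 (Omega4_20 f1) (k1 w) = bar J2 0 3 (Omega4_20 f2) (k2 w) := E 7%N.
have cancel (x y q a b a' b' : R) : x + q * a * b = y + q * a' * b' -> a = a' -> b = b' -> x = y.
  by move=> + aa bb; rewrite aa bb => /addIr.
split; split.
- exact: (cancel _ _ _ _ _ _ _ (etrans (etrans (esym (bar_H20 B1 u1)) E0) (bar_H20 B2 u2)) Ea Ea).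
- exact: (cancel _ _ _ _ _ _ _ (etrans (etrans (esym (bar_H11 B1 u1)) E1) (bar_H11 B2 u2)) Ea Eb).
- exact: (cancel _ _ _ _ _ _ _ (etrans (etrans (esym (bar_H02 B1 u1)) E2) (bar_H02 B2 u2)) Eb Eb).
- split; first exact: (cancel _ _ _ _ _ _ _ (etrans (etrans (esym (bar_K10 B1 u1)) E3) (bar_K10 B2 u2)) Ea Ec).
  exact: (cancel _ _ _ _ _ _ _ (etrans (etrans (esym (bar_K01 B1 u1)) E4) (bar_K01 B2 u2)) Eb Ec).
- exact: (mulfI e0 (etrans (etrans (esym (bar_Omega6 B1 u1)) E5) (bar_Omega6 B2 u2))).
- exact: (mulfI e0 (etrans (etrans (esym (bar_Omega5 B1 u1)) E6) (bar_Omega5 B2 u2))).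
- exact: (mulfI e0 (etrans (etrans (esym (bar_Omega4 B1 u1)) E7) (bar_Omega4 B2 u2))).
Qed.

Let same_pc w : W w -> P1 c1 (k1 w) = P2 c2 (k2 w).
Proof.
move=> Ww; have [_ [e6 e5 e4]] := same8 Ww; have [_ _ Ec] := same_abc Ww.
have cong (e x x' y y' z z' : R) : x = x' -> y = y' -> z = z' -> e * x + y / 5 - 7 / 8 * z * z = e * x' + y' / 5 - 7 / 8 * z' * z'.
  by move=> -> -> ->.
exact: (etrans (frame_pc B1 (k1U Ww)) (etrans (cong _ _ _ _ _ _ _ e4 e6 Ec) (esym (frame_pc B2 (k2U Ww))))).
Qed.
Let same_pa w : W w -> P1 a1 (k1 w) = P2 a2 (k2 w).
Proof.
move=> Ww; have [[_ _ _ [exc _]] [e6 e5 e4]] := same8 Ww; have [Ea Eb Ec] := same_abc Ww.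
have cong (x x' y y' z z' a a' c c' : R) : x = x' -> y = y' -> z = z' -> a = a' -> c = c' ->
  x + y + 24 / 5 * z - a * c / 2 = x' + y' + 24 / 5 * z' - a' * c' / 2 by move=> -> -> -> -> ->.
exact: (etrans (gauge_pa oU1 G1 (k1U Ww)) (etrans (cong _ _ _ _ _ _ _ _ _ _ exc Eb e5 Ea Ec) (esym (gauge_pa oU2 G2 (k2U Ww))))).
Qed.

Let F1 := @coordinate_frame R s U1 W f1 J1 k1 B1 oW (ch_smooth C1) k1U hk1 kh1 _ _ _ _ _ _ _ _ _ _ _ _
  (fun _ _ => erefl) (fun _ _ => erefl) (fun _ _ => erefl) (fun _ _ => erefl) (fun _ _ => erefl) (fun _ _ => erefl)
  (fun _ _ => erefl) (fun _ _ => erefl) (fun _ _ => erefl) (fun _ _ => erefl) (fun _ _ => erefl) (fun _ _ => erefl).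

Let xa w := X1 a1 (k1 w). Let xb w := X1 b1 (k1 w). Let xc w := X1 c1 (k1 w).
Let pa w := P1 a1 (k1 w). Let pc w := P1 c1 (k1 w).
Let yb w := Y1 b1 (k1 w). Let yc w := Y1 c1 (k1 w).
Let exa : eq_on W xa (fun w => X2 a2 (k2 w)). Proof. by move=> w /same8[[]]. Qed.
Let exb : eq_on W xb (fun w => X2 b2 (k2 w)). Proof. by move=> w /same8[[]]. Qed.
Let exc : eq_on W xc (fun w => X2 c2 (k2 w)). Proof. by move=> w /same8[[_ _ _ []]]. Qed.
Let eyb : eq_on W yb (fun w => Y2 b2 (k2 w)). Proof. by move=> w /same8[[]]. Qed.
Let eyc : eq_on W yc (fun w => Y2 c2 (k2 w)). Proof. by move=> w /same8[[_ _ _ []]]. Qed.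

(** The frame of the second equation is described by the components of the first wherever these are
    known to agree. What remains free is P b and Y a, as required by [frame_structure_unique]. *)
Let F2 := @coordinate_frame R s U2 W f2 J2 k2 B2 oW (ch_smooth C2) k2U hk2 kh2 _ _ _ _ _ _ _ _ _ _ _ _
  exa exb exc same_pa (fun _ _ => erefl) same_pc (fun _ _ => erefl) eyb eyc
  (fun w Ww => (let: conj _ (And3 _ _ e) := same8 Ww in e))
  (fun w Ww => (let: conj _ (And3 _ e _) := same8 Ww in e))
  (fun w Ww => (let: conj _ (And3 e _ _) := same8 Ww in e)).

Let same_pb w : W w -> P1 b1 (k1 w) = P2 b2 (k2 w).
Proof. by move=> Ww; have [H _] := frame_structure_unique oW F1 F2; exact: H. Qed.

Definition matching z := k2 (coords f1 J1 z).

Lemma matching_X F : smooth U2 F -> forall z, U1 z -> W (coords f1 J1 z) ->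
  X1 (F \o matching) z = X2 F (matching z).
Proof.
move=> sF z Uz Wz.
have sg : smooth W (fun w => F (k2 w)) := smooth_comp3 oW (ch_smooth C2) sF k2U.
have E1 := @push_X R s U1 W f1 J1 k1 B1 k1U hk1 xa xb xc (fun _ _ => erefl) (fun _ _ => erefl) (fun _ _ => erefl)
  W (@subset_refl _ W) _ sg _ Wz.
have E2 := @pull_X R s U2 W f2 J2 k2 B2 oW (ch_smooth C2) k2U hk2 kh2 xa xb xc exa exb exc F _ sF (fun _ _ => erefl) _ Wz.
rewrite /= in E1 E2; rewrite E2 in E1; rewrite /matching [RHS]E1 (ch_kh C1 Uz).
have oV := open_preimage_smooth oU1 (smooth_pair oU1 (smooth_pair oU1 (cX_smooth oU1 G1) (cY_smooth oU1 G1)) (cP_smooth oU1 G1)) oW.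
set V := U1 `&` _ in oV.
have Vz : V z by split=> //=; move: Wz; rewrite (coordsE B1).
have VU : V `<=` U1 by move=> ? [].
apply/esym; apply: (der_eq (nX_der oV (gauge_sub VU G1)) _ _ Vz) => [|y [Uy _] /=]; last by rewrite -(coordsE B1).
apply: (smooth_comp3 oV _ sg) => [|y []//].
apply: (smooth_sub VU); exact: (smooth_pair oU1 (smooth_pair oU1 (cX_smooth oU1 G1) (cY_smooth oU1 G1)) (cP_smooth oU1 G1)).
Qed.

Lemma matching_P F : smooth U2 F -> forall z, U1 z -> W (coords f1 J1 z) ->
  P1 (F \o matching) z = P2 F (matching z).
Proof.
move=> sF z Uz Wz.
have sg : smooth W (fun w => F (k2 w)) := smooth_comp3 oW (ch_smooth C2) sF k2U.
have epb : eq_on W (fun w => P1 b1 (k1 w)) (fun w => P2 b2 (k2 w)) by move=> w; exact: same_pb.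
have E1 := @push_P R s U1 W f1 J1 k1 B1 k1U hk1 pa (fun w => P1 b1 (k1 w)) pc (fun _ _ => erefl) (fun _ _ => erefl) (fun _ _ => erefl)
  W (@subset_refl _ W) _ sg _ Wz.
have E2 := @pull_P R s U2 W f2 J2 k2 B2 oW (ch_smooth C2) k2U hk2 kh2 pa (fun w => P1 b1 (k1 w)) pc same_pa epb same_pc F _ sF (fun _ _ => erefl) _ Wz.
rewrite /= in E1 E2; rewrite E2 in E1; rewrite /matching [RHS]E1 (ch_kh C1 Uz).
have oV := open_preimage_smooth oU1 (smooth_pair oU1 (smooth_pair oU1 (cX_smooth oU1 G1) (cY_smooth oU1 G1)) (cP_smooth oU1 G1)) oW.
set V := U1 `&` _ in oV.
have Vz : V z by split=> //=; move: Wz; rewrite (coordsE B1).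
have VU : V `<=` U1 by move=> ? [].
apply/esym; apply: (der_eq (nP_der oV (gauge_sub VU G1)) _ _ Vz) => [|y [Uy _] /=]; last by rewrite -(coordsE B1).
apply: (smooth_comp3 oV _ sg) => [|y []//].
apply: (smooth_sub VU); exact: (smooth_pair oU1 (smooth_pair oU1 (cX_smooth oU1 G1) (cY_smooth oU1 G1)) (cP_smooth oU1 G1)).
Qed.
End TwoEquations.
End Match.

(** * Maps preserving fibres and solutions are prolongations *)

Section ContactMaps.
Variables (R : realType).
Notation R2 := (R * R)%type.
Notation R3 := (R * R * R)%type.

(** T carries [Dp] to v [Dp] and the solution field of f1 to u times that of f2; it is enough to
    state this on the three coordinate functions. *)
Record contact_map (f1 f2 : R3 -> R) (U : set R3) (T : R3 -> R3) (u v : R3 -> R) : Prop := ContactMap {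
  cm_open : open U;
  cm_smooth : smooth U T;
  cm_u : forall z, U z -> u z != 0;
  cm_v : forall z, U z -> v z != 0;
  cm_px : forall z, U z -> Dp (fun z => (T z).1.1) z = 0;
  cm_py : forall z, U z -> Dp (fun z => (T z).1.2) z = 0;
  cm_pp : forall z, U z -> Dp (fun z => (T z).2) z = v z;
  cm_tx : forall z, U z -> Dt f1 (fun z => (T z).1.1) z = u z;
  cm_ty : forall z, U z -> Dt f1 (fun z => (T z).1.2) z = u z * (T z).2;
  cm_tp : forall z, U z -> Dt f1 (fun z => (T z).2) z = u z * f2 (T z) }.

Lemma fiber_constant (g : R3 -> R) (q : R2) (p0 p : R) (d : R) :
  (forall t, `|t - p0| < d -> differentiable g (q, t) /\ Dp g (q, t) = 0) -> `|p - p0| < d ->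
  g (q, p) = g (q, p0).
Proof.
move=> H pd.
have d0 : 0 < d by exact: le_lt_trans pd.
have line (x t : R) : (q, x) + t *: ((0, 0, 1) : R3) = (q, x + t).
  have E (a b : R3) (c : R) : a + c *: b = ((a.1.1 + c * b.1.1, a.1.2 + c * b.1.2), a.2 + c * b.2) by [].
  by rewrite E /= !mulr0 !addr0 mulr1; case: (q).
have step (x h : R) : 0 < h -> (forall t, 0 <= t <= h -> `|x + t - p0| < d) -> g (q, x + h) = g (q, x).
  move=> h0 Ht; have [t th|t /andP[t0 th]] := @MVT_line R _ g (q, x) (0, 0, 1) h h0.
    by rewrite line; exact: (H _ (Ht _ th)).1.
  rewrite !line; have := (H _ (Ht t _)).2; rewrite /Dp => ->; last by rewrite !ltW.
  by rewrite mulr0 => /subr0_eq.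
have [pp|pp|->] := ltgtP p p0; last by [].
- rewrite -[in RHS](subrK p p0) addrC; apply/esym; apply: step; first by rewrite subr_gt0.
  move=> t /andP[t0 th]; rewrite ler0_norm; last by lra.
  by move: pd; rewrite ler0_norm; lra.
- rewrite -[in LHS](subrK p0 p) addrC; apply: step; first by rewrite subr_gt0.
  move=> t /andP[t0 th]; rewrite addrC addKr ger0_norm //.
  by move: pd; rewrite gtr0_norm; lra.
Qed.

Definition base_map (T : R3 -> R3) (p0 : R) (q : R2) : R2 := (T (q, p0)).1.

(** A product neighbourhood has intervals as fibres, on which the vanishing of the p-derivatives
    makes the base components of T constant. *)
Lemma fiber_box f1 f2 U T u v (m : R3) : contact_map f1 f2 U T u v -> U m ->
  exists2 A : set R3, [/\ open A, A m & A `<=` U] &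
    forall z, A z -> A (z.1, m.2) /\ (T z).1 = base_map T m.2 z.1.
Proof.
move=> C Um; have oU := cm_open C.
have : nbhs m U by exact: open_nbhs_nbhs.
case: m Um => q0 p0 Um [[N0 I0] /= [nN nI] NI].
move: nN; rewrite nbhsE => -[N [oN Nq] NN0].
move: nI => /nbhs_ballP[d /= d0 dI].
pose A : set R3 := [set z | N z.1 /\ `|z.2 - p0| < d].
have AU : A `<=` U.
  by move=> -[q p] [/= Nq' pd]; apply: (NI (q, p)); split=> /=; [exact: NN0|apply: dI; rewrite /ball /= distrC].
have oA : open A.
  rewrite openE => z [Nz pz]; exists (N, [set t | `|t - p0| < d]) => /=.
    split; first exact: open_nbhs_nbhs.
    apply: open_nbhs_nbhs; split => //; have -> : [set t | `|t - p0| < d] = ball p0 d.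
      by apply/seteqP; split=> t /=; rewrite /ball /= distrC.
    exact: ball_open.
  by move=> w [? ?].
exists A; first by split => //; split=> //=; rewrite subrr normr0.
move=> [q p] [/= Nq' pd]; split; first by split=> //=; rewrite subrr normr0.
have sT := cm_smooth C.
have s1 := smooth_fst oU (smooth_fst oU sT); have s2 := smooth_snd oU (smooth_fst oU sT).
have ft (t : R) : `|t - p0| < d -> U (q, t) by move=> td; exact: AU.
rewrite /base_map /=.
have e1 := @fiber_constant (fun z => (T z).1.1) q p0 p d
  (fun t td => conj (smooth_diff s1 (ft t td)) (cm_px C (ft t td))) pd.
have e2 := @fiber_constant (fun z => (T z).1.2) q p0 p d
  (fun t td => conj (smooth_diff s2 (ft t td)) (cm_py C (ft t td))) pd.
by rewrite [LHS]surjective_pairing [RHS]surjective_pairing e1 e2.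
Qed.

Lemma section_smooth (p0 : R) (A : set R2) : open A -> smooth A (fun q : R2 => (q, p0)).
Proof.
move=> oA; apply: (smooth_pair oA); last by move=> n; exact: (@smooth_cst R _ A oA p0).
apply: (@smooth_coind R _ _ A (fun g => g = id \/ exists c : R2, g = fun=> c)) => //; last by left.
move=> _ [->|[c ->]]; split=> [a _|v].
- exact: ex_diff.
- exists (fun=> v); first by right; exists v.
  by move=> a _; rewrite derive_id.
- exact: differentiable_cst.
- by exists (fun=> 0); [right; exists 0|move=> a _; rewrite derive_cst].
Qed.

Lemma section_open (p0 : R) (A : set R3) : open A -> open [set q : R2 | A (q, p0)].
Proof.
move=> oA; have := open_preimage_smooth openT (section_smooth p0 openT) oA.
by rewrite setTI.
Qed.

Lemma open_fst (V W : normedModType R) (N : set V) : open N -> open [set z : V * W | N z.1].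
Proof.
move=> oN; rewrite openE => z Nz.
have c : {for z, continuous (@fst V W)} := differentiable_continuous (derive_fst z 0).1.
by apply: (c N); exact: open_nbhs_nbhs.
Qed.

Lemma along_lift (G : R2 -> R) (g : R3 -> R) z : differentiable G z.1 ->
  (\near z, g z = G z.1) -> Dx g z = along G z.
Proof.
move=> dG E; have D v : 'D_v g z = 'D_(v.1) G z.1.
  rewrite (near_eq_derive v E) -[LHS]/('D_v (G \o fst) z).
  rewrite (derive_comp v (derive_fst z 0).1 dG); congr ('D__ G _).
  exact: (derive_fst z v).2.
by rewrite /Dx /along /Dy !D.
Qed.

Lemma base_inverse f1 f2 U T u v V T' u' v' m :
  contact_map f1 f2 U T u v -> contact_map f2 f1 V T' u' v' ->
  U m -> V (T m) -> (forall z, U z -> T' (T z) = z) ->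
  \forall q \near m.1, base_map T' (T m).2 (base_map T m.2 q) = q.
Proof.
move=> C C' Um Vm TT.
have [A [oA Am AU] HA] := fiber_box C Um.
have [B [oB Bm BV] HB] := fiber_box C' Vm.
have oAB := open_preimage_smooth oA (smooth_sub AU (cm_smooth C)) oB.
have oS := section_open (p0 := m.2) oAB.
apply: (near_open oS) => [|q [/= Aq Bq]].
  by rewrite /= -surjective_pairing.
by have [_ <-] := HB _ Bq; rewrite TT //; exact: AU.
Qed.

Lemma base_map_smooth_at f1 f2 U T u v m : contact_map f1 f2 U T u v -> U m -> smooth_at (base_map T m.2) m.1.
Proof.
move=> C Um; have oS := section_open (p0 := m.2) (cm_open C).
exists [set q | U (q, m.2)]; first by split => //=; rewrite -surjective_pairing.
have sT := cm_smooth C; have oU := cm_open C.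
have s1 := smooth_fst oU (smooth_fst oU sT); have s2 := smooth_snd oU (smooth_fst oU sT).
have ss := section_smooth m.2 oS.
have t1 := smooth_comp3 oS ss s1 (fun q h => h); have t2 := smooth_comp3 oS ss s2 (fun q h => h).
apply: (smooth_eq oS _ (smooth_pair oS t1 t2)) => q _.
by rewrite /base_map; case: (T _) => [[]].
Qed.

(** The point map is the map induced on the base. The action of T on the solution field forces its
    first prolongation to be T, and the inverse contact map induces the inverse point map. *)
Lemma contact_map_equivalent f1 f2 U T u v V T' u' v' m1 m2 :
  contact_map f1 f2 U T u v -> contact_map f2 f1 V T' u' v' ->
  U m1 -> V m2 -> T m1 = m2 -> T' m2 = m1 ->
  (forall z, U z -> T' (T z) = z) -> (forall w, V w -> T (T' w) = w) ->
  point_equivalent f1 m1 f2 m2.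
Proof.
move=> C C' Um Vm Tm Tm' TT TT'.
pose phi := base_map T m1.2; pose psi := base_map T' m2.2.
have [A [oA Am AU] HA] := fiber_box C Um.
have phiE z : A z -> (T z).1 = phi z.1 by move=> /HA[].
have phi_m : phi m1.1 = m2.1 by rewrite -phiE // Tm.
have psi_m : psi m2.1 = m1.1 by rewrite /psi /base_map -surjective_pairing Tm'.
have sphi := base_map_smooth_at C Um; have spsi := base_map_smooth_at C' Vm.
have [N [oN Nm] sN] := sphi.
pose A' := A `&` [set z | N z.1].
have oA' : open A'.
  by apply: openI => //; exact: open_fst.
have sx : smooth N (fun q => (phi q).1) := smooth_fst oN (sN : smooth N phi).
have sy : smooth N (fun q => (phi q).2) := smooth_snd oN (sN : smooth N phi).
have Dphi z : A' z -> along (fun q => (phi q).1) z = u z /\ along (fun q => (phi q).2) z = u z * (T z).2.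
  move=> [Az Nz]; have Uz := AU _ Az; split.
    rewrite -(cm_tx C Uz) /Dt (cm_px C Uz) mulr0 addr0.
    apply/esym; apply: along_lift; first exact: smooth_diff sx Nz.
    by apply: (near_open oA Az) => y Ay; rewrite phiE.
  rewrite -(cm_ty C Uz) /Dt (cm_py C Uz) mulr0 addr0.
  apply/esym; apply: along_lift; first exact: smooth_diff sy Nz.
  by apply: (near_open oA Az) => y Ay; rewrite phiE.
have PE z : A' z -> prolonged_p phi z = (T z).2.
  move=> A'z; have [e1 e2] := Dphi _ A'z.
  by rewrite /prolonged_p /slope_den e1 e2 mulrC mulKf //; apply: (cm_u C); apply: AU; case: A'z.
(* The prolongation to second order is affine in the second derivative t with slope v / u. As this
   is nonzero, it meets the second equation exactly when t = f1 z. *)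
have UE z t : A' z -> prolonged_u phi (z, t) = f2 (T z) + (t - f1 z) * v z / u z.
  move=> A'z; have [e1 _] := Dphi _ A'z; have Uz : U z by apply: AU; case: A'z.
  have nE : \near z, prolonged_p phi z = (T z).2 by apply: (near_open oA' A'z) => y /PE.
  rewrite /prolonged_u /slope_den /= e1 !(near_eq_derive _ nE).
  have tp := cm_tp C Uz; have pp := cm_pp C Uz; have u0 := cm_u C Uz.
  rewrite /Dt /Dx /Dy /Dp in tp pp; move: tp pp.
  move: ('D_((1, 0, 0) : R3) _ z) ('D_((0, 1, 0) : R3) _ z) ('D_((0, 0, 1) : R3) _ z) => d1 d2 d3 tp pp.
  have -> : f2 (T z) = (d1 + z.2 * d2 + f1 z * d3) / u z by rewrite tp mulrC mulKf.
  by rewrite -pp -mulrDl; congr (_ / _); ring.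
have A'm : A' m1 by split.
have A'Tm := Dphi _ A'm.
exists phi; split.
- split; first exact: sphi.
  exists psi; rewrite phi_m; split; first exact: spsi.
    have := base_inverse C C' Um _ TT; rewrite Tm; exact.
  have := base_inverse C' C Vm _ TT'; rewrite Tm'; exact.
- by rewrite /slope_den A'Tm.1; exact: (cm_u C).
- rewrite /prolong2 /= PE // UE // subrr !mul0r addr0 phi_m Tm; congr (_, _).
  by rewrite -surjective_pairing.
apply: (near_open (open_fst oA')) => [//|[z t] /= A'z]; rewrite /ode /prolong2 /= PE // UE // -phiE; last by case: A'z.
have Uz : U z by apply: AU; case: A'z.
rewrite -surjective_pairing; split=> [->|/eqP]; first by rewrite subrr !mul0r addr0.
rewrite -subr_eq0 addrAC subrr add0r !mulf_eq0 invr_eq0 (negbTE (cm_u C Uz)) (negbTE (cm_v C Uz)) !orbF.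
by rewrite subr_eq0 => /eqP.
Qed.
End ContactMaps.

(** * Independence of the branch, and conclusion of the converse *)

Section Converse.
Variables (R : realType).
Notation R3 := (R * R * R)%type.

Lemma branch_neq0 s U (f : R3 -> R) J z : regular_branch s U f J -> U z -> (J z).1 != 0 /\ (J z).2 != 0.
Proof.
move=> B Uz; have := rb_H B Uz; rewrite -(rb_3 B Uz) mulf_eq0 expf_eq0 /= => /norP[h1 h2].
by split.
Qed.

Lemma branch_sign s s' U U' (f : R3 -> R) J J' z : regular_branch s U f J -> regular_branch s' U' f J' ->
  U z -> U' z -> s = s'.
Proof.
move=> B B' Uz U'z; have [_ h] := branch_neq0 B Uz; have [_ h'] := branch_neq0 B' U'z.
have e := rb_2 B Uz; have e' := rb_2 B' U'z.
have p : 0 < (-1) ^+ s * (rel_I f z * rel_H f z) by rewrite -e exprn_even_gt0.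
have p' : 0 < (-1) ^+ s' * (rel_I f z * rel_H f z) by rewrite -e' exprn_even_gt0.
case: s s' p p' {B B' e e'} => -[] //=; rewrite expr0 expr1 mul1r mulN1r oppr_gt0 => p p'.
  by have := lt_trans p p'; rewrite ltxx.
by have := lt_trans p p'; rewrite ltxx.
Qed.

Lemma branch_ratio s U (f : R3 -> R) J J' z : regular_branch s U f J -> regular_branch s U f J' -> U z ->
  ((J z).1 / (J' z).1) ^+ 2 = 1 /\ (J z).2 = (J' z).2.
Proof.
move=> B B' Uz; have [h1 h2] := branch_neq0 B Uz; have [h1' h2'] := branch_neq0 B' Uz.
have E : (J z).1 ^+ 2 = (J' z).1 ^+ 2.
  apply/eqP; rewrite -(@eqrXn2 _ 4) ?sqr_ge0 // -!exprM; apply/eqP.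
  exact: (etrans (rb_1 B Uz) (esym (rb_1 B' Uz))).
split; first by rewrite expr_div_n E mulfV // expf_neq0.
have n1 : (J z).1 ^+ 2 != 0 by rewrite expf_neq0.
apply/(mulfI n1); rewrite [RHS](congr1 (fun t => t * _) E).
exact: (etrans (rb_3 B Uz) (esym (rb_3 B' Uz))).
Qed.

Lemma coords_smooth s U (f : R3 -> R) J : regular_branch s U f J -> smooth U (coords f J).
Proof.
move=> B; have oU := rb_open B; have G := branch_gauge B.
apply: (smooth_eq oU _ (smooth_pair oU (smooth_pair oU (cX_smooth oU G) (cY_smooth oU G)) (cP_smooth oU G))).
by move=> z Uz; rewrite (coordsE B).
Qed.

Lemma flip_smooth (c : R) : smooth setT (fun w : R3 => (c * w.1.1, w.1.2, c * w.2)).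
Proof.
have oT : open (@setT R3) := openT.
have nu : smooth (@setT R3) (fun=> c) := smooth_cst oT c.
exact: (smooth_pair oT (smooth_pair oT (smooth_mul oT nu (smooth_cx oT)) (smooth_cy oT)) (smooth_mul oT nu (smooth_cp oT))).
Qed.

(** Genericity provides coordinates for one branch. The sign s is that of I H, so two branches share
    it; then J2 is the same and J1 agrees up to sign. The coordinates thus differ by the reflection
    of a and c. *)
Lemma generic_local_diffeo s (f : R3 -> R) m J : smooth_at f m -> generic f m -> root_branch s f m J ->
  local_diffeo (coords f J) m.
Proof.
move=> sf [s' [J' [bJ' dJ']]] bJ.
have [U Um B] := root_branch_regular sf bJ; have [U' U'm B'] := root_branch_regular sf bJ'.
have es := branch_sign B B' Um U'm; rewrite -{s'}es in bJ' B'.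
have oU := rb_open B; have oU' := rb_open B'.
pose V := U `&` U'; have oV : open V by exact: openI.
have BV : regular_branch s V f J by apply: regular_branch_sub B => // ? [].
have BV' : regular_branch s V f J' by apply: regular_branch_sub B' => // ? [].
pose q z := (J z).1 / (J' z).1.
have sq : smooth V q.
  have s1 : smooth V (fun z => (J' z).1^-1).
    apply: sclass_smooth => //; apply: Sinv; first by apply: Sbase; exact: rb_J BV'.
    by move=> z Vz; exact: (branch_neq0 BV' Vz).1.
  exact: (smooth_mul oV (rb_J BV) s1).
have q1 z : V z -> q z = 1 \/ q z = - 1.
  move=> Vz; have [/eqP] := branch_ratio BV BV' Vz; rewrite -/(q z) sqrf_eq1 => /orP[/eqP|/eqP]; by [left|right].
have Vm : V m by split.
pose e := q m.
have ee : e * e = 1 by rewrite /e; case: (q1 _ Vm) => ->; rewrite ?mulr1 // mulrN1 opprK.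
have e0 : e != 0 by apply/eqP => E; move: ee; rewrite E mul0r => /eqP; rewrite eq_sym oner_eq0.
(* The ratio of the branches takes only the values 1 and -1; where its product with the value at m
   is positive it is constant. *)
have oA := open_preimage_smooth oV (smooth_mul oV sq (smooth_cst oV e)) (open_gt (y := (0 : R))).
set A := V `&` _ in oA.
have Am : A m by split=> //=; rewrite -/e ee.
have qA z : A z -> q z = e.
  move=> [Vz /= pz]; move: pz; rewrite /e; case: (q1 _ Vz) (q1 _ Vm) => -> [] -> //; rewrite ?mulr1 ?mul1r ?mulrN1 ?mulN1r.
    by rewrite ltr0N1.
  by rewrite ltr0N1.
pose L (w : R3) : R3 := (e * w.1.1, w.1.2, e * w.2).
have eex (x : R) : e * (e * x) = x by rewrite mulrA ee mul1r.
have LL w : L (L w) = w.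
  by case: w => -[x y] t; rewrite -[LHS]/(e * (e * x), y, e * (e * t)) !eex.
have CL z : A z -> coords f J z = L (coords f J' z).
  move=> Az; have Vz : V z by case: Az.
  have [h1 h2] := branch_neq0 BV' Vz; have [_ E2] := branch_ratio BV BV' Vz.
  have E1 : (J z).1 = e * (J' z).1 by rewrite -(qA _ Az) /q divfK.
  have ei : e^-1 = e by apply/(mulfI e0); rewrite mulfV.
  have inv_e (g x y : R) : g / (e * x * y) = e * (g / (x * y)) by rewrite -[e * x * y]mulrA invfM ei mulrCA.
  have c3 (x : R) : (e * x) ^+ 3 = e * x ^+ 3 by rewrite exprMn exprS expr2 ee mulr1.
  have c2 (x : R) : (e * x) ^+ 2 = x ^+ 2 by rewrite exprMn expr2 ee mul1r.
  have b3 g : bar J 3 1 g z = e * bar J' 3 1 g z.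
    by rewrite -[LHS]/(g z / ((J z).1 ^+ 3 * (J z).2)) E1 E2 c3 inv_e.
  have b2 g : bar J 2 2 g z = bar J' 2 2 g z.
    by rewrite -[LHS]/(g z / ((J z).1 ^+ 2 * (J z).2 ^+ 2)) E1 E2 c2.
  have b1 g : bar J 1 2 g z = e * bar J' 1 2 g z.
    by rewrite -[LHS]/(g z / ((J z).1 * (J z).2 ^+ 2)) E1 E2 inv_e.
  by rewrite -[LHS]/(bar J 3 1 (rel_Hij f 1 0) z, bar J 2 2 (rel_Hij f 0 1) z, bar J 1 2 (wK f) z) b3 b2 b1.
have [_ [k [sk kh hk]]] := dJ'.
have Lm : L (coords f J m) = coords f J' m by rewrite CL // LL.
split; first by exists U => //; exact: (coords_smooth B).
exists (k \o L); split.
- have [K [oK Km] sK] := sk; rewrite -Lm in Km.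
  have oK' := open_preimage_smooth openT (flip_smooth e) oK; rewrite setTI in oK'.
  exists [set w | K (L w)]; first by split.
  have sL : smooth [set w | K (L w)] L := smooth_sub (@subsetT _ _) (flip_smooth e).
  have sKk : smooth K k := sK.
  have k1 := smooth_comp3 oK' sL (smooth_fst oK (smooth_fst oK sKk)) (fun w h => h).
  have k2 := smooth_comp3 oK' sL (smooth_snd oK (smooth_fst oK sKk)) (fun w h => h).
  have k3 := smooth_comp3 oK' sL (smooth_snd oK sKk) (fun w h => h).
  apply: (smooth_eq oK' _ (smooth_pair oK' (smooth_pair oK' k1 k2) k3)) => w _ /=.
  by case: (k _) => [[]].
- have [K1 [oK1 K1m HK]] := near_openP kh.
  apply: (near_open (openI oA oK1)) => [|z [Az Kz]]; first by split.
  by rewrite /= CL // LL HK.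
- have [K [oK Km] sK] := sk; have [K1 [oK1 K1m HK]] := near_openP hk.
  have oK2 := openI oK oK1.
  have sk2 : smooth (K `&` K1) k by apply: smooth_sub (sK : smooth K k) => ? [].
  have oM := open_preimage_smooth oK2 sk2 oA; set M := (K `&` K1) `&` _ in oM.
  have oN := open_preimage_smooth openT (flip_smooth e) oM; rewrite setTI in oN.
  apply: (near_open oN) => [|w /= [[_ K1w] Aw]].
    have km := nbhs_singleton kh.
    have ML : M (L (coords f J m)) by rewrite Lm; split; [split|rewrite /= km].
    exact: ML.
  by rewrite CL // HK // LL.
Qed.

Section Matching.
Variables (s : bool) (U1 U2 W : set R3) (f1 f2 : R3 -> R) (J1 J2 : R3 -> R * R) (k1 k2 : R3 -> R3).
Hypotheses (C1 : chart s U1 W f1 J1 k1) (C2 : chart s U2 W f2 J2 k2).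
Hypothesis same : forall w, W w -> structure_tuple f1 J1 (k1 w) = structure_tuple f2 J2 (k2 w).

Definition matching_dom : set R3 := U1 `&` [set z | W (coords f1 J1 z)].
Let T := matching f1 J1 k2.

Lemma matching_contact : contact_map f1 f2 matching_dom T
  (fun z => scale1 J2 (T z) / scale1 J1 z) (fun z => scale2 J2 (T z) / scale2 J1 z).
Proof.
have B1 := ch_branch C1; have B2 := ch_branch C2; have oU1 := rb_open B1; have oU2 := rb_open B2.
have G1 := branch_gauge B1; have G2 := branch_gauge B2.
have oD : open matching_dom := open_preimage_smooth oU1 (coords_smooth B1) (ch_open C1).
have DU : matching_dom `<=` U1 by move=> ? [].
have TU z : matching_dom z -> U2 (T z) by move=> [_ Wz]; exact: (ch_U C2).
have sT : smooth matching_dom T.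
  have sk := ch_smooth C2; have oW := ch_open C1; have sc := smooth_sub DU (coords_smooth B1).
  have t1 := smooth_comp3 oD sc (smooth_fst oW (smooth_fst oW sk)) (fun z h => h.2).
  have t2 := smooth_comp3 oD sc (smooth_snd oW (smooth_fst oW sk)) (fun z h => h.2).
  have t3 := smooth_comp3 oD sc (smooth_snd oW sk) (fun z h => h.2).
  apply: (smooth_eq oD _ (smooth_pair oD (smooth_pair oD t1 t2) t3)) => z _ /=.
  by rewrite /T /matching; case: (k2 _) => [[]].
have n1 z : matching_dom z -> scale1 J1 z != 0 by move=> [Uz _]; exact: (gauge_n1 G1).
have n2 z : matching_dom z -> scale2 J1 z != 0 by move=> [Uz _]; exact: (gauge_n2 G1).
have MX F : smooth U2 F -> forall z, matching_dom z -> Dt f1 (F \o T) z = scale1 J2 (T z) / scale1 J1 z * Dt f2 F (T z).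
  move=> sF z Dz; have [Uz Wz] := Dz; have E := matching_X C1 C2 same sF Uz Wz.
  by apply/(mulfI (n1 _ Dz)); rewrite [LHS]E mulrA mulrCA mulfV ?mulr1 ?n1.
have MP F : smooth U2 F -> forall z, matching_dom z -> Dp (F \o T) z = scale2 J2 (T z) / scale2 J1 z * Dp F (T z).
  move=> sF z Dz; have [Uz Wz] := Dz; have E := matching_P C1 C2 same sF Uz Wz.
  by apply/(mulfI (n2 _ Dz)); rewrite [LHS]E mulrA mulrCA mulfV ?mulr1 ?n2.
have cx := smooth_cx oU2; have cy := smooth_cy oU2; have cp := smooth_cp oU2.
have tx w : Dt f2 (fun z => z.1.1) w = 1.
  by rewrite /Dt /Dx /Dy /Dp !(derive_cx _ _).2 /= !mulr0 !addr0.
have ty w : Dt f2 (fun z => z.1.2) w = w.2.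
  by rewrite /Dt /Dx /Dy /Dp !(derive_cy _ _).2 /= mulr1 mulr0 add0r addr0.
have tp w : Dt f2 (fun z => z.2) w = f2 w.
  by rewrite /Dt /Dx /Dy /Dp !(derive_cp _ _).2 /= mulr0 mulr1 !add0r.
split; [exact: oD|exact: sT| | | | | | | |].
- by move=> z Dz; apply: mulf_neq0; [exact: (gauge_n1 G2 (TU _ Dz))|rewrite invr_eq0 n1].
- by move=> z Dz; apply: mulf_neq0; [exact: (gauge_n2 G2 (TU _ Dz))|rewrite invr_eq0 n2].
- by move=> z Dz; rewrite [LHS](MP _ cx z Dz) /Dp (derive_cx _ _).2 mulr0.
- by move=> z Dz; rewrite [LHS](MP _ cy z Dz) /Dp (derive_cy _ _).2 mulr0.
- by move=> z Dz; rewrite [LHS](MP _ cp z Dz) /Dp (derive_cp _ _).2 mulr1.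
- by move=> z Dz; rewrite [LHS](MX _ cx z Dz) tx mulr1.
- by move=> z Dz; rewrite [LHS](MX _ cy z Dz) ty.
- by move=> z Dz; rewrite [LHS](MX _ cp z Dz) tp.
Qed.
End Matching.

Lemma same_structure_equivalent s (f1 f2 : R3 -> R) m1 m2 J1 J2 : smooth_at f1 m1 -> smooth_at f2 m2 ->
  generic f1 m1 -> generic f2 m2 -> root_branch s f1 m1 J1 -> root_branch s f2 m2 J2 ->
  same_structure_functions f1 m1 J1 f2 m2 J2 -> point_equivalent f1 m1 f2 m2.
Proof.
move=> sf1 sf2 g1 g2 b1 b2 [Ec [Phi1 [Phi2 [S1 S2 S12]]]].
have [U1 [W1 [k1 [C1 U1m W1m]]]] := local_chart sf1 b1 (generic_local_diffeo sf1 g1 b1).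
have [U2 [W2 [k2 [C2 U2m W2m]]]] := local_chart sf2 b2 (generic_local_diffeo sf2 g2 b2).
have [A1 [oA1 A1m HA1]] := near_openP S1; have [A2 [oA2 A2m HA2]] := near_openP S2.
have [D [oD Dm HD]] := near_openP S12.
pose W := ((W1 `&` [set w | A1 (k1 w)]) `&` (W2 `&` [set w | A2 (k2 w)])) `&` D.
have oW : open W.
  apply: openI => //; apply: openI.
    exact: (open_preimage_smooth (ch_open C1) (ch_smooth C1) oA1).
  exact: (open_preimage_smooth (ch_open C2) (ch_smooth C2) oA2).
have K1 : chart s U1 W f1 J1 k1 by apply: chart_sub C1 => // w [[[]]].
have K2 : chart s U2 W f2 J2 k2 by apply: chart_sub C2 => // w [[_ []]].
have k1m : k1 (coords f1 J1 m1) = m1 := ch_kh C1 U1m.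
have k2m : k2 (coords f1 J1 m1) = m2 by rewrite Ec (ch_kh C2 U2m).
have Wm : W (coords f1 J1 m1).
  split=> //; split; first by split=> //=; rewrite k1m.
  by split; [rewrite Ec|rewrite /= k2m].
have same w : W w -> structure_tuple f1 J1 (k1 w) = structure_tuple f2 J2 (k2 w).
  move=> Ww; have [[[_ A1w] [_ A2w]] Dw] := Ww.
  have e1 := HA1 _ A1w; have e2 := HA2 _ A2w.
  rewrite (ch_hk K1 Ww) in e1; rewrite (ch_hk K2 Ww) in e2.
  exact: (etrans (esym e1) (etrans (HD _ Dw) e2)).
have M1 := matching_contact K1 K2 same.
have M2 := matching_contact K2 K1 (fun w Ww => esym (same w Ww)).
apply: (contact_map_equivalent M1 M2).
- by split.
- by split=> //=; rewrite -Ec.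
- by rewrite /matching k2m.
- by rewrite /matching -Ec k1m.
- by move=> z [Uz Wz]; rewrite /matching (ch_hk K2 Wz) (ch_kh K1 Uz).
- by move=> z [Uz Wz]; rewrite /matching (ch_hk K1 Wz) (ch_kh K2 Uz).
Qed.
End Converse.

(** * Transformation of the invariants under a point map *)

Section LogSquare.
Variables (R : realType).

Definition lnsq (x : R) : R := ln (x * x) / 2.

Let sq_gt0 (x : R) : x != 0 -> 0 < x * x.
Proof. by move=> x0; rewrite -expr2 exprn_even_gt0. Qed.

Let sq_pos (x : R) : x != 0 -> x * x \is Num.pos.
Proof. by move=> x0; rewrite posrE sq_gt0. Qed.

Lemma lnsqM (x y : R) : x != 0 -> y != 0 -> lnsq (x * y) = lnsq x + lnsq y.
Proof.
move=> x0 y0; have E : ln ((x * y) * (x * y)) = ln (x * x) + ln (y * y) :> R.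
  by rewrite mulrACA (lnM (sq_pos x0) (sq_pos y0)).
by rewrite /lnsq E mulrDl.
Qed.

Lemma lnsqV (x : R) : x != 0 -> lnsq x^-1 = - lnsq x.
Proof.
move=> x0; have E : ln (x^-1 * x^-1) = - ln (x * x) :> R by rewrite -invfM (lnV (sq_pos x0)).
by rewrite /lnsq E mulNr.
Qed.
End LogSquare.

(** * The frame and its invariants along a prolonged point map *)

Section Prolongation.
Variables (R : realType).
Notation R3 := (R * R * R)%type.
Variables (U1 U2 : set R3) (f1 f2 X Y P : R3 -> R).
Hypotheses (o1 : open U1) (o2 : open U2).
Hypotheses (sf1 : smooth U1 f1) (sf2 : smooth U2 f2) (sX : smooth U1 X) (sY : smooth U1 Y) (sP : smooth U1 P).
Definition prolongation z : R3 := (X z, Y z, P z).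
Local Notation E := prolongation.
Let a := Dt f1 X.
Let Jac z := Db f1 Y z * a z - Dt f1 Y z * Db f1 X z.
Hypotheses (PX : eq_on U1 (Dp X) (fun=> 0)) (PY : eq_on U1 (Dp Y) (fun=> 0)).
Hypotheses (a0 : forall z, U1 z -> a z != 0) (J0 : forall z, U1 z -> Jac z != 0).
Hypothesis aP : eq_on U1 (fun z => a z * P z) (Dt f1 Y).
Hypothesis E_U : forall z, U1 z -> U2 (E z).
Hypothesis DP : eq_on U1 (Dt f1 P) (fun z => a z * f2 (E z)).

Let d k g := frame f1 k g.
Let der k : derivation U1 (frame f1 k) := frame_der o1 sf1 k.
Let sd k (g : R3 -> R) (sg : smooth U1 g) : smooth U1 (frame f1 k g) := der_smooth (der k) sg.
Let sa : smooth U1 a. Proof. exact: (sd 0 sX). Qed.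
Let sJ : smooth U1 Jac.
Proof.
exact: (smooth_add o1 (smooth_mul o1 (sd 1 sY) sa) (smooth_opp o1 (smooth_mul o1 (sd 0 sY) (sd 1 sX)))).
Qed.

Let bs := [:: X; Y].
Let base := nth (fun=> 0) (f1 :: bs).
Let bs_smooth i : (i < size bs)%N -> smooth U1 (nth (fun=> 0) bs i).
Proof. by case: i => [|[|]]. Qed.
Let tab (k : nat) (v : dvar) : option dpoly :=
  if (k == 2%N) && (v.2 == [::]) && ((v.1 == 1%N) || (v.1 == 2%N)) then Some [::] else None.
Let tab_ok k v p : alias_frame k = None -> tab k v = Some p ->
  eq_on U1 (frame f1 k (env base (frame f1) v)) (peval base (frame f1) p).
Proof.
move=> _; rewrite /tab; case: ifP => // /andP[/andP[/eqP -> ]]; case: v => b ks /= /eqP -> /orP[]/eqP -> /Some_inj <-.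
  exact: PX.
exact: PY.
Qed.
Let geq := @frame_eq R U1 o1 f1 sf1 bs bs_smooth tab tab_ok.

Let F := EB 0. Let eXx := EB 1. Let eYy := EB 2.
Local Notation D := (ED 0). Local Notation dY := (ED 1). Local Notation dP := (ED 2).
Let ea := D eXx.
Let eJ := (dY eYy * ea - D eYy * dY eXx)%DE.
Let eN := (ea * D (D eYy) - D eYy * D ea)%DE.

Let PJ : eq_on U1 (Dp Jac) (fun=> 0).
Proof. by apply: (geq (e1 := dP eJ) (e2 := EN 0)); vm_compute. Qed.
Let PPa : eq_on U1 (Dp (Dp a)) (fun=> 0).
Proof. by apply: (geq (e1 := dP (dP ea)) (e2 := EN 0)); vm_compute. Qed.
Let PDY : eq_on U1 (fun z => Dp (Dt f1 Y) z * a z - Dt f1 Y z * Dp a z) Jac.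
Proof. by apply: (geq (e1 := (dP (D eYy) * ea - D eYy * dP ea)%DE) (e2 := eJ)); vm_compute. Qed.
(** This is a^2 times the derivative of P = D Y / a along solutions, that is a^3 times f2 along the
    map ([NE]). *)
Let Nn z := a z * Dt f1 (Dt f1 Y) z - Dt f1 Y z * Dt f1 a z.
Let PN : eq_on U1 (fun z => Dp Nn z * a z - 3 * Nn z * Dp a z)
  (fun z => a z * Jac z * Dp f1 z - 3 * Jac z * Dt f1 a z + 2 * a z * Dt f1 Jac z).
Proof.
by apply: (geq (e1 := (dP eN * ea - EN 3 * eN * dP ea)%DE)
  (e2 := (ea * eJ * dP F - EN 3 * eJ * D ea + EN 2 * ea * D eJ)%DE)); vm_compute.
Qed.

Let p1 := log_abs a.
Let p2 := log_abs Jac.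
Let La : log_derivative U1 f1 a (fun k => d k p1) := frame_log_abs o1 f1 sa a0.
Let LJ : log_derivative U1 f1 Jac (fun k => d k p2) := frame_log_abs o1 f1 sJ J0.
Let sp1 : smooth U1 p1 := log_abs_smooth o1 sa a0.
Let sp2 : smooth U1 p2 := log_abs_smooth o1 sJ J0.
Let da k z : U1 z -> d k a z = a z * d k p1 z.
Proof. by case: La => _ _ H Uz; exact: H. Qed.
Let dJ k z : U1 z -> d k Jac z = Jac z * d k p2 z.
Proof. by case: LJ => _ _ H Uz; exact: H. Qed.

Let Pp2 : eq_on U1 (Dp p2) (fun=> 0).
Proof. by move=> z Uz; apply/(mulfI (J0 Uz)); rewrite mulr0 -(PJ Uz) -[RHS]/(d 2 Jac z) dJ. Qed.

(** The slope a is affine in p, and this is its vanishing second derivative written for ln |a|. *)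
Let PPp1 : eq_on U1 (Dp (Dp p1)) (fun z => - (Dp p1 z * Dp p1 z)).
Proof.
move=> z Uz; apply/(mulfI (a0 Uz)).
have H := der_eq (der 2) (sd 2 sa) (fun y Uy => da 2 Uy) Uz.
rewrite (der_mul (der 2) sa (sd 2 sp1) Uz) in H.
have E0 : d 2 (d 2 a) z = 0 := PPa Uz.
rewrite /d in E0; rewrite E0 -[frame f1 2 a z]/(d 2 a z) da // in H.
rewrite -[LHS]/(a z * d 2 (d 2 p1) z) -[in RHS]/(d 2 p1 z) mulrN; apply/eqP; rewrite -addr_eq0; apply/eqP.
by rewrite [RHS]H; congr (_ + _); rewrite mulrCA.
Qed.

Let PPJ z : U1 z -> a z * a z * Dp P z = Jac z.
Proof.
move=> Uz; have H : d 2 (fun z => a z * P z) z = d 2 (Dt f1 Y) z := der_eq (der 2) (smooth_mul o1 sa sP) aP Uz.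
rewrite /d (der_mul (der 2) sa sP Uz) -/(d 2 P z) -/(d 2 a z) -/(d 2 (Dt f1 Y) z) in H.
rewrite -(PDY Uz) -[Dp (Dt f1 Y) z]/(d 2 (Dt f1 Y) z) -H -aP // -[Dp P z]/(d 2 P z) -[Dp a z]/(d 2 a z); ring.
Qed.

Let comp k (g : R3 -> R) z : smooth U2 g -> U1 z -> d k (g \o E) z =
  d k X z * partial 0 g (E z) + d k Y z * partial 1 g (E z) + d k P z * partial 2 g (E z).
Proof.
move=> sg Uz; exact: (frame_comp3 f1 k (smooth_diff sX Uz) (smooth_diff sY Uz) (smooth_diff sP Uz) (smooth_diff sg (E_U Uz))).
Qed.

Let compP (g : R3 -> R) z : smooth U2 g -> U1 z -> Dp (g \o E) z = Dp P z * Dp g (E z).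
Proof.
move=> sg Uz.
have H : Dp (g \o E) z = Dp X z * partial 0 g (E z) + Dp Y z * partial 1 g (E z) + Dp P z * Dp g (E z) := comp 2 sg Uz.
have lin0 (x y u v w : R) : x = 0 -> y = 0 -> x * u + y * v + w = w by move=> -> ->; rewrite !mul0r !add0r.
exact: (etrans H (lin0 _ _ _ _ _ (PX Uz) (PY Uz))).
Qed.

Let compD (g : R3 -> R) z : smooth U2 g -> U1 z -> Dt f1 (g \o E) z = a z * Dt f2 g (E z).
Proof.
move=> sg Uz.
have H : Dt f1 (g \o E) z = a z * partial 0 g (E z) + Dt f1 Y z * partial 1 g (E z) + Dt f1 P z * partial 2 g (E z) :=
  comp 0 sg Uz.
have H2 : Dt f2 g (E z) = partial 0 g (E z) + P z * partial 1 g (E z) + f2 (E z) * partial 2 g (E z) := erefl.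
have lin (x y p u v w t k : R) : x * p = y -> k = x * t -> x * u + y * v + k * w = x * (u + p * v + t * w).
  by move=> <- ->; rewrite !mulrDr !mulrA.
exact: (etrans H (etrans (lin _ _ _ _ _ _ _ _ (aP Uz) (DP Uz)) (congr1 (fun t => a z * t) (esym H2)))).
Qed.

Let sE : smooth U1 E := smooth_pair o1 (smooth_pair o1 sX sY) sP.
Let E_smooth (g : R3 -> R) : smooth U2 g -> smooth U1 (g \o E).
Proof. by move=> sg; exact: (smooth_comp3 o1 sE sg E_U). Qed.

Let NE : eq_on U1 Nn (fun z => a z * a z * a z * f2 (E z)).
Proof.
move=> z Uz; have H : d 0 (fun z => a z * P z) z = d 0 (Dt f1 Y) z := der_eq (der 0) (smooth_mul o1 sa sP) aP Uz.
rewrite /d (der_mul (der 0) sa sP Uz) -[frame f1 0 P z]/(Dt f1 P z) DP // in H.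
rewrite /Nn -[Dt f1 (Dt f1 Y) z]/(frame f1 0 (Dt f1 Y) z) -H -aP //.
rewrite -[frame f1 0 a z]/(Dt f1 a z); ring.
Qed.

(** Differentiate [NE] in p and compare with [PN]; the p-derivative of a cancels, and a [Jac] is
    divided out. *)
Lemma prolonged_fp z : U1 z -> a z * Dp f2 (E z) = Dp f1 z - 3 * Dt f1 p1 z + 2 * Dt f1 p2 z.
Proof.
move=> Uz; have Ja := PPJ Uz.
have sNN : smooth U1 Nn.
  exact: (smooth_add o1 (smooth_mul o1 sa (sd 0 (sd 0 sY))) (smooth_opp o1 (smooth_mul o1 (sd 0 sY) (sd 0 sa)))).
have sfE := E_smooth sf2; have saa := smooth_mul o1 sa sa; have saaa := smooth_mul o1 saa sa.
have H : Dp Nn z = d 2 (fun z => a z * a z * a z * f2 (E z)) z := der_eq (der 2) sNN NE Uz.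
rewrite /d (der_mul (der 2) saaa sfE Uz) (der_mul (der 2) saa sa Uz) (der_mul (der 2) sa sa Uz) in H.
have Q := PN Uz; rewrite /= H (NE Uz) in Q.
rewrite -[frame f1 2 (f2 \o E) z]/(Dp (f2 \o E) z) (compP sf2 Uz) in Q.
rewrite -[(f2 \o E) z]/(f2 (E z)) -[frame f1 2 a z]/(Dp a z) -[Dt f1 a z]/(d 0 a z) -[Dt f1 Jac z]/(d 0 Jac z) da // dJ // in Q.
have n : a z * Jac z != 0 by rewrite mulf_neq0 ?a0 ?J0.
apply/(mulfI n); rewrite -[Dt f1 p1 z]/(d 0 p1 z) -[Dt f1 p2 z]/(d 0 p2 z).
move: Q Ja; move: (d 0 p1 z) (d 0 p2 z) (Dp f1 z) (Dp f2 (E z)) (Dp a z) (f2 (E z)) (Dp P z) (Jac z) (a z).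
move=> x1 x2 x3 x4 x5 x6 x7 x8 x9 Q Ja.
have -> : x9 * x8 * (x3 - 3 * x1 + 2 * x2) = x9 * x8 * x3 - 3 * x8 * (x9 * x1) + 2 * x9 * (x8 * x2) by ring.
by rewrite -Q -Ja; ring.
Qed.

Let mu z := (a z)^-1.
Let lam z := a z * a z * (Jac z)^-1.
Let Lmu : log_derivative U1 f1 mu (fun k z => - d k p1 z) := log_derivative_inv o1 sf1 La.
Let Llam : log_derivative U1 f1 lam (fun k z => d k p1 z + d k p1 z + - d k p2 z) :=
  log_derivative_mul o1 sf1 (log_derivative_mul o1 sf1 La La) (log_derivative_inv o1 sf1 LJ).

Let lamP z : U1 z -> lam z * Dp P z = 1.
Proof.
by move=> Uz; rewrite /lam mulrAC PPJ // mulfV // J0.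
Qed.

(* [mu] and [lam] are the factors of [Dt] and [Dp].  The trivial gauge of the target pulls back
   to the gauge with [iota] = - ln |mu lam^3| and [eta] = - ln |mu^3 lam|, so that the transport
   of the curvature identities gives the transformation rules of I and H. *)
Let i1 z := 3 * p2 z + (- 5) * p1 z.
Let e1 z := p1 z + p2 z.
Let di1 k z : U1 z -> frame f1 k i1 z = 3 * d k p2 z - 5 * d k p1 z.
Proof.
move=> Uz; have nu (c : R) := smooth_cst o1 c.
rewrite (der_add (der k) (smooth_mul o1 (nu _) sp2) (smooth_mul o1 (nu _) sp1) Uz).
rewrite (der_mul (der k) (nu _) sp2 Uz) (der_mul (der k) (nu _) sp1 Uz) !(der_cst (der k)) // !mulr0 !addr0.
by rewrite mulNr.
Qed.
Let de1 k z : U1 z -> frame f1 k e1 z = d k p1 z + d k p2 z.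
Proof. by move=> Uz; rewrite (der_add (der k) sp1 sp2 Uz). Qed.

Let G1 : gauge U1 f1 i1 e1 mu lam.
Proof.
have nu (c : R) := smooth_cst o1 c.
have [s1 n1 dd1] := Lmu; have [s2 n2 dd2] := Llam.
split; [exact: sf1|exact: (smooth_add o1 (smooth_mul o1 (nu 3) sp2) (smooth_mul o1 (nu (- 5)) sp1))|
  exact: (smooth_add o1 sp1 sp2)|exact: s1|exact: s2| | |exact: n1|exact: n2].
- move=> k z Uz; rewrite dd1 // di1 // de1 //; congr (_ * _); move: (d k p1 z) (d k p2 z) => x y; by field.
- move=> k z Uz; rewrite dd2 // di1 // de1 //; congr (_ * _); move: (d k p1 z) (d k p2 z) => x y; by field.
Qed.

Let G2 : gauge U2 f2 (fun=> 0) (fun=> 0) (fun=> 1) (fun=> 1).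
Proof.
have nu (c : R) := smooth_cst o2 c.
have D2 k := frame_der o2 sf2 k.
split; [exact: sf2|exact: nu|exact: nu|exact: nu|exact: nu| | | |].
- by move=> k z Uz; rewrite !(der_cst (D2 k)) // !mulr0 subr0 mul0r mulr0.
- by move=> k z Uz; rewrite !(der_cst (D2 k)) // !mulr0 subr0 mul0r mulr0.
- by move=> z _; exact: oner_neq0.
- by move=> z _; exact: oner_neq0.
Qed.

Let tP g : smooth U2 g -> eq_on U1 (nP lam (g \o E)) (nP (fun=> 1) g \o E).
Proof. by move=> sg z Uz; rewrite /nP /= (compP sg Uz) mulrA lamP. Qed.
Let tX g : smooth U2 g -> eq_on U1 (nX f1 mu (g \o E)) (nX f2 (fun=> 1) g \o E).
Proof. by move=> sg z Uz; rewrite /nX /= (compD sg Uz) mulrA mulVf ?a0. Qed.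
(** By the choice of [e1] and [i1], D e1 + 5 D i1 is 8 (2 D p2 - 3 D p1), which is the correction in
    [prolonged_fp] multiplied by 8. *)
Let ta : eq_on U1 (cX f1 i1 e1 mu) (cX f2 (fun=> 0) (fun=> 0) (fun=> 1) \o E).
Proof.
move=> z Uz; have D2 := frame_der o2 sf2 0.
have z0 : Dt f2 (fun=> 0) (E z) = 0 := der_cst D2 0 (E_U Uz).
rewrite /= /cX !z0 -[Dt f1 e1 z]/(frame f1 0 e1 z) -[Dt f1 i1 z]/(frame f1 0 i1 z) de1 // di1 //.
have H := prolonged_fp Uz; rewrite -[Dt f1 p1 z]/(d 0 p1 z) -[Dt f1 p2 z]/(d 0 p2 z) in H.
have -> : Dp f2 (E z) = mu z * (Dp f1 z - 3 * d 0 p1 z + 2 * d 0 p2 z) by rewrite -H /mu mulKf ?a0.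
move: (d 0 p1 z) (d 0 p2 z) (Dp f1 z) (mu z) => x1 x2 x3 x4; ring.
Qed.
Let tc : eq_on U1 (cP i1 e1 lam) (cP (fun=> 0) (fun=> 0) (fun=> 1) \o E).
Proof.
move=> z Uz; have D2 := frame_der o2 sf2 2.
have z0 : Dp (fun=> 0) (E z) = 0 := der_cst D2 0 (E_U Uz).
rewrite /= /cP !z0 -[Dp e1 z]/(frame f1 2 e1 z) -[Dp i1 z]/(frame f1 2 i1 z) de1 // di1 //.
rewrite -[d 2 p2 z]/(Dp p2 z) Pp2 //; move: (d 2 p1 z) (lam z) => x1 x2; by field.
Qed.
(** Both sides vanish: on the left [o6] is -5 times the second p-derivative of a, divided by a,
    because p2 does not depend on p. *)
Let t6 : eq_on U1 (n6 i1 lam) (n6 (fun=> 0) (fun=> 1) \o E).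
Proof.
move=> z Uz; have D2 := frame_der o2 sf2 2.
have z0 : eq_on U2 (Dp (fun=> 0)) (fun=> 0) := der_cst D2 0.
have z1 : Dp (Dp (fun=> 0)) (E z) = 0.
  rewrite -[LHS]/(frame f2 2 (Dp (fun=> 0)) (E z)).
  rewrite (der_eq D2 (der_smooth D2 (smooth_cst o2 0)) z0 (E_U Uz)); exact: z0 (E_U Uz).
have Pi : eq_on U1 (Dp i1) (fun z => (- 5) * Dp p1 z).
  by move=> y Uy; rewrite -[LHS]/(frame f1 2 i1 y) di1 // -[d 2 p2 y]/(Dp p2 y) Pp2 // mulr0 add0r mulNr.
have si : smooth U1 i1 := gauge_i G1.
have PPi : Dp (Dp i1) z = (- 5) * Dp (Dp p1) z.
  rewrite -[LHS]/(frame f1 2 (Dp i1) z) (der_eq (der 2) (sd 2 si) Pi Uz).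
  by rewrite (der_mul (der 2) (smooth_cst o1 (- 5)) (sd 2 sp1) Uz) (der_cst (der 2)) // mulr0 addr0.
rewrite /= /n6 /o6 z1 (z0 _ (E_U Uz)) PPi Pi // PPp1 //.
move: (Dp p1 z) (lam z) => x1 x2; by field.
Qed.

Lemma prolonged_I z : U1 z -> rel_I f2 (E z) = mu z * lam z ^+ 3 * rel_I f1 z.
Proof.
move=> Uz; have H : mu z * lam z * lam z * lam z * rel_I f1 z = 1 * 1 * 1 * 1 * rel_I f2 (E z) :=
  transport_I o1 o2 G1 G2 E_U E_smooth tP tX ta tc t6 Uz.
have lin (m l i j : R) : m * l * l * l * i = 1 * 1 * 1 * 1 * j -> j = m * l ^+ 3 * i.
  by rewrite !mul1r => <-; rewrite !exprS expr0 mulr1 !mulrA.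
exact: lin H.
Qed.

Lemma prolonged_H z : U1 z -> rel_H f2 (E z) = mu z ^+ 3 * lam z * rel_H f1 z.
Proof.
move=> Uz; have H : mu z * mu z * mu z * lam z * rel_H f1 z = 1 * 1 * 1 * 1 * rel_H f2 (E z) :=
  transport_H o1 o2 G1 G2 E_U E_smooth tP tX ta tc t6 Uz.
have lin (m l i j : R) : m * m * m * l * i = 1 * 1 * 1 * 1 * j -> j = m ^+ 3 * l * i.
  by rewrite !mul1r => <-; rewrite !exprS expr0 mulr1 !mulrA.
exact: lin H.
Qed.

Section Branches.
Variables (s : bool) (J1 J2 : R3 -> R * R).
Hypotheses (B1 : regular_branch s U1 f1 J1) (B2 : regular_branch s U2 f2 J2).
Hypothesis EJ : forall z, U1 z -> (J2 (E z)).1 = mu z * (J1 z).1 /\ (J2 (E z)).2 = lam z * mu z * (J1 z).2.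
Let H1 := branch_gauge B1. Let H2 := branch_gauge B2.

Let nz z : U1 z -> [/\ mu z != 0, lam z != 0, (J1 z).1 != 0 & (J1 z).2 != 0].
Proof.
move=> Uz; have [h1 h2] := branch_neq0 B1 Uz; have [_ n1 _] := Lmu; have [_ n2 _] := Llam.
by split; [exact: n1|exact: n2|exact: h1|exact: h2].
Qed.

Let uP z : U1 z -> scale2 J1 z = lam z * scale2 J2 (E z).
Proof.
move=> Uz; have [m0 l0 x0 y0] := nz Uz; have [e1' e2'] := EJ Uz.
rewrite /scale2 e1' e2'; move: (mu z) (lam z) ((J1 z).1) ((J1 z).2) m0 l0 x0 y0 => m l x y m0 l0 x0 y0.
by field; rewrite m0 l0 y0.
Qed.
Let uX z : U1 z -> scale1 J1 z = mu z * scale1 J2 (E z).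
Proof.
move=> Uz; have [m0 l0 x0 y0] := nz Uz; have [e1' _] := EJ Uz.
rewrite /scale1 e1'; move: (mu z) ((J1 z).1) m0 x0 => m x m0 x0.
by field; rewrite m0 x0.
Qed.

Let bP (g : R3 -> R) : smooth U2 g -> eq_on U1 (nP (scale2 J1) (g \o E)) (nP (scale2 J2) g \o E).
Proof.
move=> sg z Uz; have lin (s1 s2 l p x y : R) : s1 = l * s2 -> l * p = 1 -> x = p * y -> s1 * x = s2 * y.
  by move=> -> lp ->; rewrite -[RHS]mul1r -{}lp; ring.
exact: (lin _ _ _ _ _ _ (uP Uz) (lamP Uz) (compP sg Uz)).
Qed.
Let bX (g : R3 -> R) : smooth U2 g -> eq_on U1 (nX f1 (scale1 J1) (g \o E)) (nX f2 (scale1 J2) g \o E).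
Proof.
move=> sg z Uz; have lin (s1 s2 l p x y : R) : s1 = l * s2 -> l * p = 1 -> x = p * y -> s1 * x = s2 * y.
  by move=> -> lp ->; rewrite -[RHS]mul1r -{}lp; ring.
have ma : mu z * a z = 1 by rewrite mulVf // a0.
exact: (lin _ _ _ _ _ _ (uX Uz) ma (compD sg Uz)).
Qed.

Let lnmu z : U1 z -> lnsq (mu z) = - p1 z.
Proof. by move=> Uz; exact: (lnsqV (a0 Uz)). Qed.
Let lnlam z : U1 z -> lnsq (lam z) = p1 z + p1 z - p2 z.
Proof.
move=> Uz; have n1 := a0 Uz; have n2 := J0 Uz.
rewrite /lam lnsqM ?lnsqM ?lnsqV ?invr_eq0 //; exact: mulf_neq0.
Qed.

(** [logI] and [i1] shift by the same cocycle ln |mu lam^3|. With [logH_E] this reduces the matching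
    of a, c and n6 for the branches to the one for the trivial gauge. *)
Let logI_E : eq_on U1 (logI f2 \o E) (fun z => logI f1 z + (- i1 z)).
Proof.
move=> z Uz; have [m0 l0 _ _] := nz Uz; have I0 := rb_I B1 Uz.
rewrite -[LHS]/(lnsq (rel_I f2 (E z))) prolonged_I // -[logI f1 z]/(lnsq (rel_I f1 z)).
have lin (m l i : R) : m != 0 -> l != 0 -> i != 0 -> lnsq (m * l ^+ 3 * i) = lnsq i + (lnsq m + 3 * lnsq l).
  move=> n1 n2 n3; have n4 := mulf_neq0 n2 n2; have n5 := mulf_neq0 n2 n4.
  have -> : m * l ^+ 3 * i = m * (l * (l * l)) * i by ring.
  rewrite (lnsqM (mulf_neq0 n1 n5) n3) (lnsqM n1 n5) (lnsqM n2 n4) (lnsqM n2 n2); ring.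
rewrite (lin _ _ _ m0 l0 I0) (lnmu Uz) (lnlam Uz) /i1.
move: (lnsq _) (p1 z) (p2 z) => x y t; ring.
Qed.
Let logH_E : eq_on U1 (logH f2 \o E) (fun z => logH f1 z + (- e1 z)).
Proof.
move=> z Uz; have [m0 l0 _ _] := nz Uz; have I0 := rb_H B1 Uz.
rewrite -[LHS]/(lnsq (rel_H f2 (E z))) prolonged_H // -[logH f1 z]/(lnsq (rel_H f1 z)).
have lin (m l i : R) : m != 0 -> l != 0 -> i != 0 -> lnsq (m ^+ 3 * l * i) = lnsq i + (3 * lnsq m + lnsq l).
  move=> n1 n2 n3; have n4 := mulf_neq0 n1 n1; have n5 := mulf_neq0 n1 n4.
  have -> : m ^+ 3 * l * i = m * (m * m) * l * i by ring.
  rewrite (lnsqM (mulf_neq0 n5 n2) n3) (lnsqM n5 n2) (lnsqM n1 n4) (lnsqM n1 n1); ring.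
rewrite (lin _ _ _ m0 l0 I0) (lnmu Uz) (lnlam Uz) /e1.
move: (lnsq _) (p1 z) (p2 z) => x y t; ring.
Qed.

Let si1 := gauge_i H1. Let se1 := gauge_e H1. Let si2 := gauge_i H2. Let se2 := gauge_e H2.
Let sI1 : smooth U1 i1 := gauge_i G1. Let sE1 : smooth U1 e1 := gauge_e G1.

Let dlogI k z : U1 z -> d k (logI f2 \o E) z = d k (logI f1) z - (3 * d k p2 z - 5 * d k p1 z).
Proof.
move=> Uz; have sN := smooth_opp o1 sI1; have c := smooth_cst o1 (- 1).
have e : eq_on U1 (fun z => - i1 z) (fun z => (- 1) * i1 z) by move=> y _; rewrite mulN1r.
have h1 := der_eq (der k) (E_smooth si2) logI_E Uz.
have h2 := der_add (der k) si1 sN Uz.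
have h3 := der_eq (der k) sN e Uz.
have h4 := der_mul (der k) c sI1 Uz.
have h5 := der_cst (der k) (- 1) Uz.
have lin (x y t u v w r : R) : x = y + t -> t = u -> u = - 1 * v + i1 z * w -> w = 0 -> v = r -> x = y - r.
  by move=> -> -> -> -> ->; rewrite mulr0 addr0 mulN1r.
exact: (lin _ _ _ _ _ _ _ (etrans h1 h2) h3 h4 h5 (di1 k Uz)).
Qed.
Let dlogH k z : U1 z -> d k (logH f2 \o E) z = d k (logH f1) z - (d k p1 z + d k p2 z).
Proof.
move=> Uz; have sN := smooth_opp o1 sE1; have c := smooth_cst o1 (- 1).
have e : eq_on U1 (fun z => - e1 z) (fun z => (- 1) * e1 z) by move=> y _; rewrite mulN1r.
have h1 := der_eq (der k) (E_smooth se2) logH_E Uz.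
have h2 := der_add (der k) se1 sN Uz.
have h3 := der_eq (der k) sN e Uz.
have h4 := der_mul (der k) c sE1 Uz.
have h5 := der_cst (der k) (- 1) Uz.
have lin (x y t u v w r : R) : x = y + t -> t = u -> u = - 1 * v + e1 z * w -> w = 0 -> v = r -> x = y - r.
  by move=> -> -> -> -> ->; rewrite mulr0 addr0 mulN1r.
exact: (lin _ _ _ _ _ _ _ (etrans h1 h2) h3 h4 h5 (de1 k Uz)).
Qed.

Let Plog (h2 : R3 -> R) z : smooth U2 h2 -> U1 z -> Dp h2 (E z) = lam z * d 2 (h2 \o E) z.
Proof.
move=> sh Uz; have lin (l p x y : R) : l * p = 1 -> y = p * x -> x = l * y by move=> lp ->; rewrite mulrA lp mul1r.
exact: (lin _ _ _ _ (lamP Uz) (compP sh Uz)).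
Qed.
Let Dlog (h2 : R3 -> R) z : smooth U2 h2 -> U1 z -> Dt f2 h2 (E z) = mu z * d 0 (h2 \o E) z.
Proof.
move=> sh Uz; have lin (l p x y : R) : l * p = 1 -> y = p * x -> x = l * y by move=> lp ->; rewrite mulrA lp mul1r.
have ma : mu z * a z = 1 by rewrite mulVf // a0.
exact: (lin _ _ _ _ ma (compD sh Uz)).
Qed.

Let ba : eq_on U1 (cX f1 (logI f1) (logH f1) (scale1 J1)) (cX f2 (logI f2) (logH f2) (scale1 J2) \o E).
Proof.
move=> z Uz.
have r1 := etrans (Dlog se2 Uz) (congr1 (fun t => mu z * t) (dlogH 0 Uz)).
have r2 := etrans (Dlog si2 Uz) (congr1 (fun t => mu z * t) (dlogI 0 Uz)).
have r3 : Dp f2 (E z) = mu z * (Dp f1 z - 3 * d 0 p1 z + 2 * d 0 p2 z).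
  have ma : mu z * a z = 1 by rewrite mulVf // a0.
  have lin (l p x y : R) : l * p = 1 -> p * x = y -> x = l * y by move=> lp <-; rewrite mulrA lp mul1r.
  exact: (lin _ _ _ _ ma (prolonged_fp Uz)).
have lin (s1 s2 m x0 x1 x2 x3 x4 y1 y2 y3 : R) : s1 = m * s2 ->
  y1 = m * (x1 - (x3 + x4)) -> y2 = m * (x2 - (3 * x4 - 5 * x3)) -> y3 = m * (x0 - 3 * x3 + 2 * x4) ->
  s1 * (x1 + 8 * x0 + 5 * x2) = s2 * (y1 + 8 * y3 + 5 * y2) by move=> -> -> -> ->; ring.
exact: (lin _ _ _ _ _ _ _ _ _ _ _ (uX Uz) r1 r2 r3).
Qed.

Let bc : eq_on U1 (cP (logI f1) (logH f1) (scale2 J1)) (cP (logI f2) (logH f2) (scale2 J2) \o E).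
Proof.
move=> z Uz.
have r1 := etrans (Plog se2 Uz) (congr1 (fun t => lam z * t) (dlogH 2 Uz)).
have r2 := etrans (Plog si2 Uz) (congr1 (fun t => lam z * t) (dlogI 2 Uz)).
have lin (s1 s2 m x1 x2 x3 x4 y1 y2 : R) : s1 = m * s2 -> x4 = 0 ->
  y1 = m * (x1 - (x3 + x4)) -> y2 = m * (x2 - (3 * x4 - 5 * x3)) ->
  s1 * (x1 + x2 / 5) = s2 * (y1 + y2 / 5) by move=> -> -> -> ->; field.
exact: (lin _ _ _ _ _ _ _ _ _ (uP Uz) (Pp2 Uz) r1 r2).
Qed.

Let b6 : eq_on U1 (n6 (logI f1) (scale2 J1)) (n6 (logI f2) (scale2 J2) \o E).
Proof.
move=> z Uz.
have slam : smooth U1 lam by case: Llam.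
have r2 y : U1 y -> Dp (logI f2) (E y) = lam y * (d 2 (logI f1) y + 5 * d 2 p1 y).
  move=> Uy; have r := etrans (Plog si2 Uy) (congr1 (fun t => lam y * t) (dlogI 2 Uy)).
  have lin (m x x3 x4 y2 : R) : x4 = 0 -> y2 = m * (x - (3 * x4 - 5 * x3)) -> y2 = m * (x + 5 * x3).
    by move=> -> ->; ring.
  exact: (lin _ _ _ _ _ (Pp2 Uy) r).
have sPi : smooth U2 (Dp (logI f2)) := der_smooth (frame_der o2 sf2 2) si2.
have t1 := sd 2 si1; have t2 := smooth_mul o1 (smooth_cst o1 5) (sd 2 sp1).
have dl : d 2 (fun y => lam y * (d 2 (logI f1) y + 5 * d 2 p1 y)) z =
  lam z * (d 2 (d 2 (logI f1)) z + 5 * d 2 (d 2 p1) z) + (d 2 (logI f1) z + 5 * d 2 p1 z) * (lam z * (d 2 p1 z + d 2 p1 z + - d 2 p2 z)).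
  rewrite /d (der_mul (der 2) slam (smooth_add o1 t1 t2) Uz) (der_add (der 2) t1 t2 Uz).
  rewrite (der_mul (der 2) (smooth_cst o1 5) (sd 2 sp1) Uz) (der_cst (der 2)) // mulr0 addr0.
  by have [_ _ ->] := Llam.
have r3 : Dp (Dp (logI f2)) (E z) = lam z * d 2 (fun y => lam y * (d 2 (logI f1) y + 5 * d 2 p1 y)) z.
  rewrite (Plog sPi Uz); congr (_ * _); exact: (der_eq (der 2) (E_smooth sPi) r2 Uz).
have r4 := etrans r3 (congr1 (fun t => lam z * t) dl).
have lin (s1 s2 m x xx p pp p2' y yy : R) : s1 = m * s2 -> p2' = 0 -> pp = - (p * p) ->
   y = m * (x + 5 * p) -> yy = m * (m * (xx + 5 * pp) + (x + 5 * p) * (m * (p + p + - p2'))) ->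
   s1 * s1 * (xx - x * x / 5) = s2 * s2 * (yy - y * y / 5) by move=> -> -> -> -> ->; field.
exact: (lin _ _ _ _ _ _ _ _ _ _ (uP Uz) (Pp2 Uz) (PPp1 Uz) (r2 _ Uz) r4).
Qed.

Let bY := transport_Y o1 o2 H1 H2 E_U E_smooth bP bX ba bc.
Let bb := transport_cY o1 o2 H1 H2 E_U E_smooth bP bX ba bc b6.
Let b5 := transport_n5 o1 o2 H1 H2 E_U E_smooth bP bX ba bc b6.
Let b4 := transport_n4 o1 o2 H1 H2 E_U E_smooth bP bX ba bc b6.

Lemma prolonged_coords z : U1 z -> coords f2 J2 (E z) = coords f1 J1 z.
Proof.
move=> Uz; rewrite (coordsE B2 (E_U Uz)) (coordsE B1 Uz).
have cong (x x' y y' t t' : R) : x = x' -> y = y' -> t = t' -> (x', y', t') = (x, y, t) by move=> -> -> ->.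
exact: (cong _ _ _ _ _ _ (ba Uz) (bb Uz) (bc Uz)).
Qed.

Lemma prolonged_tuple z : U1 z -> structure_tuple f2 J2 (E z) = structure_tuple f1 J1 z.
Proof.
move=> Uz; have Vz := E_U Uz.
have sa1 := cX_smooth o1 H1; have sa2 := cX_smooth o2 H2; have sb1 := cY_smooth o1 H1; have sb2 := cY_smooth o2 H2.
have sc1 := cP_smooth o1 H1; have sc2 := cP_smooth o2 H2.
have dX1 := nX_der o1 H1; have dY1 := nY_der o1 H1.
have lin (x x' q u u' v v' : R) : x = x' -> u = u' -> v = v' -> x' + q * u' * v' = x + q * u * v by move=> -> -> ->.
have lin1 (q u u' : R) : u = u' -> q * u' = q * u by move=> ->.
have e20 := etrans (bar_H20 B2 Vz) (etrans (lin _ _ _ _ _ _ _ (transport_der dX1 bX sa1 sa2 ba Uz) (ba Uz) (ba Uz)) (esym (bar_H20 B1 Uz))).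
have e11 := etrans (bar_H11 B2 Vz) (etrans (lin _ _ _ _ _ _ _ (transport_der dX1 bX sb1 sb2 bb Uz) (ba Uz) (bb Uz)) (esym (bar_H11 B1 Uz))).
have e02 := etrans (bar_H02 B2 Vz) (etrans (lin _ _ _ _ _ _ _ (transport_der dY1 bY sb1 sb2 bb Uz) (bb Uz) (bb Uz)) (esym (bar_H02 B1 Uz))).
have e10 := etrans (bar_K10 B2 Vz) (etrans (lin _ _ _ _ _ _ _ (transport_der dX1 bX sc1 sc2 bc Uz) (ba Uz) (bc Uz)) (esym (bar_K10 B1 Uz))).
have e01 := etrans (bar_K01 B2 Vz) (etrans (lin _ _ _ _ _ _ _ (transport_der dY1 bY sc1 sc2 bc Uz) (bb Uz) (bc Uz)) (esym (bar_K01 B1 Uz))).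
have e6 := etrans (bar_Omega6 B2 Vz) (etrans (lin1 _ _ _ (b6 Uz)) (esym (bar_Omega6 B1 Uz))).
have e5 := etrans (bar_Omega5 B2 Vz) (etrans (lin1 _ _ _ (b5 Uz)) (esym (bar_Omega5 B1 Uz))).
have e4 := etrans (bar_Omega4 B2 Vz) (etrans (lin1 _ _ _ (b4 Uz)) (esym (bar_Omega4 B1 Uz))).
apply: val_inj; rewrite -[LHS]/([:: _; _; _; _; _; _; _; _]) -[RHS]/([:: _; _; _; _; _; _; _; _]).
have cong (x1 x2 x3 x4 x5 x6 x7 x8 y1 y2 y3 y4 y5 y6 y7 y8 : R) : x1 = y1 -> x2 = y2 -> x3 = y3 -> x4 = y4 -> x5 = y5 ->
  x6 = y6 -> x7 = y7 -> x8 = y8 -> [:: x1; x2; x3; x4; x5; x6; x7; x8] = [:: y1; y2; y3; y4; y5; y6; y7; y8].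
  by move=> -> -> -> -> -> -> -> ->.
exact: (cong _ _ _ _ _ _ _ _ _ _ _ _ _ _ _ _ e20 e11 e02 e10 e01 e6 e5 e4).
Qed.
End Branches.
End Prolongation.

(** * Lifting a point map and its inverse to (x, y, p) *)

Section PointMap.
Variables (R : realType).
Notation R2 := (R * R)%type.
Notation R3 := (R * R * R)%type.
Variables (phi psi : R2 -> R2) (N M : set R2).
Hypotheses (oN : open N) (oM : open M) (sphi : smooth N phi) (spsi : smooth M psi).
Hypotheses (phiM : forall q, N q -> M (phi q)) (psi_phi : forall q, N q -> psi (phi q) = q).

Let px q := (phi q).1. Let py q := (phi q).2.
Let spx : smooth N px := smooth_fst oN sphi.
Let spy : smooth N py := smooth_snd oN sphi.
Let ux : R2 := (1, 0). Let uy : R2 := (0, 1).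
Let xx (q : R2) : R := 'D_ux px q. Let xy (q : R2) : R := 'D_uy px q.
Let yx (q : R2) : R := 'D_ux py q. Let yy (q : R2) : R := 'D_uy py q.
Definition jacobian (q : R2) : R := xx q * yy q - yx q * xy q.

(** The chain rule for psi (phi q) = q makes the product of the two Jacobian determinants equal to
    1. *)
Lemma jacobian_neq0 q : N q -> jacobian q != 0.
Proof.
move=> Nq; have Mq := phiM Nq.
have s1 := smooth_fst oM spsi; have s2 := smooth_snd oM spsi.
have dx := smooth_diff spx Nq; have dy := smooth_diff spy Nq.
have Mq' : M (px q, py q) by rewrite -surjective_pairing.
have E1 v : 'D_v (fun q => (psi (px q, py q)).1) q = v.1.
  rewrite -(derive_fst q v).2; apply: near_eq_derive; apply: (near_open oN Nq) => y Ny.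
  by rewrite -surjective_pairing psi_phi.
have E2 v : 'D_v (fun q => (psi (px q, py q)).2) q = v.2.
  rewrite -(derive_snd q v).2; apply: near_eq_derive; apply: (near_open oN Nq) => y Ny.
  by rewrite -surjective_pairing psi_phi.
have C1 v := etrans (esym (derive_comp2 v dx dy (smooth_diff s1 Mq'))) (E1 v).
have C2 v := etrans (esym (derive_comp2 v dx dy (smooth_diff s2 Mq'))) (E2 v).
have lin (a b c d x1 x2 y1 y2 : R) : x1 * a + y1 * b = 1 -> x2 * a + y2 * b = 0 -> x1 * c + y1 * d = 0 ->
  x2 * c + y2 * d = 1 -> (x1 * y2 - y1 * x2) * (a * d - b * c) = 1.
  move=> e1 e2 e3 e4; have -> : (x1 * y2 - y1 * x2) * (a * d - b * c) =
    (x1 * a + y1 * b) * (x2 * c + y2 * d) - (x2 * a + y2 * b) * (x1 * c + y1 * d) by ring.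
  by rewrite e1 e2 e3 e4 mulr1 mulr0 subr0.
have H := lin _ _ _ _ _ _ _ _ (C1 ux) (C1 uy) (C2 ux) (C2 uy).
by apply/eqP => j0; move: H; rewrite -[X in X * _]/(jacobian q) j0 mul0r => /eqP; rewrite eq_sym oner_eq0.
Qed.

Definition lift_dom : set R3 := [set z | N z.1] `&` [set z | slope_den phi z != 0].
Let X (z : R3) := px z.1. Let Y (z : R3) := py z.1. Let P : R3 -> R := prolonged_p phi.
Let slope (z : R3) := xx z.1 + z.2 * xy z.1.

Let oN3 : open [set z : R3 | N z.1]. Proof. exact: open_fst. Qed.
Let lift_smooth (g : R2 -> R) : smooth N g -> smooth [set z : R3 | N z.1] (fun z => g z.1).
Proof.
move=> sg; have sid := smooth_pair oN3 (smooth_cx oN3) (smooth_cy oN3).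
have H : smooth [set z : R3 | N z.1] (fun z : R3 => g (z.1.1, z.1.2)).
  apply: (smooth_comp2 oN3 sid sg) => z /=; by rewrite -surjective_pairing.
by apply: (smooth_eq oN3 _ H) => z _; rewrite -surjective_pairing.
Qed.
Let lift_derive (g : R2 -> R) z v : smooth N g -> N z.1 -> 'D_v (fun z : R3 => g z.1) z = 'D_(v.1) g z.1.
Proof.
move=> sg Nz; rewrite -[LHS]/('D_v (g \o fst) z).
rewrite (derive_comp v (derive_fst z 0).1 (smooth_diff sg Nz)); congr ('D__ g _).
exact: (derive_fst z v).2.
Qed.

Let slope_smooth : smooth [set z : R3 | N z.1] slope.
Proof.
exact: (smooth_add oN3 (lift_smooth (smooth_derive ux spx)) (smooth_mul oN3 (smooth_cp oN3) (lift_smooth (smooth_derive uy spx)))).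
Qed.

Lemma lift_open : open lift_dom.
Proof. exact: (open_neq0 oN3 slope_smooth). Qed.

Let oL := lift_open.
Let LN : lift_dom `<=` [set z : R3 | N z.1]. Proof. by move=> ? []. Qed.

Lemma lift_X : smooth lift_dom X. Proof. exact: (smooth_sub LN (lift_smooth spx)). Qed.
Lemma lift_Y : smooth lift_dom Y. Proof. exact: (smooth_sub LN (lift_smooth spy)). Qed.
Lemma lift_P : smooth lift_dom P.
Proof.
have s0 : smooth lift_dom slope := smooth_sub LN slope_smooth.
have s1 : smooth lift_dom (fun z => (slope z)^-1).
  by apply: sclass_smooth => //; apply: Sinv; [exact: Sbase|move=> z []].
have s2 := smooth_sub LN (smooth_add oN3 (lift_smooth (smooth_derive ux spy)) (smooth_mul oN3 (smooth_cp oN3) (lift_smooth (smooth_derive uy spy)))).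
exact: (smooth_mul oL s2 s1).
Qed.

Variable f : R3 -> R.
Lemma lift_PX : eq_on lift_dom (Dp X) (fun=> 0).
Proof. by move=> z [Nz _]; rewrite /Dp (lift_derive _ spx Nz) derive0. Qed.
Lemma lift_PY : eq_on lift_dom (Dp Y) (fun=> 0).
Proof. by move=> z [Nz _]; rewrite /Dp (lift_derive _ spy Nz) derive0. Qed.
Lemma lift_DX z : lift_dom z -> Dt f X z = slope_den phi z.
Proof.
move=> Lz; have [Nz _] := Lz; rewrite /Dt (lift_PX Lz) mulr0 addr0.
by rewrite /Dx /Dy !(lift_derive _ spx Nz).
Qed.
Lemma lift_DY z : lift_dom z -> Dt f Y z = slope_den phi z * P z.
Proof.
move=> Lz; have [Nz s0] := Lz; rewrite /Dt (lift_PY Lz) mulr0 addr0.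
rewrite /Dx /Dy !(lift_derive _ spy Nz) /P /prolonged_p [RHS]mulrC divfK //.
Qed.
Lemma lift_DP z : slope_den phi z != 0 -> Dt f P z = slope_den phi z * prolonged_u phi (z, f z).
Proof. by move=> s0; rewrite /prolonged_u [RHS]mulrC divfK. Qed.
Lemma lift_jacobian z : lift_dom z -> Db f Y z * Dt f X z - Dt f Y z * Db f X z = jacobian z.1.
Proof.
move=> Lz; have [Nz s0] := Lz; rewrite lift_DX // lift_DY //.
rewrite /Db (lift_PX Lz) (lift_PY Lz) !mulr0 !addr0 /Dy !(lift_derive _ _ Nz) //=.
have -> : slope_den phi z * P z = yx z.1 + z.2 * yy z.1 by rewrite /P /prolonged_p mulrC divfK.
have -> : slope_den phi z = xx z.1 + z.2 * xy z.1 by [].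
rewrite /jacobian -/(yy z.1) -/(xy z.1); move: (xx _) (xy _) (yx _) (yy _) (z.2) => *; ring.
Qed.

Let den (w : R3) := yy (psi w.1) - w.2 * xy (psi w.1).
(** Over a fixed base point the prolonged slope is a fractional linear function of p whose
    determinant is the Jacobian of phi; this is its inverse. *)
Definition unlift (w : R3) : R3 := (psi w.1, (w.2 * xx (psi w.1) - yx (psi w.1)) / den w).
Local Notation E := (prolongation X Y P).

Let E_fst z : (E z).1 = phi z.1. Proof. by rewrite [RHS]surjective_pairing. Qed.

Lemma unlift_lift z : lift_dom z -> unlift (E z) = z.
Proof.
move=> [Nz s0]; rewrite /unlift /den E_fst psi_phi // -[(E z).2]/(P z).
have j0 := jacobian_neq0 Nz.
have -> : P z = (yx z.1 + z.2 * yy z.1) / (xx z.1 + z.2 * xy z.1) by [].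
have s1 : xx z.1 + z.2 * xy z.1 != 0 by [].
rewrite [RHS]surjective_pairing; congr (_, _).
move: j0 s1; rewrite /jacobian; move: (xx _) (xy _) (yx _) (yy _) (z.2) => a b c d p j0 s1.
have -> : (c + p * d) / (a + p * b) * a - c = p * (a * d - c * b) / (a + p * b) by field.
have -> : d - (c + p * d) / (a + p * b) * b = (a * d - c * b) / (a + p * b) by field.
by field; rewrite s1 j0.
Qed.

Definition unlift_dom : set R3 := ([set w | M w.1] `&` [set w | N (psi w.1)]) `&` [set w | den w != 0].

Let oM3 : open [set w : R3 | M w.1]. Proof. exact: open_fst. Qed.
Let spsi3 : smooth [set w : R3 | M w.1] (fun w => psi w.1).
Proof.
have sid := smooth_pair oM3 (smooth_cx oM3) (smooth_cy oM3).
have h z : [set w : R3 | M w.1] z -> M (z.1.1, z.1.2) by rewrite -surjective_pairing.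
have H1 := smooth_comp2 oM3 sid (smooth_fst oM spsi) h.
have H2 := smooth_comp2 oM3 sid (smooth_snd oM spsi) h.
by apply: (smooth_eq oM3 _ (smooth_pair oM3 H1 H2)) => z _ /=; rewrite -!surjective_pairing.
Qed.
Let oMN : open ([set w : R3 | M w.1] `&` [set w | N (psi w.1)]).
Proof. exact: (open_preimage_smooth oM3 spsi3 oN). Qed.
Let pull_smooth (g : R2 -> R) : smooth N g ->
  smooth ([set w : R3 | M w.1] `&` [set w | N (psi w.1)]) (fun w => g (psi w.1)).
Proof.
move=> sg; apply: (smooth_comp2 oMN _ sg) => [|z []//].
by apply: smooth_sub spsi3 => ? [].
Qed.
Let den_smooth : smooth ([set w : R3 | M w.1] `&` [set w | N (psi w.1)]) den.
Proof.
exact: (smooth_add oMN (pull_smooth (smooth_derive uy spy)) (smooth_opp oMN (smooth_mul oMN (smooth_cp oMN) (pull_smooth (smooth_derive uy spx))))).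
Qed.

Lemma unlift_open : open unlift_dom.
Proof. exact: (open_neq0 oMN den_smooth). Qed.

Lemma unlift_smooth : smooth unlift_dom unlift.
Proof.
have oU := unlift_open.
have s : unlift_dom `<=` [set w : R3 | M w.1] `&` [set w | N (psi w.1)] by move=> ? [].
have s1 : smooth unlift_dom (fun w => (den w)^-1).
  by apply: sclass_smooth => //; apply: Sinv; [apply: Sbase; exact: (smooth_sub s den_smooth)|move=> z []].
have s2 := smooth_sub s (smooth_add oMN (smooth_mul oMN (smooth_cp oMN) (pull_smooth (smooth_derive ux spx))) (smooth_opp oMN (pull_smooth (smooth_derive ux spy)))).
apply: (smooth_pair oU _ (smooth_mul oU s2 s1)).
by apply: smooth_sub spsi3 => ? [[]].
Qed.

Lemma lift_unlift_dom z : lift_dom z -> unlift_dom (E z).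
Proof.
move=> [Nz s0]; have s1 : xx z.1 + z.2 * xy z.1 != 0 by [].
have e1 := E_fst z; have h1 : M (E z).1 by rewrite e1; exact: phiM.
have h2 : N (psi (E z).1) by rewrite e1 psi_phi.
suff h3 : den (E z) != 0 by exact: (conj (conj h1 h2) h3).
rewrite /den e1 psi_phi // -[(E z).2]/((yx z.1 + z.2 * yy z.1) / (xx z.1 + z.2 * xy z.1)).
have j0 := jacobian_neq0 Nz.
move: j0 s1; rewrite /jacobian; move: (xx _) (xy _) (yx _) (yy _) (z.2) => a b c d p j0 s1.
have -> : d - (c + p * d) / (a + p * b) * b = (a * d - c * b) / (a + p * b) by field.
by rewrite mulf_neq0 // invr_eq0.
Qed.

Lemma lift_unlift w : unlift_dom w -> phi (psi w.1) = w.1 -> E (unlift w) = w.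
Proof.
move=> [[_ Nw] d0] H; rewrite [RHS]surjective_pairing [LHS]surjective_pairing E_fst H; congr (_, _).
have j0 := jacobian_neq0 Nw.
rewrite -[LHS]/((yx (psi w.1) + (w.2 * xx (psi w.1) - yx (psi w.1)) / den w * yy (psi w.1)) /
 (xx (psi w.1) + (w.2 * xx (psi w.1) - yx (psi w.1)) / den w * xy (psi w.1))).
move: d0 j0; rewrite /= /den /jacobian; move: (xx _) (xy _) (yx _) (yy _) (w.2) => a b c d p d0 j0.
have -> : c + (p * a - c) / (d - p * b) * d = p * (a * d - c * b) / (d - p * b) by field.
have -> : a + (p * a - c) / (d - p * b) * b = (a * d - c * b) / (d - p * b) by field.
by field; rewrite d0 j0.
Qed.
End PointMap.

(** * Transport of a branch by a point map *)

Section TransportedBranch.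
Variables (R : realType).
Notation R3 := (R * R * R)%type.
Variables (U1 U2 V : set R3) (f1 f2 X Y P : R3 -> R) (G : R3 -> R3).
Local Notation E := (prolongation X Y P).
Hypotheses (o1 : open U1) (o2 : open U2) (oV : open V).
Hypotheses (sf1 : smooth U1 f1) (sf2 : smooth U2 f2) (sX : smooth U1 X) (sY : smooth U1 Y) (sP : smooth U1 P).
Hypotheses (PX : eq_on U1 (Dp X) (fun=> 0)) (PY : eq_on U1 (Dp Y) (fun=> 0)).
Local Notation a := (Dt f1 X).
Local Notation Jac := (fun z => Db f1 Y z * a z - Dt f1 Y z * Db f1 X z).
Hypotheses (a0 : forall z, U1 z -> a z != 0) (J0 : forall z, U1 z -> Jac z != 0).
Hypothesis aP : eq_on U1 (fun z => a z * P z) (Dt f1 Y).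
Hypothesis E_U : forall z, U1 z -> U2 (E z).
Hypothesis DP : eq_on U1 (Dt f1 P) (fun z => a z * f2 (E z)).
Hypotheses (sG : smooth V G) (GU : forall w, V w -> U1 (G w)) (EG : forall w, V w -> E (G w) = w).
Hypotheses (EV : forall z, U1 z -> V (E z)) (GE : forall z, U1 z -> G (E z) = z).
Variables (s : bool) (J1 : R3 -> R * R).
Hypothesis B1 : regular_branch s U1 f1 J1.

Let mu z := (a z)^-1.
Let lam z := a z * a z * (Jac z)^-1.
(** I and H are multiplied by mu lam^3 and mu^3 lam, hence H^3 / I by mu^8 and I H by (lam mu)^4.
    The factors mu and lam mu are the roots compatible with J1^2 J2 = H. *)
Definition transported_branch (w : R3) : R * R := (mu (G w) * (J1 (G w)).1, lam (G w) * mu (G w) * (J1 (G w)).2).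

Let inv_smooth (h : R3 -> R) : smooth U1 h -> (forall z, U1 z -> h z != 0) -> smooth U1 (fun z => (h z)^-1).
Proof. by move=> sh h0; apply: sclass_smooth => //; apply: Sinv => //; exact: Sbase. Qed.

Let transported_smooth : smooth V transported_branch.
Proof.
have D0 := derivation_Dt o1 sf1; have D1 := derivation_Db o1 sf1.
have sa : smooth U1 a := der_smooth D0 sX.
have sJ : smooth U1 Jac := smooth_add o1 (smooth_mul o1 (der_smooth D1 sY) sa) (smooth_opp o1 (smooth_mul o1 (der_smooth D0 sY) (der_smooth D1 sX))).
have smu := inv_smooth sa a0; have slam := smooth_mul o1 (smooth_mul o1 sa sa) (inv_smooth sJ J0).
have sx := rb_J B1; have x0 z (Uz : U1 z) := (branch_neq0 B1 Uz).1.
have six := inv_smooth sx x0.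
have sy : smooth U1 (fun z => (J1 z).2).
  apply: (smooth_eq o1 _ (smooth_mul o1 (rel_H_smooth o1 sf1) (smooth_mul o1 six six))) => z Uz.
  have lin (x y h : R) : x != 0 -> x ^+ 2 * y = h -> h * (x^-1 * x^-1) = y by move=> n <-; field.
  exact: (lin _ _ _ (x0 _ Uz) (rb_3 B1 Uz)).
have t1 := smooth_comp3 oV sG (smooth_mul o1 smu sx) GU.
have t2 := smooth_comp3 oV sG (smooth_mul o1 (smooth_mul o1 slam smu) sy) GU.
exact: (smooth_pair oV t1 t2).
Qed.

Lemma transported_root_branch m1 : U1 m1 -> root_branch s f2 (E m1) transported_branch.
Proof.
move=> Um; have m0 z : U1 z -> mu z != 0 by move=> Uz; rewrite /mu invr_eq0; exact: a0.
have l0 z : U1 z -> lam z != 0 by move=> Uz; rewrite /lam !mulf_neq0 ?invr_eq0 ?a0 ?J0.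
have TI z (Uz : U1 z) : rel_I f2 (E z) = mu z * lam z ^+ 3 * rel_I f1 z :=
  prolonged_I o1 o2 sf1 sf2 sX sY sP PX PY a0 J0 aP E_U DP Uz.
have TH z (Uz : U1 z) : rel_H f2 (E z) = mu z ^+ 3 * lam z * rel_H f1 z :=
  prolonged_H o1 o2 sf1 sf2 sX sY sP PX PY a0 J0 aP E_U DP Uz.
split.
- rewrite (TI _ Um); exact: (mulf_neq0 (mulf_neq0 (m0 _ Um) (expf_neq0 3 (l0 _ Um))) (rb_I B1 Um)).
- rewrite (TH _ Um); exact: (mulf_neq0 (mulf_neq0 (expf_neq0 3 (m0 _ Um)) (l0 _ Um)) (rb_H B1 Um)).
apply: (near_open oV (EV Um)) => w Vw; split; first exact: (smooth_continuous transported_smooth Vw).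
have Uz := GU Vw; have hI := TI _ Uz; have hH := TH _ Uz; rewrite EG // in hI hH.
have e1 := rb_1 B1 Uz; have e2 := rb_2 B1 Uz; have e3 := rb_3 B1 Uz.
have n1 := m0 _ Uz; have n2 := l0 _ Uz; have n3 := rb_I B1 Uz.
have lin1 (m l x i h i' h' e : R) : m != 0 -> l != 0 -> i != 0 -> i' = m * l ^+ 3 * i -> h' = m ^+ 3 * l * h ->
  x ^+ 8 = e * (h ^+ 3 / i) -> (m * x) ^+ 8 = e * (h' ^+ 3 / i').
  by move=> k1 k2 k3 -> -> k; rewrite exprMn k; field; rewrite k1 k2 k3.
have lin2 (m l y i h i' h' e : R) : i' = m * l ^+ 3 * i -> h' = m ^+ 3 * l * h ->
  y ^+ 4 = e * (i * h) -> (l * m * y) ^+ 4 = e * (i' * h').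
  by move=> -> -> k; rewrite exprMn k; ring.
have lin3 (m l x y h h' : R) : h' = m ^+ 3 * l * h -> x ^+ 2 * y = h -> (m * x) ^+ 2 * (l * m * y) = h'.
  by move=> -> <-; ring.
split; [exact: (lin1 _ _ _ _ _ _ _ _ n1 n2 n3 hI hH e1)|exact: (lin2 _ _ _ _ _ _ _ _ hI hH e2)|exact: (lin3 _ _ _ _ _ _ hH e3)].
Qed.

Lemma transported_structure m1 : U1 m1 -> smooth_at f2 (E m1) ->
  \forall z \near m1, coords f2 transported_branch (E z) = coords f1 J1 z /\
    structure_tuple f2 transported_branch (E z) = structure_tuple f1 J1 z.
Proof.
move=> Um s2; have [W Wm B2] := root_branch_regular s2 (transported_root_branch Um).
have sE : smooth U1 E := smooth_pair o1 (smooth_pair o1 sX sY) sP.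
have oU := open_preimage_smooth o1 sE (rb_open B2); set U := U1 `&` _ in oU.
have UU : U `<=` U1 by move=> ? [].
have sub (T : Type) (g h : R3 -> T) : eq_on U1 g h -> eq_on U g h by move=> e z /UU; exact: e.
have C1 := regular_branch_sub oU UU B1.
have EW z : U z -> W (E z) by case.
have EJ z : U z -> (transported_branch (E z)).1 = mu z * (J1 z).1 /\
  (transported_branch (E z)).2 = lam z * mu z * (J1 z).2.
  by move=> /UU Uz; rewrite /transported_branch GE.
have a0' z (Uz : U z) := a0 (UU _ Uz); have J0' z (Uz : U z) := J0 (UU _ Uz).
have sW := rb_f B2; have oW := rb_open B2.
apply: (near_open oU) => [|z Uz]; first by split.
split.
  exact: (prolonged_coords oU oW (smooth_sub UU sf1) sW (smooth_sub UU sX) (smooth_sub UU sY) (smooth_sub UU sP)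
    (sub _ _ _ PX) (sub _ _ _ PY) a0' J0' (sub _ _ _ aP) EW (sub _ _ _ DP) C1 B2 EJ Uz).
exact: (prolonged_tuple oU oW (smooth_sub UU sf1) sW (smooth_sub UU sX) (smooth_sub UU sY) (smooth_sub UU sP)
    (sub _ _ _ PX) (sub _ _ _ PY) a0' J0' (sub _ _ _ aP) EW (sub _ _ _ DP) C1 B2 EJ Uz).
Qed.

(** The coordinates and the eight invariants agree along the map, so one function, the tuple of the
    first equation read through the inverse of its coordinates, represents both germs. *)
Lemma transported_same_structure m1 : U1 m1 -> smooth_at f2 (E m1) -> smooth_at f1 m1 -> generic f1 m1 ->
  root_branch s f1 m1 J1 ->
  same_structure_functions f1 m1 J1 f2 (E m1) transported_branch.
Proof.
move=> Um s2 s1 g1 b1.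
have [A [oA Am HA]] := near_openP (transported_structure Um s2).
have [_ [k [_ kh _]]] := generic_local_diffeo s1 g1 b1.
split; first by have [] := HA _ Am.
exists (structure_tuple f1 J1 \o k), (structure_tuple f1 J1 \o k); split.
- by apply: filterS kh => z kz; rewrite /= kz.
- have [K [oK Km HK]] := near_openP kh.
  have oB := open_preimage_smooth oV sG (openI oA oK).
  apply: (near_open oB) => [|w [Vw [Aw Kw]]]; first by split; [exact: EV|rewrite /= GE].
  have [e1 e2] := HA _ Aw; rewrite EG // in e1 e2.
  by rewrite -[LHS]/(structure_tuple f1 J1 (k (coords f2 transported_branch w))) e1 HK // -e2.
- exact: (near_open openT I (fun _ _ => erefl)).
Qed.
End TransportedBranch.

Lemma equivalent_same_structure (R : realType) s (f1 f2 : R * R * R -> R) m1 m2 J1 :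
  smooth_at f1 m1 -> smooth_at f2 m2 -> generic f1 m1 -> root_branch s f1 m1 J1 ->
  point_equivalent f1 m1 f2 m2 ->
  exists J2, root_branch s f2 m2 J2 /\ same_structure_functions f1 m1 J1 f2 m2 J2.
Proof.
move=> s1 s2 g1 b1 [phi [[sphi [psi [spsi psi_phi phi_psi]]] den0 pm nearE]].
have [U0 U0m B0] := root_branch_regular s1 b1; have oU0 := rb_open B0.
have [N0 [oN0 N0m] sN0] := sphi; have [M0 [oM0 M0m] sM0] := spsi.
have [N1 [oN1 N1m HN1]] := near_openP psi_phi; have [M1 [oM1 M1m HM1]] := near_openP phi_psi.
pose M := M0 `&` M1; have oM : open M by exact: openI.
have sM : smooth M psi by apply: smooth_sub (sM0 : smooth M0 psi) => ? [].
pose N01 := N0 `&` N1; have oN01 : open N01 by exact: openI.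
have sN01 : smooth N01 phi by apply: smooth_sub (sN0 : smooth N0 phi) => ? [].
have oN := open_preimage_smooth oN01 sN01 oM; set N := N01 `&` _ in oN.
have sN : smooth N phi by apply: smooth_sub sN01 => ? [].
have NM q : N q -> M (phi q) by case.
have Npsi q : N q -> psi (phi q) = q by move=> [[_ N1q] _]; exact: HN1.
have Mphi q : M q -> phi (psi q) = q by move=> [_ M1q]; exact: HM1.
have Nm : N m1.1 by split; split.
pose X (z : R * R * R) := (phi z.1).1; pose Y (z : R * R * R) := (phi z.1).2; pose P := prolonged_p phi.
pose L := lift_dom phi N; have oL : open L := lift_open oN sN.
have Lm : L m1 by split.
have sX : smooth L X := lift_X oN sN; have sY : smooth L Y := lift_Y oN sN; have sP : smooth L P := lift_P oN sN.
have sE : smooth L (prolongation X Y P) := smooth_pair oL (smooth_pair oL sX sY) sP.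
have [A2 [oA2 A2m] sA2] := s2; have [A3 [oA3 A3m HA3]] := near_openP nearE.
have Em : prolongation X Y P m1 = m2.
  have := congr1 fst pm; rewrite /= => <-; congr (_, _); by rewrite -surjective_pairing.
have oU1 := open_preimage_smooth oL sE oA2; set U1 := L `&` _ in oU1.
have U1m : U1 m1 by split=> //=; rewrite -/(prolongation X Y P m1) Em.
have oU2 : open (U1 `&` U0) by exact: openI.
have sgr : smooth (U1 `&` U0) (fun z => (z, f1 z)).
  apply: (smooth_pair oU2).
    apply: (smooth_eq oU2 _ (smooth_pair oU2 (smooth_pair oU2 (smooth_cx oU2) (smooth_cy oU2)) (smooth_cp oU2))).
    by move=> -[[]].
  by apply: smooth_sub (rb_f B0) => ? [].
(* Points are kept whose lift to the graph of f1 lies where the prolongation is known to exchange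
   the two equations. *)
have oU := open_preimage_smooth oU2 sgr oA3; set U := (U1 `&` U0) `&` _ in oU.
have Um : U m1 by split.
have UL : U `<=` L by move=> ? [[[]]].
have UU0 : U `<=` U0 by move=> ? [[_]].
have B1 := regular_branch_sub oU UU0 B0.
have E_U z : U z -> A2 (prolongation X Y P z) by case=> -[[_]].
have sV0 := unlift_smooth oN oM sN sM; have oV0 := unlift_open oN oM sN sM.
have oV := open_preimage_smooth oV0 sV0 oU; set V := unlift_dom phi psi N M `&` _ in oV.
have sV : smooth V (unlift phi psi) by apply: smooth_sub sV0 => ? [].
have GU w : V w -> U (unlift phi psi w) by case.
have GE z (Uz : U z) : unlift phi psi (prolongation X Y P z) = z := unlift_lift oN oM sN sM NM Npsi (UL _ Uz).
have EG w (Vw : V w) : prolongation X Y P (unlift phi psi w) = w.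
  have [Vw0 _] := Vw; apply: (lift_unlift oN oM sN sM NM Npsi Vw0); apply: Mphi.
  by case: Vw0 => -[].
have EV z : U z -> V (prolongation X Y P z).
  move=> Uz; have h := lift_unlift_dom oN oM sN sM NM Npsi (UL _ Uz).
  have h2 : U (unlift phi psi (prolongation X Y P z)) by rewrite GE.
  exact: (conj h h2).
have den z (Uz : U z) : slope_den phi z != 0 by have [] := UL _ Uz.
have DX z (Uz : U z) : Dt f1 X z = slope_den phi z := lift_DX oN sN f1 (UL _ Uz).
have a0 z (Uz : U z) : Dt f1 X z != 0 by rewrite DX // den.
have J0 z (Uz : U z) : Db f1 Y z * Dt f1 X z - Dt f1 Y z * Db f1 X z != 0.
  have [Nz _] := UL _ Uz; have j := jacobian_neq0 oN oM sN sM NM Npsi Nz.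
  have e : _ = jacobian phi z.1 := lift_jacobian oN sN f1 (UL _ Uz).
  by move: j; rewrite -e.
have aP : eq_on U (fun z => Dt f1 X z * P z) (Dt f1 Y).
  by move=> z Uz; rewrite DX //; apply/esym; exact: (lift_DY oN sN f1 (UL _ Uz)).
(* Applied at (z, f1 z), the equivalence of the hypersurfaces says that the prolonged second
   derivative is f2 at the image point. *)
have DP : eq_on U (Dt f1 P) (fun z => Dt f1 X z * f2 (prolongation X Y P z)).
  move=> z Uz; rewrite DX // [LHS](lift_DP f1 (den _ Uz)); congr (_ * _).
  have [_ Az] := Uz; have [H _] := HA3 _ Az; rewrite [LHS](H erefl) /=; congr f2.
  by rewrite /prolongation /X /Y -surjective_pairing.
have PX : eq_on U (Dp X) (fun=> 0) by move=> z /UL Lz; exact: (lift_PX oN sN Lz).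
have PY : eq_on U (Dp Y) (fun=> 0) by move=> z /UL Lz; exact: (lift_PY oN sN Lz).
have sA2' : smooth A2 f2 := sA2.
pose J2 := transported_branch f1 X Y (unlift phi psi) J1.
have tX := smooth_sub UL sX; have tY := smooth_sub UL sY; have tP := smooth_sub UL sP.
have r := transported_root_branch oU oA2 oV (rb_f B1) sA2' tX tY tP PX PY a0 J0 aP E_U DP sV GU EG EV B1 Um.
have s2' : smooth_at f2 (prolongation X Y P m1) by rewrite Em.
have t := transported_same_structure oU oA2 oV (rb_f B1) sA2' tX tY tP PX PY a0 J0 aP E_U DP sV GU EG EV GE B1 Um s2' s1 g1 b1.
by exists J2; rewrite Em in r t.
Qed.

Theorem theorem3 (R : realType) (f1 f2 : R * R * R -> R) (m1 m2 : R * R * R)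
    (f1_smooth : smooth_at f1 m1) (f2_smooth : smooth_at f2 m2)
    (f1_generic : generic f1 m1) (f2_generic : generic f2 m2)
    (s : bool) (J1 : R * R * R -> R * R) (J1_branch : root_branch s f1 m1 J1) :
  point_equivalent f1 m1 f2 m2 <->
  exists J2 : R * R * R -> R * R,
    root_branch s f2 m2 J2 /\ same_structure_functions f1 m1 J1 f2 m2 J2.
Proof.
split; first exact: equivalent_same_structure.
move=> [J2 [J2_branch same]].
exact: (same_structure_equivalent f1_smooth f2_smooth f1_generic f2_generic J1_branch J2_branch same).
Qed.
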